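(* Let $X$ be a compact metric space, $f\colon X\to X$ a homeomorphism, and $\phi\colon X\to\mathbb{R}$ a continuous function. Suppose that $P^\perp_{\exp}(\phi)<P(\phi)$ and $X\times\mathbb{N}$ admits a decomposition $(\mathcal{P},\mathcal{G},\mathcal{S})$ such that: (I) $\mathcal{G}$ has (W)-specification at any scale $\delta>0$; (II) $\phi$ has the Bowen property on $\mathcal{G}$; (III) $P(\mathcal{P}\cup\mathcal{S},\phi)<P(\phi)$. Then $(X,f,\phi)$ has a unique equilibrium state $\mu$. Moreover, if $A$ is any weak$^*$-closed convex subset of the space of Borel probability measures on $X$, then $$\limsup_{n\to\infty}\frac1n\log\mu(\mathcal{E}_n^{-1}(A))\le\sup_{\nu\in A\cap\mathcal{M}_f(X)}\Big(h_\nu(f)+\int\phi\,d\nu-P(\phi)\Big),$$ where $\mathcal{E}_n(x)=\frac1n\sum_{k=0}^{n-1}\delta_{f^kx}$.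
   Context: $\mathcal{M}_f(X)$ is the set of $f$-invariant Borel probability measures; $\mathbb{N}_0=\mathbb{N}\cup\{0\}$; $d$ is the metric. $d_n(x,y)=\max_{0\le k<n}d(f^kx,f^ky)$, $B_n(x,\delta)=\{y:d_n(x,y)<\delta\}$; $E$ is $(n,\delta)$-separated if $d_n(x,y)>\delta$ for distinct $x,y\in E$. Pairs $(x,n)$ are orbit segments $\{f^kx:0\le k<n\}$ ($(x,0)$ empty); $\mathcal{C}_n=\{x:(x,n)\in\mathcal{C}\}$. $\Phi_0(x,n)=\sum_{k=0}^{n-1}\phi(f^kx)$; $\Lambda(\mathcal{C},\phi,\delta,n)=\sup\{\sum_{x\in E}e^{\Phi_0(x,n)}:E\subset\mathcal{C}_n\ (n,\delta)\text{-separated}\}$; $P(\mathcal{C},\phi,\delta)=\limsup_n\frac1n\log\Lambda(\mathcal{C},\phi,\delta,n)$, $P(\mathcal{C},\phi)=\lim_{\delta\to0}P(\mathcal{C},\phi,\delta)$; $P(\phi)$ is the topological pressure. An equilibrium state maximizes $h_\mu(f)+\int\phi\,d\mu$ over $\mathcal{M}_f(X)$. $\Gamma_\varepsilon(x)=\{y:d(f^nx,f^ny)\le\varepsilon\ \forall n\in\mathbb{Z}\}$, $\mathrm{NE}(\varepsilon)=\{x:\Gamma_\varepsilon(x)\ne\{x\}\}$, $P^\perp_{\exp}(\phi,\varepsilon)=\sup\{h_\mu(f)+\int\phi\,d\mu:\mu\text{ ergodic},\ \mu(\mathrm{NE}(\varepsilon))>0\}$, $P^\perp_{\exp}(\phi)=\lim_{\varepsilon\to0}P^\perp_{\exp}(\phi,\varepsilon)$.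 Decomposition of $X\times\mathbb{N}$: collections $\mathcal{P},\mathcal{G},\mathcal{S}\subset X\times\mathbb{N}_0$ and $p,g,s:X\times\mathbb{N}\to\mathbb{N}_0$ with $n=p+g+s$, $(x,p)\in\mathcal{P}$, $(f^px,g)\in\mathcal{G}$, $(f^{p+g}x,s)\in\mathcal{S}$; standing assumption $X\times\{0\}\subset\mathcal{P}\cap\mathcal{G}\cap\mathcal{S}$. (W)-specification at scale $\delta$: there is $\tau\in\mathbb{N}$ such that for every $\{(x_i,n_i)\}_{i=1}^k\subset\mathcal{G}$ there are $y$ and $\tau_1,\dots,\tau_{k-1}\in\mathbb{N}$, $\tau_i\le\tau$, with $d_{n_j}(f^{N_{j-1}+\tau_{j-1}}y,x_j)<\delta$ for $1\le j\le k$, where $N_j=\sum_{i=1}^jn_i+\sum_{i=1}^{j-1}\tau_i$, $N_0=\tau_0=0$. $\phi$ has the Bowen property on $\mathcal{G}$ if there are $\varepsilon>0$ and $K$ with $|\Phi_0(x,n)-\Phi_0(y,n)|\le K$ for all $(x,n)\in\mathcal{G}$, $y\in B_n(x,\varepsilon)$. *)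

(* Defs.v *)
From mathcomp Require Import all_boot all_order all_algebra.
From mathcomp Require Import all_classical all_reals all_analysis.
From Stdlib Require Lists.List.
Set Implicit Arguments. Unset Strict Implicit. Unset Printing Implicit Defensive.
Import Order.TTheory GRing.Theory Num.Theory.
Local Open Scope classical_set_scope.
Local Open Scope ring_scope.

Section Dyn.
Context {R : realType} {X : Type}.

Definition is_metric (d : X -> X -> R) : Prop :=
  [/\ forall x y, d x y = 0 <-> x = y,
      forall x y, d x y = d y x &
      forall x y z, d x z <= d x y + d y z].

Definition dball (d : X -> X -> R) (x : X) (r : R) : set X :=
  [set y | d x y < r].

Definition dopen (d : X -> X -> R) (U : set X) : Prop :=
  forall x, U x -> exists2 r : R, 0 < r & dball d x r `<=` U.

Definition dcompact (d : X -> X -> R) : Prop :=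
  forall (I : Type) (U : I -> set X), (forall i, dopen d (U i)) ->
    (forall x, exists i, U i x) ->
    exists s : seq I, forall x, exists2 i, Stdlib.Lists.List.In i s & U i x.

Definition dcont_fun (d : X -> X -> R) (f : X -> X) : Prop :=
  forall x (e : R), 0 < e -> exists2 eta : R, 0 < eta &
    forall y, d x y < eta -> d (f x) (f y) < e.

Definition dcont_real (d : X -> X -> R) (g : X -> R) : Prop :=
  forall x (e : R), 0 < e -> exists2 eta : R, 0 < eta &
    forall y, d x y < eta -> `|g x - g y| < e.

Definition dn (d : X -> X -> R) (f : X -> X) (n : nat) (x y : X) : R :=
  \big[Num.max/0]_(k < n) d (iter k f x) (iter k f y).

Definition bowen_ball d f (n : nat) (x : X) (delta : R) : set X :=
  [set y | dn d f n x y < delta].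

Definition separated d f (n : nat) (delta : R) (E : seq X) : Prop :=
  forall x y, Stdlib.Lists.List.In x E -> Stdlib.Lists.List.In y E -> x <> y -> delta < dn d f n x y.

Definition birkhoff (f : X -> X) (phi : X -> R) (x : X) (n : nat) : R :=
  \sum_(k < n) phi (iter k f x).

Definition elog (a : \bar R) : \bar R :=
  match a with
  | r%:E => if (0 < r)%R then (ln r)%:E else -oo
  | +oo => +oo
  | -oo => -oo
  end%E.

Definition Lambda d f phi (C : set (X * nat)) (delta : R) (n : nat) : \bar R :=
  ereal_sup [set ((\sum_(x <- E) expR (birkhoff f phi x n))%:E)%E
            | E in [set E : seq X | Stdlib.Lists.List.NoDup E /\ separated d f n delta E /\
                                    (forall x, Stdlib.Lists.List.In x E -> C (x, n))]].

Definition pressure_delta d f phi (C : set (X * nat)) (delta : R) : \bar R :=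
  limn_esup (fun n => ((n%:R)^-1)%:E * elog (Lambda d f phi C delta n))%E.

Definition pressure_coll d f phi (C : set (X * nat)) : \bar R :=
  lim ((fun delta : R => pressure_delta d f phi C delta) @ 0^'+).

Definition top_pressure d f phi : \bar R := pressure_coll d f phi setT.

Definition decomposition (f : X -> X) (P G S : set (X * nat))
  (p g s : X -> nat -> nat) : Prop :=
  (forall x, P (x, 0%N) /\ G (x, 0%N) /\ S (x, 0%N)) /\
  forall x n, (0 < n)%N ->
    [/\ n = (p x n + g x n + s x n)%N, P (x, p x n),
        G (iter (p x n) f x, g x n) &
        S (iter (p x n + g x n) f x, s x n)].

Definition W_spec d f (G : set (X * nat)) (delta : R) : Prop :=
  exists tau : nat, forall xs : seq (X * nat),
    (forall i, Stdlib.Lists.List.In i xs -> G i) ->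
    exists (y : X) (ts : seq nat),
      [/\ size ts = (size xs).-1,
          (forall t, Stdlib.Lists.List.In t ts -> (0 < t <= tau)%N) &
          forall j, (j < size xs)%N ->
            dn d f (nth (y, 0%N) xs j).2
               (iter (\sum_(i < j) ((nth (y, 0%N) xs i).2 + nth 0%N ts i))%N f y)
               (nth (y, 0%N) xs j).1 < delta].

Definition bowen_prop d f phi (G : set (X * nat)) : Prop :=
  exists (eps : R) (K : R), 0 < eps /\
    forall x n y, G (x, n) -> bowen_ball d f n x eps y ->
      `|birkhoff f phi x n - birkhoff f phi y n| <= K.

Definition ziter (f finv : X -> X) (n : int) (x : X) : X :=
  match n with
  | Posz k => iter k f x
  | Negz k => iter k.+1 finv x
  end.

Definition NE d (f finv : X -> X) (eps : R) : set X :=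
  [set x | exists2 y, y <> x & forall n : int,
             d (ziter f finv n x) (ziter f finv n y) <= eps].

End Dyn.

Section Meas.
Context {R : realType} {dsp : measure_display} {X : measurableType dsp}.

Definition finvariant (f : X -> X) (mu : probability X R) : Prop :=
  forall A, measurable A -> mu (f @^-1` A) = mu A.

Definition ergodic (f : X -> X) (mu : probability X R) : Prop :=
  finvariant f mu /\
  forall A, measurable A -> f @^-1` A = A -> (mu A = 0%E \/ mu A = 1%E).

Definition meas_partition (xi : seq (set X)) : Prop :=
  [/\ forall A, Stdlib.Lists.List.In A xi -> measurable A,
      forall i j, (i < size xi)%N -> (j < size xi)%N -> i <> j ->
         nth set0 xi i `&` nth set0 xi j = set0 &
      forall x, exists2 A, Stdlib.Lists.List.In A xi & A x].

Definition join_block (f : X -> X) (xi : seq (set X)) (n : nat)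
   (w : {ffun 'I_n -> 'I_(size xi)}) : set X :=
  [set x | forall k : 'I_n, nth set0 xi (w k) (iter k f x)].
Arguments join_block f xi n w : clear implicits.

Definition join_entropy (mu : probability X R) f (xi : seq (set X)) (n : nat) : R :=
  - \sum_(w : {ffun 'I_n -> 'I_(size xi)})
      (let a := fine (mu (join_block f xi n w)) in
       if 0 < a then a * ln a else 0).

(* h_mu(f, xi) = lim (1/n) H_mu(xi^n)  (the limit exists; we take limsup) *)
Definition ent_partition (mu : probability X R) f (xi : seq (set X)) : \bar R :=
  limn_esup (fun n => ((n%:R)^-1 * join_entropy mu f xi n)%:E).

Definition ks_entropy (mu : probability X R) (f : X -> X) : \bar R :=
  ereal_sup [set ent_partition mu f xi | xi in meas_partition].

Definition free_energy (mu : probability X R) f (phi : X -> R) : \bar R :=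
  (ks_entropy mu f + \int[mu]_x (phi x)%:E)%E.

Definition equilibrium_state f phi (mu : probability X R) : Prop :=
  finvariant f mu /\
  forall nu : probability X R, finvariant f nu ->
    (free_energy nu f phi <= free_energy mu f phi)%E.

Definition Pexp_perp_eps (d : X -> X -> R) (f finv : X -> X) (phi : X -> R)
  (eps : R) : \bar R :=
  ereal_sup [set free_energy mu f phi | mu in
              [set mu : probability X R | ergodic f mu /\ (0 < mu (NE d f finv eps))%E]].

Definition Pexp_perp d f finv phi : \bar R :=
  lim ((fun eps : R => Pexp_perp_eps d f finv phi eps) @ 0^'+).

Definition weak_nbhd (d : X -> X -> R) (nu : probability X R)
   (gs : seq (X -> R)) (e : R) : set (probability X R) :=
  [set nu' | forall g, Stdlib.Lists.List.In g gs ->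
     `| fine (\int[nu']_x (g x)%:E) - fine (\int[nu]_x (g x)%:E) | < e].

Definition weak_closed (d : X -> X -> R) (A : set (probability X R)) : Prop :=
  forall nu, ~ A nu -> exists gs : seq (X -> R), exists2 e : R,
    (forall g, Stdlib.Lists.List.In g gs -> dcont_real d g) /\ 0 < e &
    weak_nbhd d nu gs e `&` A = set0.

Definition mconvex (A : set (probability X R)) : Prop :=
  forall nu1 nu2 (t : R), A nu1 -> A nu2 -> 0 <= t <= 1 ->
    forall nu : probability X R,
      (forall B, measurable B -> nu B = (t%:E * nu1 B + (1 - t)%:E * nu2 B)%E) ->
      A nu.

Definition empirical_preimage (f : X -> X) (n : nat) (A : set (probability X R))
  : set X :=
  [set x | exists2 nu, A nu & forall B, measurable B ->
      nu B = ((n%:R)^-1 * \sum_(k < n) (\1_B (iter k f x) : R))%:E].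

End Meas.

(* Main.v *)
(* Entropy off NE(eps): for an invariant measure giving no mass to NE(eps), a coding whose atoms
   have d_n-diameter at most eps nearly determines the n-words of every other coding, so n times
   the entropy is at most the static entropy of that coding.  An invariant measure living on
   NE(eps) has free energy at most P_exp^perp(eps): conditioning on finitely many invariant sets
   without decreasing the free energy, and passing to a limit along finer and finer families,
   yields an ergodic measure; a summable penalty keeps the limit on NE(eps).  So only the part of a
   measure off NE(eps) matters for free energies near P, and one scale eps suffices.

   Counting: gluing words of segments of G by (W)-specification is injective for fixed gap lengths,
   so the partition sums of G over separated sets are at most C exp(nP).  Prefixes and suffixes
   have smaller pressure, hence the same bound holds on X, even with an exponential weight in the
   length p + s of the bad part.  Through the Gibbs inequality for entropy, it follows that free
   energies are at most P, and that for an equilibrium state every set of mass at least al contains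
   a separated set with bounded p + s and partition sum at least c exp(nP).

   Existence: averages of Gibbs weights on separated sets converge to a measure mu of free energy P,
   and mu(B_m(z, a)) <= Q exp(sup Phi - mP) because a separated orbit visiting a Bowen ball is
   determined by its past and its future.

   Uniqueness: suppose that two equilibrium states give a function h different integrals.  Pair a
   segment of length (i + 1)L typical for the first with one of length (N - i)L typical for the
   second, for i < N.  For each i the pairs have partition sum at least c^2 exp((N + 1)LP), and
   gluings with different switching times i are separated, since the averages of h disagree on a
   whole block.  Gluing many pairs gains a factor proportional to N per pair, against the upper
   bound C exp(nP).

   Large deviations: the Gibbs bound on mu controls mu(E_n^-1(A)) by the partition sum of a separated
   subset, and a limit of its Gibbs averages stays in A since A is convex and closed. *)

Require Import Defs.
From HB Require Import structures.
From mathcomp Require Import all_boot all_order all_algebra.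
From mathcomp Require Import all_classical all_reals all_analysis.
From mathcomp Require Import measurable_realfun ring lra zify.
Set Implicit Arguments. Unset Strict Implicit. Unset Printing Implicit Defensive.
Import Order.TTheory GRing.Theory Num.Theory.
Import numFieldNormedType.Exports.
Local Open Scope classical_set_scope.
Local Open Scope ring_scope.

(** * Entropy of finite-valued codings *)

(** Equilibrium states are not known to be ergodic when uniqueness is proved, so typical behaviour
    is available only on a set of some positive mass. The lower bound used there therefore concerns
    all sets of mass at least al, with constants that depend on al and neither on the set, nor on
    the length, nor on the measure; this allows the number N of switching times and the block length
    L to be chosen last. The exponent has to be exactly P in every count, since an error exp(n e)
    would outweigh a linear gain N. On the upper side the error is removed by gluing arbitrarily
    many words and taking a root; on the lower side, for each n, by a measure with free energy
    within 1 / n of P. What remains is a constant factor per glued word, independent of its length.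
    The gap between P and the pressure of the bad collections is cut into four parts w. Two pay for
    a weight carried by the counts: one half of it turns Phi into a bound on a whole Bowen ball, the
    other discards orbits with large p + s. The third pays for the variation of Phi on nets of
    prefixes and suffixes, and the last makes the sum over their lengths converge. *)

Section FiniteEntropy.
Context {R : realType}.
Implicit Types a b k : R.

Definition eta a : R := if 0 < a then - (a * ln a) else 0.

Lemma ln_le_sub1 a : 0 < a -> ln a <= a - 1.
Proof.
by move=> a0; have := @le_ln1Dx R (a - 1); rewrite (_ : 1 + (a - 1) = a); [apply; lra|ring].
Qed.

Lemma le0E a : 0 <= a -> a <= 0 -> a = 0.
Proof. by move=> h1 h2; apply/eqP; rewrite eq_le h1 h2. Qed.

(** The tangent inequality ln t <= t - 1 at t = b / a. The excess b - a sums to at most 0 when the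
    a's sum to 1 and the b's to at most 1, which gives the Gibbs inequality. *)
Lemma eta_gibbs a b : 0 <= a -> 0 <= b -> (0 < a -> 0 < b) ->
  eta a <= a * (- ln b) + (b - a).
Proof.
rewrite /eta => a0 b0 ab; case: ifP => [a0'|/negbT]; last first.
  by rewrite -leNgt => a0'; rewrite (le0E a0 a0'); lra.
have b0' := ab a0'.
have : ln (b / a) <= b / a - 1 by apply: ln_le_sub1; rewrite divr_gt0.
rewrite ln_div ?posrE// => /(ler_wpM2l a0).
have -> : a * (b / a - 1) = b - a by field; rewrite gt_eqF.
lra.
Qed.

Lemma eta_ge0 a : a <= 1 -> 0 <= eta a.
Proof.
rewrite /eta => a1; case: ifP => // a0.
by rewrite -mulrN mulr_ge0 ?(ltW a0)// oppr_ge0 ln_le0.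
Qed.

Lemma etaE a : 0 <= a -> eta a = a * (- ln a).
Proof.
rewrite /eta mulrN => a0; case: ifP => // /negbT; rewrite -leNgt => a1.
by rewrite (le0E a0 a1) mul0r oppr0.
Qed.

Lemma gibbs (T : finType) (p q : T -> R) :
  (forall t, 0 <= p t) -> \sum_t p t = 1 -> (forall t, 0 <= q t) ->
  \sum_t q t <= 1 -> (forall t, 0 < p t -> 0 < q t) ->
  \sum_t eta (p t) <= \sum_t p t * (- ln (q t)).
Proof.
move=> p0 p1 q0 q1 pq.
have : \sum_t eta (p t) <= \sum_t (p t * (- ln (q t)) + (q t - p t)).
  by apply: ler_sum => t _; apply: eta_gibbs => //; exact: pq.
by rewrite big_split /= sumrB p1; lra.
Qed.

End FiniteEntropy.

(** * Static entropy under finitely additive probabilities *)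

Section Charge.
Context {R : realType} {dsp : measure_display} {X : measurableType dsp}.
Implicit Types m : set X -> R.

(** Static entropy and the elementary estimates need finite additivity only. This covers images of a
    measure under iterates and the setwise limit along an ultrafilter, which are not packaged as
    measures. *)
Record fap m : Prop := Fap {
  fapT : m setT = 1;
  fap_ge0 : forall A, measurable A -> 0 <= m A;
  fapU : forall A B, measurable A -> measurable B -> A `&` B = set0 ->
           m (A `|` B) = m A + m B }.

Lemma fap0 m : fap m -> m set0 = 0.
Proof.
move=> hm; have := fapU hm measurable0 measurable0 (setI0 _).
by rewrite setU0; lra.
Qed.

Lemma fap_le m A B : fap m -> measurable A -> measurable B -> A `<=` B -> m A <= m B.
Proof.
move=> hm mA mB AB.
have mBA : measurable (B `\` A) by exact: measurableD.
have := fapU hm mA mBA _; rewrite setDUK// => ->; last by rewrite setDE setICA setICr setI0.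
by rewrite lerDl; exact: (fap_ge0 hm).
Qed.

Lemma fap_le1 m A : fap m -> measurable A -> m A <= 1.
Proof. by move=> hm mA; rewrite -(fapT hm); apply: fap_le. Qed.

Lemma fapC m A : fap m -> measurable A -> m (~` A) = 1 - m A.
Proof.
move=> hm mA; have := fapU hm mA (measurableC mA) (setICr _).
by rewrite setUCr (fapT hm); lra.
Qed.

Lemma fapUle m A B : fap m -> measurable A -> measurable B ->
  m (A `|` B) <= m A + m B.
Proof.
move=> hm mA mB; have -> : A `|` B = A `|` (B `\` A) by rewrite setDE setUIr setUCr setIT.
have mBA : measurable (B `\` A) by exact: measurableD.
rewrite (fapU hm)//; last by rewrite setDE setICA setICr setI0.
by rewrite lerD2l; apply: fap_le => //; exact: subDsetl.
Qed.

(** A finite measurable partition presented as the map to its index set, so that joins are words or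
    pairs and coarsenings are compositions. *)
Definition mcod (T : finType) (c : X -> T) : Prop :=
  forall t, measurable (c @^-1` [set t]).

Lemma mcodP (T : finType) (c : X -> T) (P : pred T) : mcod c ->
  measurable (c @^-1` [set t | P t]).
Proof.
move=> mc.
have -> : c @^-1` [set t | P t] = \big[setU/set0]_(t in P) (c @^-1` [set t]).
  rewrite -bigcup_seq_cond; apply/seteqP; split => x /=.
  - by move=> Px; exists (c x) => //=; rewrite mem_index_enum.
  - by move=> [t /= /andP[_ Pt] /= ->].
by apply: bigsetU_measurable.
Qed.

Lemma mcod_comp (T T' : finType) (c : X -> T) (h : T -> T') : mcod c -> mcod (h \o c).
Proof.
move=> mc t'; have := mcodP (fun t => h t == t') mc.
by congr measurable; apply/seteqP; split => x /= /eqP.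
Qed.

Lemma fap_sum m (T : finType) (c : X -> T) (P : pred T) : fap m -> mcod c ->
  m (c @^-1` [set t | P t]) = \sum_(t | P t) m (c @^-1` [set t]).
Proof.
move=> hm mc.
have H (s : seq T) : uniq s ->
    m (c @^-1` [set t | t \in s]) = \sum_(t <- s) m (c @^-1` [set t]).
  elim: s => [_|t s IH /= /andP[ts us]].
    rewrite big_nil -(fap0 hm); congr m.
    by apply/seteqP; split => x.
  rewrite big_cons -IH// -(fapU hm) //; last 2 first.
  - exact: mcodP.
  - by apply/seteqP; split => x //= -[-> /=]; apply/negP.
  congr m; apply/seteqP; split => x /=; rewrite inE.
  - by case/orP => [/eqP|]; [left|right].
  - by case=> [->|->]; rewrite ?eqxx ?orbT.
have := H [seq t <- enum T | P t]; rewrite filter_uniq ?enum_uniq// => /(_ isT).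
rewrite big_filter big_enum_cond /= => <-; congr m.
by apply/seteqP; split => x /=; rewrite mem_filter mem_enum andbT.
Qed.

Lemma fap_sum1 m (T : finType) (c : X -> T) : fap m -> mcod c ->
  \sum_t m (c @^-1` [set t]) = 1.
Proof.
move=> hm mc; rewrite -(fap_sum (fun=> true) hm mc) -(fapT hm); congr m.
by apply/seteqP; split.
Qed.

Lemma fap_marg m (T T' : finType) (c : X -> T) (h : T -> T') (F : T' -> R) :
  fap m -> mcod c ->
  \sum_t m (c @^-1` [set t]) * F (h t) =
  \sum_t' m ((h \o c) @^-1` [set t']) * F t'.
Proof.
move=> hm mc; rewrite (partition_big h predT)//=; apply: eq_bigr => t' _.
have -> : (h \o c) @^-1` [set t'] = c @^-1` [set t | h t == t'].
  by apply/seteqP; split => x /= /eqP.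
rewrite (fap_sum (fun t => h t == t') hm mc) mulr_suml.
by apply: eq_bigr => t /eqP ->.
Qed.

Definition Hent m (T : finType) (c : X -> T) : R := \sum_t eta (m (c @^-1` [set t])).

Lemma Hent_gibbs m (T : finType) (c : X -> T) (q : T -> R) : fap m -> mcod c ->
  (forall t, 0 <= q t) -> \sum_t q t <= 1 ->
  (forall t, 0 < m (c @^-1` [set t]) -> 0 < q t) ->
  Hent m c <= \sum_t m (c @^-1` [set t]) * (- ln (q t)).
Proof.
move=> hm mc q0 q1 pq; apply: gibbs => // [t|]; last exact: fap_sum1.
exact: (fap_ge0 hm).
Qed.

Lemma HentE m (T : finType) (c : X -> T) : fap m -> mcod c ->
  Hent m c = \sum_t m (c @^-1` [set t]) * (- ln (m (c @^-1` [set t]))).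
Proof. by move=> hm mc; apply: eq_bigr => t _; rewrite etaE// (fap_ge0 hm). Qed.

Lemma Hent_ge0 m (T : finType) (c : X -> T) : fap m -> mcod c -> 0 <= Hent m c.
Proof. by move=> hm mc; apply: sumr_ge0 => t _; rewrite eta_ge0// fap_le1. Qed.

Lemma Hent_le_card m (T : finType) (c : X -> T) : fap m -> mcod c ->
  Hent m c <= ln #|T|%:R.
Proof.
move=> hm mc; have T0 : (0 < #|T|)%N by apply/card_gt0P; exists (c point).
have T0' : 0 < #|T|%:R :> R by rewrite ltr0n.
have q1 : \sum_(t : T) (#|T|%:R : R)^-1 = 1.
  transitivity ((#|T|%:R : R) * #|T|%:R^-1); first by rewrite sumr_const mulr_natl.
  by rewrite mulfV // gt_eqF.
apply: (@le_trans _ _ (\sum_t m (c @^-1` [set t]) * (- ln (#|T|%:R^-1)))).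
  apply: Hent_gibbs => //; first by rewrite q1.
  by move=> t _; rewrite invr_gt0.
by rewrite -mulr_suml fap_sum1// mul1r lnV ?posrE// opprK.
Qed.

Lemma Hent_comp m (T T' : finType) (c : X -> T) (h : T -> T') : fap m -> mcod c ->
  Hent m (h \o c) <= Hent m c.
Proof.
move=> hm mc; rewrite !HentE//; last exact: mcod_comp.
rewrite -(fap_marg h (fun t => - ln (m ((h \o c) @^-1` [set t]))))//.
apply: ler_sum => t _.
have [p0|p0] := leP (m (c @^-1` [set t])) 0.
  have -> : m (c @^-1` [set t]) = 0.
    by apply/eqP; rewrite eq_le p0 (fap_ge0 hm).
  by rewrite !mul0r.
rewrite ler_wpM2l ?(ltW p0)// lerN2.
have le1 : m (c @^-1` [set t]) <= m ((h \o c) @^-1` [set h t]).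
  by apply: fap_le => //; [exact: mcod_comp|move=> x /= ->].
by rewrite ler_ln ?posrE//; exact: lt_le_trans le1.
Qed.

Lemma Hent_det m (T T' : finType) (c : X -> T) (c' : X -> T') : fap m -> mcod c ->
  (forall x y, c x = c y -> c' x = c' y) -> Hent m c' <= Hent m c.
Proof.
move=> hm mc cc'.
pose h t := c' (xget point [set x | c x = t]).
have -> : c' = h \o c.
  apply/funext => x; apply: cc'.
  by case: xgetP => [y _ ->|/(_ x)] //=.
exact: Hent_comp.
Qed.

Lemma mcod_det (T T' : finType) (c : X -> T) (c' : X -> T') : mcod c ->
  (forall x y, c x = c y -> c' x = c' y) -> mcod c'.
Proof.
move=> mc cc'; pose h t := c' (xget point [set x | c x = t]).
have -> : c' = h \o c.
  apply/funext => x; apply: cc'.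
  by case: xgetP => [y _ ->|/(_ x)] //=.
exact: mcod_comp.
Qed.

Lemma mcod_ffun (A T : finType) (c : A -> X -> T) : (forall a, mcod (c a)) ->
  mcod (fun x => [ffun a => c a x]).
Proof.
move=> mc w.
have -> : (fun x => [ffun a => c a x]) @^-1` [set w] =
    \big[setI/setT]_(a : A) (c a @^-1` [set w a]).
  rewrite -bigcap_seq; apply/seteqP; split => x /=.
  - by move=> <- a _ /=; rewrite ffunE.
  - by move=> H; apply/ffunP => a; rewrite ffunE; apply: H => /=; rewrite mem_index_enum.
by apply: bigsetI_measurable => a _; exact: mc.
Qed.

Lemma mcod_pair (T T' : finType) (c : X -> T) (c' : X -> T') : mcod c -> mcod c' ->
  mcod (fun x => (c x, c' x)).
Proof.
move=> mc mc' [t t'].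
have -> : (fun x => (c x, c' x)) @^-1` [set (t, t')] = c @^-1` [set t] `&` c' @^-1` [set t'].
  by apply/seteqP; split => x /= [-> ->].
exact: measurableI.
Qed.

Lemma ln_prod (I : finType) (g : I -> R) : (forall i, 0 < g i) ->
  ln (\prod_i g i) = \sum_i ln (g i).
Proof.
move=> g0; suff [_ ->] : 0 < \prod_i g i /\ ln (\prod_i g i) = \sum_i ln (g i) by [].
apply: (big_ind2 (fun a b => 0 < a /\ ln a = b)).
- by rewrite ltr01 ln1.
- by move=> a a' b b' [a0 <-] [b0 <-]; rewrite mulr_gt0// lnM.
- by move=> i _.
Qed.

(** Gibbs inequality against the product of the marginal laws. *)
Lemma Hent_subadd m (A T : finType) (c : A -> X -> T) : fap m ->
  (forall a, mcod (c a)) ->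
  Hent m (fun x => [ffun a => c a x]) <= \sum_a Hent m (c a).
Proof.
move=> hm mc; pose C x := [ffun a => c a x]; have mC : mcod C := mcod_ffun mc.
pose p a t := m (c a @^-1` [set t]).
have p0 (a : A) t : 0 <= p a t by apply: (fap_ge0 hm); exact: mc.
have pw a w : m (C @^-1` [set w]) <= p a (w a).
  by apply: fap_le => //; [exact: mc|move=> x /= <-; rewrite ffunE].
apply: (@le_trans _ _ (\sum_w m (C @^-1` [set w]) * (- ln (\prod_a p a (w a))))).
  apply: Hent_gibbs => // [w||w w0]; first by rewrite prodr_ge0.
  - rewrite -(bigA_distr_bigA p) /= big1// => a _; exact: fap_sum1.
  - by apply: prodr_gt0 => a _; exact: lt_le_trans (pw a w).
have -> : \sum_a Hent m (c a) =
    \sum_w m (C @^-1` [set w]) * \sum_a (- ln (p a (w a))).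
  under [RHS]eq_bigr do rewrite mulr_sumr.
  rewrite [RHS]exchange_big /=; apply: eq_bigr => a _.
  rewrite HentE// (fap_marg (fun w : {ffun A -> T} => w a) (fun t => - ln (p a t)))//.
  apply: eq_bigr => t _; congr (m _ * _).
  by apply/seteqP; split => x /=; rewrite ffunE.
apply: ler_sum => w _.
have [w0|w0] := leP (m (C @^-1` [set w])) 0.
  have -> : m (C @^-1` [set w]) = 0 by apply/eqP; rewrite eq_le w0 (fap_ge0 hm).
  by rewrite !mul0r.
rewrite ln_prod ?sumrN// => a; exact: lt_le_trans (pw a w).
Qed.

(** A form of Fano's inequality, where [gs a (v x)] is the guess of [u a x] from [v x]. It is the
    Gibbs inequality for the pair of [u] and [v] against the law of [v] times independent letters
    that follow the guess with weight 1 - k and are uniform otherwise. *)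
Lemma Hent_guess m (A J V : finType) (u : A -> X -> J) (v : X -> V) (gs : A -> V -> J) k :
  fap m -> (forall a, mcod (u a)) -> mcod v -> 0 < k < 1 ->
  Hent m (fun x => [ffun a => u a x]) <= Hent m v +
   \sum_a (- ln (1 - k) + m [set x | u a x <> gs a (v x)] * ln (#|J|%:R / k)).
Proof.
move=> hm mu mv /andP[k0 k1].
pose z x := ([ffun a => u a x], v x).
have mz : mcod z by apply: mcod_pair => //; exact: mcod_ffun.
apply: (@le_trans _ _ (Hent m z)).
  by apply: Hent_det => // x y [-> _].
have J0 : A -> (0 < #|J|)%N by move=> a; apply/card_gt0P; exists (u a point).
have J0' : A -> 1 <= #|J|%:R :> R by move=> a; rewrite ler1n J0.
pose r (j j' : J) : R := (if j == j' then 1 - k else 0) + k / #|J|%:R.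
have r0 (a : A) j j' : 0 < r j j'.
  rewrite /r ltr_wpDl ?divr_gt0 ?(lt_le_trans _ (J0' a))//.
  by case: ifP => // _; rewrite subr_ge0 ltW.
have r1 (a : A) j' : \sum_j r j j' = 1.
  rewrite big_split /= -big_mkcond /= big_pred1_eq sumr_const -[_ *+ #|J|]mulr_natr divfK; last first.
    by rewrite gt_eqF// (lt_le_trans _ (J0' a)).
  by rewrite subrK.
pose pv t := m (v @^-1` [set t]).
pose q (zz : {ffun A -> J} * V) := pv zz.2 * \prod_a r (zz.1 a) (gs a zz.2).
have pz zz : m (z @^-1` [set zz]) <= pv zz.2.
  by apply: fap_le => // x /= <-.
have pr0 (w : {ffun A -> J}) t : 0 < \prod_a r (w a) (gs a t).
  by apply: prodr_gt0 => a _; exact: r0.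
apply: (@le_trans _ _ (\sum_zz m (z @^-1` [set zz]) * (- ln (q zz)))).
  apply: Hent_gibbs => // [zz||zz zz0].
  - by rewrite mulr_ge0 ?(fap_ge0 hm)// ltW.
  - rewrite -(pair_bigA _ (fun (w : {ffun A -> J}) t => pv t * \prod_a r (w a) (gs a t))) exchange_big /=.
    under eq_bigr do rewrite -mulr_sumr.
    rewrite -[leRHS](fap_sum1 hm mv); apply: ler_sum => t _.
    rewrite -(bigA_distr_bigA (fun a j => r j (gs a t))) /= big1 ?mulr1// => a _.
    exact: r1.
  - by rewrite mulr_gt0// (lt_le_trans _ (pz zz)).
have lnr (a : A) j j' : - ln (r j j') <= - ln (1 - k) + (j != j')%:R * ln (#|J|%:R / k).
  have k1' : 0 < 1 - k by rewrite subr_gt0.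
  have J1 := J0' a.
  have l2 : 0 <= ln (#|J|%:R / k).
    by rewrite ln_ge0// ler_pdivlMr// mul1r (le_trans (ltW k1)).
  have l1 : ln (1 - k) <= 0 by apply: ln_le0; rewrite gerBl ltW.
  rewrite /r; case: eqVneq => _ /=.
    have Jp : 0 < #|J|%:R :> R by rewrite (lt_le_trans _ J1).
    have kJ : 0 < k / #|J|%:R by rewrite divr_gt0.
    rewrite mul0r addr0 lerN2 ler_ln; first by rewrite lerDl ltW.
    - by rewrite posrE.
    - by rewrite posrE addr_gt0.
  rewrite mul1r add0r -lnV ?posrE ?divr_gt0 ?(lt_le_trans _ J1)// invf_div.
  by rewrite lerDr oppr_ge0.
have -> : Hent m v = \sum_zz m (z @^-1` [set zz]) * (- ln (pv zz.2)).
  by rewrite HentE// (fap_marg snd (fun t => - ln (pv t))).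

have -> : \sum_a (- ln (1 - k) + m [set x | u a x <> gs a (v x)] * ln (#|J|%:R / k)) =
  \sum_zz m (z @^-1` [set zz]) * \sum_a
     (- ln (1 - k) + (zz.1 a != gs a zz.2)%:R * ln (#|J|%:R / k)).
  under [RHS]eq_bigr do rewrite mulr_sumr.
  rewrite [RHS]exchange_big /=; apply: eq_bigr => a _.
  under [RHS]eq_bigr do rewrite mulrDr mulrA.
  rewrite big_split /= -!mulr_suml (fap_sum1 hm mz) mul1r; congr (_ + _ * _).
  have -> : [set x | u a x <> gs a (v x)] =
      z @^-1` [set zz : {ffun A -> J} * V | zz.1 a != gs a zz.2].
    by apply/seteqP; split => x /=; rewrite ffunE => /eqP.
  rewrite (fap_sum (fun zz : {ffun A -> J} * V => zz.1 a != gs a zz.2) hm mz) big_mkcond /=.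
  by apply: eq_bigr => zz _; case: ifP; rewrite ?mulr1 ?mulr0.
rewrite -big_split /=; apply: ler_sum => zz _; rewrite -mulrDr.
have [w0|w0] := leP (m (z @^-1` [set zz])) 0.
  have -> : m (z @^-1` [set zz]) = 0 by apply/eqP; rewrite eq_le w0 (fap_ge0 hm).
  by rewrite !mul0r.
rewrite ler_wpM2l ?(ltW w0)// /q lnM ?posrE ?(lt_le_trans w0 (pz zz))//.
rewrite opprD lerD2l ln_prod => [|a]; last exact: r0.
by rewrite -sumrN; apply: ler_sum => a _; exact: lnr.
Qed.

(** Each component is tested against the atom masses of the mixture; the average of these cross
    terms is the entropy of the mixture itself. *)
Lemma Hent_concave (I T : finType) (mi : I -> set X -> R) (l : I -> R) m (c : X -> T) :
  (forall i, fap (mi i)) -> fap m -> mcod c -> (forall i, 0 < l i) ->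
  (forall A, measurable A -> m A = \sum_i l i * mi i A) ->
  \sum_i l i * Hent (mi i) c <= Hent m c.
Proof.
move=> hmi hm mc l0 mE.
apply: (@le_trans _ _ (\sum_i l i *
    \sum_t mi i (c @^-1` [set t]) * (- ln (m (c @^-1` [set t]))))).
  apply: ler_sum => i _; apply: ler_wpM2l; first exact: ltW.
  apply: Hent_gibbs => // [t||t t0].
  - exact: (fap_ge0 hm).
  - by rewrite fap_sum1.
  - rewrite mE// (bigD1 i)//= ltr_wpDr ?mulr_gt0//.
    by apply: sumr_ge0 => j _; rewrite mulr_ge0 ?(ltW (l0 j))// (fap_ge0 (hmi j)).
rewrite HentE//.
under eq_bigr do rewrite mulr_sumr.
rewrite exchange_big /=; apply: ler_sum => t _.
rewrite [X in _ <= X * _](mE _ (mc t)) mulr_suml.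
by apply: ler_sum => i _; rewrite mulrA.
Qed.

(** The atom masses of m dominate those of t m1 and (1 - t) m2, so the logarithms lose at most - ln
    t and - ln (1 - t). As - s ln s <= 1 - s, the two losses weigh at most 1 - t and t, whence the
    1. *)
Lemma Hent_mix (T : finType) m m1 m2 t (c : X -> T) :
  fap m -> fap m1 -> fap m2 -> mcod c -> 0 < t < 1 ->
  (forall A, measurable A -> m A = t * m1 A + (1 - t) * m2 A) ->
  Hent m c <= t * Hent m1 c + (1 - t) * Hent m2 c + 1.
Proof.
move=> hm hm1 hm2 mc /andP[t0 t1] mE.
have s0 : 0 < 1 - t by lra.
have key (a b s : R) : 0 <= a -> 0 < s -> s * a <= b ->
    s * a * (- ln b) <= s * (a * (- ln a)) + a * (1 - s).
  move=> a0 s1 ab; have [->|an0] := eqVneq a 0; first by rewrite !(mulr0,mul0r) addr0.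
  have a0' : 0 < a by rewrite lt_neqAle eq_sym an0.
  have sa : 0 < s * a by rewrite mulr_gt0.
  have : ln (s * a) <= ln b by rewrite ler_ln ?posrE//; lra.
  rewrite lnM ?posrE//.
  have : ln s^-1 <= s^-1 - 1 by apply: ln_le_sub1; rewrite invr_gt0.
  rewrite lnV ?posrE// => /(ler_wpM2l (ltW sa)).
  have -> : s * a * (s^-1 - 1) = a * (1 - s) by field; rewrite gt_eqF.
  move=> h1 /(ler_wpM2l (ltW sa)); lra.
have pos A : measurable A -> 0 <= m1 A /\ 0 <= m2 A.
  by move=> mA; rewrite (fap_ge0 hm1)// (fap_ge0 hm2).
rewrite !HentE//.
have : \sum_a m (c @^-1` [set a]) * - ln (m (c @^-1` [set a])) <=
  \sum_a (t * (m1 (c @^-1` [set a]) * - ln (m1 (c @^-1` [set a]))) +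
   (1 - t) * (m2 (c @^-1` [set a]) * - ln (m2 (c @^-1` [set a]))) +
   (m1 (c @^-1` [set a]) * (1 - t) + m2 (c @^-1` [set a]) * t)).
  apply: ler_sum => a _; have := mE _ (mc a); have := pos _ (mc a).
  move: (m _) (m1 _) (m2 _) => x y z [y0 z0] xE.
  have h1 : t * y <= x by rewrite xE lerDl mulr_ge0// ltW.
  have h2 : (1 - t) * z <= x by rewrite xE lerDr mulr_ge0// ltW.
  have := key _ _ _ y0 t0 h1; have := key _ _ _ z0 s0 h2.
  by rewrite {3}xE; lra.
rewrite !big_split /= -!mulr_sumr -!mulr_suml !fap_sum1//; lra.
Qed.

End Charge.

Lemma InP (T : eqType) (x : T) (s : seq T) : List.In x s <-> x \in s.
Proof.
elim: s => [|y s IH] //=; rewrite inE; split.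
- by case=> [->|/IH ->]; rewrite ?eqxx ?orbT.
- by case/orP => [/eqP ->|/IH]; [left|right].
Qed.

Lemma NoDupP (T : eqType) (s : seq T) : List.NoDup s <-> uniq s.
Proof.
elim: s => [|y s IH] /=; first by split => // _; constructor.
split.
- by move=> H; inversion H; subst; apply/andP; split; [apply/negP => /InP|apply/IH].
- by case/andP => ys /IH us; constructor => // /InP; exact/negP.
Qed.

(** * Compact metric spaces and Bowen balls *)

Section Metric.
Context {R : realType} {dsp : measure_display} {X : measurableType dsp}.
Implicit Types (d : X -> X -> R) (x y z : X) (U V F : set X) (g : X -> R) (h : X -> X).

Record cspace d : Prop := Cspace {
  cs_metric : is_metric d;
  cs_compact : dcompact d;
  cs_borel : @measurable dsp X = <<s dopen d >> }.

Lemma dxx d x : cspace d -> d x x = 0.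
Proof. by case=> -[H _ _] _ _; apply/H. Qed.

Lemma dsym d x y : cspace d -> d x y = d y x.
Proof. by case=> -[_ H _] _ _; apply: H. Qed.

Lemma dtri d x y z : cspace d -> d x z <= d x y + d y z.
Proof. by case=> -[_ _ H] _ _; apply: H. Qed.

Lemma d_ge0 d x y : cspace d -> 0 <= d x y.
Proof. by move=> H; have := dtri x y x H; rewrite (dxx x H) (dsym y x H); lra. Qed.

Lemma d_gt0 d x y : cspace d -> x <> y -> 0 < d x y.
Proof.
move=> H xy; rewrite lt_neqAle d_ge0// andbT; apply/eqP => e0.
by case: H => -[H _ _] _ _; apply: xy; apply/H.
Qed.

Definition dclosed d F := dopen d (~` F).

Lemma dopenT d : dopen d setT.
Proof. by move=> x _; exists 1. Qed.

Lemma dopen0 d : dopen d set0.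
Proof. by move=> x. Qed.

Lemma dopenI d U V : dopen d U -> dopen d V -> dopen d (U `&` V).
Proof.
move=> oU oV x [/oU[r r0 rU] /oV[s s0 sV]].
exists (Num.min r s); first by rewrite lt_min r0.
by move=> y; rewrite /dball /= lt_min => /andP[/rU ? /sV].
Qed.

Lemma dopen_bigcup d (I : Type) (P : set I) (U : I -> set X) :
  (forall i, P i -> dopen d (U i)) -> dopen d (\bigcup_(i in P) U i).
Proof.
move=> oU x [i Pi /(oU i Pi)[r r0 rU]]; exists r => // y /rU Uy.
by exists i.
Qed.

Lemma dopenU d U V : dopen d U -> dopen d V -> dopen d (U `|` V).
Proof.
move=> oU oV x [/oU|/oV] [r r0 rU]; exists r => // y /rU; [by left|by right].
Qed.

Lemma dclosedT d : dclosed d setT.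
Proof. by rewrite /dclosed setCT; exact: dopen0. Qed.

Lemma dclosed0 d : dclosed d set0.
Proof. by rewrite /dclosed setC0; exact: dopenT. Qed.

Lemma dclosedU d F F' : dclosed d F -> dclosed d F' -> dclosed d (F `|` F').
Proof. by rewrite /dclosed setCU; exact: dopenI. Qed.

Lemma dclosedI d F F' : dclosed d F -> dclosed d F' -> dclosed d (F `&` F').
Proof. by rewrite /dclosed setCI; exact: dopenU. Qed.

Lemma dclosed_bigcap d (I : Type) (P : set I) (F : I -> set X) :
  (forall i, P i -> dclosed d (F i)) -> dclosed d (\bigcap_(i in P) F i).
Proof. by move=> oU; rewrite /dclosed setC_bigcap; exact: dopen_bigcup. Qed.

Lemma dopenD d U F : dopen d U -> dclosed d F -> dopen d (U `\` F).
Proof. by move=> oU oF; rewrite setDE; exact: dopenI. Qed.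

Lemma dclosedD d U F : dclosed d F -> dopen d U -> dclosed d (F `\` U).
Proof. by move=> oU oF; rewrite setDE; apply: dclosedI => //; rewrite /dclosed setCK. Qed.

Lemma dopen_bigU d (I : eqType) (s : seq I) (P : pred I) (U : I -> set X) :
  (forall i, i \in s -> P i -> dopen d (U i)) -> dopen d (\big[setU/set0]_(i <- s | P i) U i).
Proof.
move=> oU; rewrite big_seq_cond; apply: big_ind => //.
- by move=> U' V'; exact: dopenU.
- by move=> i /andP[]; exact: oU.
Qed.

Lemma dopen_bigI d (I : eqType) (s : seq I) (P : pred I) (U : I -> set X) :
  (forall i, i \in s -> P i -> dopen d (U i)) -> dopen d (\big[setI/setT]_(i <- s | P i) U i).
Proof.
move=> oU; rewrite big_seq_cond; apply: big_ind => //.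
- exact: dopenT.
- by move=> U' V'; exact: dopenI.
- by move=> i /andP[]; exact: oU.
Qed.

Lemma dclosed_bigU d (I : eqType) (s : seq I) (P : pred I) (U : I -> set X) :
  (forall i, i \in s -> P i -> dclosed d (U i)) ->
  dclosed d (\big[setU/set0]_(i <- s | P i) U i).
Proof.
move=> oU; rewrite big_seq_cond; apply: big_ind => //.
- exact: dclosed0.
- exact: dclosedU.
- by move=> i /andP[]; exact: oU.
Qed.

Lemma dclosed_bigI d (I : eqType) (s : seq I) (P : pred I) (U : I -> set X) :
  (forall i, i \in s -> P i -> dclosed d (U i)) ->
  dclosed d (\big[setI/setT]_(i <- s | P i) U i).
Proof.
move=> oU; rewrite big_seq_cond; apply: big_ind => //.
- exact: dclosedT.
- exact: dclosedI.
- by move=> i /andP[]; exact: oU.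
Qed.

Lemma dball_open d x r : cspace d -> dopen d (dball d x r).
Proof.
move=> H y xy; rewrite /dball /= in xy; exists (r - d x y); first by rewrite subr_gt0.
by move=> z; rewrite /dball /= => yz; have := dtri x y z H; lra.
Qed.

Lemma open_measurable d U : cspace d -> dopen d U -> measurable U.
Proof. by move=> H oU; rewrite (cs_borel H); exact: sub_sigma_algebra. Qed.

Lemma closed_measurable d F : cspace d -> dclosed d F -> measurable F.
Proof. by move=> H oF; rewrite -(setCK F); apply: measurableC; exact: open_measurable oF. Qed.

Lemma dcont_real_open d g a : dcont_real d g -> dopen d [set x | g x < a].
Proof.
move=> cg x /= gx; have [e e0 He] := cg x (a - g x) ltac:(lra).
by exists e => // y /He /=; rewrite ltr_norml; lra.
Qed.

Lemma dcont_realN d g : dcont_real d g -> dcont_real d (fun x => - g x).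
Proof.
move=> cg x e e0; have [r r0 H] := cg x e e0; exists r => // y /H.
by rewrite -normrN opprB opprK addrC.
Qed.

Lemma dcont_real_open' d g a : dcont_real d g -> dopen d [set x | a < g x].
Proof.
move=> /dcont_realN/(@dcont_real_open _ _ (- a)); congr dopen.
by apply/seteqP; split => x /=; rewrite ltrN2.
Qed.

Lemma dcont_real_closed d g a : dcont_real d g -> dclosed d [set x | g x <= a].
Proof.
move=> /(@dcont_real_open' _ _ a); congr dopen; apply/seteqP; split => x /=.
- by rewrite ltNge => /negP.
- by move/negP; rewrite -ltNge.
Qed.

Lemma dcont_real_closed' d g a : dcont_real d g -> dclosed d [set x | a <= g x].
Proof.
move=> /(@dcont_real_open _ _ a); congr dopen; apply/seteqP; split => x /=.
- by rewrite ltNge => /negP.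
- by move/negP; rewrite -ltNge.
Qed.

Lemma dcont_cst d (a : R) : dcont_real d (fun=> a).
Proof. by move=> x e e0; exists 1 => // y _; rewrite subrr normr0. Qed.

Lemma dcont_realD d g g' : dcont_real d g -> dcont_real d g' ->
  dcont_real d (fun x => g x + g' x).
Proof.
move=> cg cg' x e e0; have [|r r0 H] := cg x (e / 2); first by lra.
have [|r' r'0 H'] := cg' x (e / 2); first by lra.
exists (Num.min r r'); first by rewrite lt_min r0.
move=> y; rewrite lt_min => /andP[/H gy /H' gy'].
rewrite (_ : _ - _ = (g x - g y) + (g' x - g' y)); last by ring.
by apply: le_lt_trans (ler_normD _ _) _; lra.
Qed.

Lemma dcont_realZ d g (a : R) : dcont_real d g -> dcont_real d (fun x => a * g x).
Proof.
move=> cg x e e0; have a0 : 0 < `|a| + 1 by rewrite ltr_wpDl.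
have [|r r0 H] := cg x (e / (`|a| + 1)); first by rewrite divr_gt0.
exists r => // y /H; rewrite ltr_pdivlMr// -mulrBr normrM => h.
have : 0 <= `|g x - g y| by [].
by have : 0 <= `|a| by []; nra.
Qed.

Lemma dcont_realB d g g' : dcont_real d g -> dcont_real d g' ->
  dcont_real d (fun x => g x - g' x).
Proof. by move=> cg cg'; apply: dcont_realD => //; exact: dcont_realN. Qed.

Lemma dcont_real_sum d (I : Type) (s : seq I) (g : I -> X -> R) :
  (forall i, dcont_real d (g i)) -> dcont_real d (fun x => \sum_(i <- s) g i x).
Proof.
move=> cg; elim: s => [|i s IH].
  by under eq_fun do rewrite big_nil; exact: dcont_cst.
by under eq_fun do rewrite big_cons; exact: dcont_realD.
Qed.

Lemma dcont_real_lip d g (C : R) : 0 < C ->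
  (forall x y, `|g x - g y| <= C * d x y) -> dcont_real d g.
Proof.
move=> C0 H x e e0; exists (e / C); first by rewrite divr_gt0.
by move=> y; rewrite ltr_pdivlMr// => xy; apply: le_lt_trans (H x y) _; rewrite mulrC.
Qed.

Lemma dcont_real_comp d g h : dcont_real d g -> dcont_fun d h -> dcont_real d (g \o h).
Proof.
move=> cg ch x e e0; have [r r0 H] := cg (h x) e e0.
by have [s s0 H'] := ch x r r0; exists s => // y /H'/H.
Qed.

Lemma dcont_real_comp1 d g (k : R -> R) : dcont_real d g -> continuous k ->
  dcont_real d (k \o g).
Proof.
move=> cg ck x e e0; have /cvgrPdist_lt/(_ e e0) := ck (g x).
move=> /nbhs_ballP[r /= r0 H].
by have [s s0 H'] := cg x r r0; exists s => // y /H' xy /=; exact: H.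
Qed.

Lemma dcont_fun_comp d h h' : dcont_fun d h -> dcont_fun d h' -> dcont_fun d (h \o h').
Proof.
move=> cg ch x e e0; have [r r0 H] := cg (h' x) e e0.
by have [s s0 H'] := ch x r r0; exists s => // y /H'/H.
Qed.

Lemma dcont_fun_id d : dcont_fun d id.
Proof. by move=> x e e0; exists e. Qed.

Lemma dcont_fun_iter d h n : dcont_fun d h -> dcont_fun d (iter n h).
Proof.
move=> ch; elim: n => [|n IH] /=; first exact: dcont_fun_id.
exact: (dcont_fun_comp ch IH).
Qed.

Lemma dopen_preimage d h U : dcont_fun d h -> dopen d U -> dopen d (h @^-1` U).
Proof.
move=> ch oU x /= /oU[e e0 eU]; have [r r0 H] := ch x e e0.
by exists r => // y /H /eU.
Qed.

Lemma dclosed_preimage d h F : dcont_fun d h -> dclosed d F -> dclosed d (h @^-1` F).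
Proof. by move=> ch; exact: dopen_preimage. Qed.

Lemma dcont_measurable d h : cspace d -> dcont_fun d h -> measurable_fun setT h.
Proof.
move=> H ch; apply: (measurability (dopen d)); first exact: (cs_borel H).
move=> _ [U oU <-]; rewrite setTI; apply: (open_measurable H).
exact: dopen_preimage.
Qed.

Lemma preimage_measurable d h A : cspace d -> dcont_fun d h -> measurable A ->
  measurable (h @^-1` A).
Proof.
by move=> H ch mA; rewrite -[_ @^-1` _]setTI; apply: (dcont_measurable H ch).
Qed.

Lemma dcont_real_measurable d g : cspace d -> dcont_real d g -> measurable_fun setT g.
Proof.
move=> H cg; apply: (measurability _ (measurable_realfun.RGenOInfty.measurableE R)).
move=> _ [_ [a ->] <-]; rewrite setTI; apply: (open_measurable H).
have := @dcont_real_open' d g a cg; congr dopen.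
by apply/seteqP; split => x /=; rewrite in_itv /= andbT.
Qed.

Lemma dcont_dist d x : cspace d -> dcont_real d (d x).
Proof.
move=> H; apply: (@dcont_real_lip d _ 1) => // y z; rewrite mul1r ler_norml.
have := dtri x y z H; have := dtri x z y H; rewrite (dsym z y H); lra.
Qed.

Lemma lebesgue_number d (I : Type) (U : I -> set X) : cspace d ->
  (forall i, dopen d (U i)) -> (forall x, exists i, U i x) ->
  exists (r : R) (s : seq I), 0 < r /\
    forall x, exists2 i, List.In i s & dball d x r `<=` U i.
Proof.
move=> H oU cU.
have {}cU x : {ir : I * R | 0 < ir.2 /\ dball d x (ir.2 *+ 2) `<=` U ir.1}.
  apply: cid; have [i Ui] := cU x; have [r r0 rU] := oU i x Ui.
  exists (i, r / 2) => /=; split; first by lra.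
  by rewrite mulr2n (_ : r / 2 + r / 2 = r)//; field.
pose B x := dball d x (projT1 (cid (ex_intro _ _ (projT2 (cU x))))).2.
pose rx x := (projT1 (cU x)).2.
have [s Hs] := @cs_compact d H X (fun x => dball d x (rx x))
  (fun x => @dball_open d x (rx x) H)
  (fun x => ex_intro _ x (eq_ind_r (fun t => t < rx x) (proj1 (projT2 (cU x))) (dxx x H))).
have [r r0 Hr] : exists2 r : R, 0 < r & forall x, List.In x s -> r <= rx x.
  elim: s {Hs} => [|x s [r r0 IH]]; first by exists 1.
  exists (Num.min r (rx x)); first by rewrite lt_min r0 (proj1 (projT2 (cU x))).
  move=> y /= [<-|/IH]; rewrite ge_min ?lexx ?orbT// => ->//.
exists r, (map (fun x => (projT1 (cU x)).1) s); split => // x.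
have [y ys xy] := Hs x; exists (projT1 (cU y)).1.
  by elim: s ys {Hs Hr} => //= z s IH [->|/IH]; [left|right].
move=> z xz; apply: (proj2 (projT2 (cU y))); rewrite /dball /= in xy xz *.
have := dtri y x z H; have := Hr _ ys; rewrite -/(rx y); lra.
Qed.

(** The complement of F joins the cover as one more open set, indexed by [None]. *)
Lemma lebesgue_number_closed d (I : Type) (U : I -> set X) F : cspace d ->
  (forall i, dopen d (U i)) -> dclosed d F -> (forall x, F x -> exists i, U i x) ->
  exists (r : R) (s : seq I), 0 < r /\
    forall x, F x -> exists2 i, List.In i s & dball d x r `<=` U i.
Proof.
move=> H oU cF cU; pose V (o : option I) := if o is Some i then U i else ~` F.
have [|x|r [s [r0 Hr]]] := @lebesgue_number d _ V H.
- by case.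
- by have [/cU[i Ui]|Fx] := pselect (F x); [exists (Some i)|exists None].
exists r, (pmap id s); split => // x Fx; have [[i|] /= is_ iU] := Hr x.
- exists i => //; elim: s is_ {Hr} => //= -[j|] s IH [|] //=.
  + by case=> ->; left.
  + by move/IH; right.
- by move: (iU x); rewrite /dball /= (dxx x H) => /(_ r0).
Qed.

Lemma dcont_unif d g : cspace d -> dcont_real d g -> forall e, 0 < e ->
  exists2 r : R, 0 < r & forall x y, d x y < r -> `|g x - g y| < e.
Proof.
move=> H cg e e0; pose U (a : R) := [set x | a - e / 2 < g x] `&` [set x | g x < a + e / 2].
have [a|x|r [s [r0 Hr]]] := @lebesgue_number d _ U H.
- by apply: dopenI; [exact: dcont_real_open'|exact: dcont_real_open].
- by exists (g x); split => /=; lra.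
exists r => // x y xy; have [a _ aU] := Hr x.
have [|/= x1 x2] := aU x; first by rewrite /dball /= (dxx x H).
have [//|/= y1 y2] := aU y.
by rewrite ltr_norml; lra.
Qed.

Lemma dcont_fun_unif d h : cspace d -> dcont_fun d h -> forall e, 0 < e ->
  exists2 r : R, 0 < r & forall x y, d x y < r -> d (h x) (h y) < e.
Proof.
move=> H cg e e0; pose U z := h @^-1` (dball d z (e / 2)).
have [a|x|r [s [r0 Hr]]] := @lebesgue_number d _ U H.
- by apply: dopen_preimage => //; exact: dball_open.
- by exists (h x); rewrite /U /dball /= (dxx _ H); lra.
exists r => // x y xy; have [a _ aU] := Hr x.
have := aU x; rewrite /U /dball /= (dxx x H) => /(_ r0) x1.
have := aU y; rewrite /U /dball /= => /(_ xy) y1.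
by have := dtri (h x) a (h y) H; rewrite (dsym _ a H); lra.
Qed.

Lemma finite_net d (r : R) : cspace d -> 0 < r ->
  exists s : seq X, forall x, exists2 y, y \in s & d y x < r.
Proof.
move=> H r0; have [s Hs] := @cs_compact d H X (fun x => dball d x r)
  (fun x => @dball_open d x r H)
  (fun x => ex_intro _ x (eq_ind_r (fun t => t < r) r0 (dxx x H))).
by exists s => x; have [y /InP ys yx] := Hs x; exists y.
Qed.

Lemma dcont_bounded d g : cspace d -> dcont_real d g ->
  exists2 C : R, 0 < C & forall x, `|g x| <= C.
Proof.
move=> H cg; have [r r0 Hr] := dcont_unif H cg ltr01.
have [s Hs] := finite_net H r0.
exists (1 + \sum_(y <- s) `|g y|); first by rewrite ltr_pwDl// sumr_ge0.
move=> x; have [y ys yx] := Hs x; have := Hr _ _ yx.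
have : `|g y| <= \sum_(y <- s) `|g y|.
  by rewrite (big_rem y)//= lerDl sumr_ge0.
have := ler_normB (g y) (g y - g x); rewrite (_ : g y - (g y - g x) = g x); last by ring.
lra.
Qed.

End Metric.

Section BowenMetric.
Context {R : realType} {dsp : measure_display} {X : measurableType dsp}.
Context (d : X -> X -> R) (f : X -> X) (H : cspace d) (cf : dcont_fun d f).
Implicit Types (x y z : X) (n : nat) (r : R).

Lemma dn_ge0 n x y : 0 <= dn d f n x y.
Proof. by apply: bigmax_ge_id. Qed.

Lemma dn_ltP n x y r : 0 < r ->
  reflect (forall k, (k < n)%N -> d (iter k f x) (iter k f y) < r) (dn d f n x y < r).
Proof.
move=> r0; apply: (iffP idP) => [h k kn|h].
  exact: le_lt_trans (@le_bigmax _ _ _ 0 (fun k : 'I_n => d (iter k f x) (iter k f y)) (Ordinal kn)) h.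
by apply/bigmax_ltP; split => // k _; exact: h.
Qed.

Lemma dn_leP n x y r : 0 <= r ->
  reflect (forall k, (k < n)%N -> d (iter k f x) (iter k f y) <= r) (dn d f n x y <= r).
Proof.
move=> r0; apply: (iffP idP) => [h k kn|h].
  exact: le_trans (@le_bigmax _ _ _ 0 (fun k : 'I_n => d (iter k f x) (iter k f y)) (Ordinal kn)) h.
by apply/bigmax_leP; split => // k _; exact: h.
Qed.

Lemma dn_sym n x y : dn d f n x y = dn d f n y x.
Proof. by apply: eq_bigr => k _; exact: dsym. Qed.

Lemma dnxx n x : dn d f n x x = 0.
Proof.
apply/le_anti; rewrite dn_ge0 andbT; apply/dn_leP => // k _.
by rewrite (dxx _ H).
Qed.

Lemma dn_tri n x y z : dn d f n x z <= dn d f n x y + dn d f n y z.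
Proof.
apply/dn_leP; first by rewrite addr_ge0 ?dn_ge0.
move=> k kn; apply: le_trans (dtri _ (iter k f y) _ H) _.
by apply: lerD; [move: (lexx (dn d f n x y))|move: (lexx (dn d f n y z))];
  move/dn_leP; apply => //; exact: dn_ge0.
Qed.

Lemma dn_mono m n x y : (m <= n)%N -> dn d f m x y <= dn d f n x y.
Proof.
move=> mn; apply/dn_leP; first exact: dn_ge0.
move=> k km; have := lexx (dn d f n x y); move/dn_leP; apply; first exact: dn_ge0.
exact: leq_trans mn.
Qed.

Lemma dn_iter_le p m n x y : (p + m <= n)%N ->
  dn d f m (iter p f x) (iter p f y) <= dn d f n x y.
Proof.
move=> pmn; apply/dn_leP; first exact: dn_ge0.
move=> k km; rewrite -!iterD; have := lexx (dn d f n x y); move/dn_leP; apply.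
  exact: dn_ge0.
by rewrite addnC; apply: leq_trans pmn; rewrite ltn_add2l.
Qed.

Lemma dn_split p g n x y r : 0 <= r -> (n <= p + g)%N ->
  dn d f p x y <= r -> dn d f g (iter p f x) (iter p f y) <= r -> dn d f n x y <= r.
Proof.
move=> r0 npg /(dn_leP _ _ _ r0) h1 /(dn_leP _ _ _ r0) h2; apply/(dn_leP _ _ _ r0) => k kn.
have [kp|pk] := ltnP k p; first exact: h1.
have := h2 (k - p)%N; rewrite -!iterD subnK//; apply.
by rewrite ltn_subLR//; exact: leq_trans kn npg.
Qed.

Lemma bowen_open n x r : dopen d (bowen_ball d f n x r).
Proof.
have [r0|r0] := ltP 0 r; last first.
  have -> : bowen_ball d f n x r = set0; last exact: dopen0.
  apply/seteqP; split => y //=; rewrite /bowen_ball /=.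
  by have := dn_ge0 n x y; lra.
have -> : bowen_ball d f n x r =
    \big[setI/setT]_(k <- iota 0 n) (iter k f @^-1` dball d (iter k f x) r).
  rewrite -bigcap_seq; apply/seteqP; split => y /=.
  - by move/(dn_ltP _ _ _ r0) => h k /=; rewrite mem_iota => /h.
  - by move=> h; apply/(dn_ltP _ _ _ r0) => k kn; apply: (h k); rewrite /= mem_iota.
apply: dopen_bigI => k _ _; apply: dopen_preimage; first exact: dcont_fun_iter.
exact: dball_open.
Qed.

Lemma bowen_closed n x r : dclosed d [set y | dn d f n x y <= r].
Proof.
have [r0|r0] := leP 0 r; last first.
  have -> : [set y | dn d f n x y <= r] = set0; last exact: dclosed0.
  by apply/seteqP; split => y //=; have := dn_ge0 n x y; lra.
have -> : [set y | dn d f n x y <= r] =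
    \big[setI/setT]_(k <- iota 0 n) (iter k f @^-1` [set y | d (iter k f x) y <= r]).
  rewrite -bigcap_seq; apply/seteqP; split => y /=.
  - by move/(dn_leP _ _ _ r0) => h k /=; rewrite mem_iota => /h.
  - by move=> h; apply/(dn_leP _ _ _ r0) => k kn; apply: (h k); rewrite /= mem_iota.
apply: dclosed_bigI => k _ _; apply: dclosed_preimage; first exact: dcont_fun_iter.
by apply: dcont_real_closed; exact: dcont_dist.
Qed.

Definition sep n r (E : seq X) := {in E &, forall x y, x <> y -> r < dn d f n x y}.

Lemma sepP n r E : Defs.separated d f n r E <-> sep n r E.
Proof.
split => h x y; first by move=> /InP xE /InP yE; exact: h.
by move=> /InP xE /InP yE; exact: h.
Qed.

(** Pigeonhole on a finite cover by Bowen balls of radius r / 2. *)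
Lemma sep_bounded n r : 0 < r ->
  exists N : nat, forall E, uniq E -> sep n r E -> (size E <= N)%N.
Proof.
move=> r0; have r20 : 0 < r / 2 by lra.
have [s Hs] := @cs_compact _ _ _ d H X (fun x => bowen_ball d f n x (r / 2))
  (fun x => @bowen_open n x (r / 2))
  (fun x => ex_intro _ x (eq_ind_r (fun t => t < r / 2) r20 (dnxx n x))).
exists (size s) => E uE sE.
pose h x := xget point [set y | y \in s /\ dn d f n y x < r / 2].
have hP x : h x \in s /\ dn d f n (h x) x < r / 2.
  rewrite /h; case: xgetP => [y _ //|]; have [y /InP ys yx] := Hs x.
  by move/(_ y) => /=; tauto.
have hinj : {in E &, injective h}.
  move=> x y xE yE hxy; apply: contrapT => xy.
  have := sE x y xE yE xy; have := dn_tri n x (h x) y; rewrite (dn_sym n x (h x)).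
  by have := (hP x).2; have := (hP y).2; rewrite hxy; lra.
rewrite -(size_map h E); apply: uniq_leq_size; first by rewrite map_inj_in_uniq.
by move=> _ /mapP[x xE ->]; exact: (hP x).1.
Qed.

(** A separated subset of largest size is also a net: a point of Z far from it could be added. *)
Lemma max_sep n r (Z : set X) : 0 < r ->
  exists E : seq X, [/\ uniq E, sep n r E, (forall x, x \in E -> Z x) &
    forall z, Z z -> exists2 x, x \in E & dn d f n x z <= r].
Proof.
move=> r0; have [N HN] := sep_bounded n r0.
pose Q k := `[< exists E, [/\ uniq E, sep n r E, (forall x, x \in E -> Z x) & size E = k] >].
have Q0 : exists k, Q k by exists 0%N; apply/asboolP; exists [::].
have QN k : Q k -> (k <= N)%N by move/asboolP => [E [uE sE _ <-]]; exact: HN.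
case: (ex_maxnP Q0 QN) => k /asboolP[E [uE sE ZE Ek]] kmax.
exists E; split => // z Zz; apply: contrapT => hz.
have {}hz x : x \in E -> r < dn d f n x z.
  by move=> xE; rewrite ltNge; apply/negP => xz; apply: hz; exists x.
have zE : z \notin E by apply/negP => /hz; rewrite dnxx; lra.
suff /kmax : Q k.+1 by rewrite ltnn.
apply/asboolP; exists (z :: E); split => /=.
- by rewrite zE.
- move=> x y; rewrite !inE => /orP[/eqP ->|xE] /orP[/eqP ->|yE] // xy.
  + by rewrite dn_sym; exact: hz.
  + exact: hz.
  + exact: sE.
- by move=> x; rewrite inE => /orP[/eqP ->|/ZE].
- by rewrite Ek.
Qed.

End BowenMetric.

(** * Integration and regularity *)

Section MkProb.
Context {R : realType} {dsp : measure_display} {X : measurableType dsp}.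
Context (m : set X -> \bar R) (m0 : m set0 = 0%E) (mge : forall A, (0 <= m A)%E).
Context (madd : semi_sigma_additive m) (m1 : m setT = 1%E).

(** The vacuous [let] makes the constant depend on the four proofs, so that the structures of
    measure and probability can be attached to it. *)
Definition mkprob : set X -> \bar R := let _ := (m0, mge, madd, m1) in m.

HB.instance Definition _ := isMeasure.Build dsp X R mkprob m0 mge madd.
HB.instance Definition _ := Measure_isProbability.Build dsp X R mkprob m1.

Lemma prob_of : exists P : probability X R, forall A, P A = m A.
Proof. by exists (mkprob : probability X R). Qed.

End MkProb.

Section Expectation.
Context {R : realType} {dsp : measure_display} {X : measurableType dsp}.
Implicit Types (mu nu : probability X R) (g h : X -> R) (A B : set X).

Definition pr mu A : R := fine (mu A).

Lemma prE mu A : measurable A -> mu A = (pr mu A)%:E.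
Proof. by move=> mA; rewrite fineK// fin_num_measure. Qed.

Lemma pr_fap mu : fap (pr mu).
Proof.
split; first by rewrite /pr probability_setT.
- by move=> A mA; rewrite /pr fine_ge0.
- move=> A B mA mB AB; rewrite /pr measureU//.
  by rewrite fineD// fin_num_measure.
Qed.

Lemma pr_ge0 mu A : 0 <= pr mu A.
Proof. by rewrite /pr fine_ge0. Qed.

Definition bmeas g := measurable_fun setT g /\ exists C, forall x, `|g x| <= C.

Lemma bmeas_cst (a : R) : bmeas (fun=> a).
Proof. by split; [exact: measurable_cst|exists `|a|]. Qed.

Lemma bmeasD g h : bmeas g -> bmeas h -> bmeas (fun x => g x + h x).
Proof.
move=> [mg [C gC]] [mh [C' hC]]; split; first exact: measurable_funD.
by exists (C + C') => x; apply: le_trans (ler_normD _ _) (lerD _ _).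
Qed.

Lemma bmeasM g h : bmeas g -> bmeas h -> bmeas (fun x => g x * h x).
Proof.
move=> [mg [C gC]] [mh [C' hC]]; split; first exact: measurable_funM.
by exists (C * C') => x; rewrite normrM; apply: ler_pM.
Qed.

Lemma bmeasZ (a : R) g : bmeas g -> bmeas (fun x => a * g x).
Proof. by move=> bg; apply: bmeasM => //; exact: bmeas_cst. Qed.

Lemma bmeasN g : bmeas g -> bmeas (fun x => - g x).
Proof.
move=> /(bmeasZ (-1)); congr bmeas; apply/funext => x; ring.
Qed.

Lemma bmeasB g h : bmeas g -> bmeas h -> bmeas (fun x => g x - h x).
Proof. by move=> bg bh; apply: bmeasD => //; exact: bmeasN. Qed.

Lemma bmeas_norm g : bmeas g -> bmeas (fun x => `|g x|).
Proof.
move=> [mg [C gC]]; split; first exact: measurableT_comp.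
by exists C => x; rewrite normr_id.
Qed.

Lemma bmeas_sum (I : Type) (s : seq I) (g : I -> X -> R) :
  (forall i, bmeas (g i)) -> bmeas (fun x => \sum_(i <- s) g i x).
Proof.
move=> bg; elim: s => [|i s IH].
  by under eq_fun do rewrite big_nil; exact: bmeas_cst.
by under eq_fun do rewrite big_cons; exact: bmeasD.
Qed.

Lemma bmeas_indic A : measurable A -> bmeas (\1_A : X -> R).
Proof.
move=> mA; split; first exact: measurable_indic.
by exists 1 => x; rewrite indicE; case: (_ \in _); rewrite ?normr1 ?normr0.
Qed.

Lemma bmeas_level g (a : R) : bmeas g -> measurable [set x | a < g x].
Proof.
move=> [mg _]; have := mg measurableT `]a, +oo[%classic (measurable_itv _).
rewrite setTI; congr measurable; apply/seteqP.
by split => x /=; rewrite in_itv /= andbT.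
Qed.

Lemma bmeas_comp g (f : X -> X) : bmeas g -> measurable_fun setT f -> bmeas (g \o f).
Proof.
move=> [mg [C gC]] mf; split; first exact: measurableT_comp.
by exists C => x /=.
Qed.

Lemma bmeas_integrable mu g : bmeas g -> mu.-integrable setT (EFin \o g).
Proof.
move=> [mg [C gC]]; apply: measurable_bounded_integrable => //.
  exact: le_lt_trans (probability_le1 mu measurableT) (ltry _).
exists C; split; first exact: num_real.
by move=> M CM x _ /=; apply: le_trans (gC x) (ltW CM).
Qed.

Definition Ex mu g : R := fine (\int[mu]_x (g x)%:E)%E.

Lemma ExE mu g : bmeas g -> (\int[mu]_x (g x)%:E)%E = (Ex mu g)%:E.
Proof. by move=> bg; rewrite fineK// integrable_fin_num// bmeas_integrable. Qed.

Lemma ExD mu g h : bmeas g -> bmeas h -> Ex mu (fun x => g x + h x) = Ex mu g + Ex mu h.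
Proof. by move=> bg bh; apply: RintegralD => //; exact: bmeas_integrable. Qed.

Lemma ExZ mu (a : R) g : bmeas g -> Ex mu (fun x => a * g x) = a * Ex mu g.
Proof. by move=> bg; apply: RintegralZl => //; exact: bmeas_integrable. Qed.

Lemma Ex_cst mu (a : R) : Ex mu (fun=> a) = a.
Proof.
have e1 : mu setT = 1%E := probability_setT mu.
transitivity (a * fine (mu setT)); last by rewrite e1 mulr1.
exact: (@Rintegral_cst _ _ _ mu setT measurableT a).
Qed.

Lemma ExN mu g : bmeas g -> Ex mu (fun x => - g x) = - Ex mu g.
Proof.
move=> bg; rewrite -mulN1r -ExZ//; congr (Ex mu _).
by apply/funext => x; rewrite mulN1r.
Qed.

Lemma ExB mu g h : bmeas g -> bmeas h -> Ex mu (fun x => g x - h x) = Ex mu g - Ex mu h.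
Proof. by move=> bg bh; rewrite ExD ?ExN//; exact: bmeasN. Qed.

Lemma Ex_le mu g h : bmeas g -> bmeas h -> (forall x, g x <= h x) -> Ex mu g <= Ex mu h.
Proof.
by move=> bg bh gh; apply: le_Rintegral => //; exact: bmeas_integrable.
Qed.

Lemma Ex_ge0 mu g : (forall x, 0 <= g x) -> 0 <= Ex mu g.
Proof. by move=> g0; apply: Rintegral_ge0. Qed.

Lemma Ex_sum mu (I : Type) (s : seq I) (g : I -> X -> R) :
  (forall i, bmeas (g i)) -> Ex mu (fun x => \sum_(i <- s) g i x) = \sum_(i <- s) Ex mu (g i).
Proof.
move=> bg; elim: s => [|i s IH].
  by rewrite big_nil; under eq_fun do rewrite big_nil; exact: Ex_cst.
rewrite big_cons -IH -ExD//; last exact: bmeas_sum.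
by congr (Ex mu _); apply/funext => x; rewrite big_cons.
Qed.

Lemma Ex_indic mu A : measurable A -> Ex mu (\1_A) = pr mu A.
Proof. by move=> mA; rewrite /Ex integral_indic// setIT. Qed.

Lemma Ex_abs mu g : bmeas g -> `|Ex mu g| <= Ex mu (fun x => `|g x|).
Proof.
move=> bg; rewrite ler_norml; apply/andP; split; last first.
  by apply: Ex_le => //; [exact: bmeas_norm|move=> x; exact: ler_norm].
rewrite -ExN; last exact: bmeas_norm.
apply: Ex_le => //; first by apply: bmeasN; exact: bmeas_norm.
by move=> x; rewrite lerNl -normrN ler_norm.
Qed.

Lemma Ex_bound mu g (C : R) : bmeas g -> (forall x, `|g x| <= C) -> `|Ex mu g| <= C.
Proof.
move=> bg gC; apply: le_trans (Ex_abs mu bg) _.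
rewrite -[leRHS](Ex_cst mu C); apply: Ex_le => //; first exact: bmeas_norm.
exact: bmeas_cst.
Qed.

Lemma Ex_markov mu g (a : R) : bmeas g -> (forall x, 0 <= g x) -> 0 < a ->
  pr mu [set x | a < g x] <= Ex mu g / a.
Proof.
move=> bg g0 a0; rewrite ler_pdivlMr// mulrC -Ex_indic; last exact: bmeas_level.
have bi : bmeas (\1_[set x | a < g x] : X -> R).
  by apply: bmeas_indic; exact: bmeas_level.
rewrite -ExZ//; apply: Ex_le => //; first exact: bmeasZ.
move=> x; rewrite indicE; case: (boolP (x \in _)) => [|_]; last by rewrite mulr0.
by rewrite inE /= mulr1 => /ltW.
Qed.

(** Rounds a number of [0, 1] up to a multiple of 1 / N, as an average of indicators of levels.
    Integrals are thus read off, to within 1 / N, from the masses of superlevel sets, and statements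
    on sets transfer to functions. *)
Definition layer (N : nat) (a : R) : R := N%:R^-1 * \sum_(k < N) ((k%:R / N%:R < a)%R)%:R.

Lemma layer_bound (N : nat) (a : R) : (0 < N)%N -> 0 <= a <= 1 ->
  a <= layer N a <= a + N%:R^-1.
Proof.
move=> N0 /andP[a0 a1]; have N0' : 0 < N%:R :> R by rewrite ltr0n.
rewrite /layer; set S := \sum_(k < N) _.
suff : a * N%:R <= S <= a * N%:R + 1.
  case/andP => h1 h2; rewrite mulrC ler_pdivlMr// h1 ler_pdivrMr//.
  by rewrite mulrDl mulVf ?gt_eqF.
have {S}-> : S = \sum_(k < N) ((k%:R < a * N%:R)%R)%:R.
  by apply: eq_bigr => k _; rewrite ltr_pdivrMr.
have : a * N%:R <= N%:R by rewrite ler_piMl// ltW.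
have : 0 <= a * N%:R by rewrite mulr_ge0// ltW.
move: (a * N%:R) => b {N0 N0' a0 a1}.
elim: N => [|n IH] b0 bn; first by rewrite big_ord0; lra.
rewrite big_ord_recr /=; case: (ltP n%:R b) => nb.
  have -> : \sum_(i < n) (((widen_ord (leqnSn n) i)%:R < b)%R)%:R = n%:R :> R.
    rewrite (eq_bigr (fun=> 1)) ?sumr_const ?card_ord// => i _ /=.
    by rewrite (lt_le_trans _ (ltW nb)) ?ltr_nat.
  by rewrite -natr1 in bn; rewrite mulr1n; lra.
by rewrite addr0; apply: IH.
Qed.

Lemma layer_Ex mu g (N : nat) : bmeas g -> (0 < N)%N -> (forall x, 0 <= g x <= 1) ->
  Ex mu g <= N%:R^-1 * \sum_(k < N) pr mu [set x | k%:R / N%:R < g x] <= Ex mu g + N%:R^-1.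
Proof.
move=> bg N0 g01.
have bi (k : 'I_N) : bmeas (\1_[set x | k%:R / N%:R < g x] : X -> R).
  by apply: bmeas_indic; exact: bmeas_level.
have -> : N%:R^-1 * \sum_(k < N) pr mu [set x | k%:R / N%:R < g x] =
    Ex mu (fun x => layer N (g x)).
  transitivity (Ex mu (fun x => N%:R^-1 * \sum_(k < N) \1_[set x | k%:R / N%:R < g x] x)).
    rewrite ExZ; last exact: bmeas_sum.
    rewrite Ex_sum//; congr (_ * _); apply: eq_bigr => k _.
    by rewrite Ex_indic//; exact: bmeas_level.
  congr (Ex mu _); apply/funext => x; congr (_ * _); apply: eq_bigr => k _.
  by rewrite indicE; congr ((nat_of_bool _)%:R); apply/idP/idP; rewrite inE.
have bl : bmeas (fun x => layer N (g x)).
  rewrite (_ : (fun x => layer N (g x)) =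
    (fun x => N%:R^-1 * \sum_(k < N) \1_[set x | k%:R / N%:R < g x] x)).
    by apply: bmeasZ; exact: bmeas_sum.
  apply/funext => x; congr (_ * _); apply: eq_bigr => k _.
  by rewrite indicE; congr ((nat_of_bool _)%:R); apply/idP/idP; rewrite inE.
apply/andP; split.
  by apply: Ex_le => // x; have /andP[] := layer_bound N0 (g01 x).
rewrite -[X in _ + X](Ex_cst mu) -ExD//; last exact: bmeas_cst.
apply: Ex_le => //; first by apply: bmeasD => //; exact: bmeas_cst.
by move=> x; have /andP[] := layer_bound N0 (g01 x).
Qed.

Lemma inv_nat_small (e : R) : 0 < e -> exists2 N : nat, (0 < N)%N & N%:R^-1 < e.
Proof.
move=> e0; exists (Num.truncn e^-1).+1 => //.
rewrite -[ltRHS]invrK ltf_pV2 ?posrE ?invr_gt0// ?ltr0n//.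
exact: truncnS_gt.
Qed.

Lemma bmeas_scale g (C : R) : 0 < C -> bmeas g -> (forall x, `|g x| <= C) ->
  let G := fun x => (2 * C)^-1 * (g x + C) in
  [/\ bmeas G, forall x, 0 <= G x <= 1 & forall mu, Ex mu g = 2 * C * Ex mu G - C].
Proof.
move=> C0 bg gC G; have C2 : 0 < 2 * C by lra.
have bgC : bmeas (fun x => g x + C) by apply: bmeasD => //; exact: bmeas_cst.
split; first exact: bmeasZ.
- move=> x; rewrite /G mulrC; have := gC x; rewrite ler_norml => /andP[h1 h2].
  by rewrite divr_ge0 ?ler_pdivrMr//; lra.
- move=> mu; rewrite /G ExZ// ExD// ?Ex_cst; last exact: bmeas_cst.
  by rewrite mulrA mulfV ?gt_eqF// mul1r addrK.
Qed.

Lemma bmeas_pos g : bmeas g -> exists2 C : R, 0 < C & forall x, `|g x| <= C.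
Proof.
move=> [_ [C gC]]; exists (`|C| + 1); first by rewrite ltr_wpDl.
by move=> x; have := gC x; have := ler_norm C; lra.
Qed.

Lemma Ex_lin mu (I : finType) (mi : I -> probability X R) (w : I -> R) g :
  (forall A, measurable A -> pr mu A = \sum_i w i * pr (mi i) A) ->
  (forall i, 0 <= w i) -> bmeas g -> Ex mu g = \sum_i w i * Ex (mi i) g.
Proof.
move=> mE w0 bg.
have w1 : \sum_i w i = 1.
  have := mE _ measurableT; rewrite (fapT (pr_fap mu)) => ->.
  by apply: eq_bigr => i _; rewrite (fapT (pr_fap (mi i))) mulr1.
have [C C0 gC] := bmeas_pos bg.
pose G x := (2 * C)^-1 * (g x + C).
have [bG G01 EG] : [/\ bmeas G, forall x, 0 <= G x <= 1 &
  forall mu, Ex mu g = 2 * C * Ex mu G - C] := bmeas_scale C0 bg gC.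
suff -> : Ex mu g = 2 * C * (\sum_i w i * Ex (mi i) G) - C.
  have CE : C = \sum_i w i * C by rewrite -mulr_suml w1 mul1r.
  rewrite mulr_sumr [X in _ - X]CE -sumrB.
  by apply: eq_bigr => i _; rewrite EG; ring.
rewrite EG; congr (_ * _ - _).
apply/eqP; rewrite -subr_eq0 -normr_le0; apply/ler_addgt0Pr => e e0; rewrite add0r.
have [N N0 Ne] := inv_nat_small e0.
have := layer_Ex mu bG N0 G01.
have -> : N%:R^-1 * (\sum_(k < N) pr mu [set x | k%:R / N%:R < G x]) =
   \sum_i w i * (N%:R^-1 * (\sum_(k < N) pr (mi i) [set x | k%:R / N%:R < G x])).
  under [RHS]eq_bigr do rewrite mulrCA !mulr_sumr.
  rewrite [RHS]exchange_big /= mulr_sumr; apply: eq_bigr => k _.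
  rewrite mE; last exact: bmeas_level.
  by rewrite mulr_sumr; apply: eq_bigr.
have h1 : \sum_i w i * Ex (mi i) G <=
    \sum_i w i * (N%:R^-1 * (\sum_(k < N) pr (mi i) [set x | k%:R / N%:R < G x])).
  by apply: ler_sum => i _; apply: ler_wpM2l => //; have /andP[] := layer_Ex (mi i) bG N0 G01.
have h2 : \sum_i w i * (N%:R^-1 * (\sum_(k < N) pr (mi i) [set x | k%:R / N%:R < G x]))
   <= \sum_i w i * Ex (mi i) G + N%:R^-1.
  have NE : N%:R^-1 = \sum_i w i * N%:R^-1 by rewrite -mulr_suml w1 mul1r.
  rewrite [X in _ + X]NE -big_split /=.
  apply: ler_sum => i _; rewrite -mulrDr; apply: ler_wpM2l => //.
  by have /andP[] := layer_Ex (mi i) bG N0 G01.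
by move=> /andP[h3 h4]; rewrite ler_norml; lra.
Qed.

Lemma Ex_level_le mu nu g h : bmeas g -> bmeas h ->
  (forall a : R, pr mu [set x | a < g x] <= pr nu [set x | a < h x]) -> Ex mu g <= Ex nu h.
Proof.
move=> bg bh H.
have [C0 C00 gC0] := bmeas_pos bg; have [C1 C10 hC1] := bmeas_pos bh.
have [C CE] : exists C : R, C = C0 + C1 by exists (C0 + C1).
have C0' : 0 < C by rewrite CE addr_gt0.
have gC x : `|g x| <= C by have := gC0 x; lra.
have hC x : `|h x| <= C by have := hC1 x; lra.
have [bG G01 ->] := bmeas_scale C0' bg gC.
have [bH H01 ->] := bmeas_scale C0' bh hC.
rewrite lerD2r ler_pM2l; last by lra.
apply/ler_addgt0Pr => e e0; have [N N0 Ne] := inv_nat_small e0.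
have /andP[h1 _] := layer_Ex mu bG N0 G01.
have /andP[_ h2] := layer_Ex nu bH N0 H01.
suff : N%:R^-1 * \sum_(k < N) pr mu [set x | k%:R / N%:R < (2 * C)^-1 * (g x + C)] <=
  N%:R^-1 * \sum_(k < N) pr nu [set x | k%:R / N%:R < (2 * C)^-1 * (h x + C)].
  by lra.
rewrite ler_wpM2l ?invr_ge0//; apply: ler_sum => k _.
have C2 : 0 < 2 * C by lra.
have e1 (u : X -> R) : [set x | k%:R / N%:R < (2 * C)^-1 * (u x + C)] =
    [set x | k%:R / N%:R * (2 * C) - C < u x].
  by apply/seteqP; split => x /=; rewrite [(2 * C)^-1 * _]mulrC ltr_pdivlMr// ltrBlDr.
by rewrite !e1.
Qed.

Lemma Ex_invariant mu (f : X -> X) g : measurable_fun setT f -> finvariant f mu ->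
  bmeas g -> Ex mu (g \o f) = Ex mu g.
Proof.
move=> mf fmu bg; have bgf := bmeas_comp bg mf.
have e (a : R) : pr mu [set x | a < (g \o f) x] = pr mu [set x | a < g x].
  by rewrite /pr -(fmu _ (bmeas_level a bg)).
by apply/le_anti/andP; split; apply: Ex_level_le => // a; rewrite e.
Qed.

Lemma Ex_dirac x g : bmeas g -> Ex (dirac x : probability X R) g = g x.
Proof.
move=> bg; have mg : measurable_fun setT (EFin \o g) by apply/measurable_EFinP; exact: bg.1.
by rewrite /Ex integral_dirac//= indicE in_setT mul1r.
Qed.

Lemma prob_mix (I : finType) (mi : I -> probability X R) (w : I -> R) :
  (forall i, 0 <= w i) -> \sum_i w i = 1 ->
  exists mu : probability X R, forall A, measurable A ->
    pr mu A = \sum_i w i * pr (mi i) A.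
Proof.
move=> w0 w1.
have H (s : seq I) : exists M : {measure set X -> \bar R},
    forall A, M A = (\sum_(i <- s) (w i)%:E * mi i A)%E.
  elim: s => [|i s [M HM]].
    by exists mzero => A; rewrite big_nil.
  exists (measure_add (mscale (NngNum (w0 i)) (mi i)) M) => A.
  transitivity (mscale (NngNum (w0 i)) (mi i) A + M A)%E; first exact: measure_addE.
  by rewrite HM big_cons.
have [M HM] := H (index_enum I).
have MT : M setT = 1%E.
  rewrite HM (eq_bigr (fun i => (w i)%:E)) => [|i _]; last first.
    by rewrite probability_setT mule1.
  by rewrite sumEFin w1.
have [mu Hmu] := @prob_of _ _ _ M (measure0 M) (fun A => measure_ge0 M A)
  (@measure_semi_sigma_additive _ _ _ M) MT.
exists mu => A mA; rewrite /pr Hmu HM.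
rewrite (eq_bigr (fun i => (w i * pr (mi i) A)%:E)) => [|i _]; last by rewrite prE.
by rewrite sumEFin.
Qed.

Lemma prob_discrete (I : finType) (x : I -> X) (w : I -> R) :
  (forall i, 0 <= w i) -> \sum_i w i = 1 ->
  exists mu : probability X R, (forall A, measurable A ->
    pr mu A = \sum_i w i * \1_A (x i)) /\
    forall g, bmeas g -> Ex mu g = \sum_i w i * g (x i).
Proof.
move=> w0 w1; have [mu Hmu] := prob_mix (fun i => dirac (x i) : probability X R) w0 w1.
exists mu; split=> [A mA|g bg].
  by rewrite Hmu//; apply: eq_bigr => i _; rewrite /pr /= diracE indicE.
rewrite (Ex_lin Hmu)//; apply: eq_bigr => i _; rewrite Ex_dirac//.
Qed.

Lemma prob_cond mu D : measurable D -> 0 < pr mu D ->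
  exists nu : probability X R, forall A, measurable A -> pr nu A = pr mu (A `&` D) / pr mu D.
Proof.
move=> mD D0.
have k0 : 0 <= (pr mu D)^-1 by rewrite invr_ge0 ltW.
pose M : {measure set X -> \bar R} := mscale (NngNum k0) (mrestr mu mD).
have MT : M setT = 1%E.
  rewrite /M /= /mscale /= /mrestr setTI prE// -EFinM mulVf// gt_eqF//.
have [nu Hnu] := @prob_of _ _ _ M (measure0 M) (fun A => measure_ge0 M A)
  (@measure_semi_sigma_additive _ _ _ M) MT.
exists nu => A mA; rewrite /pr Hnu /M /= /mscale /= /mrestr.
by rewrite prE; [rewrite mulrC|exact: measurableI].
Qed.

Lemma pr_decr mu (F : (set X)^nat) : (forall n, measurable (F n)) ->
  (forall n, F n.+1 `<=` F n) ->
  forall e : R, 0 < e -> exists n, forall m, (n <= m)%N ->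
    pr mu (F m) <= pr mu (\bigcap_k F k) + e.
Proof.
move=> mF dF e e0.
have F0 : (mu (F 0%N) < +oo)%E by rewrite (le_lt_trans (probability_le1 mu (mF 0%N)))// ltry.
have T0 : [set: nat] !=set0 by exists 0%N.
have Fd : {homo F : n m / (n <= m)%N >-> (m <= n)%O}.
  by apply/nonincreasing_seqP => n; apply/subsetPset; exact: dF.
have mI : measurable (\bigcap_k F k) by exact: bigcap_measurable.
have : (mu \o F) n @[n --> \oo] --> (pr mu (\bigcap_n F n))%:E.
  by rewrite -prE//; exact: nonincreasing_cvg_mu.
move=> /fine_cvgP[_] /cvgrPdist_le /(_ e e0)[n _ Hn].
exists n => m nm; have := Hn m nm; rewrite /= ler_norml => /andP[h _].
by rewrite -/(pr mu (F m)) in h; lra.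
Qed.

Lemma pr_incr mu (F : (set X)^nat) : (forall n, measurable (F n)) ->
  (forall n, F n `<=` F n.+1) ->
  forall e : R, 0 < e -> exists n, forall m, (n <= m)%N ->
    pr mu (\bigcup_k F k) <= pr mu (F m) + e.
Proof.
move=> mF iF e e0.
have [|n|n Hn] := @pr_decr mu (fun n => ~` F n) _ _ e e0.
- by move=> n; exact: measurableC.
- exact: subsetC.
exists n => m nm; have := Hn m nm; rewrite -setC_bigcup !(fapC (pr_fap mu))//; first by lra.
exact: bigcup_measurable.
Qed.

Lemma fap_bigU_le mu (n : nat) (F : nat -> set X) : (forall n, measurable (F n)) ->
  pr mu (\big[setU/set0]_(i < n) F i) <= \sum_(i < n) pr mu (F i).
Proof.
move=> mF; elim: n => [|n IH]; first by rewrite !big_ord0 (fap0 (pr_fap mu)).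
rewrite !big_ord_recr /=.
apply: le_trans (fapUle (pr_fap mu) _ (mF n)) _; last by rewrite lerD2r.
exact: bigsetU_measurable.
Qed.

End Expectation.

Section Regularity.
Context {R : realType} {dsp : measure_display} {X : measurableType dsp}.
Context (d : X -> X -> R) (H : cspace d).
Implicit Types (mu nu : probability X R) (A U K : set X).

Definition inner_set U (r : R) : set X := [set x | forall y, ~ U y -> r <= d x y].

Lemma inner_closed U r : dclosed d (inner_set U r).
Proof.
have -> : inner_set U r = \bigcap_(y in ~` U) [set x | r <= d y x].
  by apply/seteqP; split => x Hx y Uy; have := Hx y Uy; rewrite /= (dsym _ _ H).
by apply: dclosed_bigcap => y _; apply: dcont_real_closed'; exact: dcont_dist.
Qed.

Lemma inner_sub U r : 0 < r -> inner_set U r `<=` U.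
Proof.
move=> r0 x Hx; apply: contrapT => /Hx; rewrite (dxx _ H); lra.
Qed.

Lemma inner_cover U : dopen d U -> U `<=` \bigcup_n inner_set U (n.+1%:R^-1).
Proof.
move=> oU x /oU[r r0 rU]; have [[|N]//= _ Nr] := inv_nat_small r0.
exists N => // y Uy; rewrite leNgt; apply/negP => xy; apply: Uy; apply: rU.
exact: lt_trans xy Nr.
Qed.

Lemma inner_mono U (r s : R) : r <= s -> inner_set U s `<=` inner_set U r.
Proof. by move=> rs x Hx y /Hx; exact: le_trans. Qed.

Definition regular mu A := forall e : R, 0 < e -> exists K U,
  [/\ dclosed d K, dopen d U, K `<=` A, A `<=` U & pr mu (U `\` K) <= e].

Lemma regular_open mu U : dopen d U -> regular mu U.
Proof.
move=> oU e e0.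
have mK n : measurable (inner_set U (n.+1%:R^-1)) by apply: (closed_measurable H); exact: inner_closed.
have iK n : inner_set U (n.+1%:R^-1) `<=` inner_set U (n.+2%:R^-1).
  by apply: inner_mono; rewrite lef_pV2 ?posrE ?ltr0n// ler_nat.
have [n /(_ n (leqnn n)) Hn] := pr_incr mu mK iK e0.
exists (inner_set U (n.+1%:R^-1)), U; split => //; first exact: inner_closed.
  by apply: inner_sub; rewrite invr_gt0.
have mU := open_measurable H oU.
have KU : inner_set U (n.+1%:R^-1) `<=` U by apply: inner_sub; rewrite invr_gt0.
have : pr mu U <= pr mu (inner_set U n.+1%:R^-1) + e.
  apply: le_trans Hn; apply: (fap_le (pr_fap mu)) => //; last exact: inner_cover.
  exact: bigcup_measurable.
have := fapU (pr_fap mu) (mK n) (measurableD mU (mK n)) _; rewrite setDUK// => ->; first by lra.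
by rewrite setDE setICA setICr setI0.
Qed.

(** Sets with this property contain the open sets and form a sigma-algebra. Only countable unions
    need care, because a union of closed sets has to be truncated to remain closed. *)
Lemma measurable_regular mu A : measurable A -> regular mu A.
Proof.
rewrite (cs_borel H); apply: smallest_sub; last by move=> U; exact: regular_open.
split.
- by apply: regular_open; exact: dopen0.
- move=> B rB e /rB[K [U [cK oU KB BU le]]]; exists (~` U), (~` K); split => //.
  + by rewrite /dclosed setCK.
  + by rewrite setTD; exact: subsetC.
  + by rewrite setTD; exact: subsetC.
  + by rewrite setDE setCK setIC -setDE.
move=> F rF e e0.
(* These tolerances sum to at most e / 2; the other half pays for the truncation of the union. *)
have e2 n : 0 < e / 2 ^+ n.+2 by rewrite divr_gt0// exprn_gt0.
have KU n := cid (rF n _ (e2 n)).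
have KU' n := cid (projT2 (KU n)).
pose K n := projT1 (KU n); pose U n := projT1 (KU' n).
have P n : [/\ dclosed d (K n), dopen d (U n), K n `<=` F n, F n `<=` U n &
   pr mu (U n `\` K n) <= e / 2 ^+ n.+2] := projT2 (KU' n).
pose UU := \bigcup_n U n; pose KK n := \big[setU/set0]_(i < n) K i.
have mU n : dsp.-measurable (U n) by apply: (open_measurable H); case: (P n).
have mK n : measurable (K n) by apply: (closed_measurable H); case: (P n).
have mUU : measurable UU by exact: bigcup_measurable.
have cKK n : dclosed d (KK n).
  by rewrite /KK; apply: dclosed_bigU => i _ _; case: (P i).
have mKK n : measurable (KK n) by exact: (closed_measurable H).
have [|||n /(_ n (leqnn n)) Hn] := @pr_incr _ _ _ mu (fun n => \big[setU/set0]_(i < n) U i) _ _ (e / 2).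
- by move=> n; apply: bigsetU_measurable.
- by move=> n; rewrite big_ord_recr; exact: subsetUl.
- by lra.
exists (KK n), UU; split => //.
- by apply: dopen_bigcup => i _; case: (P i).
- rewrite /KK -bigcup_mkord => x [i _ Kx]; exists i => //; case: (P i) => _ _ + _ _; exact.
- by apply: subset_bigcup => i _; case: (P i).
have UUE : \bigcup_k \big[setU/set0]_(i < k) U i = UU.
  apply/seteqP; split => x.
    by move=> [k _]; rewrite -bigcup_mkord => -[i _ Ux]; exists i.
  by move=> [i _ Ux]; exists i.+1 => //; rewrite -bigcup_mkord; exists i => //=.
rewrite UUE in Hn.
have mUn : measurable (\big[setU/set0]_(i < n) U i) by apply: bigsetU_measurable.
have mD i : measurable (U i `\` K i) by exact: measurableD.
have h1 : pr mu (UU `\` KK n) <= pr mu (UU `\` \big[setU/set0]_(i < n) U i) +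
     pr mu (\big[setU/set0]_(i < n) (U i `\` K i)).
  apply: le_trans (fapUle (pr_fap mu) _ _).
  - apply: (fap_le (pr_fap mu)); [exact: measurableD|apply: measurableU|].
    + exact: measurableD.
    + exact: bigsetU_measurable.
    move=> x [UUx KKx]; have [Ux|Ux] := pselect ((\big[setU/set0]_(i < n) U i) x); last by left.
    right; move: Ux; rewrite -bigcup_mkord => -[i /= lin Ux].
    rewrite -(bigcup_mkord n (fun i => U i `\` K i)); exists i => //; split => // Kx.
    by apply: KKx; rewrite /KK -bigcup_mkord; exists i.
  - exact: measurableD.
  - exact: bigsetU_measurable.
have h2 : pr mu (UU `\` \big[setU/set0]_(i < n) U i) <= e / 2.
  have sub : \big[setU/set0]_(i < n) U i `<=` UU.
    by rewrite -bigcup_mkord => x [i _ Ux]; exists i.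
  have := fapU (pr_fap mu) mUn (measurableD mUU mUn) _; rewrite setDUK// => eq.
  by have := eq _; rewrite setDE setICA setICr setI0 => /(_ erefl); lra.
have h3 : pr mu (\big[setU/set0]_(i < n) (U i `\` K i)) <= e / 2.
  apply: le_trans (fap_bigU_le mu n mD) _.
  apply: (@le_trans _ _ (\sum_(i < n) e / 2 ^+ i.+2)).
    by apply: ler_sum => i _; case: (P i).
  suff -> : \sum_(i < n) e / 2 ^+ i.+2 = e / 2 - e / 2 ^+ n.+1.
    by rewrite gerBl divr_ge0// ?exprn_ge0// ltW.
  elim: n {Hn mUn h1 h2} => [|n IH]; first by rewrite big_ord0 expr1 subrr.
  rewrite big_ord_recr /= IH; rewrite !exprS; field.
  by rewrite expf_neq0.
lra.
Qed.

End Regularity.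

(** * Limits of probability measures along ultrafilters *)

Section UltraLimit.
Context {R : realType} {I : Type} {U : set_system I} {UU : UltraFilter U}.
Implicit Types a b : I -> R.

(** Compactness provides a cluster point, and an ultrafilter converges to its cluster points. *)
Lemma ultra_cvg a (C : R) : (forall i, `|a i| <= C) -> cvg (a i @[i --> U]).
Proof.
move=> aC.
have PF : ProperFilter (a i @[i --> U]) by exact: fmap_proper_filter.
have [|p [_ cp]] := @segment_compact R (- C) C _ PF.
  suff : \forall i \near U, `[- C, C]%classic (a i) by [].
  by apply: nearW => i /=; rewrite in_itv /=; have := aC i; rewrite ler_norml.
apply/cvg_ex; exists p => B nB; have [//|h] := in_ultra_setVsetC (a @^-1` B) UU.
have [|y [By]] := cp (~` B) B _ nB; first exact: h.
by [].
Qed.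

Lemma ultra_cvg_ex a (C : R) : (forall i, `|a i| <= C) ->
  exists l : R, a i @[i --> U] --> l.
Proof. by move=> /ultra_cvg ca; exists (lim (a i @[i --> U])). Qed.

Lemma ucvg_le a b (l l' : R) : a i @[i --> U] --> l -> b i @[i --> U] --> l' ->
  (\forall i \near U, a i <= b i) -> l <= l'.
Proof.
move=> al bl ab; rewrite leNgt; apply/negP => ll.
have e0 : 0 < (l - l') / 2 by lra.
move/cvgrPdist_lt/(_ _ e0) : al => al; move/cvgrPdist_lt/(_ _ e0) : bl => bl.
have [i [[/= + +] +]] := filter_ex (filterI (filterI al bl) ab).
by rewrite !ltr_norml /=; lra.
Qed.

Lemma ucvg_uniq a (l l' : R) : a i @[i --> U] --> l -> a i @[i --> U] --> l' -> l = l'.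
Proof. by move=> h1 h2; apply: (cvg_unique _ h1 h2). Qed.

Lemma ucvg_sum (J : Type) (s : seq J) (a : J -> I -> R) (l : J -> R) :
  (forall j, a j i @[i --> U] --> l j) ->
  (\sum_(j <- s) a j i) @[i --> U] --> \sum_(j <- s) l j.
Proof.
move=> al; elim: s => [|j s IH].
  by under eq_fun do rewrite big_nil; rewrite big_nil; exact: cvg_cst.
by under eq_fun do rewrite big_cons; rewrite big_cons; exact: cvgD.
Qed.

End UltraLimit.

Section Clip.
Context {R : realType} {dsp : measure_display} {X : measurableType dsp}.
Context (d : X -> X -> R) (H : cspace d).

Definition clip (a : R) : R := Num.max 0 (Num.min 1 a).

Lemma clip_lip a b : `|clip a - clip b| <= `|a - b|.
Proof.
rewrite ler_norml /clip /Num.max /Num.min.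
have := ler_norm (a - b); have := ler_norm (b - a); rewrite (distrC b a).
by case: (ltrP 1 a) => ?; case: (ltrP 1 b) => ?; do 2?case: ltrP => ?; lra.
Qed.

Lemma clip01 a : 0 <= clip a <= 1.
Proof. by rewrite /clip le_max lexx /= ge_max ler01 ge_min lexx. Qed.

Lemma clip1 a : 1 <= a -> clip a = 1.
Proof. by move=> a1; rewrite /clip min_l// max_r. Qed.

Lemma clip0 a : a <= 0 -> clip a = 0.
Proof. by move=> a1; rewrite /clip max_l// ge_min a1 orbT. Qed.

Lemma dcont_clip g : dcont_real d g -> dcont_real d (fun x => clip (g x)).
Proof.
move=> cg x e e0; have [r r0 Hr] := cg x e e0; exists r => // y /Hr.
exact: le_lt_trans (clip_lip _ _).
Qed.

Definition net (k : nat) : seq X :=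
  projT1 (cid (@finite_net _ _ _ d (k.+1%:R^-1) H ltac:(by rewrite invr_gt0 ltr0n))).

Lemma netP k x : exists2 y, y \in net k & d y x < k.+1%:R^-1.
Proof. exact: (projT2 (cid (finite_net _ _)) x). Qed.

(** A countable family of continuous functions, rich enough to determine a measure. The index gives
    the fineness of a net and a bit mask selecting points of it; the function is 1 near the selected
    points and 0 far from them. *)
Definition bump (i : nat * seq bool) (x : X) : R :=
  clip (\sum_(y <- mask i.2 (net i.1)) clip (2 - i.1.+1%:R * d y x)).

Lemma bump01 i x : 0 <= bump i x <= 1.
Proof. exact: clip01. Qed.

Lemma bump_dcont i : dcont_real d (bump i).
Proof.
apply: dcont_clip; apply: dcont_real_sum => y; apply: dcont_clip.
by apply: dcont_realB; [exact: dcont_cst|apply: dcont_realZ; exact: dcont_dist].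
Qed.

Lemma bump_between (K O : set X) : dclosed d K -> dopen d O -> K `<=` O ->
  exists i, (forall x, K x -> bump i x = 1) /\ (forall x, ~ O x -> bump i x = 0).
Proof.
move=> cK oO KO.
have [|r [s [r0 Hr]]] := @lebesgue_number_closed _ _ _ d unit (fun=> O) K H (fun=> oO) cK.
  by move=> x /KO; exists tt.
have {}Hr x y : K x -> ~ O y -> r <= d x y.
  move=> Kx Oy; rewrite leNgt; apply/negP => xy; apply: Oy.
  by have [_ _] := Hr x Kx; apply.
(* With 1 / (k + 1) < r / 3, a net point within 1 / (k + 1) of K is at least 2 / (k + 1) away from
   the complement of O, where its tent vanishes. *)
have [[|k]// _ kr] := @inv_nat_small R (r / 3) ltac:(lra).
pose P y := `[< exists2 z, K z & d y z < k.+1%:R^-1 >].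
exists (k, map P (net k)); rewrite /bump /= -filter_mask.
have k0 : 0 < k.+1%:R :> R by [].
split=> x.
- move=> Kx; apply: clip1; have [y yn yx] := netP k x.
  have Py : y \in [seq z <- net k | P z] by rewrite mem_filter yn andbT; apply/asboolP; exists x.
  rewrite (big_rem y)//= clip1 ?lerDl ?sumr_ge0//; last first.
    by move: yx; rewrite -(ltr_pM2l k0) mulfV ?gt_eqF//; lra.
  by move=> z _; have /andP[] := clip01 (2 - k.+1%:R * d z x).
- move=> Ox; apply: clip0; rewrite big_seq big1// => y.
  rewrite mem_filter => /andP[/asboolP[z Kz yz] _]; apply: clip0.
  have := Hr z x Kz Ox; have := dtri z y x H; rewrite (dsym z y H) => h1 h2.
  move: kr yz h1 h2; set q := k.+1%:R^-1; move=> *.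
  have : 2 * q <= d y x by lra.
  by rewrite -(ler_pM2l k0) mulrCA mulfV ?gt_eqF//; lra.
Qed.

Lemma dcont_bmeas g : dcont_real d g -> bmeas g.
Proof.
move=> cg; split; first exact: dcont_real_measurable cg.
by have [C _ gC] := dcont_bounded H cg; exists C.
Qed.

Lemma bump_bmeas i : bmeas (bump i).
Proof. by apply: dcont_bmeas; exact: bump_dcont. Qed.

Lemma bump_approx (mu nu : probability X R) A (e : R) : measurable A -> 0 < e ->
  exists i, Ex mu (fun x => `|bump i x - \1_A x|) <= e /\
            Ex nu (fun x => `|bump i x - \1_A x|) <= e.
Proof.
move=> mA e0.
have [K1 [U1 [cK1 oU1 KA1 AU1 le1]]] := measurable_regular H mu mA e0.
have [K2 [U2 [cK2 oU2 KA2 AU2 le2]]] := measurable_regular H nu mA e0.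
have [||x [Kx|Kx]|i [h1 h0]] := @bump_between (K1 `|` K2) (U1 `&` U2).
- exact: dclosedU.
- exact: dopenI.
- by split; [exact/AU1/KA1|exact/AU2/KA1].
- by split; [exact/AU1/KA2|exact/AU2/KA2].
exists i.
have key (m : probability X R) K O : dclosed d K -> dopen d O -> K `<=` K1 `|` K2 ->
    U1 `&` U2 `<=` O -> pr m (O `\` K) <= e ->
    Ex m (fun x => `|bump i x - \1_A x|) <= e.
  move=> cK oO sK sO; apply: le_trans.
  have mOK : measurable (O `\` K).
    by apply: measurableD; [exact: (open_measurable H)|exact: (closed_measurable H)].
  rewrite -Ex_indic//; apply: Ex_le.
  - by apply: bmeas_norm; apply: bmeasB; [exact: bump_bmeas|exact: bmeas_indic].
  - exact: bmeas_indic.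
  move=> x; rewrite !indicE; case: (boolP (x \in O `\` K)) => [_|].
    have /andP[] := bump01 i x; rewrite ler_norml /=.
    by case: (x \in A) => /=; lra.
  rewrite notin_setE /= not_andE notK => -[Ox|Kx].
  - rewrite h0; last by move/sO.
    rewrite memNset ?subr0 ?normr0// => Ax; apply: Ox; apply: sO.
    by split; [exact: AU1|exact: AU2].
  - rewrite h1; last exact: sK.
    rewrite mem_set ?subrr ?normr0//; case: (sK x Kx); [exact: KA1|exact: KA2].
split.
- by apply: (key mu K1 U1).
- by apply: (key nu K2 U2).
Qed.

Lemma pr_ext (mu nu : probability X R) :
  (forall i, Ex mu (bump i) = Ex nu (bump i)) ->
  forall A, measurable A -> pr mu A = pr nu A.
Proof.
move=> E A mA; apply/eqP; rewrite -subr_eq0 -normr_le0; apply/ler_addgt0Pr => e e0.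
rewrite add0r; have [|i [h1 h2]] := @bump_approx mu nu A (e / 2) mA; first by lra.
have bA : bmeas (\1_A : X -> R) by exact: bmeas_indic.
have bb := bump_bmeas i.
have := Ex_abs mu (bmeasB bb bA); have := Ex_abs nu (bmeasB bb bA).
rewrite !ExB// !Ex_indic// E => h3 h4.
rewrite (_ : pr mu A - pr nu A = (Ex nu (bump i) - pr nu A) - (Ex nu (bump i) - pr mu A)); last by ring.
apply: le_trans (ler_normB _ _) _; lra.
Qed.

End Clip.

Section LimitMeasure.
Context {R : realType} {dsp : measure_display} {X : measurableType dsp}.
Context (d : X -> X -> R) (H : cspace d).
Context (I : Type) (U : set_system I) {UU : UltraFilter U} (M : I -> probability X R).
Local Open Scope ereal_scope.

Let m (A : set X) : R := lim (pr (M i) A @[i --> U]).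

Let m_cvg A : measurable A -> pr (M i) A @[i --> U] --> m A.
Proof.
move=> mA; apply: (@ultra_cvg _ _ _ _ _ 1%R) => i.
by rewrite ger0_norm ?pr_ge0// (fap_le1 (pr_fap _)).
Qed.

Let m_fap : fap m.
Proof.
split.
- have := m_cvg measurableT; under eq_fun do rewrite (fapT (pr_fap _)).
  by move=> h; apply: (ucvg_uniq h); exact: cvg_cst.
- move=> A mA; apply: (ucvg_le (cvg_cst 0%R) (m_cvg mA)).
  by apply: nearW => i; exact: pr_ge0.
- move=> A B mA mB AB; apply: (ucvg_uniq (m_cvg (measurableU _ _ mA mB))).
  under eq_fun do rewrite (fapU (pr_fap _) mA mB AB).
  exact: cvgD (m_cvg mA) (m_cvg mB).
Qed.

(** The setwise limit [m] is only finitely additive. Suprema over closed subsets, followed by infima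
    over open supersets, restore countable additivity: by compactness the first operation is
    countably subadditive on open sets. *)
Let lam (O : set X) : R := sup [set m F | F in [set F | dclosed d F /\ F `<=` O]].

Let mcl F : dclosed d F -> measurable F.
Proof. exact: (closed_measurable H). Qed.

Let lam_sup O : has_sup [set m F | F in [set F | dclosed d F /\ F `<=` O]].
Proof.
split; first by exists (m set0), set0 => //; split => //; exact: dclosed0.
by exists 1%R => _ [F [cF _] <-]; apply: (fap_le1 m_fap); exact: mcl.
Qed.

Let lam_ub O F : dclosed d F -> F `<=` O -> (m F <= lam O)%R.
Proof. by move=> cF FO; apply: (sup_upper_bound (lam_sup O)); exists F. Qed.

Let lam_le O (c : R) : (forall F, dclosed d F -> F `<=` O -> (m F <= c)%R) -> (lam O <= c)%R.
Proof.
move=> h; apply: ge_sup; first by case: (lam_sup O).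
by move=> _ [F [cF FO] <-]; exact: h.
Qed.

Let lam_approx O (e : R) : (0 < e)%R -> exists F, [/\ dclosed d F, F `<=` O & (lam O - e < m F)%R].
Proof.
move=> e0; have [_ [F [cF FO] <-] h] := sup_adherent e0 (lam_sup O).
by exists F; split.
Qed.

Let lam_mono O O' : O `<=` O' -> (lam O <= lam O')%R.
Proof. by move=> OO; apply: lam_le => F cF FO; apply: lam_ub => //; exact: subset_trans OO. Qed.

Let lam_ge0 O : (0 <= lam O)%R.
Proof. by rewrite -(fap0 m_fap); apply: lam_ub => //; exact: dclosed0. Qed.

(** A Lebesgue number of the cover cuts F into finitely many closed pieces, each inside one of the
    open sets. *)
Let lam_bigcup (O : (set X)^nat) F : (forall n, dopen d (O n)) -> dclosed d F ->
  F `<=` \bigcup_n O n -> exists N : nat, (m F <= \sum_(i < N) lam (O i))%R.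
Proof.
move=> oO cF FO.
have [|r [s [r0 Hr]]] := @lebesgue_number_closed _ _ _ d nat O F H oO cF.
  by move=> x /FO[n _ On]; exists n.
pose N := (\max_(i <- s) i).+1; exists N.
pose G i := F `&` inner_set d (O i) r.
have cG i : dclosed d (G i) by apply: dclosedI => //; exact: (inner_closed H).
have FG : F `<=` \big[setU/set0]_(i < N) G i.
  move=> x Fx; have [i /InP is_ Oi] := Hr x Fx; rewrite -bigcup_mkord; exists i.
    by rewrite /= /N ltnS; apply: leq_bigmax_seq.
  split=> // y Oy; rewrite leNgt; apply/negP => xy; apply: Oy; exact: Oi.
have mG i : measurable (G i) by exact: mcl.
apply: (@le_trans _ _ (m (\big[setU/set0]_(i < N) G i))).
  by apply: (fap_le m_fap) => //; [exact: mcl|apply: bigsetU_measurable].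
elim: N {FG} => [|N IH]; first by rewrite !big_ord0 (fap0 m_fap).
rewrite !big_ord_recr /=; apply: le_trans (fapUle m_fap _ (mG N)) _.
  by apply: bigsetU_measurable.
apply: lerD => //; apply: lam_ub => // x [_ /(inner_sub H r0)]; exact.
Qed.

Let om (A : set X) : \bar R := ereal_inf [set (lam O)%:E | O in [set O | dopen d O /\ A `<=` O]].

Let om_le A O : dopen d O -> A `<=` O -> om A <= (lam O)%:E.
Proof. by move=> oO AO; apply: ereal_inf_lbound; exists O. Qed.

Let om_ge A (c : \bar R) : (forall O, dopen d O -> A `<=` O -> c <= (lam O)%:E) -> c <= om A.
Proof. by move=> h; apply: le_ereal_inf_tmp => _ [V [oV AV] <-]; exact: h. Qed.

Let om_open O : dopen d O -> om O = (lam O)%:E.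
Proof.
move=> oO; apply/le_anti/andP; split; first exact: om_le.
by apply: om_ge => O' _ OO; rewrite lee_fin; exact: lam_mono.
Qed.

Let om_fin A : om A \is a fin_num.
Proof.
apply/fin_numPlt/andP; split; first by apply: (@lt_le_trans _ _ 0); [exact: ltNy0|apply: om_ge => *; rewrite lee_fin].
by apply: le_lt_trans (om_le (dopenT d) (@subsetT _ _)) _; rewrite ltry.
Qed.

Let om_approx A (e : R) : (0 < e)%R ->
  exists O, [/\ dopen d O, A `<=` O & (lam O)%:E <= om A + e%:E].
Proof.
move=> e0; have [_ [V [oV AV] <-] h] := lb_ereal_inf_adherent e0 (om_fin A).
by exists V; split => //; exact: ltW.
Qed.

Let om0 : om set0 = 0.
Proof.
rewrite om_open; last exact: dopen0.
congr EFin; apply/le_anti; rewrite lam_ge0 andbT; apply: lam_le => F _.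
by rewrite subset0 => ->; rewrite (fap0 m_fap).
Qed.

Let om_ge0 A : 0 <= om A.
Proof. by apply: om_ge => *; rewrite lee_fin. Qed.

Let om_mono : {homo om : A B / A `<=` B >-> A <= B}.
Proof. by move=> A B AB; apply: om_ge => O oO BO; apply: om_le => //; exact: subset_trans BO. Qed.

Let om_sub : sigma_subadditive om.
Proof.
move=> A; apply/lee_addgt0Pr => e e0.
have e2 n : (0 < e / (2 ^ n.+1)%:R)%R by rewrite divr_gt0// ltr0n expn_gt0.
have /choice[V HV] := fun n => om_approx (A n) (e2 n).
have oV n : dopen d (V n) by case: (HV n).
apply: (@le_trans _ _ (lam (\bigcup_n V n))%:E).
  apply: om_le; first by apply: dopen_bigcup => n _.
  by apply: subset_bigcup => n _; case: (HV n).
apply: (@le_trans _ _ (\sum_(i <oo) (om (A i) + (e / (2 ^ i.+1)%:R)%:E))); last first.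
  by apply: epsilon_trick => //; exact: ltW.
apply: (@le_trans _ _ (\sum_(i <oo) (lam (V i))%:E)); last first.
  by apply: lee_nneseries => [i _|i _]; [rewrite lee_fin|case: (HV i)].
apply/lee_addgt0Pr => e' e'0.
have [F [cF FO lF]] := lam_approx (\bigcup_n V n) e'0.
have [N mFN] := lam_bigcup oV cF FO.
apply: (@le_trans _ _ ((\sum_(i < N) lam (V i))%:E + e'%:E)).
  by rewrite -EFinD lee_fin; lra.
rewrite leeD2r// -sumEFin -(big_mkord xpredT (fun i => (lam (V i))%:E)).
by apply: nneseries_lim_ge => i _ _; rewrite lee_fin.
Qed.

HB.instance Definition _ := isOuterMeasure.Build R X om om0 om_ge0 om_mono om_sub.

Let om_cara O : dopen d O -> (om : outer_measure R X).-caratheodory O.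
Proof.
move=> oO; apply: le_caratheodory_measurable => A.
apply: om_ge => V oV AV.
apply/lee_addgt0Pr => e e0.
have oVO : dopen d (V `&` O) by exact: dopenI.
have [F [cF FO lF]] := lam_approx (V `&` O) (ltac:(lra) : (0 < e / 2)%R).
(* Removing the closed set F instead of O leaves an open set, which still contains the part of A
   outside O. *)
have oVF : dopen d (V `\` F) by exact: dopenD.
have [F' [cF' F'O lF']] := lam_approx (V `\` F) (ltac:(lra) : (0 < e / 2)%R).
apply: (@le_trans _ _ ((lam (V `&` O))%:E + (lam (V `\` F))%:E)).
  apply: leeD; first by apply: om_le => //; exact: setSI.
  by apply: om_le => // x [/AV Vx Ox]; split => // /FO[].
have FF : F `&` F' = set0.
  by apply/seteqP; split => x //= [Fx /F'O[]].
have : (m F + m F' <= lam V)%R.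
  rewrite -(fapU m_fap (mcl cF) (mcl cF') FF); apply: lam_ub; first exact: dclosedU.
  by move=> x [/FO[]|/F'O[]].
by rewrite -!EFinD lee_fin; lra.
Qed.

(** Mass may escape from an open set to its boundary in the limit, hence an inequality. It already
    determines the limits of integrals of continuous functions. *)
Lemma ulim_measure : exists mu : probability X R, forall O (l : R), dopen d O ->
  pr (M i) O @[i --> U] --> l -> (pr mu O <= l)%R.
Proof.
pose OM : outer_measure R X := om.
have mcara A : measurable A -> OM.-caratheodory A.
  rewrite (cs_borel H); apply: smallest_sub => [|O]; last exact: om_cara.
  split.
  - exact: caratheodory_measurable_set0.
  - by move=> B; rewrite setTD; exact: caratheodory_measurable_setC.
  - by move=> F; exact: caratheodory_measurable_bigcup.
have omT : om setT = 1.
  rewrite om_open; last exact: dopenT.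
  congr EFin; apply/le_anti/andP; split.
    by apply: lam_le => F cF _; apply: (fap_le1 m_fap); exact: mcl.
  by rewrite -[leLHS](fapT m_fap); apply: lam_ub => //; exact: dclosedT.
have om_add : semi_sigma_additive (om : set X -> \bar R).
  move=> A mA tA mUA.
  apply: (@caratheodory_measure_sigma_additive R X OM A) => //.
  - by move=> i; exact: mcara.
  - exact: mcara.
have [mu Hmu] := prob_of om0 om_ge0 om_add omT.
exists mu => O l oO Ol; rewrite /pr Hmu om_open//=.
have mO := open_measurable H oO.
rewrite (ucvg_uniq Ol (m_cvg mO)); apply: lam_le => F cF FO.
by apply: (fap_le m_fap) => //; exact: mcl.
Qed.

End LimitMeasure.

Section WeakLimit.
Context {R : realType} {dsp : measure_display} {X : measurableType dsp}.
Context (d : X -> X -> R) (H : cspace d).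
Context (I : Type) (U : set_system I) {UU : UltraFilter U} (M : I -> probability X R).
Context (mu : probability X R).
Context (mu_open : forall O (l : R), dopen d O ->
  pr (M i) O @[i --> U] --> l -> pr mu O <= l).

(** Superlevel sets of a continuous function are open, so its layer sums give one inequality between
    integrals; the opposite function gives the other. *)
Lemma ulim_Ex g : dcont_real d g -> Ex (M i) g @[i --> U] --> Ex mu g.
Proof.
have half G : dcont_real d G -> (forall x, 0 <= G x <= 1) ->
    forall l : R, Ex (M i) G @[i --> U] --> l -> Ex mu G <= l.
  move=> cG G01 l Gl; have bG := dcont_bmeas H cG.
  apply/ler_addgt0Pr => e e0; have [N N0 Ne] := inv_nat_small e0.
  have oG k : dopen d [set x | k%:R / N%:R < G x] by exact: dcont_real_open'.
  have ck (k : 'I_N) : exists l : R, pr (M i) [set x | k%:R / N%:R < G x] @[i --> U] --> l.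
    apply: (@ultra_cvg_ex _ _ _ _ _ 1) => i; rewrite ger0_norm ?pr_ge0//.
    by apply: (fap_le1 (pr_fap _)); exact: (open_measurable H).
  have /choice[lk Hlk] := ck.
  have h1 : Ex mu G <= N%:R^-1 * \sum_(k < N) lk k.
    have /andP[h _] := layer_Ex mu bG N0 G01; apply: le_trans h _.
    by rewrite ler_wpM2l ?invr_ge0//; apply: ler_sum => k _; exact: mu_open (Hlk k).
  have h2 : N%:R^-1 * \sum_(k < N) lk k <= l + N%:R^-1.
    have A1 : N%:R^-1 * (\sum_(k < N) pr (M i) [set x | k%:R / N%:R < G x]) @[i --> U] -->
        N%:R^-1 * \sum_(k < N) lk k by apply: cvgMl_tmp; exact: ucvg_sum.
    have A2 : Ex (M i) G + N%:R^-1 @[i --> U] --> l + N%:R^-1 by apply: cvgD => //; exact: cvg_cst.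
    apply: (ucvg_le A1 A2).
    by apply: nearW => i; have /andP[] := layer_Ex (M i) bG N0 G01.
  by apply: le_trans h1 (le_trans h2 _); lra.
move=> cg; have bg := dcont_bmeas H cg.
have [C C0 gC] := dcont_bounded H cg.
have [l Hl] := @ultra_cvg_ex _ _ _ _ (fun i => Ex (M i) g) C (fun i => Ex_bound (M i) bg gC).
pose G (s : R) x := (2 * C)^-1 * (s * g x + C).
have C2 : 0 < 2 * C by lra.
have lim s : (s = 1 \/ s = -1) -> s * Ex mu g <= s * l.
  move=> s1; have bsg : bmeas (fun x => s * g x) by exact: bmeasZ.
  have sgC x : `|s * g x| <= C by case: s1 => ->; rewrite ?mul1r ?mulN1r ?normrN.
  have [bG G01 EG] := bmeas_scale C0 bsg sgC.
  have cG : dcont_real d (fun x => (2 * C)^-1 * (s * g x + C)).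
    apply: dcont_realZ; apply: dcont_realD; last exact: dcont_cst.
    exact: dcont_realZ.
  have e m : Ex m (fun x => (2 * C)^-1 * (s * g x + C)) = (2 * C)^-1 * (s * Ex m g + C).
    rewrite ExZ; last by apply: bmeasD => //; exact: bmeas_cst.
    by rewrite ExD ?Ex_cst ?ExZ//; exact: bmeas_cst.
  have := half _ cG G01 ((2 * C)^-1 * (s * l + C)).
  rewrite e ler_pM2l ?invr_gt0// lerD2r; apply.
  under eq_fun do rewrite e.
  apply: cvgMl_tmp; apply: cvgD; last exact: cvg_cst.
  exact: cvgMl_tmp.
have h1 := lim 1 (or_introl erefl); have h2 := lim (-1) (or_intror erefl).
by have -> : Ex mu g = l by apply/le_anti/andP; split; lra.
Qed.

Lemma ulim_closed F (l : R) : dclosed d F -> pr (M i) F @[i --> U] --> l -> l <= pr mu F.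
Proof.
move=> cF Fl; have mF := closed_measurable H cF.
have mF' := measurableC mF.
have := @mu_open (~` F) (1 - l) cF _; rewrite (fapC (pr_fap _))// => h.
suff : 1 - pr mu F <= 1 - l by lra.
apply: h; under eq_fun do rewrite (fapC (pr_fap _))//.
by apply: cvgB => //; exact: cvg_cst.
Qed.

Lemma ulim_invariant f : dcont_fun d f ->
  (forall g, dcont_real d g -> Ex (M i) (g \o f) - Ex (M i) g @[i --> U] --> 0) ->
  finvariant f mu.
Proof.
move=> cf Hinv; have mf := dcont_measurable H cf.
have Eg g : dcont_real d g -> Ex mu (g \o f) = Ex mu g.
  move=> cg; apply/eqP; rewrite -subr_eq0; apply/eqP.
  apply: (ucvg_uniq _ (Hinv g cg)); apply: cvgB; apply: ulim_Ex => //.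
  exact: dcont_real_comp.
have [nu Hnu] : exists nu : probability X R, forall A, nu A = mu (f @^-1` A).
  have := @prob_of _ _ _ (pushforward mu f) (measure0 (pushforward mu f))
    (fun A => measure_ge0 (pushforward mu f) A)
    (@measure_semi_sigma_additive _ _ _ (pushforward mu f)).
  apply => //; transitivity (mu setT); last exact: probability_setT.
  by rewrite /pushforward preimage_setT.
have En g : dcont_real d g -> Ex nu g = Ex mu (g \o f).
  move=> cg; have bg := dcont_bmeas H cg; have bgf := bmeas_comp bg mf.
  have e (a : R) : pr nu [set x | a < g x] = pr mu [set x | a < (g \o f) x].
    by rewrite /pr Hnu.
  by apply/le_anti/andP; split; apply: Ex_level_le => // a; rewrite e.
move=> A mA; rewrite -Hnu (prE nu)// (prE mu)//; congr EFin.
apply: (@pr_ext _ _ _ d H nu mu) => // i; rewrite En; last exact: bump_dcont.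
by apply: Eg; exact: bump_dcont.
Qed.

End WeakLimit.

Section LimSup.
Context {R : realType}.
Implicit Types (u : (\bar R)^nat) (a : \bar R).
Local Open Scope ereal_scope.

Lemma limn_esup_le u a : (exists n0, forall n, (n0 <= n)%N -> u n <= a) -> limn_esup u <= a.
Proof.
move=> [n0 Hn]; rewrite limn_esup_lim; apply: (@le_trans _ _ (esups u n0)).
  have -> : limn (esups u) = ereal_inf (range (esups u)) by apply/cvg_lim/cvg_esups_inf.
  by apply: ereal_inf_lbound; exists n0.
by apply: ge_ereal_sup => _ [n /= n0n <-]; exact: Hn.
Qed.

Lemma limn_esup_ge u a : (forall n0, exists2 n, (n0 <= n)%N & a <= u n) -> a <= limn_esup u.
Proof.
move=> Hn; rewrite limn_esup_lim.
have -> : limn (esups u) = ereal_inf (range (esups u)) by apply/cvg_lim/cvg_esups_inf.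
apply: le_ereal_inf_tmp => _ [n0 _ <-]; have [n n0n an] := Hn n0.
by apply: le_trans an _; apply: ereal_sup_ubound; exists n.
Qed.

Lemma limn_esup_lt u a : limn_esup u < a -> exists n0, forall n, (n0 <= n)%N -> u n < a.
Proof.
rewrite ltNge => h; apply: contrapT => h'; move/negP: h; apply.
apply: limn_esup_ge => n0; apply: contrapT => h2; apply: h'; exists n0 => n n0n.
by rewrite ltNge; apply/negP => an; apply: h2; exists n.
Qed.

Lemma limn_esup_gt u a : a < limn_esup u -> forall n0, exists2 n, (n0 <= n)%N & a < u n.
Proof.
rewrite ltNge => h n0; apply: contrapT => h'; move/negP: h; apply.
apply: limn_esup_le; exists n0 => n n0n; rewrite leNgt; apply/negP => an.
by apply: h'; exists n.
Qed.

Lemma arch_le0 (a C : R) : (forall N : nat, (N%:R * a <= C)%R) -> (a <= 0)%R.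
Proof.
move=> h; rewrite leNgt; apply/negP => a0.
have := h (Num.truncn (C / a)).+1; rewrite leNgt -ltr_pdivrMr// => /negP; apply.
exact: truncnS_gt.
Qed.

End LimSup.

(** * Entropy rates and expansivity *)

Section System.
Context {R : realType} {dsp : measure_display} {X : measurableType dsp}.

Record csys (d : X -> X -> R) (f finv : X -> X) : Prop := Csys {
  cs_space : cspace d;
  cs_fK : forall x, f (finv x) = x;
  cs_Kf : forall x, finv (f x) = x;
  cs_f : dcont_fun d f;
  cs_finv : dcont_fun d finv }.

Context (d : X -> X -> R) (f finv : X -> X) (S : csys d f finv).
Implicit Types (T J : finType) (m : set X -> R) (mu nu : probability X R).

Let H := cs_space S.

Definition minv m := forall A, measurable A -> m (f @^-1` A) = m A.

Lemma iter_measurable k A : measurable A -> measurable (iter k f @^-1` A).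
Proof. by apply: preimage_measurable H _; exact: dcont_fun_iter (cs_f S). Qed.

Lemma minv_iter m k A : minv m -> measurable A -> m (iter k f @^-1` A) = m A.
Proof.
move=> hm mA; elim: k => [|k IH] //; rewrite -[RHS]IH.
by rewrite -(hm (iter k f @^-1` A))//; [congr m; apply/funext => x /=; rewrite -iterSr|exact: iter_measurable].
Qed.

Lemma pr_minv mu : finvariant f mu -> minv (pr mu).
Proof. by move=> h A mA; rewrite /pr h. Qed.

Lemma mcod_iter T (c : X -> T) k : mcod c -> mcod (c \o iter k f).
Proof. by move=> mc t; exact: (iter_measurable k (mc t)). Qed.

Lemma Hent_iter m T (c : X -> T) k : minv m -> mcod c -> Hent m (c \o iter k f) = Hent m c.
Proof.
move=> hm mc; apply: eq_bigr => t _; congr eta.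
exact: (minv_iter k hm (mc t)).
Qed.

Definition wd T (c : X -> T) (n : nat) (x : X) : {ffun 'I_n -> T} :=
  [ffun k : 'I_n => c (iter k f x)].

Lemma mcod_wd T (c : X -> T) n : mcod c -> mcod (wd c n).
Proof. by move=> mc; apply: (mcod_ffun (c := fun k : 'I_n => c \o iter k f)) => k; exact: mcod_iter. Qed.

Lemma wdP T (c : X -> T) n x y :
  wd c n x = wd c n y <-> forall k, (k < n)%N -> c (iter k f x) = c (iter k f y).
Proof.
split=> [/ffunP h k kn|h]; first by have := h (Ordinal kn); rewrite !ffunE.
by apply/ffunP => k; rewrite !ffunE; exact: h.
Qed.

(* Covering the times [0, N) by blocks of length q starting at the multiples of q. *)
Lemma Hent_blocks m T (c : X -> T) q N : (0 < q)%N -> fap m -> minv m -> mcod c ->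
  Hent m (wd c N) <= N%:R * (Hent m (wd c q) / q%:R) + Hent m (wd c q).
Proof.
move=> q0 hm im mc; have mq := @mcod_wd _ c q mc.
have q0' : 0 < q%:R :> R by rewrite ltr0n.
pose k := (N %/ q).+1.
have : Hent m (wd c N) <= Hent m (fun x => [ffun t : 'I_k => wd c q (iter (t * q) f x)]).
  apply: Hent_det => //.
    by apply: (mcod_ffun (c := fun t : 'I_k => wd c q \o iter (t * q) f)) => t; exact: mcod_iter.
  move=> x y /ffunP h; apply/wdP => j jN.
  have jk : (j %/ q < k)%N by rewrite ltnS leq_div2r// ltnW.
  have := h (Ordinal jk); rewrite !ffunE /= => /wdP/(_ (j %% q)%N).
  by rewrite ltn_pmod// -!iterD addnC -divn_eq; apply.
move/le_trans; apply.
apply: le_trans (Hent_subadd (c := fun t : 'I_k => wd c q \o iter (t * q) f) hm _) _.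
  by move=> t; exact: mcod_iter.
under eq_bigr do rewrite Hent_iter//.
have -> : \sum_(i < k) Hent m (wd c q) = (N %/ q)%:R * Hent m (wd c q) + Hent m (wd c q).
  by rewrite sumr_const card_ord /k mulrSr mulr_natl.
rewrite lerD2r.
rewrite mulrA -mulrAC ler_wpM2r//; first exact: Hent_ge0.
by rewrite ler_pdivlMr// -natrM ler_nat leq_trunc_div.
Qed.

(** The entropy rate of the coding as an infimum instead of a limit; [Hent_blocks] makes the two
    agree for an invariant m. As an infimum it bounds the entropies of words from below with no
    error term. *)
Definition hr m T (c : X -> T) : R :=
  inf [set Hent m (wd c n.+1) / n.+1%:R | n in setT].

Lemma hr_le m T (c : X -> T) n : fap m -> mcod c -> (0 < n)%N ->
  n%:R * hr m c <= Hent m (wd c n).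
Proof.
case: n => // n hm mc _; rewrite mulrC -ler_pdivlMr ?ltr0n//.
apply: inf_lbound; last by exists n.
exists 0 => _ [k _ <-]; rewrite divr_ge0//; exact: (Hent_ge0 hm (mcod_wd mc)).
Qed.

Lemma hr_ge m T (c : X -> T) (a : R) :
  (forall n, (0 < n)%N -> n%:R * a <= Hent m (wd c n)) -> a <= hr m c.
Proof.
move=> h; apply: lb_le_inf; first by exists (Hent m (wd c 1) / 1%:R), 0%N.
by move=> _ [n _ <-]; rewrite ler_pdivlMr ?ltr0n// mulrC; exact: h.
Qed.

Lemma hr_near m T (c : X -> T) (e : R) : fap m -> minv m -> mcod c -> 0 < e ->
  exists C, 0 <= C /\ forall N, Hent m (wd c N) <= N%:R * (hr m c + e) + C.
Proof.
move=> hm im mc e0.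
have hinf : has_inf [set Hent m (wd c n.+1) / n.+1%:R | n in setT].
  split; first by exists (Hent m (wd c 1) / 1%:R), 0%N.
  exists 0 => _ [k _ <-]; rewrite divr_ge0//; exact: (Hent_ge0 hm (mcod_wd mc)).
have [_ [n _ <-] hn] := inf_adherent e0 hinf.
exists (Hent m (wd c n.+1)); split; first exact: (Hent_ge0 hm (mcod_wd mc)).
move=> N; apply: le_trans (Hent_blocks N (ltn0Sn n) hm im mc) _.
by rewrite lerD2r ler_wpM2l// ltW.
Qed.

Lemma hr_le_card m T (c : X -> T) : fap m -> mcod c -> hr m c <= ln #|T|%:R.
Proof.
move=> hm mc; have := hr_le hm mc (ltn0Sn 0); rewrite mul1r => /le_trans; apply.
apply: le_trans (Hent_le_card hm mc).
by apply: Hent_det => // x y h; apply/wdP => -[|k] //.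
Qed.

Lemma part_cod (xi : seq (set X)) : meas_partition xi ->
  exists c : X -> 'I_(size xi), mcod c /\ forall x (i : 'I_(size xi)), nth set0 xi i x <-> c x = i.
Proof.
move=> [mxi dxi cxi].
have ex x : exists i : 'I_(size xi), nth set0 xi i x.
  have [A /(@List.In_nth _ _ _ set0)[i [il iA]] Ax] := cxi x.
  have il' : (i < size xi)%N by apply/ssrnat.ltP.
  exists (Ordinal il') => /=; suff -> : nth set0 xi i = A by [].
  by rewrite -iA; elim: (xi) i {il iA il'} => [|B s IH] [|i] //=.
have [c cP] := choice ex; exists c.
have iff_c x (i : 'I_(size xi)) : nth set0 xi i x <-> c x = i.
  split=> [xi_x|<-//]; apply: contrapT => ci.
  have := dxi (c x) i (ltn_ord _) (ltn_ord _) (fun e => ci (val_inj e)).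
  by move/seteqP => -[/(_ x) h _]; apply: h; split.
split => // i; have -> : c @^-1` [set i] = nth set0 xi i.
  by apply/seteqP; split => x /=; rewrite iff_c.
apply: mxi; have : (i < size xi)%N by [].
move: (nat_of_ord i) => j; elim: (xi) j => [|B s IH] [|j] //= js; first by left.
by right; exact: IH.
Qed.

Lemma join_entropyE mu (xi : seq (set X)) (c : X -> 'I_(size xi)) n :
  (forall x (i : 'I_(size xi)), nth set0 xi i x <-> c x = i) ->
  join_entropy mu f xi n = Hent (pr mu) (wd c n).
Proof.
move=> hc; rewrite /join_entropy /Hent -sumrN; apply: eq_bigr => w _.
have -> : join_block f w = wd c n @^-1` [set w].
  apply/seteqP; split => x /=.
  - by move=> h; apply/ffunP => k; rewrite ffunE; apply/hc; exact: h.
  - by move=> <- k; apply/hc; rewrite ffunE.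
by rewrite /= /eta /pr; case: ifP; rewrite ?oppr0.
Qed.

Lemma ent_partitionE mu (xi : seq (set X)) (c : X -> 'I_(size xi)) :
  finvariant f mu -> mcod c ->
  (forall x (i : 'I_(size xi)), nth set0 xi i x <-> c x = i) ->
  ent_partition mu f xi = (hr (pr mu) c)%:E.
Proof.
move=> imu mc hc; have hm := pr_fap mu; have im := pr_minv imu.
apply/le_anti/andP; split; last first.
  apply: limn_esup_ge => n0; exists n0.+1 => //.
  rewrite (join_entropyE _ _ hc) lee_fin mulrC ler_pdivlMr ?ltr0n// mulrC.
  exact: hr_le.
apply/lee_addgt0Pr => e e0; have e20 : 0 < e / 2 by lra.
have [C [C0 HC]] := hr_near hm im mc e20.
apply: limn_esup_le; exists (Num.truncn (C / (e / 2))).+1 => n n0.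
have n0' : 0 < n%:R :> R by rewrite ltr0n; exact: leq_trans n0.
have : C / (e / 2) < n%:R by apply: lt_le_trans (truncnS_gt _) _; rewrite ler_nat.
rewrite ltr_pdivrMr// => Cn.
rewrite (join_entropyE _ _ hc) -EFinD lee_fin mulrC ler_pdivrMr//.
apply: le_trans (HC n) _; nra.
Qed.

Lemma hr_det m T J (c : X -> T) (c' : X -> J) : fap m -> mcod c ->
  (forall x y, c x = c y -> c' x = c' y) -> hr m c' <= hr m c.
Proof.
move=> hm mc cc'; have mc' := mcod_det mc cc'.
apply: hr_ge => n n0; apply: le_trans (hr_le hm mc' n0) _.
apply: Hent_det => //; first exact: mcod_wd.
by move=> x y /wdP h; apply/wdP => k /h /cc'.
Qed.

Lemma ks_ge mu T (c : X -> T) : finvariant f mu -> mcod c ->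
  ((hr (pr mu) c)%:E <= ks_entropy mu f)%E.
Proof.
move=> imu mc; pose xi := [seq c @^-1` [set t] | t <- enum T].
have pxi : meas_partition xi.
  split.
  - move=> A; rewrite /xi; elim: (enum T) => //= t s IH [<-|/IH //]; exact: mc.
  - move=> i j; rewrite size_map => il jl ij.
    have [t0 _] : exists t : T, True by exists (c point).
    rewrite -subset0 => x; rewrite /xi (nth_map t0)// (nth_map t0)// => -[/= -> /eqP].
    by rewrite nth_uniq ?enum_uniq// => /eqP.
  - move=> x; exists (c @^-1` [set c x]) => //.
    have : c x \in enum T by rewrite mem_enum.
    rewrite /xi; elim: (enum T) => //= t s IH; rewrite inE => /orP[/eqP ->|/IH]; by [left|right].
have [c' [mc' hc']] := part_cod pxi.
apply: le_trans (_ : ent_partition mu f xi <= _)%E; last first.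
  by apply: ereal_sup_ubound; exists xi.
rewrite (ent_partitionE imu mc' hc') lee_fin; apply: hr_det => //; first exact: pr_fap.
move=> x y /esym/hc'; have xx : nth set0 xi (c' x) x by apply/hc'.
have cx : (c' x < size (enum T))%N.
  by rewrite -(size_map (fun t => c @^-1` [set t])); exact: ltn_ord.
by move: xx; rewrite /xi (nth_map (c x))// => /= e1 e2; rewrite [LHS]e1 [RHS]e2.
Qed.

Lemma ks_le mu (a : \bar R) : finvariant f mu ->
  (forall T (c : X -> T), mcod c -> ((hr (pr mu) c)%:E <= a)%E) -> (ks_entropy mu f <= a)%E.
Proof.
move=> imu h; apply: ge_ereal_sup => _ [xi /part_cod[c [mc hc]] <-].
by rewrite (ent_partitionE imu mc hc); exact: h.
Qed.

(** The free energy seen by one coding. It is a real number, whereas the supremum over codings,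
    [free_energy], is not known to be finite at this stage. *)
Definition FE mu (phi : X -> R) T (c : X -> T) : R := hr (pr mu) c + Ex mu phi.

Lemma free_ge mu phi T (c : X -> T) : finvariant f mu -> mcod c -> dcont_real d phi ->
  ((FE mu phi c)%:E <= free_energy mu f phi)%E.
Proof.
move=> imu mc cphi; rewrite /free_energy ExE; last exact: (dcont_bmeas H).
by rewrite EFinD leeD2r// ks_ge.
Qed.

Lemma free_le mu phi (a : R) : finvariant f mu -> dcont_real d phi ->
  (forall T (c : X -> T), mcod c -> FE mu phi c <= a) -> (free_energy mu f phi <= a%:E)%E.
Proof.
move=> imu cphi h; rewrite /free_energy ExE; last exact: (dcont_bmeas H).
rewrite -leeBrDr//; apply: ks_le => // T c mc.
by rewrite -EFinB lee_fin; have := h T c mc; rewrite /FE; lra.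
Qed.

Lemma free_gt mu phi (a : R) : finvariant f mu -> dcont_real d phi ->
  (a%:E < free_energy mu f phi)%E -> exists T (c : X -> T), mcod c /\ a < FE mu phi c.
Proof.
move=> imu cphi; rewrite ltNge => h; apply: contrapT => h'; move/negP: h; apply.
apply: free_le => // T c mc; rewrite leNgt; apply/negP => ac.
by apply: h'; exists T, c.
Qed.

(** The additive constant 1 of [Hent_mix] disappears in entropy rates. *)
Lemma FE_mix mu mu1 mu2 (t : R) phi T (c : X -> T) : finvariant f mu -> finvariant f mu1 ->
  finvariant f mu2 -> mcod c -> bmeas phi -> 0 < t < 1 ->
  (forall A, measurable A -> pr mu A = t * pr mu1 A + (1 - t) * pr mu2 A) ->
  FE mu phi c <= t * FE mu1 phi c + (1 - t) * FE mu2 phi c.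
Proof.
move=> imu imu1 imu2 mc bphi t01 mE; have /andP[t0 t1] := t01.
have EE : Ex mu phi = t * Ex mu1 phi + (1 - t) * Ex mu2 phi.
  have := @Ex_lin _ _ _ mu _ (fun b : bool => if b then mu1 else mu2)
    (fun b => if b then t else 1 - t) phi; rewrite !big_bool /=; apply => //.
  - by move=> A mA; rewrite big_bool mE.
  - by case; lra.
suff : hr (pr mu) c <= t * hr (pr mu1) c + (1 - t) * hr (pr mu2) c by rewrite /FE EE; lra.
apply/ler_addgt0Pr => e e0.
have [C1 [C10 HC1]] := hr_near (pr_fap mu1) (pr_minv imu1) mc e0.
have [C2 [C20 HC2]] := hr_near (pr_fap mu2) (pr_minv imu2) mc e0.
rewrite -subr_le0; apply: (@arch_le0 _ _ (t * C1 + (1 - t) * C2 + 1)) => -[|N].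
  by rewrite mul0r; nra.
have h := hr_le (pr_fap mu) mc (ltn0Sn N).
have h' := Hent_mix (pr_fap mu) (pr_fap mu1) (pr_fap mu2) (@mcod_wd _ c N.+1 mc) t01 mE.
have := ler_wpM2l (ltW t0) (HC1 N.+1).
have : 0 <= 1 - t by lra.
move=> /ler_wpM2l /(_ _ _ (HC2 N.+1)).
move: h h'; move: (Hent _ _) (Hent _ _) (Hent _ _) (N.+1%:R : R) => a b b' NN; nra.
Qed.

Lemma cond_inv mu D : finvariant f mu -> measurable D -> f @^-1` D = D -> 0 < pr mu D ->
  exists nu, [/\ finvariant f nu, pr nu D = 1 &
    forall A, measurable A -> pr nu A = pr mu (A `&` D) / pr mu D].
Proof.
move=> imu mD fD D0; have [nu Hnu] := prob_cond mD D0.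
exists nu; split => //; last by rewrite Hnu// setIid divff ?gt_eqF.
move=> A mA; have mfA := iter_measurable 1 mA.
rewrite (prE nu mfA) (prE nu mA) !Hnu//; congr (_ / _)%:E.
by rewrite -{1}fD -preimage_setI (pr_minv imu)//; exact: measurableI.
Qed.

Lemma cond_split mu D : finvariant f mu -> measurable D -> f @^-1` D = D -> 0 < pr mu D < 1 ->
  exists mu1 mu2, [/\ finvariant f mu1, finvariant f mu2, pr mu1 D = 1, pr mu2 D = 0 &
    forall A, measurable A -> pr mu A = pr mu D * pr mu1 A + (1 - pr mu D) * pr mu2 A].
Proof.
move=> imu mD fD /andP[D0 D1].
have mDC := measurableC mD; have prC := fapC (pr_fap mu) mD.
have DC0 : 0 < pr mu (~` D) by rewrite prC; lra.
have [mu1 [i1 p1 H1]] := cond_inv imu mD fD D0.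
have [|mu2 [i2 p2 H2]] := cond_inv imu mDC _ DC0; first by rewrite -[in RHS]fD preimage_setC.
exists mu1, mu2; split => //.
  by have := fapC (pr_fap mu2) mD; rewrite p2; lra.
move=> A mA; rewrite H1// H2// -prC mulrC divfK ?gt_eqF// mulrC divfK ?gt_eqF//.
rewrite -(fapU (pr_fap mu)); first by rewrite -setIUr setUCr setIT.
- exact: measurableI.
- exact: measurableI.
- by rewrite setIACA setICr setI0.
Qed.

End System.

(** * Non-expansive points and the entropy of fine codings *)

Section Expansivity.
Context {R : realType} {dsp : measure_display} {X : measurableType dsp}.
Context (d : X -> X -> R) (f finv : X -> X) (S : csys d f finv) (eps : R).
Implicit Types (T J : finType) (mu nu : probability X R) (K : set int).

Let H := cs_space S.

Notation zi := (ziter f finv).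

Lemma ziter_cont (n : int) : dcont_fun d (zi n).
Proof.
case: n => n /=; first exact: dcont_fun_iter (cs_f S).
exact: (@dcont_fun_iter _ _ _ d finv n.+1 (cs_finv S)).
Qed.

Lemma iter_cancel n x : iter n f (iter n finv x) = x.
Proof.
elim: n x => // n IH x; rewrite iterSr iterS (cs_fK S); exact: IH.
Qed.

Lemma iter_cancel' n x : iter n finv (iter n f x) = x.
Proof.
elim: n x => // n IH x; rewrite iterSr iterS (cs_Kf S); exact: IH.
Qed.

(** Turns two-sided times into forward times of a point pulled back by M steps, where words can be
    read. *)
Lemma ziter_shift (n : int) (M : nat) : (`|n| <= M)%N ->
  exists2 k, (k <= M + M)%N & forall x, zi n x = iter k f (iter M finv x).
Proof.
case: n => n /= nM.
- exists (n + M)%N; first by rewrite leq_add2r.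
  by move=> y; rewrite iterD iter_cancel.
- exists (M - n.+1)%N; first by rewrite (leq_trans (leq_subr _ _))// leq_addr.
  move=> y; rewrite -{2}(subnK nM) iterD -[RHS]/(iter (M - n.+1) f _).
  by rewrite iter_cancel.
Qed.

(** Approximations of [NE] from which it is recovered by countable operations: a lower bound r on
    the distance of the partner makes the set closed, which [NE] itself need not be. *)
Definition close_pairs K (r : R) : set X :=
  [set x | exists y, r <= d x y /\ forall n, K n -> d (zi n x) (zi n y) <= eps].

Definition zball (m : nat) : set int := [set n | (`|n| <= m)%N].

(** Each potential partner y is excluded on a neighbourhood, either because it is too close to x or
    because the orbits part at some time of K. Finitely many neighbourhoods cover the space, so
    finitely many times suffice. *)
Lemma close_pairs_far K r x : ~ close_pairs K r x -> exists (rho : R) (m : nat), 0 < rho /\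
  forall x', d x x' < rho -> ~ close_pairs (K `&` zball m) r x'.
Proof.
move=> nx.
have loc y : exists rm : R * nat, 0 < rm.1 /\ forall x' y', d x x' < rm.1 -> d y y' < rm.1 ->
    d x' y' < r \/ exists n, [/\ K n, zball rm.2 n & eps < d (zi n x') (zi n y')].
  have [xy|xy] := ltP (d x y) r.
    exists ((r - d x y) / 2, 0%N); split => /=; first by lra.
    move=> x' y' h1 h2; left.
    have := dtri x' x y' H; have := dtri x y y' H; rewrite (dsym x' x H); lra.
  have [n [Kn en]] : exists n, K n /\ eps < d (zi n x) (zi n y).
    apply: contrapT => h; apply: nx; exists y; split => // n Kn.
    by rewrite leNgt; apply/negP => en; apply: h; exists n.
  have e0 : 0 < (d (zi n x) (zi n y) - eps) / 2 by lra.
  have [r1 r10 h1] := ziter_cont n x e0; have [r2 r20 h2] := ziter_cont n y e0.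
  exists (Num.min r1 r2, `|n|%N); split => /=; first by rewrite lt_min r10.
  move=> x' y'; rewrite !lt_min => /andP[/h1 xx _] /andP[_ /h2 yy]; right.
  exists n; split => //; rewrite /zball //=.
  have := dtri (zi n x) (zi n x') (zi n y) H.
  have := dtri (zi n x') (zi n y') (zi n y) H; rewrite (dsym (zi n y') _ H); lra.
have [rm hrm] := choice loc.
have [s Hs] := @cs_compact _ _ _ d H X (fun y => dball d y (rm y).1)
  (fun y => @dball_open _ _ _ d y _ H)
  (fun y => ex_intro _ y (eq_ind_r (fun t => t < (rm y).1) (proj1 (hrm y)) (dxx y H))).
have [rho rho0 Hrho] : exists2 rho : R, 0 < rho & forall y, List.In y s -> rho <= (rm y).1.
  elim: s {Hs} => [|y s [q q0 IH]]; first by exists 1.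
  exists (Num.min q (rm y).1); first by rewrite lt_min q0 (proj1 (hrm y)).
  by move=> z /= [<-|/IH]; rewrite ge_min ?lexx ?orbT// => ->.
exists rho, (\max_(y <- s) (rm y).2); split => // x' xx' [y' [ry' hy']].
have [y ys yy'] := Hs y'.
have [||h|[n [Kn mn en]]] := (proj2 (hrm y)) x' y'.
- exact: lt_le_trans (Hrho y ys).
- exact: yy'.
- by move: ry'; rewrite leNgt h.
- move: en; rewrite ltNge hy'//; split => //; rewrite /zball /=.
  apply: leq_trans mn _; apply: (@leq_bigmax_seq _ _ xpredT (fun y => (rm y).2)) => //.
  exact/InP.
Qed.

Lemma close_pairs_closed K r : dclosed d (close_pairs K r).
Proof.
move=> x /close_pairs_far[rho [m [rho0 h]]]; exists rho => // y xy [z [rz hz]].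
by apply: (h y xy); exists z; split => // n [Kn _]; exact: hz.
Qed.

Lemma close_pairs_bigcap r :
  \bigcap_m close_pairs (zball m) r = close_pairs setT r.
Proof.
apply/seteqP; split => x; last first.
  by move=> [y [ry hy]] m _; exists y; split => // n _; exact: hy.
move=> h; apply: contrapT => /close_pairs_far[rho [m [rho0 h']]].
by apply: (h' x); rewrite ?(dxx x H)// setTI; exact: h.
Qed.

Lemma NE_bigcup : NE d f finv eps = \bigcup_k close_pairs setT (k.+1%:R^-1).
Proof.
apply/seteqP; split => x.
- move=> [y yx hy]; have xy : 0 < d x y by apply: (d_gt0 H) => e; exact: yx.
  have [[|k]// _ hk] := inv_nat_small xy.
  by exists k => //; exists y; split; [exact: ltW|move=> n _].
- move=> [k _ [y [ry hy]]]; exists y; last by move=> n; exact: hy.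
  by move=> e; move: ry; rewrite e (dxx x H) leNgt invr_gt0 ltr0n.
Qed.

Lemma close_pairs_measurable K r : measurable (close_pairs K r).
Proof. by apply: (closed_measurable H); exact: close_pairs_closed. Qed.

Lemma NE_measurable : measurable (NE d f finv eps).
Proof. by rewrite NE_bigcup; apply: bigcup_measurable => k _; exact: close_pairs_measurable. Qed.

Lemma ziterS n x : zi n (f x) = zi (n + 1) x.
Proof.
case: n => [n|[|n]].
- by rewrite -[Posz n + 1]/(Posz (n + 1)) addn1 /= -iterSr.
- by rewrite /= (cs_Kf S).
- have -> : Negz n.+1 + 1 = Negz n by rewrite !NegzE -addn1 PoszD; ring.
  by rewrite -[LHS]/(iter n.+2 finv (f x)) iterSr (cs_Kf S).
Qed.

Lemma NE_invariant : f @^-1` NE d f finv eps = NE d f finv eps.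
Proof.
apply/seteqP; split => x /=.
- move=> [y yx hy]; exists (finv y).
    by move=> e; apply: yx; rewrite -e (cs_fK S).
  move=> n; have := hy (n - 1); rewrite -{1}(cs_fK S y) !ziterS.
  by rewrite subrK.
- move=> [y yx hy]; exists (f y).
    by move=> e; apply: yx; rewrite -(cs_Kf S y) e (cs_Kf S).
  by move=> n; rewrite !ziterS.
Qed.

Lemma close_pairs_null nu r : pr nu (NE d f finv eps) = 0 -> 0 < r ->
  forall e : R, 0 < e -> exists m0, forall m, (m0 <= m)%N -> pr nu (close_pairs (zball m) r) <= e.
Proof.
move=> h0 r0 e e0.
have [||m0 hm0] := @pr_decr _ _ _ nu (fun m => close_pairs (zball m) r) _ _ e e0.
- by move=> n; exact: close_pairs_measurable.
- move=> n x [y [ry hy]]; exists y; split => // k kn; apply: hy.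
  exact: leq_trans kn (leqnSn n).
exists m0 => m /hm0 /le_trans; apply; rewrite close_pairs_bigcap.
suff : pr nu (close_pairs setT r) <= 0 by lra.
rewrite -h0; apply: (fap_le (pr_fap nu)).
- exact: close_pairs_measurable.
- exact: NE_measurable.
- move=> x [y [ry hy]]; exists y; last by move=> n; exact: hy.
  by move=> e'; move: ry; rewrite e' (dxx x H) leNgt r0.
Qed.

(** Lusin's theorem for a coding: regularity gives a closed set inside each atom, and finitely many
    disjoint closed sets of a compact space are a positive distance apart. *)
Lemma cod_separated_compacts nu T (c : X -> T) (e : R) : mcod c -> 0 < e ->
  exists (K : set X) (r : R), [/\ measurable K, 0 < r, pr nu (~` K) <= e &
    forall x y, K x -> K y -> d x y < r -> c x = c y].
Proof.
move=> mc e0.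
have T0 : (0 < #|T|)%N by apply/card_gt0P; exists (c point).
have T0' : 0 < #|T|%:R :> R by rewrite ltr0n.
have eT : 0 < e / #|T|%:R by rewrite divr_gt0.
have reg t : exists K : set X, [/\ dclosed d K, K `<=` c @^-1` [set t] &
    pr nu (c @^-1` [set t] `\` K) <= e / #|T|%:R].
  have [K [U [cK oU KA AU le]]] := measurable_regular H nu (mc t) eT.
  exists K; split => //; apply: le_trans le; apply: (fap_le (pr_fap nu)).
  - by apply: measurableD; [exact: mc|exact: (closed_measurable H)].
  - by apply: measurableD; [exact: (open_measurable H)|exact: (closed_measurable H)].
  - exact: setSD.
have [K hK] := choice reg.
have cK t : dclosed d (K t) by case: (hK t).
have mK t : measurable (K t) by exact: (closed_measurable H).
have mD t : measurable (c @^-1` [set t] `\` K t) by exact: measurableD.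
have Kc t x : K t x -> c x = t by case: (hK t) => _ + _; exact.
pose V t := \big[setI/setT]_(t' <- enum T | t' != t) ~` K t'.
have rt t : exists r : R, 0 < r /\ forall x y, K t x -> d x y < r -> V t y.
  have [||r [s [r0 hr]]] := @lebesgue_number_closed _ _ _ d unit (fun=> V t) (K t) H _ (cK t).
  - by move=> _; apply: dopen_bigI => t' _ _; exact: cK.
  - move=> x Kx; exists tt; rewrite /V -bigcap_seq_cond => t' /= /andP[_ /eqP tt'] Kx'.
    by apply: tt'; rewrite -(Kc _ _ Kx) (Kc _ _ Kx').
  by exists r; split => // x y Kx xy; have [_ _] := hr x Kx; apply.
have [r hr] := choice rt.
exists (\bigcup_t K t), (\big[Num.min/1]_t r t); split.
- by apply: fin_bigcup_measurable.
- by apply/bigmin_gtP; split => // t _; case: (hr t).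
- have -> : ~` (\bigcup_t K t) = \big[setU/set0]_(t <- enum T) (c @^-1` [set t] `\` K t).
    rewrite -bigcup_seq; apply/seteqP; split => x.
      move=> nx; exists (c x); first by rewrite /= mem_enum.
      by split => // Kx; apply: nx; exists (c x).
    by move=> [t _ [<- nK]] [t' _ Kx]; apply: nK; rewrite (Kc _ _ Kx).
  have : pr nu (\big[setU/set0]_(t <- enum T) (c @^-1` [set t] `\` K t)) <=
     \sum_(t <- enum T) e / #|T|%:R.
    elim: (enum T) => [|t s IH]; first by rewrite !big_nil (fap0 (pr_fap nu)).
    rewrite !big_cons; apply: le_trans (fapUle (pr_fap nu) (mD t) _) (lerD _ _) => //.
      by apply: bigsetU_measurable.
    by case: (hK t).
  move=> /le_trans; apply; rewrite big_const_seq count_predT -cardE iter_addr addr0.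
  by rewrite -[leLHS]mulr_natr divfK ?gt_eqF.
- move=> x y [t _ Kx] [t' _ Ky] xy; rewrite (Kc _ _ Kx) (Kc _ _ Ky).
  have tr : d x y < r t.
    by apply: lt_le_trans xy _; apply: bigmin_le_cond.
  have := (proj2 (hr t)) x y Kx tr; rewrite /V -bigcap_seq_cond => h.
  apply/esym/eqP/negPn/negP => tt'; apply: (h t') => //=.
  by rewrite mem_enum.
Qed.

Lemma small_ln (e : R) : 0 < e -> exists2 k : R, 0 < k < 1 & - ln (1 - k) <= e.
Proof.
move=> e0; exists (1 - expR (- e)); last by rewrite opprB addrC subrK expRK opprK.
by rewrite subr_gt0 expR_lt1 oppr_lt0 e0 gtrBl expR_gt0.
Qed.

(* An itinerary of length 2m+1 with respect to [c] under f^n nearly determines the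
   [c']-word of length n at the middle time, because two points of the same itinerary
   stay eps-close for all times |k| <= mn. *)
Lemma expansive_rate nu T J (c : X -> T) (c' : X -> J) n : finvariant f nu ->
  pr nu (NE d f finv eps) = 0 -> (0 < n)%N -> mcod c -> mcod c' ->
  (forall x y, c x = c y -> forall k, (k < n)%N -> d (iter k f x) (iter k f y) <= eps) ->
  n%:R * hr f (pr nu) c' <= Hent (pr nu) c.
Proof.
move=> inu h0 n0 mc mc' cc; have hm := pr_fap nu; have im := pr_minv inu.
pose JJ : finType := {ffun 'I_n -> J}; pose u : X -> JJ := wd f c' n.
have mu : mcod u by exact: (mcod_wd S).
apply/ler_addgt0Pr => th th0.
have th2 : 0 < th / 2 by lra.
have [k k01 lnk] := small_ln th2; have /andP[k0 k1] := k01.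
have JJ0 : 1 <= #|JJ|%:R :> R by rewrite ler1n; apply/card_gt0P; exists (u point).
set L := ln (#|JJ|%:R / k).
have L0 : 0 <= L by rewrite ln_ge0// ler_pdivlMr// mul1r (le_trans (ltW k1)).
(* A wrong guess of a word costs L, so an error probability e contributes at most th / 2 per word;
   the other half is spent on - ln (1 - k). *)
pose e := (th / 2) / (L + 1).
have e0 : 0 < e by rewrite divr_gt0//; lra.
have eL : e * L <= th / 2.
  have : e * (L + 1) = th / 2 by rewrite divfK// gt_eqF//; lra.
  nra.
have e20 : 0 < e / 2 by lra.
have [K [r [mK r0 nK hK]]] := cod_separated_compacts nu mu e20.
have [m0 hm0] := close_pairs_null h0 r0 e20.
pose m := m0; pose M := (m * n)%N.
have m0M : (m0 <= M)%N by rewrite /M /m leq_pmulr.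
have nC := hm0 _ m0M.
(* N consecutive words of length n for [c'] are guessed from N + 2 m + 1 letters of [c]; the cost of
   the 2 m + 1 additional letters does not depend on N. *)
rewrite -subr_le0; apply: (@arch_le0 _ _ ((2 * m).+1%:R * Hent (pr nu) c)) => N.
pose W x : {ffun 'I_(N + (2 * m).+1) -> T} := [ffun j : 'I_(N + (2 * m).+1) => c (iter (j * n) f x)].
have mW : mcod W.
  by apply: (mcod_ffun (c := fun j : 'I_(N + (2 * m).+1) => c \o iter (j * n) f)) => j; exact: (mcod_iter S).
have tj (t : 'I_N) (j : 'I_(2 * m).+1) : (t + j < N + (2 * m).+1)%N.
  by rewrite -addSn leq_add// ltnW.
(* The guess is the word of any point of the good set K that shows the observed window of
   letters. *)
pose gs (t : 'I_N) (w : {ffun 'I_(N + (2 * m).+1) -> T}) : JJ :=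
  u (xget point [set y | K y /\ forall j : 'I_(2 * m).+1,
     c (iter (j * n) f (iter M finv y)) = w (Ordinal (tj t j))]).
pose uu (t : 'I_N) x := u (iter ((t + m) * n) f x).
have muu t : mcod (uu t) by exact: (mcod_iter S).
have err t : pr nu [set x | uu t x <> gs t (W x)] <= e.
  (* Outside this set the guess is right: the true point and the guessing point lie in K and stay
     eps-close for all times up to M in modulus, so they are less than r apart and have the same
     word. *)
  pose B := ~` K `|` close_pairs (zball M) r.
  have mB : measurable B by apply: measurableU; [exact: measurableC|exact: close_pairs_measurable].
  apply: (@le_trans _ _ (pr nu (iter ((t + m) * n) f @^-1` B))); last first.
    rewrite (minv_iter S _ im mB); apply: le_trans (fapUle hm _ _) _.
    - exact: measurableC.
    - exact: close_pairs_measurable.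
    - lra.
  apply: (fap_le hm); last first.
  - move=> x /= ux; apply: contrapT => /not_orP[]; rewrite notK.
    set z := iter _ f x => Kz ncz; apply: ux.
    have Mz j : (j <= 2 * m)%N -> iter (j * n) f (iter M finv z) = iter ((t + j) * n) f x.
      move=> jm; rewrite /z mulnDl addnC iterD -/M iter_cancel' -iterD.
      by congr (iter _ f x); rewrite mulnDl addnC.
    rewrite /gs; case: xgetP => [y _ [Ky hy]|/(_ z) []]; last first.
      by split => // j; rewrite Mz ?ffunE// -ltnS.
    rewrite /uu -/z; apply: hK => //; rewrite ltNge; apply/negP => rzy; apply: ncz.
    exists y; split => // i /ziter_shift[k' k'M ki]; rewrite !ki.
    have jm : (k' %/ n < (2 * m).+1)%N.
      rewrite ltnS -(leq_pmul2r n0); apply: leq_trans (leq_trunc_div _ _) _.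
      by rewrite -mulnA mul2n -addnn.
    have e2 : c (iter (k' %/ n * n) f (iter M finv z)) = c (iter (k' %/ n * n) f (iter M finv y)).
      by have := hy (Ordinal jm); rewrite Mz//= => ->; rewrite ffunE.
    have := cc _ _ e2 (k' %% n)%N (ltn_pmod _ n0).
    by rewrite -!iterD addnC -divn_eq.
  - exact: (iter_measurable S).
  - have -> : [set x | uu t x <> gs t (W x)] = (fun x => (uu t x, W x)) @^-1` [set p | p.1 != gs t p.2].
      by apply/seteqP; split => x /= /eqP.
    exact: (mcodP (fun p : JJ * {ffun 'I_(N + (2 * m).+1) -> T} => p.1 != gs t p.2) (mcod_pair (muu t) mW)).
have h1 := Hent_guess gs hm muu mW k01.
have h2 : Hent (pr nu) W <= (N + (2 * m).+1)%:R * Hent (pr nu) c.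
  apply: le_trans (Hent_subadd (c := fun j : 'I_(N + (2 * m).+1) => c \o iter (j * n) f) hm _) _.
    by move=> j; exact: (mcod_iter S).
  under eq_bigr do rewrite (Hent_iter S)//.
  by rewrite sumr_const card_ord mulr_natl.
have Hc0 : 0 <= Hent (pr nu) c by exact: Hent_ge0.
have h3 : Hent (pr nu) (wd f c' (N * n)) <= Hent (pr nu) (fun x => [ffun t => uu t x]).
  rewrite -(Hent_iter S M im (mcod_wd S mc' (n := N * n))); apply: Hent_det => //.
    exact: (mcod_ffun (c := uu)).
  move=> x y /ffunP h; apply/wdP => j jN.
  have jn : (j %/ n < N)%N by rewrite ltn_divLR.
  have := h (Ordinal jn); rewrite !ffunE /= /uu /u => /wdP/(_ (j %% n)%N).
  rewrite ltn_pmod// -!iterD mulnDl addnA [(j %% n + _)%N]addnC -divn_eq; exact.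
have h4 : \sum_(t < N) (- ln (1 - k) + pr nu [set x | uu t x <> gs t (W x)] * L) <= N%:R * th.
  apply: (@le_trans _ _ (\sum_(t < N) th)); last by rewrite sumr_const card_ord mulr_natl.
  apply: ler_sum => t _; have := ler_wpM2r L0 (err t); lra.
have h5 : (N * n)%:R * hr f (pr nu) c' <= Hent (pr nu) (wd f c' (N * n)).
  have [->|Nn] := posnP (N * n); first by rewrite mul0r; apply: Hent_ge0 => //; exact: (mcod_wd S).
  exact: (hr_le S).
rewrite natrM in h5; rewrite natrD in h2; nra.
Qed.

End Expansivity.

(** * Limits of Gibbs averages *)

Section NullBoundary.
Context {R : realType} {dsp : measure_display} {X : measurableType dsp}.
Context (d : X -> X -> R) (H : cspace d).
Implicit Types (T : finType) (mu : probability X R).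

Lemma first_cod (A : seq (set X)) : (forall i, (i < size A)%N -> measurable (nth set0 A i)) ->
  (forall x, exists2 i, (i < size A)%N & nth set0 A i x) ->
  exists c : X -> 'I_(size A), mcod c /\ forall i : 'I_(size A),
    c @^-1` [set i] = nth set0 A i `\` \big[setU/set0]_(j <- iota 0 i) nth set0 A j.
Proof.
move=> mA cA.
have ex x : exists i : 'I_(size A), nth set0 A i x /\ forall j, (j < i)%N -> ~ nth set0 A j x.
  have ex1 : exists i, (i < size A)%N && `[< nth set0 A i x >].
    by have [i il Ai] := cA x; exists i; rewrite il; apply/asboolP.
  case: (ex_minnP ex1) => i /andP[il /asboolP Ai] imin.
  exists (Ordinal il); split => // j /= ji Aj.
  have : (i <= j)%N by apply: imin; rewrite (ltn_trans ji il); apply/asboolP.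
  by rewrite leqNgt ji.
have [c hc] := choice ex; exists c.
have cE (i : 'I_(size A)) :
    c @^-1` [set i] = nth set0 A i `\` \big[setU/set0]_(j <- iota 0 i) nth set0 A j.
  apply/seteqP; split => x /=.
  - move=> <-; case: (hc x) => h1 h2; split => //.
    by rewrite -bigcup_seq => -[j /=]; rewrite mem_iota add0n => /h2.
  - rewrite -bigcup_seq => -[Ai nj]; case: (hc x) => h1 h2.
    apply: val_inj; have [ci|ic|//] := ltngtP (c x) i.
    + by exfalso; apply: nj; exists (c x : nat); rewrite //= mem_iota.
    + by case: (h2 i ic).
split => // i; rewrite cE; apply: measurableD; first exact: mA.
rewrite big_seq; apply: bigsetU_measurable => j; rewrite mem_iota add0n => /andP[_ ji].
by apply: mA; exact: ltn_trans ji (ltn_ord i).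
Qed.

(** Spheres around x are disjoint, so only countably many radii can carry mass, whereas the interval
    has positive Lebesgue measure. *)
Lemma null_sphere mu x (a b : R) : a < b ->
  exists r, a < r < b /\ pr mu [set y | d x y = r] = 0.
Proof.
move=> ab; apply: contrapT => h.
have mS r : measurable [set y | d x y = r].
  have -> : [set y | d x y = r] = [set y | d x y <= r] `&` [set y | r <= d x y].
    by apply/seteqP; split => y /=; [move=> ->|move=> [h1 h2]; apply/le_anti/andP].
  apply: (closed_measurable H); apply: dclosedI.
    by apply: dcont_real_closed; exact: dcont_dist.
  by apply: dcont_real_closed'; exact: dcont_dist.
have pos r : a < r < b -> 0 < pr mu [set y | d x y = r].
  move=> rab; rewrite lt_neqAle pr_ge0 andbT; apply/eqP => e; apply: h.
  by exists r; split.
pose B (j : nat) := [set r | a < r < b /\ j.+1%:R^-1 <= pr mu [set y | d x y = r]].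
have Bfin j : finite_set (B j).
  apply: contrapT => infB.
  have [C [uC CB Cj]] : exists s : seq R, [/\ uniq s, forall r, r \in s -> B j r & (j.+2 <= size s)%N].
    have [C CB Cj] := infinite_set_fset j.+2 infB.
    by exists (finmap.enum_fset C); split => //; exact: finmap.fset_uniq.
  have sum1 : \sum_(r <- C) pr mu [set y | d x y = r] <= 1.
    have eqU : forall s : seq R, uniq s ->
        \sum_(r <- s) pr mu [set y | d x y = r] = pr mu [set y | d x y \in s].
      elim=> [|r s IH] /=; first by rewrite big_nil -(fap0 (pr_fap mu)) => _; congr (pr mu _); apply/seteqP; split.
      move=> /andP[rs us]; rewrite big_cons IH// -(fapU (pr_fap mu))//.
      - congr (pr mu _); apply/seteqP; split => y /=; rewrite inE.
        + by case=> [->|->]; rewrite ?eqxx ?orbT.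
        + by case/orP => [/eqP|]; [left|right].
      - have -> : [set y | d x y \in s] = \big[setU/set0]_(r <- s) [set y | d x y = r].
          rewrite -bigcup_seq; apply/seteqP; split => y /=; first by exists (d x y).
          by move=> [r' /= r's ->].
        exact: bigsetU_measurable.
      - by apply/seteqP; split => y //= [-> ]; apply/negP.
    rewrite eqU//; apply: (fap_le1 (pr_fap mu)).
    have -> : [set y | d x y \in C] = \big[setU/set0]_(r <- C) [set y | d x y = r].
      rewrite -bigcup_seq; apply/seteqP; split => y /=; first by exists (d x y).
      by move=> [r' /= r's ->].
    exact: bigsetU_measurable.
  have : \sum_(r <- C) (j.+1%:R^-1 : R) <= 1.
    apply: le_trans sum1; rewrite big_seq [leRHS]big_seq; apply: ler_sum => r rC.
    by have [] := CB r rC.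
  rewrite big_const_seq count_predT iter_addr addr0 -[X in X <= _]mulr_natl ler_pdivrMr ?ltr0n// mul1r ler_nat.
  by rewrite leqNgt; rewrite Cj.
have cB : countable [set r | a < r < b].
  apply: (@sub_countable _ _ _ (\bigcup_j B j)); last first.
    by apply: bigcup_countable => // j _; exact: finite_set_countable.
  apply: subset_card_le => r /= rab; have [[|j]// _ hj] := inv_nat_small (pos r rab).
  by exists j => //; split => //; exact: ltW.
have := countable_lebesgue_measure0 cB.
have -> : [set r | a < r < b] = `]a, b[%classic.
  by apply/seteqP; split => r /=; rewrite in_itv.
rewrite lebesgue_measure_itv /= lte_fin ab => /eqP; rewrite -EFinB eqe; lra.
Qed.

(** Atoms with null boundary, expressed by an open set inside and a closed set outside. *)
Definition nullbd mu T (c : X -> T) := forall t, exists O F : set X,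
  [/\ dopen d O, dclosed d F, O `<=` c @^-1` [set t], c @^-1` [set t] `<=` F &
      pr mu (F `\` O) = 0].

(** Balls with null spheres around a net are made disjoint; radii between rho / 4 and rho / 2 let
    them cover and keep diameters at most rho. *)
Lemma nullbd_cod mu (rho : R) : 0 < rho -> exists (T : finType) (c : X -> T),
  [/\ mcod c, nullbd mu c & forall x y, c x = c y -> d x y <= rho].
Proof.
move=> rho0; have r4 : 0 < rho / 4 by lra.
have [s hs] := finite_net H r4.
have ab : rho / 4 < rho / 2 by lra.
have [r hr] := choice (fun x => null_sphere mu x ab).
pose A := [seq [set y | d x y <= r x] | x <- s].
have nthA i : (i < size s)%N -> nth set0 A i = [set y | d (nth point s i) y <= r (nth point s i)].
  by move=> il; rewrite (nth_map point).
have sA : size A = size s by rewrite size_map.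
have clA x : dclosed d [set y | d x y <= r x] by apply: dcont_real_closed; exact: dcont_dist.
have opA x : dopen d [set y | d x y < r x] by apply: dcont_real_open; exact: dcont_dist.
have [||c [mc cE]] := @first_cod A.
- by move=> i; rewrite sA => il; rewrite nthA//; exact: (closed_measurable H).
- move=> x; have [y ys yx] := hs x; exists (index y s); rewrite ?sA ?index_mem//.
  rewrite nthA ?index_mem// nth_index//= (le_trans (ltW yx))//.
  by have [/andP[/ltW]] := hr y.
exists 'I_(size A), c; split => //; last first.
  move=> x y e; have il : (c y < size s)%N by rewrite -sA.
  have : (c @^-1` [set c y]) x by []; have : (c @^-1` [set c y]) y by [].
  rewrite cE nthA// => -[/= h1 _] [/= h2 _].
  have := dtri x (nth point s (c y)) y H; rewrite (dsym x (nth point s (c y)) H).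
  by have [/andP[_]] := hr (nth point s (c y)); lra.
move=> i; have il : (i < size s)%N by rewrite -sA.
pose x_ j := nth point s j.
exists ([set y | d (x_ i) y < r (x_ i)] `\` \big[setU/set0]_(j <- iota 0 i) [set y | d (x_ j) y <= r (x_ j)]).
exists ([set y | d (x_ i) y <= r (x_ i)] `\` \big[setU/set0]_(j <- iota 0 i) [set y | d (x_ j) y < r (x_ j)]).
have bigE : \big[setU/set0]_(j <- iota 0 i) nth set0 A j =
    \big[setU/set0]_(j <- iota 0 i) [set y | d (x_ j) y <= r (x_ j)].
  rewrite big_seq [RHS]big_seq; apply: eq_bigr => j; rewrite mem_iota add0n => /andP[_ ji].
  by rewrite nthA//; exact: ltn_trans ji il.
rewrite cE nthA// bigE; split.
- by apply: dopenD => //; apply: dclosed_bigU => j _ _; exact: clA.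
- by apply: dclosedD => //; apply: dopen_bigU => j _ _; exact: opA.
- by apply: setSD => y /ltW.
- apply: setDS; rewrite -!bigcup_seq => y [j jl /= /ltW h]; by exists j.
pose Sph j := [set y | d (x_ j) y = r (x_ j)].
have mSph j : measurable (Sph j).
  have -> : Sph j = [set y | d (x_ j) y <= r (x_ j)] `\` [set y | d (x_ j) y < r (x_ j)].
    apply/seteqP; split => y; rewrite /Sph /=; first by move=> ->; rewrite lexx ltxx.
    by move=> [h1 /negP]; rewrite -leNgt => h2; apply/le_anti/andP.
  by apply: measurableD; [exact: (closed_measurable H)|exact: (open_measurable H)].
apply/le_anti; rewrite pr_ge0 andbT.
have sub : ([set y | d (x_ i) y <= r (x_ i)] `\` \big[setU/set0]_(j <- iota 0 i) [set y | d (x_ j) y < r (x_ j)]) `\`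
  ([set y | d (x_ i) y < r (x_ i)] `\` \big[setU/set0]_(j <- iota 0 i) [set y | d (x_ j) y <= r (x_ j)])
  `<=` \big[setU/set0]_(j <- iota 0 i.+1) Sph j.
  have mi (k : nat) : (k < i.+1)%N -> k \in iota 0 i.+1 by rewrite mem_iota.
  rewrite -!bigcup_seq => y [[h1 h2] h3].
  have [h4|h4] := ltP (d (x_ i) y) (r (x_ i)).
    have [j jl jy] : (\bigcup_(j in [set` iota 0 i]) [set y | d (x_ j) y <= r (x_ j)]) y.
      by apply: contrapT => h; apply: h3.
    have ji : (j < i)%N by move: jl; rewrite /= mem_iota.
    exists j; first by apply: mi; exact: ltnW.
    apply/le_anti/andP; split => //; rewrite leNgt; apply/negP => h5.
    by apply: h2; exists j.
  exists (i : nat); first exact: mi.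
  by apply/le_anti/andP.
apply: (@le_trans _ _ (pr mu (\big[setU/set0]_(j <- iota 0 i.+1) Sph j))).
  apply: (fap_le (pr_fap mu)) => //; last by apply: bigsetU_measurable.
  apply: measurableD; last first.
    by apply: (open_measurable H); apply: dopenD => //; apply: dclosed_bigU => j _ _; exact: clA.
  by apply: (closed_measurable H); apply: dclosedD => //; apply: dopen_bigU => j _ _; exact: opA.
elim: (iota 0 i.+1) => [|j l IH]; first by rewrite big_nil (fap0 (pr_fap mu)).
rewrite big_cons; apply: le_trans (fapUle (pr_fap mu) (mSph j) _) _.
  by apply: bigsetU_measurable.
by have [_ ->] := hr (x_ j); rewrite add0r.
Qed.

Lemma nullbd_wd f mu T (c : X -> T) q : dcont_fun d f -> finvariant f mu ->
  nullbd mu c -> nullbd mu (wd f c q).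
Proof.
move=> cf imu nc w.
have [V hV] := choice nc; have [F hF] := choice hV.
have oV t : dopen d (V t) by case: (hF t).
have cF t : dclosed d (F t) by case: (hF t).
have ck k : dcont_fun d (iter k f) by exact: dcont_fun_iter.
exists (\big[setI/setT]_(k : 'I_q) (iter k f @^-1` V (w k))).
exists (\big[setI/setT]_(k : 'I_q) (iter k f @^-1` F (w k))).
split.
- by apply: dopen_bigI => k _ _; exact: dopen_preimage.
- by apply: dclosed_bigI => k _ _; exact: dclosed_preimage.
- rewrite -bigcap_seq => x h /=; apply/ffunP => k; rewrite ffunE.
  have := h k; rewrite /= mem_index_enum => /(_ isT).
  by case: (hF (w k)) => _ _ + _ _; apply.
- rewrite -bigcap_seq => x /= <- k _ /=.
  by case: (hF (wd f c q x k)) => _ _ _ + _; apply; rewrite /= ffunE.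
have mD (k : 'I_q) : measurable (iter k f @^-1` (F (w k) `\` V (w k))).
  apply: (preimage_measurable H (ck k)).
  by apply: measurableD; [exact: (closed_measurable H)|exact: (open_measurable H)].
apply/le_anti; rewrite pr_ge0 andbT.
apply: (@le_trans _ _ (pr mu (\big[setU/set0]_(k <- index_enum 'I_q) (iter k f @^-1` (F (w k) `\` V (w k)))))).
  apply: (fap_le (pr_fap mu)); last first.
  - rewrite -!bigcap_seq -bigcup_seq => x [h1 h2]; apply: contrapT => h3; apply: h2 => k kq.
    by apply: contrapT => h4; apply: h3; exists k => //; split => //; exact: h1.
  - by apply: bigsetU_measurable.
  - apply: measurableD; last first.
      by apply: (open_measurable H); apply: dopen_bigI => k _ _; exact: dopen_preimage.
    by apply: (closed_measurable H); apply: dclosed_bigI => k _ _; exact: dclosed_preimage.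
elim: (index_enum _) => [|k l IH]; first by rewrite big_nil (fap0 (pr_fap mu)).
rewrite big_cons; apply: le_trans (fapUle (pr_fap mu) (mD k) _) _.
  by apply: bigsetU_measurable.
have -> : pr mu (iter k f @^-1` (F (w k) `\` V (w k))) = 0; last by rewrite add0r.
have iter_inv n A : measurable A -> pr mu (iter n f @^-1` A) = pr mu A.
  move=> mA; elim: n => [|n IHn] //; rewrite -IHn /pr -(imu (iter n f @^-1` A)).
    by congr (fine (mu _)); apply/funext => x /=; rewrite -iterSr.
  exact: (preimage_measurable H (ck n)).
rewrite iter_inv; first by case: (hF (w k)).
by apply: measurableD; [exact: (closed_measurable H)|exact: (open_measurable H)].
Qed.

Context (I : Type) (U : set_system I) {UU : UltraFilter U} (M : I -> probability X R).

Lemma nullbd_cvg mu T (c : X -> T) t : mcod c ->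
  (forall O (l : R), dopen d O -> pr (M i) O @[i --> U] --> l -> pr mu O <= l) ->
  nullbd mu c -> pr (M i) (c @^-1` [set t]) @[i --> U] --> pr mu (c @^-1` [set t]).
Proof.
move=> mc muO nc; have [V [F [oO cF OC CF FO]]] := nc t.
have mO := open_measurable H oO; have mF := closed_measurable H cF.
have lims A : measurable A -> exists l : R, pr (M i) A @[i --> U] --> l.
  move=> mA; apply: (@ultra_cvg_ex _ _ _ _ _ 1) => i.
  by rewrite ger0_norm ?pr_ge0// (fap_le1 (pr_fap _)).
have [lO hO] := lims _ mO; have [lF hF] := lims _ mF; have [l hl] := lims _ (mc t).
suff -> : pr mu (c @^-1` [set t]) = l by [].
have h1 := muO _ _ oO hO; have h2 := ulim_closed (UU := UU) H muO cF hF.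
have h3 : lO <= l by apply: (ucvg_le hO hl); apply: nearW => i; exact: (fap_le (pr_fap _)).
have h4 : l <= lF by apply: (ucvg_le hl hF); apply: nearW => i; exact: (fap_le (pr_fap _)).
have h5 : pr mu V <= pr mu (c @^-1` [set t]) by exact: (fap_le (pr_fap _)).
have h6 : pr mu (c @^-1` [set t]) <= pr mu F by exact: (fap_le (pr_fap _)).
have h7 : pr mu F <= pr mu V.
  have := fapU (pr_fap mu) mO (measurableD mF mO); rewrite setDUK; last exact: subset_trans CF.
  by rewrite FO addr0 => -> //; rewrite setDE setICA setICr setI0.
by apply/le_anti/andP; split; lra.
Qed.

(* Upper semicontinuity of the entropy of a coding whose atoms converge, by testing
   against the positive weights (1 - k) mu(c = t) + k / #|T|. *)
Lemma Hent_usc mu T (c : X -> T) (a : I -> R) (l : R) : mcod c ->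
  (forall t, pr (M i) (c @^-1` [set t]) @[i --> U] --> pr mu (c @^-1` [set t])) ->
  (\forall i \near U, a i <= Hent (pr (M i)) c) -> a i @[i --> U] --> l ->
  l <= Hent (pr mu) c.
Proof.
move=> mc hc ha al; have hm := pr_fap mu.
have T0 : 0 < #|T|%:R :> R by rewrite ltr0n; apply/card_gt0P; exists (c point).
apply/ler_addgt0Pr => e e0; have [k /andP[k0 k1] ke] := small_ln e0.
pose q t := (1 - k) * pr mu (c @^-1` [set t]) + k / #|T|%:R.
have kT : 0 < k / #|T|%:R by rewrite divr_gt0.
have k1' : 0 < 1 - k by lra.
have q0 t : 0 < q t.
  by rewrite /q ltr_wpDl// mulr_ge0 ?pr_ge0// ltW.
have q1 : \sum_t q t <= 1.
  rewrite big_split /= -mulr_sumr (fap_sum1 hm mc) sumr_const.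
  by rewrite -[X in _ + X]mulr_natr divfK ?gt_eqF//; lra.
have h1 : l <= \sum_t pr mu (c @^-1` [set t]) * (- ln (q t)).
  have A2 : (\sum_t pr (M i) (c @^-1` [set t]) * (- ln (q t))) @[i --> U] -->
      \sum_t pr mu (c @^-1` [set t]) * (- ln (q t)).
    by apply: ucvg_sum => t; apply: cvgMr_tmp; exact: hc.
  apply: (ucvg_le al A2).
  near=> i; apply: le_trans (near ha i _) _ => //.
  by apply: Hent_gibbs => //; [exact: pr_fap|move=> t; exact: ltW].
apply: le_trans h1 _; rewrite HentE//.
have -> : \sum_t pr mu (c @^-1` [set t]) * - ln (pr mu (c @^-1` [set t])) + e =
   \sum_t pr mu (c @^-1` [set t]) * (- ln (pr mu (c @^-1` [set t])) + e).
  under [RHS]eq_bigr do rewrite mulrDr.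
  by rewrite big_split /= -mulr_suml (fap_sum1 hm mc) mul1r.
apply: ler_sum => t _; have := pr_ge0 mu (c @^-1` [set t]).
rewrite le_eqVlt => /orP[/eqP <-|p0]; first by rewrite !mul0r.
rewrite ler_wpM2l ?(ltW p0)//.
have : ln ((1 - k) * pr mu (c @^-1` [set t])) <= ln (q t).
  by rewrite ler_ln ?posrE ?mulr_gt0// /q lerDl ltW.
by rewrite lnM ?posrE//; lra.
Unshelve. all: by end_near.
Qed.

End NullBoundary.

(** * Invariant measures built from separated sets *)

Section Misiurewicz.
Context {R : realType} {dsp : measure_display} {X : measurableType dsp}.
Context (d : X -> X -> R) (f finv : X -> X) (S : csys d f finv) (phi : X -> R).
Context (cphi : dcont_real d phi).
Implicit Types (T : finType) (mu nu : probability X R) (E : seq X).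

Let H := cs_space S.

Notation Phi := (birkhoff f phi).

Definition psum E n : R := \sum_(x <- E) expR (Phi x n).

Lemma psum_gt0 E n : E != [::] -> 0 < psum E n.
Proof.
case: E => // x E _; rewrite /psum big_cons ltr_pwDl ?expR_gt0//.
by apply: sumr_ge0 => y _; exact: expR_ge0.
Qed.

Lemma birkhoff_dcont n : dcont_real d (Phi ^~ n).
Proof.
have -> : Phi ^~ n = fun x => \sum_(k <- index_enum 'I_n) phi (iter k f x) by [].
apply: dcont_real_sum => k.
exact: (dcont_real_comp cphi (dcont_fun_iter k (cs_f S))).
Qed.

Lemma Ex_birkhoff mu n : finvariant f mu -> Ex mu (Phi ^~ n) = n%:R * Ex mu phi.
Proof.
move=> imu; have bphi := dcont_bmeas H cphi.
have -> : Phi ^~ n = fun x => \sum_(k <- index_enum 'I_n) (phi \o iter k f) x by [].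
rewrite Ex_sum; last first.
  by move=> k; exact: (dcont_bmeas H (dcont_real_comp cphi (dcont_fun_iter k (cs_f S)))).
rewrite (eq_bigr (fun=> Ex mu phi)); first by rewrite sumr_const card_ord mulr_natl.
move=> k _; elim: (k : nat) => //= j IH; rewrite -[RHS]IH.
rewrite -(@Ex_invariant _ _ _ mu f (phi \o iter j f)) //.
- by congr (Ex mu _); apply/funext => x /=; rewrite -iterSr.
- exact: (dcont_measurable H (cs_f S)).
- exact: (dcont_bmeas H (dcont_real_comp cphi (dcont_fun_iter j (cs_f S)))).
Qed.

Lemma Hent_cst mu T (t : T) : Hent (pr mu) (fun=> t) = 0.
Proof.
have mc : mcod (fun _ : X => tt).
  move=> u; have -> : (fun _ : X => tt) @^-1` [set u] = setT by apply/seteqP; split => // x _; case: u.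
  exact: measurableT.
apply/le_anti/andP; split.
  apply: (@le_trans _ _ (Hent (pr mu) (fun _ : X => tt))).
    exact: (Hent_det (pr_fap mu)).
  apply: le_trans (Hent_le_card (pr_fap mu) mc) _.
  by rewrite card_unit ln1.
apply: Hent_ge0; first exact: pr_fap.
exact: (mcod_det mc).
Qed.

(** For each residue j modulo q, a word of length n is determined by its first q letters and by the
    q-words starting at times congruent to j. Summing over j uses every starting time once, and
    concavity passes from the mean of the entropies under the images of sigma to the entropy under
    their mean M. *)
Lemma Hent_average (sigma M : probability X R) T (c : X -> T) n q : (0 < n)%N -> (0 < q)%N ->
  mcod c ->
  (forall A, measurable A -> pr M A = \sum_(k < n) n%:R^-1 * pr sigma (iter k f @^-1` A)) ->
  q%:R * Hent (pr sigma) (wd f c n) <=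
  q%:R * ln #|{ffun 'I_q -> T}|%:R + n%:R * Hent (pr M) (wd f c q).
Proof.
move=> n0 q0 mc ME; have hs := pr_fap sigma; have mq := mcod_wd S mc (n := q).
have n0' : 0 < n%:R :> R by rewrite ltr0n.
have block j : (j < q)%N -> Hent (pr sigma) (wd f c n) <= ln #|{ffun 'I_q -> T}|%:R +
    \sum_(k < n) (if (k %% q == j)%N then Hent (pr sigma) (wd f c q \o iter k f) else 0).
  move=> jq.
  (* [None] codes the letters before time j; times outside the residue class get a constant code,
     which has no entropy. Blocks may run beyond time n. *)
  pose C (a : option 'I_n) : X -> {ffun 'I_q -> T} := match a with
    | None => wd f c q
    | Some k => if (k %% q == j)%N then wd f c q \o iter k f else fun=> wd f c q point end.
  have mC a : mcod (C a).
    case: a => [k|//]; rewrite /C; case: ifP => _; first exact: (mcod_iter S).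
    by apply: (mcod_det mq).
  apply: (@le_trans _ _ (Hent (pr sigma) (fun x => [ffun a => C a x]))).
    apply: Hent_det => //; first exact: mcod_ffun.
    move=> x y /ffunP h; apply/wdP => p pn.
    have [pj|jp] := ltnP p j.
      have := h None; rewrite !ffunE /= => /wdP; apply; exact: ltn_trans jq.
    have kn : (p - (p - j) %% q < n)%N by apply: leq_ltn_trans (leq_subr _ _) pn.
    have e1 : ((p - (p - j) %% q) %% q = j)%N.
      have : (p - (p - j) %% q = j + (p - j) %/ q * q)%N.
        have := divn_eq (p - j) q; move: ((p - j) %% q)%N ((p - j) %/ q * q)%N => u v; lia.
      by move=> ->; rewrite addnC modnMDl modn_small.
    have := h (Some (Ordinal kn)); rewrite !ffunE /C /= e1 eqxx => /wdP/(_ ((p - j) %% q)%N).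
    rewrite ltn_pmod// -!iterD subnKC//; first exact.
    exact: leq_trans (leq_mod _ _) (leq_subr _ _).
  apply: le_trans (Hent_subadd hs mC) _.
  rewrite (bigD1 None)//= lerD//; first exact: Hent_le_card.
  rewrite (reindex_omap Some id) /=; last by case.
  rewrite (eq_bigl xpredT) => [|k]; last by rewrite eqxx.
  apply: ler_sum => k _; rewrite /C; case: ifP => // _.
  by rewrite Hent_cst.
have h1 : q%:R * Hent (pr sigma) (wd f c n) <= \sum_(j < q) (ln #|{ffun 'I_q -> T}|%:R +
    \sum_(k < n) (if (k %% q == j)%N then Hent (pr sigma) (wd f c q \o iter k f) else 0)).
  rewrite -[leLHS]/(q%:R * _) mulr_natl -[q in leLHS]card_ord -sumr_const.
  by apply: ler_sum => j _; exact: block.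
apply: le_trans h1 _; rewrite big_split /= sumr_const card_ord mulr_natl lerD2l.
rewrite exchange_big /=.
have -> : \sum_(k < n) \sum_(j < q) (if (k %% q == j)%N then Hent (pr sigma) (wd f c q \o iter k f) else 0) =
   \sum_(k < n) Hent (pr sigma) (wd f c q \o iter k f).
  apply: eq_bigr => k _; rewrite -big_mkcond /=.
  have kq : (k %% q < q)%N by rewrite ltn_pmod.
  have e (j : 'I_q) : (k %% q == j)%N = (j == Ordinal kq) by rewrite -val_eqE /= eq_sym.
  by rewrite (eq_bigl _ _ e) big_pred1_eq.
have hk (k : 'I_n) : fap (fun A => pr sigma (iter k f @^-1` A)).
  split; first by rewrite preimage_setT (fapT hs).
  - by move=> A mA; exact: pr_ge0.
  - move=> A B mA mB AB; rewrite preimage_setU (fapU hs) //.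
    + exact: (iter_measurable S).
    + exact: (iter_measurable S).
    + by rewrite -preimage_setI AB preimage_set0.
have := @Hent_concave _ _ _ 'I_n _ (fun k A => pr sigma (iter k f @^-1` A)) (fun=> n%:R^-1) (pr M) (wd f c q) hk (pr_fap M) mq.
rewrite -mulr_sumr => h; rewrite -ler_pdivrMl//; apply: h => //.
by move=> _; rewrite invr_gt0.
Qed.

(* M is the average of the first n images of the normalised weights expR (Phi x n) on E. *)
Definition gibbs_average E n M := forall g, bmeas g ->
  Ex M g = (psum E n)^-1 * \sum_(x <- E) expR (Phi x n) * (n%:R^-1 * \sum_(k < n) g (iter k f x)).

(** Distinct points of E have distinct n-words, so the entropy of the normalised weights on E is
    that of their words; it equals the logarithm of the partition sum minus the mean of Phi.
    [Hent_average] transfers it to q-words under M. *)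
Lemma gibbs_average_ex E n (delta : R) : (0 < n)%N -> E != [::] -> uniq E ->
  sep d f n delta E ->
  exists M, gibbs_average E n M /\ forall T (c : X -> T) q, (0 < q)%N -> mcod c ->
  (forall x y, c x = c y -> d x y <= delta) ->
  q%:R * ln (psum E n) <= q%:R * ln #|{ffun 'I_q -> T}|%:R +
     n%:R * (Hent (pr M) (wd f c q) + q%:R * Ex M phi).
Proof.
move=> n0 En uE sE; have n0' : 0 < n%:R :> R by rewrite ltr0n.
have Z0 := psum_gt0 n En; set Z := psum E n in Z0 *.
pose N := size E; pose xi (i : 'I_N) := nth point E i.
pose w (i : 'I_N) := expR (Phi (xi i) n) / Z.
have w0 i : 0 < w i by rewrite divr_gt0 ?expR_gt0.
have sumE (h : X -> R) : \sum_(x <- E) h x = \sum_(i < N) h (xi i).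
  by rewrite (big_nth point) big_mkord.
have w1 : \sum_i w i = 1 by rewrite -mulr_suml -(sumE (fun x => expR (Phi x n))) -/(psum E n) divff ?gt_eqF.
have [sigma [sA sE']] := prob_discrete xi (fun i => ltW (w0 i)) w1.
pose wM (p : 'I_N * 'I_n) := w p.1 / n%:R.
have [M [MA ME]] := @prob_discrete _ _ _ ('I_N * 'I_n)%type (fun p => iter p.2 f (xi p.1)) wM
  (fun p => ltac:(by rewrite divr_ge0 ?ltW))
  ltac:(by rewrite -(pair_bigA _ (fun i k => w i / n%:R)) /= -{}[RHS]w1; apply: eq_bigr => i _;
        rewrite sumr_const card_ord -[LHS]mulr_natr divfK ?gt_eqF).
have MA' A : measurable A -> pr M A = \sum_(k < n) n%:R^-1 * pr sigma (iter k f @^-1` A).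
  move=> mA; rewrite MA// -(pair_bigA _ (fun i k => wM (i, k) * \1_A (iter k f (xi i)))) /=.
  rewrite exchange_big /=; apply: eq_bigr => k _.
  rewrite sA; last exact: (iter_measurable S).
  by rewrite mulr_sumr; apply: eq_bigr => i _; rewrite /wM /= mulrAC mulrC.
exists M; split.
  move=> g bg; rewrite ME// -(pair_bigA _ (fun i k => wM (i, k) * g (iter k f (xi i)))) /=.
  rewrite (sumE (fun x => expR (Phi x n) * (n%:R^-1 * \sum_(k < n) g (iter k f x)))) mulr_sumr.
  apply: eq_bigr => i _; rewrite /wM /w /= -mulr_sumr; ring.
move=> T' c' q q0 mc' hc.
have inj (i i' : 'I_N) : wd f c' n (xi i) = wd f c' n (xi i') -> i = i'.
  move=> /wdP h; apply: contrapT => ii.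
  have xx : xi i <> xi i' by move=> /eqP; rewrite nth_uniq// => /eqP /val_inj.
  have := sE (xi i) (xi i') (mem_nth _ _) (mem_nth _ _) xx; rewrite !ltn_ord => /(_ isT isT).
  have [d0|d0] := leP 0 delta; last first.
    move=> _; have := h 0%N n0 => /hc; rewrite leNgt => /negP; apply.
    by apply: lt_le_trans d0 _; exact: (d_ge0 _ _ H).
  rewrite ltNge => /negP; apply; apply/dn_leP => // k kn.
  by apply: hc; exact: h.
have HS : Hent (pr sigma) (wd f c' n) = \sum_i w i * (- ln (w i)).
  have mw := mcod_wd S mc' (n := n).
  rewrite (HentE (pr_fap sigma))//.
  have pw i : pr sigma (wd f c' n @^-1` [set wd f c' n (xi i)]) = w i.
    rewrite sA// (bigD1 i)//= indicE mem_set// mulr1 big1 ?addr0// => i' ii'.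
    rewrite indicE memNset ?mulr0// => /= /inj e; by rewrite e eqxx in ii'.
  under eq_bigr do rewrite {1}sA// mulr_suml.
  rewrite exchange_big /=; apply: eq_bigr => i _.
  rewrite (bigD1 (wd f c' n (xi i)))//= indicE mem_set// mulr1 pw big1 ?addr0// => t ti.
  rewrite indicE memNset ?mulr0 ?mul0r// => /= e; by rewrite e eqxx in ti.
have lnw i : - ln (w i) = ln Z - Phi (xi i) n.
  by rewrite /w ln_div ?posrE ?expR_gt0// expRK opprB.
have lnZ : ln Z = Hent (pr sigma) (wd f c' n) + n%:R * Ex M phi.
  rewrite HS; under eq_bigr do rewrite lnw mulrBr.
  rewrite sumrB -mulr_suml w1 mul1r.
  rewrite ME; last exact: (dcont_bmeas H).
  rewrite -(pair_bigA _ (fun i k => wM (i, k) * phi (iter k f (xi i)))) /= mulr_sumr.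
  rewrite [X in _ + X](eq_bigr (fun i => w i * Phi (xi i) n)); first by rewrite subrK.
  move=> i _; rewrite /wM /= -mulr_sumr /birkhoff mulrA; congr (_ * _).
  by rewrite mulrCA mulfV ?gt_eqF// mulr1.
have := Hent_average n0 q0 mc' MA'; rewrite lnZ; lra.
Qed.

Context (U : set_system nat) {UU : UltraFilter U} (Uinf : forall N, U [set n | (N <= n)%N]).

Lemma ultra_cvg0 (a : nat -> R) (C : R) : (forall n, (0 < n)%N -> `|a n| <= C / n%:R) ->
  a n @[n --> U] --> 0.
Proof.
move=> h; apply/cvgrPdist_le => e e0.
have [N N0 hN] := @inv_nat_small R (e / (`|C| + 1)) ltac:(by rewrite divr_gt0// ltr_wpDl).
apply: (filterS _ (Uinf N)) => n /= Nn; have n0 : (0 < n)%N by exact: leq_trans Nn.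
rewrite sub0r normrN; apply: le_trans (h n n0) _.
have n0' : 0 < n%:R :> R by rewrite ltr0n.
rewrite ler_pdivrMr//.
have C1 : 0 < `|C| + 1 by rewrite ltr_wpDl.
have : 1 < N%:R * (e / (`|C| + 1)) by rewrite -ltr_pdivrMl ?ltr0n// mulr1.
rewrite mulrA ltr_pdivlMr// mul1r => h1.
have : N%:R * e <= n%:R * e by rewrite ler_wpM2r ?ler_nat// ltW.
by have := ler_norm C; lra.
Qed.

(** The classical construction for the variational principle, with an ultrafilter in place of a
    subsequence. The approximating measures are returned as well: their masses on open sets yield
    the Gibbs bound, and their membership in a closed convex set the large deviations. *)
Lemma misiurewicz (E : nat -> seq X) (delta l : R) : 0 < delta ->
  (forall n, E n != [::] /\ uniq (E n)) -> (forall n, sep d f n delta (E n)) ->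
  (ln (psum (E n) n) / n%:R) @[n --> U] --> l ->
  exists (mu : probability X R) (M : nat -> probability X R), [/\ finvariant f mu,
    (l%:E <= free_energy mu f phi)%E,
    forall n, (0 < n)%N -> gibbs_average (E n) n (M n),
    forall g, dcont_real d g -> Ex (M n) g @[n --> U] --> Ex mu g &
    forall O (a : R), dopen d O -> pr (M n) O @[n --> U] --> a -> pr mu O <= a].
Proof.
move=> d0 hE sE hl.
have exM n : exists M : probability X R, (0 < n)%N -> gibbs_average (E n) n M /\
  forall T (c : X -> T) q, (0 < q)%N -> mcod c ->
  (forall x y, c x = c y -> d x y <= delta) ->
  q%:R * ln (psum (E n) n) <= q%:R * ln #|{ffun 'I_q -> T}|%:R +
     n%:R * (Hent (pr M) (wd f c q) + q%:R * Ex M phi).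
  have [->|n0] := posnP n; first by exists (dirac point : probability X R).
  have [En uE] := hE n.
  by have [M hM] := gibbs_average_ex n0 En uE (@sE n); exists M.
have [M hM] := choice exM.
have [mu mu_open] := ulim_measure H M.
have muE g : dcont_real d g -> Ex (M n) g @[n --> U] --> Ex mu g.
  by move=> cg; exact: (ulim_Ex H mu_open).
have bphi := dcont_bmeas H cphi.
have imu : finvariant f mu.
  apply: (ulim_invariant H mu_open (cs_f S)) => g cg.
  have bg := dcont_bmeas H cg; have [C C0 gC] := dcont_bounded H cg.
  apply: (@ultra_cvg0 _ (2 * C)) => n n0.
  have bgf : bmeas (g \o f).
    by apply: (dcont_bmeas H); exact: dcont_real_comp cg (cs_f S).
  have [hg _] := hM n n0; rewrite !hg//.
  have Z0 := psum_gt0 n (proj1 (hE n)).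
  have n0' : 0 < n%:R :> R by rewrite ltr0n.
  have tele x : n%:R^-1 * \sum_(k < n) (g \o f) (iter k f x) =
      n%:R^-1 * \sum_(k < n) g (iter k f x) + n%:R^-1 * (g (iter n f x) - g x).
    rewrite -mulrDr; congr (_ * _); rewrite addrA.
    have := telescope_sumr (fun k => g (iter k f x)) (leq0n n).
    rewrite /= => e; rewrite -addrA -e big_mkord sumrB /= addrC subrK.
    by apply: eq_bigr.
  under eq_bigr do rewrite tele mulrDr.
  rewrite big_split /= mulrDr [X in `|X|]addrAC subrr add0r.
  rewrite normrM ger0_norm ?invr_ge0 ?(ltW Z0)// mulrC ler_pdivrMr//.
  apply: le_trans (ler_norm_sum _ _ _) _.
  rewrite /psum mulr_sumr; apply: ler_sum => x _.
  rewrite normrM ger0_norm ?expR_ge0// mulrC ler_wpM2r ?expR_ge0//.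
  rewrite normrM ger0_norm ?invr_ge0// mulrC ler_wpM2r ?invr_ge0//.
  apply: le_trans (ler_normB _ _) _; have := gC x; have := gC (iter n f x); lra.
exists mu, M; split => //; last by move=> n n0; case: (hM n n0).
(* The coding is chosen after mu, because its atoms need mu-null boundaries for their masses to
   converge. *)
have [T [c [mc nc hc]]] := nullbd_cod H mu d0.
apply: le_trans (free_ge S imu mc cphi); rewrite lee_fin /FE -lerBlDr.
apply: hr_ge => q q0; have q0' : 0 < q%:R :> R by rewrite ltr0n.
have mq := mcod_wd S mc (n := q).
pose a n := q%:R * (ln (psum (E n) n) / n%:R) - (q%:R * ln #|{ffun 'I_q -> T}|%:R) / n%:R - q%:R * Ex (M n) phi.
apply: (Hent_usc (UU := UU) (M := M) (a := a)) => //.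
- by move=> t; apply: (nullbd_cvg H) => //; apply: (nullbd_wd H) => //; exact: (cs_f S).
- apply: (filterS _ (Uinf 1)) => n /= n0; have [_ h] := hM n n0.
  have n0' : 0 < n%:R :> R by rewrite ltr0n.
  have := h T c q q0 mc hc; rewrite -(ler_pM2r (_ : 0 < n%:R^-1)) ?invr_gt0//.
  rewrite mulrDl -!mulrA mulrCA [n%:R * _]mulrC -mulrA mulVf ?gt_eqF// mulr1 /a -mulrA.
  lra.
- rewrite mulrBr; apply: cvgB; last by apply: cvgMl_tmp; exact: muE.
  rewrite -[X in _ --> X]subr0; apply: cvgB; first exact: cvgMl_tmp.
  apply: (@ultra_cvg0 _ `|q%:R * ln #|{ffun 'I_q -> T}|%:R|) => n n0.
  by rewrite normrM [`|n%:R^-1|]ger0_norm ?invr_ge0.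
Qed.

End Misiurewicz.

(** * Reduction to ergodic measures *)

Section MeanErgodic.
Context {R : realType} {dsp : measure_display} {X : measurableType dsp}.
Context (d : X -> X -> R) (f finv : X -> X) (S : csys d f finv).
Implicit Types (mu nu : probability X R) (g u : X -> R).

Let H := cs_space S.
Let mf : measurable_fun setT f := dcont_measurable H (cs_f S).

Definition avg n g (x : X) : R := n%:R^-1 * \sum_(k < n) g (iter k f x).

Lemma bmeas_iter g k : bmeas g -> bmeas (g \o iter k f).
Proof.
by move=> bg; apply: bmeas_comp => //; exact: (dcont_measurable H (dcont_fun_iter k (cs_f S))).
Qed.

Lemma avg_bmeas n g : bmeas g -> bmeas (avg n g).
Proof.
move=> bg; apply: bmeasZ; apply: (@bmeas_sum _ _ _ _ _ (fun (k : 'I_n) => g \o iter k f)) => k.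
exact: bmeas_iter.
Qed.

Lemma avg_dcont n g : dcont_real d g -> dcont_real d (avg n g).
Proof.
move=> cg; apply: dcont_realZ; apply: (@dcont_real_sum _ _ _ _ _ _ (fun (k : 'I_n) => g \o iter k f)) => k.
exact: (dcont_real_comp cg (dcont_fun_iter k (cs_f S))).
Qed.

Lemma Ex_iter mu g k : finvariant f mu -> bmeas g -> Ex mu (g \o iter k f) = Ex mu g.
Proof.
move=> imu bg; elim: k => //= k IH; rewrite -[RHS]IH.
rewrite -(Ex_invariant mf imu (bmeas_iter k bg)).
by congr (Ex mu _); apply/funext => x /=; rewrite -iterSr.
Qed.

Lemma Ex_avg mu g n : (0 < n)%N -> finvariant f mu -> bmeas g -> Ex mu (avg n g) = Ex mu g.
Proof.
move=> n0 imu bg; rewrite ExZ; last first.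
  by apply: (@bmeas_sum _ _ _ _ _ (fun (k : 'I_n) => g \o iter k f)) => k; exact: bmeas_iter.
rewrite (@Ex_sum _ _ _ _ _ _ (fun (k : 'I_n) => g \o iter k f)); last by move=> k; exact: bmeas_iter.
under eq_bigr do rewrite Ex_iter//.
by rewrite sumr_const card_ord -[X in _ * X]mulr_natl mulKf// gt_eqF// ltr0n.
Qed.

Lemma avg01 n g x : (forall x, 0 <= g x <= 1) -> 0 <= avg n g x <= 1.
Proof.
move=> g01; case: n => [|n]; first by rewrite /avg big_ord0 mulr0 lexx ler01.
apply/andP; split.
  by rewrite mulr_ge0 ?invr_ge0//; apply: sumr_ge0 => k _; case/andP: (g01 (iter k f x)).
rewrite ler_pdivrMl ?ltr0n// mulr1.
apply: (@le_trans _ _ (\sum_(k < n.+1) 1)); last by rewrite sumr_const card_ord.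
by apply: ler_sum => k _; case/andP: (g01 (iter k f x)).
Qed.

Lemma avg_shift1 n g x : (0 < n)%N -> (forall x, 0 <= g x <= 1) ->
  `|avg n g (f x) - avg n g x| <= n%:R^-1.
Proof.
move=> n0 g01; have n0' : 0 < n%:R :> R by rewrite ltr0n.
rewrite /avg -mulrBr normrM gtr0_norm ?invr_gt0// -[leRHS]mulr1 ler_wpM2l ?invr_ge0//.
rewrite -sumrB.
have := telescope_sumr (fun k => g (iter k f x)) (leq0n n).
rewrite big_mkord => e.
rewrite (eq_bigr (fun k : 'I_n => g (iter k.+1 f x) - g (iter k f x))); last first.
  by move=> k _; rewrite iterSr.
rewrite e /= ler_norml; have := g01 x; have := g01 (iter n f x); lra.
Qed.

Lemma avg_shift n g j x : (0 < n)%N -> (forall x, 0 <= g x <= 1) ->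
  `|avg n g (iter j f x) - avg n g x| <= j%:R / n%:R.
Proof.
move=> n0 g01; elim: j => [|j IH]; first by rewrite /= subrr normr0 mul0r.
rewrite iterS -addn1 natrD mulrDl mul1r [X in _ <= X]addrC.
rewrite (_ : _ - _ = (avg n g (f (iter j f x)) - avg n g (iter j f x)) + (avg n g (iter j f x) - avg n g x)); last by ring.
apply: le_trans (ler_normD _ _) (lerD _ IH); exact: avg_shift1.
Qed.

Lemma avg_avg_near k Q g x : (0 < k)%N -> (0 < Q)%N -> (forall x, 0 <= g x <= 1) ->
  `|avg Q (avg k g) x - avg Q g x| <= k%:R / Q%:R.
Proof.
move=> k0 Q0 g01; have k0' : 0 < k%:R :> R by rewrite ltr0n.
have -> : avg Q (avg k g) x - avg Q g x = k%:R^-1 * \sum_(j < k) (avg Q g (iter j f x) - avg Q g x).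
  have -> : \sum_(j < k) (avg Q g (iter j f x) - avg Q g x) = \sum_(j < k) avg Q g (iter j f x) - k%:R * avg Q g x.
    by rewrite sumrB sumr_const card_ord mulr_natl.
  rewrite mulrBr mulKf ?gt_eqF//; congr (_ - _).
  rewrite /avg -!mulr_sumr !mulrA [Q%:R^-1 * _]mulrC; congr (_ * _).
  by rewrite exchange_big /=; apply: eq_bigr => j _; apply: eq_bigr => i _; rewrite -!iterD addnC.
rewrite normrM gtr0_norm ?invr_gt0// ler_pdivrMl//.
apply: le_trans (ler_norm_sum _ _ _) _.
apply: (@le_trans _ _ (\sum_(j < k) k%:R / Q%:R)); last first.
  by rewrite sumr_const card_ord -[X in X <= _]mulr_natl.
apply: ler_sum => j _; apply: le_trans (avg_shift _ _ Q0 g01) _.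
by rewrite ler_wpM2r ?invr_ge0// ler_nat ltnW.
Qed.

Lemma sqr_avg_le n u x : (0 < n)%N -> avg n u x ^+ 2 <= avg n (fun y => u y ^+ 2) x.
Proof.
move=> n0; have n0' : 0 < n%:R :> R by rewrite ltr0n.
set a := avg n u x.
have : 0 <= avg n (fun y => (u y - a) ^+ 2) x.
  by rewrite mulr_ge0 ?invr_ge0//; apply: sumr_ge0 => k _; exact: sqr_ge0.
have -> : avg n (fun y => (u y - a) ^+ 2) x = avg n (fun y => u y ^+ 2) x - a ^+ 2.
  have -> : avg n (fun y => (u y - a) ^+ 2) x =
     avg n (fun y => u y ^+ 2) x - 2 * a * avg n u x + a ^+ 2.
    rewrite /avg (eq_bigr (fun k : 'I_n => u (iter k f x) ^+ 2 - 2 * a * u (iter k f x) + a ^+ 2)).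
      rewrite big_split /= sumrB -mulr_sumr sumr_const card_ord -[a ^+ 2 *+ n]mulr_natl.
      by rewrite mulrDr mulKf ?gt_eqF//; congr (_ + _); rewrite mulrBr mulrCA.
    by move=> k _; ring.
  by rewrite -/a; ring.
lra.
Qed.

Lemma bmeas_sqr u : bmeas u -> bmeas (fun x => u x ^+ 2).
Proof. by move=> bu; exact: bmeasM. Qed.

(** Averaging over Q times does not increase the energy of u, by convexity of the square and
    invariance; replacing u by g inside the average changes the square by at most twice the uniform
    distance. *)
Lemma energy_le nu g u (C : R) Q : finvariant f nu -> bmeas g -> bmeas u ->
  (forall x, 0 <= g x <= 1) -> (forall x, 0 <= u x <= 1) -> (0 < Q)%N ->
  (forall x, `|avg Q u x - avg Q g x| <= C / Q%:R) ->
  Ex nu (fun x => avg Q g x ^+ 2) <= Ex nu (fun x => u x ^+ 2) + 2 * (C / Q%:R).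
Proof.
move=> inu bg bu g01 u01 Q0 hC.
have b1 : bmeas (fun x => avg Q g x ^+ 2) by apply: bmeas_sqr; exact: avg_bmeas.
have b2 : bmeas (fun x => u x ^+ 2) by exact: bmeas_sqr.
rewrite -(Ex_avg Q0 inu b2) -[X in _ + X](Ex_cst nu) -ExD; last exact: bmeas_cst.
  apply: Ex_le => //; first by apply: bmeasD; [exact: avg_bmeas|exact: bmeas_cst].
  move=> x; have := sqr_avg_le u x Q0; have := hC x; rewrite ler_norml.
  by have := avg01 Q x g01; have := avg01 Q x u01; nra.
exact: avg_bmeas.
Qed.

Lemma midpoint_near (p q r a b : R) : `|a - r| <= p -> `|b - r| <= q ->
  `|2^-1 * (a + b) - r| <= p + q.
Proof.
move=> ap bq; have p0 := le_trans (normr_ge0 _) ap; have q0 := le_trans (normr_ge0 _) bq.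
by move: ap bq; rewrite !ler_norml; lra.
Qed.

(** Von Neumann's convexity argument. The energies of the averages approach their infimum m, and the
    midpoint of two averages has energy at least m as well, since its own long averages approach
    those of g. The parallelogram identity then makes the two averages close in L2. *)
Lemma avg_cauchy nu g (e : R) : finvariant f nu -> bmeas g -> (forall x, 0 <= g x <= 1) -> 0 < e ->
  exists N, forall n n', (N <= n)%N -> (N <= n')%N ->
    Ex nu (fun x => `|avg n.+1 g x - avg n'.+1 g x|) <= e.
Proof.
move=> inu bg g01 e0.
pose a n := Ex nu (fun x => avg n.+1 g x ^+ 2).
have ba n : bmeas (avg n g) by exact: avg_bmeas.
have ba2 n : bmeas (fun x => avg n g x ^+ 2) by exact: bmeas_sqr.
have a0 n : 0 <= a n by apply: Ex_ge0 => x; exact: sqr_ge0.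
pose th := e ^+ 2 / 8; have th0 : 0 < th by rewrite divr_gt0// exprn_gt0.
have hinf : has_inf (range a) by split; [exists (a 0%N), 0%N|exists 0 => _ [n _ <-]].
set m := inf (range a).
have ma n : m <= a n by apply: inf_lbound; [case: hinf|exists n].
have [_ [k _ <-] ak] : exists2 b, range a b & b < m + th / 4.
  by apply: inf_adherent hinf; rewrite divr_gt0.
have th4 : 0 < th / 4 by rewrite divr_gt0.
have near (C : R) : exists N : nat, forall n, (N <= n)%N -> 2 * (C / n.+1%:R) <= th / 4.
  exists (Num.truncn (2 * C / (th / 4))).+1 => n Nn.
  rewrite mulrA ler_pdivrMr ?ltr0n// -ler_pdivrMl// mulrC ltW//.
  by apply: lt_le_trans (truncnS_gt _) _; rewrite ler_nat; apply: leq_trans Nn (leqnSn n).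
have [N hN] := near k.+1%:R.
have up n : (N <= n)%N -> a n <= m + th / 2.
  move=> Nn; have := @energy_le nu g (avg k.+1 g) k.+1%:R n.+1 inu bg (ba _) g01
    (fun x => avg01 _ x g01) (ltn0Sn n) (fun x => avg_avg_near x (ltn0Sn k) (ltn0Sn n) g01).
  have key (A B w t : R) : A <= B + w -> B < m + t / 4 -> w <= t / 4 -> A <= m + t / 2.
    by move=> *; lra.
  by move/key; apply; [exact: ak|exact: hN].
exists N => n n' Nn Nn'.
pose u x := 2^-1 * (avg n.+1 g x + avg n'.+1 g x).
have bu : bmeas u by apply: bmeasZ; exact: bmeasD.
have u01 x : 0 <= u x <= 1.
  by rewrite /u; have := avg01 n.+1 x g01; have := avg01 n'.+1 x g01; lra.
have low : m <= Ex nu (fun x => u x ^+ 2).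
  apply/ler_addgt0Pr => e' e'0.
  have C0 : 0 < (n.+1 + n'.+1)%:R :> R by rewrite ltr0n.
  pose Q := (Num.truncn (2 * (n.+1 + n'.+1)%:R / e')).+1.
  have Qe : 2 * ((n.+1 + n'.+1)%:R / Q.+1%:R) <= e'.
    rewrite mulrA ler_pdivrMr ?ltr0n// -ler_pdivrMl// mulrC ltW//.
    by apply: lt_le_trans (truncnS_gt _) _; rewrite ler_nat.
  have := @energy_le nu g u (n.+1 + n'.+1)%:R Q.+1 inu bg bu g01 u01 (ltn0Sn Q).
  rewrite -/(a Q) => h; have := ma Q; suff : forall x, `|avg Q.+1 u x - avg Q.+1 g x| <= (n.+1 + n'.+1)%:R / Q.+1%:R.
    by move/h => h1 h2; apply: le_trans h2 (le_trans h1 _); rewrite lerD2l.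
  move=> x.
  have -> : avg Q.+1 u x = 2^-1 * (avg Q.+1 (avg n.+1 g) x + avg Q.+1 (avg n'.+1 g) x).
    by rewrite /avg /u -mulrDr -big_split /= mulrCA -mulr_sumr.
  have h1 := avg_avg_near x (ltn0Sn n) (ltn0Sn Q) g01.
  have h2 := avg_avg_near x (ltn0Sn n') (ltn0Sn Q) g01.
  by rewrite natrD mulrDl; apply: midpoint_near.
have sq : Ex nu (fun x => (avg n.+1 g x - avg n'.+1 g x) ^+ 2) = 2 * a n + 2 * a n' - 4 * Ex nu (fun x => u x ^+ 2).
  transitivity (Ex nu (fun x => (2 * avg n.+1 g x ^+ 2 + 2 * avg n'.+1 g x ^+ 2) - 4 * u x ^+ 2)).
    by congr (Ex nu _); apply/funext => x; rewrite /u; field.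
  have bu2 := bmeas_sqr bu.
  by rewrite ExB ?ExD ?ExZ//; do ?[apply: bmeasD|apply: bmeasZ].
have sqle : Ex nu (fun x => (avg n.+1 g x - avg n'.+1 g x) ^+ 2) <= e ^+ 2 / 4.
  by rewrite sq; have := up n Nn; have := up n' Nn'; rewrite /th; lra.
have bdiff : bmeas (fun x => avg n.+1 g x - avg n'.+1 g x) by exact: bmeasB.
(* From L2 to L1 by |b| <= e / 2 + b^2 / (2 e). *)
apply: (@le_trans _ _ (Ex nu (fun x => e / 2 + (2 * e)^-1 * (avg n.+1 g x - avg n'.+1 g x) ^+ 2))).
  apply: Ex_le; first exact: bmeas_norm.
    by apply: bmeasD; [exact: bmeas_cst|apply: bmeasZ; exact: bmeas_sqr].
  move=> x; set b := _ - _.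
  have -> : (2 * e)^-1 * b ^+ 2 = `|b| ^+ 2 / (2 * e) by rewrite real_normK ?num_real// mulrC.
  have e2 : 0 < 2 * e by lra.
  have : 0 <= (`|b| - e) ^+ 2 / (2 * e) by rewrite divr_ge0 ?sqr_ge0// ltW.
  have -> : (`|b| - e) ^+ 2 / (2 * e) = `|b| ^+ 2 / (2 * e) - `|b| + e / 2 by field; rewrite gt_eqF.
  lra.
rewrite ExD; [|exact: bmeas_cst|by apply: bmeasZ; exact: bmeas_sqr].
rewrite Ex_cst ExZ; last exact: bmeas_sqr.
have : (2 * e)^-1 * Ex nu (fun x => (avg n.+1 g x - avg n'.+1 g x) ^+ 2) <= (2 * e)^-1 * (e ^+ 2 / 4).
  by rewrite ler_wpM2l// invr_ge0; lra.
have -> : (2 * e)^-1 * (e ^+ 2 / 4) = e / 8 by field; rewrite gt_eqF.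
lra.
Qed.

(* A subsequence with summable L1 increments converges almost everywhere, so its upper
   limit, which is exactly invariant, is also its limit in L1. *)
Lemma mean_ergodic nu g : finvariant f nu -> bmeas g -> (forall x, 0 <= g x <= 1) ->
  exists gs : X -> R, [/\ bmeas gs, forall x, 0 <= gs x <= 1, forall x, gs (f x) = gs x &
    forall e : R, 0 < e -> exists r, Ex nu (fun x => `|avg r.+1 g x - gs x|) <= e].
Proof.
move=> inu bg g01.
have ba n : bmeas (avg n g) by exact: avg_bmeas.
have p4 k : 0 < (4 ^+ k)^-1 :> R by rewrite invr_gt0 exprn_gt0.
have [N hN] := choice (fun k => avg_cauchy inu bg g01 (p4 k)).
(* The indices dominate the Cauchy moduli for the errors 4^-k and also k itself; the latter sends
   the shift error of [G k] to 0 and makes the upper limit invariant. *)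
pose nk := fix nk k := if k is k'.+1 then maxn (N k'.+1) (maxn k'.+1 (nk k')) else N 0%N.
have nkN k : (N k <= nk k)%N by case: k => //= k; exact: leq_maxl.
have nkk k : (k <= nk k)%N by case: k => //= k; rewrite leq_max leq_max leqnn orbT.
have nkS k : (nk k <= nk k.+1)%N by rewrite /= !leq_max leqnn !orbT.
pose G k := avg (nk k).+1 g.
have bG k : bmeas (G k) by exact: ba.
have G01 k x : 0 <= G k x <= 1 by exact: avg01.
have inc k : Ex nu (fun x => `|G k.+1 x - G k x|) <= (4 ^+ k)^-1.
  by apply: hN => //; exact: leq_trans (nkN k) (nkS k).
pose L x := limn_esup (fun k => (G k x)%:E).
have L01 x : (0%:E <= L x <= 1%:E)%E.
  apply/andP; split.
    by apply: limn_esup_ge => n0; exists n0 => //; rewrite lee_fin; case/andP: (G01 n0 x).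
  by apply: limn_esup_le; exists 0%N => n _; rewrite lee_fin; case/andP: (G01 n x).
have Lfin x : L x \is a fin_num.
  rewrite fin_numE; have := L01 x; case: (L x) => //=; rewrite ?leNye ?leey//.
have LE x : L x = (fine (L x))%:E by rewrite fineK.
have mL : measurable_fun setT L.
  apply: measurable_fun_limn_esup => k; apply/measurable_EFinP; exact: (bG k).1.
pose gs x := fine (L x).
have gs01 x : 0 <= gs x <= 1 by have := L01 x; rewrite LE !lee_fin.
have bgs : bmeas gs.
  split; last by exists 1 => x; have := gs01 x; rewrite ler_norml; lra.
  by apply: measurableT_comp mL; exact: fine_measurable.
exists gs; split => //.
- suff le x y : (forall e : R, 0 < e -> exists k0, forall k, (k0 <= k)%N -> G k x <= G k y + e) -> gs x <= gs y.
    move=> x.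
    have shift e : 0 < e -> exists k0, forall k, (k0 <= k)%N -> `|G k (f x) - G k x| <= e.
      move=> e0; have [n0 n00 hn0] := inv_nat_small e0; exists n0 => k n0k.
      apply: le_trans (avg_shift1 _ (ltn0Sn _) g01) _; apply: le_trans (ltW hn0).
      rewrite lef_pV2 ?posrE ?ltr0n// ler_nat; apply: leq_trans n0k _.
      exact: leq_trans (nkk k) (leqnSn _).
    apply/le_anti/andP; split; apply: le => e e0; have [k0 hk0] := shift e e0;
      by exists k0 => k /hk0; rewrite ler_norml; lra.
  move=> h; rewrite -lee_fin -!LE; apply/lee_addgt0Pr => e e0.
  have e20 : 0 < e / 2 by lra.
  have [k0 hk0] := h _ e20.
  have [|k1 hk1] := @limn_esup_lt _ (fun k => (G k y)%:E) (L y + (e / 2)%:E)%E.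
    by rewrite -/(L y) LE -EFinD lte_fin; lra.
  apply: limn_esup_le; exists (maxn k0 k1) => k; rewrite geq_max => /andP[/hk0 h0 /hk1].
  by rewrite LE -!EFinD lte_fin lee_fin; lra.
move=> e e0.
(* By Markov's inequality an increment of mean at most 4^-k exceeds 2^-k on mass at most 2^-k. *)
pose D k := [set x | (2 ^+ k)^-1 < `|G k.+1 x - G k x|].
have bdiff k : bmeas (fun x => `|G k.+1 x - G k x|) by apply: bmeas_norm; exact: bmeasB.
have mD k : measurable (D k) by exact: bmeas_level.
have p2 k : 0 < (2 ^+ k)^-1 :> R by rewrite invr_gt0 exprn_gt0.
have prD k : pr nu (D k) <= (2 ^+ k)^-1.
  apply: le_trans (Ex_markov nu (bdiff k) (fun x => normr_ge0 _) (p2 k)) _.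
  rewrite ler_pdivrMr//; apply: le_trans (inc k) _.
  by rewrite -invfM -exprMn (_ : 2 * 2 = 4)//; ring.
(* One half of 4 * 2^-k bounds the mass of the exceptional set W, the other half the deviation from
   the limit outside W. *)
have [k hk] : exists k, 4 * (2 ^+ k)^-1 <= e :> R.
  have [n n0 hn] := @inv_nat_small R (e / 4) ltac:(lra).
  exists n; have : (2 ^+ n)^-1 <= n%:R^-1 :> R.
    rewrite lef_pV2 ?posrE ?ltr0n ?exprn_gt0// -natrX ler_nat ltnW//.
    exact: ltn_expl.
  lra.
exists (nk k); rewrite -/(G k).
pose W := \bigcup_l D (k + l)%N.
have mW : measurable W by apply: bigcup_measurable.
have geo n : \sum_(l < n) (2 ^+ (k + l))^-1 = 2 * (2 ^+ k)^-1 - 2 * (2 ^+ (k + n))^-1 :> R.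
  elim: n => [|n IH]; first by rewrite big_ord0 addn0 subrr.
  rewrite big_ord_recr /= IH addnS exprS invfM; field.
  by rewrite !expf_neq0.
have prW : pr nu W <= 2 * (2 ^+ k)^-1.
  apply/ler_addgt0Pr => e' e'0.
  have [||n hn] := @pr_incr _ _ _ nu (fun n => \big[setU/set0]_(l < n) D (k + l)%N) _ _ e' e'0.
  - by move=> n; exact: bigsetU_measurable.
  - by move=> n; rewrite big_ord_recr; exact: subsetUl.
  have := hn n (leqnn n).
  have -> : \bigcup_k0 \big[setU/set0]_(l < k0) D (k + l)%N = W.
    apply/seteqP; split => x.
      by move=> [j _]; rewrite -(bigcup_mkord j (fun l => D (k + l)%N)) => -[l _ Dl]; exists l.
    by move=> [l _ Dl]; exists l.+1 => //; rewrite -(bigcup_mkord l.+1 (fun l => D (k + l)%N)); exists l => /=.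
  move/le_trans; apply; rewrite lerD2r.
  apply: le_trans (fap_bigU_le nu n (fun l => mD (k + l)%N)) _.
  apply: (@le_trans _ _ (\sum_(l < n) (2 ^+ (k + l))^-1)); first by apply: ler_sum => l _.
  by rewrite geo; have := p2 (k + n)%N; lra.
have off x : ~ W x -> `|G k x - gs x| <= 2 * (2 ^+ k)^-1.
  move=> Wx.
  have step l : `|G (k + l)%N x - G k x| <= 2 * (2 ^+ k)^-1 - 2 * (2 ^+ (k + l))^-1.
    elim: l => [|l IH]; first by rewrite addn0 !subrr normr0.
    have Dl : `|G (k + l).+1 x - G (k + l)%N x| <= (2 ^+ (k + l))^-1.
      by rewrite leNgt; apply/negP => h; apply: Wx; exists l.
    rewrite addnS (_ : _ - _ = (G (k + l).+1 x - G (k + l)%N x) + (G (k + l)%N x - G k x)); last by ring.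
    apply: le_trans (ler_normD _ _) _.
    have -> : (2 ^+ (k + l).+1)^-1 = (2 ^+ (k + l))^-1 / 2 :> R by rewrite exprS invfM mulrC.
    lra.
  have near l : `|G (k + l)%N x - G k x| <= 2 * (2 ^+ k)^-1.
    by have := step l; have := p2 (k + l)%N; lra.
  have up : (L x <= (G k x + 2 * (2 ^+ k)^-1)%:E)%E.
    apply: limn_esup_le; exists k => n kn; rewrite lee_fin.
    by have := near (n - k)%N; rewrite subnKC// ler_norml; lra.
  have low : ((G k x - 2 * (2 ^+ k)^-1)%:E <= L x)%E.
    apply: limn_esup_ge => n0; exists (maxn n0 k); first exact: leq_maxl.
    by rewrite lee_fin; have := near (maxn n0 k - k)%N; rewrite subnKC ?leq_maxr// ler_norml; lra.
  by move: up low; rewrite LE !lee_fin -/(gs x) ler_norml; lra.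
have bW : bmeas (\1_W : X -> R) by exact: bmeas_indic.
apply: (@le_trans _ _ (Ex nu (fun x => 2 * (2 ^+ k)^-1 + \1_W x))).
  apply: Ex_le.
  - by apply: bmeas_norm; exact: bmeasB.
  - by apply: bmeasD => //; exact: bmeas_cst.
  move=> x; rewrite indicE; case: (boolP (x \in W)) => [_|].
    by have := G01 k x; have := gs01 x; have := p2 k; rewrite ler_norml /=; lra.
  by rewrite notin_setE addr0 => /off.
rewrite ExD//; last exact: bmeas_cst.
by rewrite Ex_cst Ex_indic//; lra.
Qed.

End MeanErgodic.

Section Selection.
Context {R : realType} {dsp : measure_display} {X : measurableType dsp}.
Context (d : X -> X -> R) (f finv : X -> X) (S : csys d f finv) (phi : X -> R).
Context (cphi : dcont_real d phi).
Implicit Types (mu nu : probability X R) (T : finType).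

Let H := cs_space S.
Let bphi : bmeas phi := dcont_bmeas H cphi.

Definition invset := {B : set X | measurable B /\ f @^-1` B = B}.

Lemma Ex_mix2 mu mu1 mu2 (t : R) g : 0 <= t <= 1 ->
  (forall A, measurable A -> pr mu A = t * pr mu1 A + (1 - t) * pr mu2 A) ->
  bmeas g -> Ex mu g = t * Ex mu1 g + (1 - t) * Ex mu2 g.
Proof.
move=> /andP[t0 t1] h bg.
have h' A : measurable A ->
    pr mu A = \sum_(b : bool) (if b then t else 1 - t) * pr (if b then mu1 else mu2) A.
  by move=> mA; rewrite big_bool /= h.
rewrite (Ex_lin h') ?big_bool//.
by case; rewrite ?subr_ge0.
Qed.

(** The sets are treated one at a time: if B has intermediate mass, condition on B or on its
    complement, whichever has the larger penalised free energy; by [FE_mix] one of them is no worse.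
    Sets of mass 0 or 1 keep their mass under both conditional measures. *)
Lemma select01 nu T (c : X -> T) (pen : X -> R) (s : seq invset) : finvariant f nu -> mcod c ->
  bmeas pen -> exists M, [/\ finvariant f M,
    forall B, List.In B s -> pr M (sval B) = 0 \/ pr M (sval B) = 1 &
    FE f nu phi c - Ex nu pen <= FE f M phi c - Ex M pen].
Proof.
move=> inu mc bp; elim: s => [|B s [M [iM M01 MJ]]]; first by exists nu; split.
have [mB iB] := svalP B.
have M1 := fap_le1 (pr_fap M) mB.
have [B0|B0] := eqVneq (pr M (sval B)) 0.
  by exists M; split => // B' [<-|]; [left|exact: M01].
have [B1|B1] := eqVneq (pr M (sval B)) 1.
  by exists M; split => // B' [<-|]; [right|exact: M01].
have t01 : 0 < pr M (sval B) < 1.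
  by rewrite lt_neqAle eq_sym B0 pr_ge0 lt_neqAle B1 M1.
have [mu1 [mu2 [i1 i2 p1 p2 pM]]] := cond_split S iM mB iB t01.
have k1 : forall B', List.In B' s -> (pr mu1 (sval B') = 0 \/ pr mu1 (sval B') = 1) /\
    (pr mu2 (sval B') = 0 \/ pr mu2 (sval B') = 1).
  move=> B' sB'; have [mB' _] := svalP B'.
  have := pM _ mB'; move: t01 (pr_ge0 mu1 (sval B')) (pr_ge0 mu2 (sval B'))
    (fap_le1 (pr_fap mu1) mB') (fap_le1 (pr_fap mu2) mB').
  set t := pr M (sval B); set a := pr mu1 _; set b := pr mu2 _ => /andP[t0 t1] a0 b0 a1 b1.
  case: (M01 B' sB') => -> e.
    by split; left; apply: le0E => //; nra.
  by split; right; apply/le_anti/andP; split => //; nra.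
have hF := FE_mix S iM i1 i2 mc bphi t01 pM.
have t01' : 0 <= pr M (sval B) <= 1 by rewrite pr_ge0.
have hE := Ex_mix2 t01' pM bp.
have [J1|J2] := leP (FE f M phi c - Ex M pen) (FE f mu1 phi c - Ex mu1 pen).
  exists mu1; split => //; last exact: le_trans J1.
  by move=> B' [<-|/k1[]//]; right.
exists mu2; split => //; first by move=> B' [<-|/k1[]//]; left.
apply: le_trans MJ _; move: hF J2; rewrite hE; case/andP: t01.
set t := pr M (sval B); set a := FE _ _ _ _; set b := FE _ mu1 _ _; set b' := FE _ mu2 _ _.
set u := Ex mu1 _; set v := Ex mu2 _ => t0 t1; nra.
Qed.

(** The slack of the free energy of nu over a pays for the penalty, whose total mean under nu is at
    most this slack, so the selected measures keep free energy at least a. Free energies of one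
    coding are bounded, hence so is the penalty of the selected measures; the factor k + 1 on the
    term of index (l, k) then makes [e l r] small uniformly over long families. *)
Lemma penalized nu T (c : X -> T) (a : R) (e : nat -> nat -> X -> R) : finvariant f nu ->
  mcod c -> a < FE f nu phi c -> (forall l r, bmeas (e l r)) ->
  (forall l r x, 0 <= e l r x) ->
  (forall l (th : R), 0 < th -> exists r, Ex nu (e l r) <= th) ->
  exists M : seq invset -> probability X R,
   [/\ forall s, finvariant f (M s),
       forall s B, List.In B s -> pr (M s) (sval B) = 0 \/ pr (M s) (sval B) = 1,
       forall s, a <= FE f (M s) phi c &
       forall l (th : R), 0 < th -> exists r N, forall s, (N <= size s)%N ->
         Ex (M s) (e l r) <= th].
Proof.
move=> inu mc aF be e0 esmall.
pose w j : R := (2 ^+ j.+1)^-1.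
have w0 j : 0 < w j by rewrite invr_gt0 exprn_gt0.
have /choice[r hr_] : forall lk : nat * nat, exists r, Ex nu (e lk.1 r) <= w (pickle lk) / lk.2.+1%:R.
  by move=> lk; apply: esmall; rewrite divr_gt0.
(* The pairs (l, k) are enumerated by [pickle]; integers that code no pair contribute nothing. *)
pose b j x := if @pickle_inv (nat * nat)%type j is Some lk then lk.2.+1%:R * e lk.1 (r lk) x else 0.
have bb j : bmeas (b j).
  rewrite /b; case: (pickle_inv j) => [lk|]; last exact: bmeas_cst.
  exact: bmeasZ.
have b0 j x : 0 <= b j x.
  by rewrite /b; case: (pickle_inv j) => [lk|//]; rewrite mulr_ge0.
have bw j : Ex nu (b j) <= w j.
  have := @pickle_invK (nat * nat)%type j.
  rewrite /b; case: (pickle_inv j) => [lk|] /=; last by rewrite Ex_cst ltW.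
  by move=> <-; rewrite ExZ//; have := hr_ lk; rewrite ler_pdivlMr ?ltr0n// mulrC.
have w1 N : \sum_(j < N) w j <= 1.
  suff -> : \sum_(j < N) w j = 1 - (2 ^+ N)^-1 by rewrite gerBl invr_ge0 exprn_ge0.
  elim: N => [|N IH]; first by rewrite big_ord0 expr0 invr1 subrr.
  rewrite big_ord_recr /= IH /w exprS invfM; field.
  by rewrite expf_neq0.
pose eta' := FE f nu phi c - a; have eta0 : 0 < eta' by rewrite subr_gt0.
pose pen N x := \sum_(j < N) eta' * b j x.
have bpen N : bmeas (pen N).
  by apply: (@bmeas_sum _ _ _ _ _ (fun (j : 'I_N) => (fun x => eta' * b j x))) => j; exact: bmeasZ.
have Epen mu N : Ex mu (pen N) = eta' * \sum_(j < N) Ex mu (b j).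
  rewrite (@Ex_sum _ _ _ _ _ _ (fun (j : 'I_N) => (fun x => eta' * b j x))); last by move=> j; exact: bmeasZ.
  by rewrite mulr_sumr; apply: eq_bigr => j _; rewrite ExZ.
have /choice[M hM] := fun s : seq invset => select01 s inu mc (bpen (size s)).
have MJ s : a + eta' * \sum_(j < size s) Ex (M s) (b j) <= FE f (M s) phi c.
  have [_ _] := hM s; rewrite !Epen.
  have : eta' * \sum_(j < size s) Ex nu (b j) <= eta' * 1.
    by rewrite ler_wpM2l ?(ltW eta0)//; apply: le_trans (w1 (size s)); apply: ler_sum => j _.
  by rewrite /eta'; lra.
have [C C0 hC] := bmeas_pos bphi.
have MC s : FE f (M s) phi c <= ln #|T|%:R + C.
  apply: lerD; first exact: (hr_le_card S (pr_fap (M s)) mc).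
  by have := Ex_bound (M s) bphi hC; rewrite ler_norml => /andP[].
exists M; split.
- by move=> s; case: (hM s).
- by move=> s; case: (hM s).
- move=> s; apply: le_trans (MJ s); rewrite lerDl mulr_ge0 ?(ltW eta0)//.
  by apply: sumr_ge0 => j _; exact: Ex_ge0.
move=> l th th0.
pose K := (ln #|T|%:R + C - a) / eta'.
pose k := Num.truncn (K / th).
exists (r (l, k)), (pickle (l, k)).+1 => s Ns.
have kK : K <= k.+1%:R * th by rewrite -ler_pdivrMr// ltW// truncnS_gt.
have bE : Ex (M s) (b (pickle (l, k))) = k.+1%:R * Ex (M s) (e l (r (l, k))).
  by rewrite /b pickleK_inv /= ExZ.
have : Ex (M s) (b (pickle (l, k))) <= K.
  rewrite ler_pdivlMr// mulrC.
  have : eta' * Ex (M s) (b (pickle (l, k))) <= eta' * \sum_(j < size s) Ex (M s) (b j).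
    rewrite ler_wpM2l ?(ltW eta0)// (bigD1 (Ordinal Ns)) //= lerDl.
    by apply: sumr_ge0 => j _; exact: Ex_ge0.
  by have := MJ s; have := MC s; lra.
by rewrite bE => h; rewrite -(ler_pM2l (ltr0Sn R k)); apply: le_trans kK.
Qed.

(** Eventually every given invariant set belongs to the family. The length is recorded separately
    because it truncates the penalty in [penalized]. *)
Definition invset_filter : set_system (seq invset) :=
  [set P | exists s0 : seq invset, forall s, (forall B, List.In B s0 -> List.In B s) ->
     (size s0 <= size s)%N -> P s].

Lemma invset_filter_proper : ProperFilter invset_filter.
Proof.
split; first by move=> [s0 /(_ s0)]; apply.
split; first by exists [::].
  move=> P Q [s0 h0] [s1 h1]; exists (s0 ++ s1) => s hs; rewrite size_cat => ss.
  by split; [apply: h0|apply: h1]; try (by move=> B sB; apply: hs; apply/List.in_app_iff; tauto); lia.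
by move=> P Q PQ [s0 h0]; exists s0 => s h1 h2; apply: PQ; exact: h0.
Qed.

Lemma invset_filter_in (B : invset) : invset_filter [set s | List.In B s].
Proof. by exists [:: B] => s h _; apply: h; left. Qed.

Lemma invset_filter_size (N : nat) : invset_filter [set s | (N <= size s)%N].
Proof.
have iT : measurable (setT : set X) /\ f @^-1` setT = setT :> set X by [].
by exists (nseq N (exist _ setT iT)) => s _; rewrite size_nseq.
Qed.

End Selection.

(** * Convergence on uniformly regular sets *)

Section TightSets.
Context {R : realType} {dsp : measure_display} {X : measurableType dsp}.
Context (d : X -> X -> R) (f finv : X -> X) (S : csys d f finv).
Context (I : Type) (U : set_system I) {UU : UltraFilter U} (M : I -> probability X R).
Context (mu : probability X R).
Context (mu_open : forall O (l : R), dopen d O ->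
  pr (M i) O @[i --> U] --> l -> pr mu O <= l).

Let H := cs_space S.

Let cf := cs_f S.

(** Regularity with a single pair (K, O) for most measures along U. It takes the place of null
    boundaries when the coding is prescribed before the limit measure is known. *)
Definition tight (A : set X) := forall e : R, 0 < e -> exists K O : set X,
  [/\ dclosed d K, dopen d O, K `<=` A, A `<=` O & \forall i \near U, pr (M i) (O `\` K) <= e].

Lemma tight_iter A k : (forall i, finvariant f (M i)) -> tight A -> tight (iter k f @^-1` A).
Proof.
move=> iM tA e e0; have [K [V [cK oV KA AV h]]] := tA e e0.
exists (iter k f @^-1` K), (iter k f @^-1` V); split.
- exact: dclosed_preimage (dcont_fun_iter k cf) cK.
- exact: dopen_preimage (dcont_fun_iter k cf) oV.
- by move=> x /KA.
- by move=> x /AV.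
have mVK : measurable (V `\` K) by apply: (open_measurable H); exact: dopenD.
apply: filterS h => i hi.
suff -> : pr (M i) (iter k f @^-1` V `\` iter k f @^-1` K) = pr (M i) (V `\` K) by [].
elim: k => //= k IH; rewrite -[RHS]IH.
rewrite /pr -(iM i (iter k f @^-1` V `\` iter k f @^-1` K)); last first.
  exact: (preimage_measurable H (dcont_fun_iter k cf) mVK).
by congr (fine (M i _)); apply/seteqP; split => x /=; rewrite -iterSr.
Qed.

Lemma tightI A B : tight A -> tight B -> tight (A `&` B).
Proof.
move=> tA tB e e0.
have [|K [V [cK oV KA AV h]]] := tA (e / 2); first lra.
have [|K' [V' [cK' oV' KB BV h']]] := tB (e / 2); first lra.
exists (K `&` K'), (V `&` V'); split.
- exact: dclosedI.
- exact: dopenI.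
- by move=> x [/KA ? /KB].
- by move=> x [/AV ? /BV].
apply: filterS2 h h' => i hi hi'.
have m1 : measurable (V `\` K) by apply: (open_measurable H); exact: dopenD.
have m2 : measurable (V' `\` K') by apply: (open_measurable H); exact: dopenD.
have m3 : measurable ((V `&` V') `\` (K `&` K')).
  by apply: (open_measurable H); apply: dopenD; [exact: dopenI|exact: dclosedI].
apply: (@le_trans _ _ (pr (M i) ((V `\` K) `|` (V' `\` K')))).
  apply: (fap_le (pr_fap _)) => //; first exact: measurableU.
  move=> x [[Vx V'x] KK]; have [Kx|Kx] := pselect (K x); last by left.
  by right; split => // K'x; exact: KK.
by apply: le_trans (fapUle (pr_fap _) m1 m2) _; lra.
Qed.

Lemma tightT : tight setT.
Proof.
move=> e e0; exists setT, setT; split => //; [exact: dclosedT|exact: dopenT|].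
by apply: filterE => i; rewrite setDv (fap0 (pr_fap _)) ltW.
Qed.

Lemma tight_cvg A : measurable A -> tight A -> pr (M i) A @[i --> U] --> pr mu A.
Proof.
move=> mA tA.
have b01 B : measurable B -> forall i, `|pr (M i) B| <= 1.
  by move=> mB i; rewrite ger0_norm ?pr_ge0 ?(fap_le1 (pr_fap _)).
have [l hl] := @ultra_cvg_ex _ _ U _ (fun i => pr (M i) A) 1 (b01 _ mA).
suff -> : pr mu A = l by [].
have up (e : R) : 0 < e -> pr mu A <= l + e.
  move=> e0; have [K [V [cK oV KA AV h]]] := tA e e0.
  have mV := open_measurable H oV; have mK := closed_measurable H cK.
  have mVK : measurable (V `\` K) by exact: measurableD.
  have [l' hl'] := @ultra_cvg_ex _ _ U _ (fun i => pr (M i) V) 1 (b01 _ mV).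
  apply: (@le_trans _ _ (pr mu V)); first exact: (fap_le (pr_fap _)).
  apply: le_trans (mu_open oV hl') _.
  apply: (ucvg_le hl' (cvgD hl (cvg_cst e))).
  apply: filterS h => i hi /=.
  apply: (@le_trans _ _ (pr (M i) (A `|` (V `\` K)))).
    apply: (fap_le (pr_fap _)) => //; first exact: measurableU.
    by move=> x Vx; have [Ax|Ax] := pselect (A x); [left|right; split => // /KA].
  by apply: le_trans (fapUle (pr_fap _) mA mVK) _; rewrite lerD2l.
have low (e : R) : 0 < e -> l <= pr mu A + e.
  move=> e0; have [K [V [cK oV KA AV h]]] := tA e e0.
  have mV := open_measurable H oV; have mK := closed_measurable H cK.
  have mVK : measurable (V `\` K) by exact: measurableD.
  have [l' hl'] := @ultra_cvg_ex _ _ U _ (fun i => pr (M i) K) 1 (b01 _ mK).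
  apply: (@le_trans _ _ (l' + e)); last first.
    by rewrite lerD2r; apply: le_trans (ulim_closed H mu_open cK hl') _; exact: (fap_le (pr_fap _)).
  apply: (ucvg_le hl (cvgD hl' (cvg_cst e))).
  apply: filterS h => i hi /=.
  apply: (@le_trans _ _ (pr (M i) (K `|` (V `\` K)))).
    apply: (fap_le (pr_fap _)) => //; first exact: measurableU.
    by move=> x /AV Vx; have [Kx|Kx] := pselect (K x); [left|right].
  by apply: le_trans (fapUle (pr_fap _) mK mVK) _; rewrite lerD2l.
by apply/le_anti/andP; split; apply/ler_addgt0Pr.
Qed.

Lemma tight_FE (T : finType) (c : X -> T) phi (a : R) : mcod c -> (forall i, finvariant f (M i)) ->
  dcont_real d phi -> (forall t, tight (c @^-1` [set t])) ->
  (forall i, a <= FE f (M i) phi c) -> a <= FE f mu phi c.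
Proof.
move=> mc iM cphi tc hFE; rewrite /FE -lerBlDr.
have tw n t : tight (wd f c n @^-1` [set t]).
  have -> : wd f c n @^-1` [set t] = \big[setI/setT]_(k < n) (iter k f @^-1` (c @^-1` [set t k])).
    rewrite -bigcap_seq; apply/seteqP; split => x /=.
      by move=> <- k _ /=; rewrite ffunE.
    by move=> h; apply/ffunP => k; rewrite ffunE; apply: h; rewrite /= mem_index_enum.
  elim/big_ind: _ => [||k _]; [exact: tightT|exact: tightI|].
  exact: tight_iter.
have mw n : mcod (wd f c n).
  apply: mcod_ffun => k t; exact: (preimage_measurable H (dcont_fun_iter k cf) (mc t)).
apply: hr_ge => n n0.
have cE : Ex (M i) phi @[i --> U] --> Ex mu phi := @ulim_Ex _ _ _ d H _ U UU M mu mu_open phi cphi.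
have cA : n%:R * (a - Ex (M i) phi) @[i --> U] --> n%:R * (a - Ex mu phi).
  by apply: cvgMl_tmp; apply: cvgB; [apply: cvg_cst|exact: cE].
apply: (Hent_usc (mw n) _ _ cA); first by move=> t; exact: tight_cvg (mw n t) (tw n t).
apply: filterE => i; apply: le_trans (hr_le S (pr_fap _) mc n0).
by rewrite ler_wpM2l// lerBlDr; exact: hFE.
Qed.

End TightSets.

(** * Ergodic measures on the non-expansive set *)

Section ErgodicReduction.
Context {R : realType} {dsp : measure_display} {X : measurableType dsp}.
Context (d : X -> X -> R) (f finv : X -> X) (S : csys d f finv) (phi : X -> R).
Context (cphi : dcont_real d phi).
Implicit Types (mu nu : probability X R) (T : finType).

Let H := cs_space S.

(** The constant is the average of the level masses; each level indicator equals its mass almost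
    everywhere, so only the rounding error of [layer] remains. *)
Lemma zero_one_concentrated mu g (N : nat) : (0 < N)%N -> bmeas g -> (forall x, 0 <= g x <= 1) ->
  (forall k, (k < N)%N -> pr mu [set x | k%:R / N%:R < g x] = 0 \/ pr mu [set x | k%:R / N%:R < g x] = 1) ->
  exists c : R, 0 <= c <= 1 /\ Ex mu (fun x => `|g x - c|) <= N%:R^-1.
Proof.
move=> N0 bg g01 L01.
have N0' : 0 < N%:R :> R by rewrite ltr0n.
pose L (k : 'I_N) := [set x | k%:R / N%:R < g x].
have mL k : measurable (L k) by exact: bmeas_level.
pose p k := pr mu (L k).
have bL k : bmeas (\1_(L k) : X -> R) by exact: bmeas_indic.
have bLp k : bmeas (fun x => `|\1_(L k) x - p k|).
  by apply: bmeas_norm; apply: bmeasB => //; exact: bmeas_cst.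
have Lp k : Ex mu (fun x => `|\1_(L k) x - p k|) = 0.
  have [p0|p1] := L01 k (ltn_ord k).
    rewrite -[RHS]p0 -(Ex_indic mu (mL k)); congr (Ex mu _); apply/funext => x.
    by rewrite /p p0 subr0 ger0_norm// indicE.
  transitivity (Ex mu (fun x => 1 - \1_(L k) x)).
    congr (Ex mu _); apply/funext => x; rewrite /p p1 distrC indicE.
    by case: (x \in L k); rewrite ?subrr ?subr0 ?normr0 ?normr1.
  by rewrite ExB ?Ex_cst ?Ex_indic ?p1 ?subrr//; exact: bmeas_cst.
pose c := N%:R^-1 * \sum_k p k; exists c; split.
  apply/andP; split.
    by rewrite mulr_ge0 ?invr_ge0//; apply: sumr_ge0 => k _; exact: pr_ge0.
  rewrite /c ler_pdivrMl// mulr1; apply: (@le_trans _ _ (\sum_(k < N) 1)).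
    by apply: ler_sum => k _; exact: fap_le1 (pr_fap _) _.
  by rewrite sumr_const card_ord.
have bs : bmeas (fun x => \sum_k `|\1_(L k) x - p k|) by exact: bmeas_sum.
apply: (@le_trans _ _ (Ex mu (fun x => N%:R^-1 + N%:R^-1 * \sum_k `|\1_(L k) x - p k|))).
  apply: Ex_le.
  - by apply: bmeas_norm; apply: bmeasB => //; exact: bmeas_cst.
  - by apply: bmeasD; [exact: bmeas_cst|exact: bmeasZ].
  move=> x; have := layer_bound N0 (g01 x) => /andP[l1 l2].
  have -> : g x - c = (g x - layer N (g x)) + (layer N (g x) - c) by ring.
  apply: le_trans (ler_normD _ _) _; apply: lerD.
    by rewrite distrC ger0_norm; lra.
  rewrite /layer /c -mulrBr normrM gtr0_norm ?invr_gt0// ler_wpM2l ?invr_ge0//.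
  rewrite -sumrB; apply: le_trans (ler_norm_sum _ _ _) _; apply: ler_sum => k _.
  by rewrite indicE mem_setE.
rewrite ExD; [|exact: bmeas_cst|exact: bmeasZ].
rewrite Ex_cst ExZ// Ex_sum// big1 ?mulr0 ?addr0//.
Qed.

Lemma ergodic_reduction (eps : R) nu (a : R) : finvariant f nu -> pr nu (NE d f finv eps) = 1 ->
  (a%:E < free_energy nu f phi)%E ->
  exists mu, [/\ ergodic f mu, (0 < mu (NE d f finv eps))%E & (a%:E <= free_energy mu f phi)%E].
Proof.
move=> inu nNE /(free_gt S inu cphi)[T [c [mc ac]]].
have T0 : 0 < #|T|%:R :> R by rewrite ltr0n; apply/card_gt0P; exists (c point).
have r0 (r : nat) : 0 < r.+1%:R^-1 :> R by rewrite invr_gt0 ltr0n.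
have /choice[KV hKV] : forall tr : T * nat, exists KV : set X * set X,
    [/\ dclosed d KV.1, dopen d KV.2, KV.1 `<=` c @^-1` [set tr.1], c @^-1` [set tr.1] `<=` KV.2 &
      pr nu (KV.2 `\` KV.1) <= tr.2.+1%:R^-1 / #|T|%:R].
  move=> tr; have [K [V h]] := measurable_regular H nu (mc tr.1) (divr_gt0 (r0 tr.2) T0).
  by exists (K, V).
pose W t r := (KV (t, r)).2 `\` (KV (t, r)).1.
have mW t r : measurable (W t r).
  by apply: (open_measurable H); case: (hKV (t, r)) => *; exact: dopenD.
pose F r := close_pairs d f finv eps setT (r.+1%:R^-1).
have mF r : measurable (F r) by exact: (close_pairs_measurable S).
pose gj j := bump H (odflt (0%N, [::]) (unpickle j)).
have bgj j : bmeas (gj j) by exact: bump_bmeas.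
have gj01 j x : 0 <= gj j x <= 1 by exact: bump01.
have /choice[gs hgs] := fun j => mean_ergodic S inu (bgj j) (gj01 j).
have bgs j : bmeas (gs j) by case: (hgs j).
have ba j r : bmeas (avg f r.+1 (gj j)) by exact: (avg_bmeas S).
(* Index 0 keeps the atoms of c tight, index 1 keeps mass on a closed part of [NE], and index j + 2
   keeps the time averages of the j-th bump near an invariant function, which will make the limit
   ergodic. *)
pose e l r : X -> R := match l with
  | 0 => fun x => (\sum_t \1_(W t r) x)%R
  | 1 => \1_(~` F r)
  | j.+2 => fun x => `|avg f r.+1 (gj j) x - gs j x|%R end%N.
have be l r : bmeas (e l r).
  case: l => [|[|j]] /=.
  - by apply: bmeas_sum => t; exact: bmeas_indic.
  - by apply: bmeas_indic; exact: measurableC.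
  - by apply: bmeas_norm; exact: bmeasB.
have e0 l r x : 0 <= e l r x.
  by case: l => [|[|j]] //=; apply: sumr_ge0 => t _; rewrite indicE.
have esmall l (th : R) : 0 < th -> exists r, Ex nu (e l r) <= th.
  move=> th0; case: l => [|[|j]] /=.
  - have [[//|r] _ hr_] := inv_nat_small th0; exists r.
    rewrite Ex_sum; last by move=> t; exact: bmeas_indic.
    apply: (@le_trans _ _ (\sum_(t : T) r.+1%:R^-1 / #|T|%:R)).
      by apply: ler_sum => t _; rewrite Ex_indic//; case: (hKV (t, r)).
    by rewrite sumr_const -[X in X <= _]mulr_natr divfK ?gt_eqF// ltW.
  - have [|r /(_ r (leqnn r))] := @pr_incr _ _ _ nu F mF _ _ th0.
      move=> r x [y [ry xy]]; exists y; split => //; apply: le_trans ry.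
      by rewrite lef_pV2 ?posrE ?ltr0n// ler_nat.
    rewrite -[\bigcup__ _](NE_bigcup S) nNE => h; exists r.
    by rewrite Ex_indic; [rewrite (fapC (pr_fap _)) //; lra|exact: measurableC].
  - by have [_ _ _ /(_ th th0)] := hgs j.
have [M [iM M01 MF Me]] := penalized S cphi inu mc ac be e0 esmall.
have PF := invset_filter_proper (X := X) f.
have [U [UU hU]] := ultraFilterLemma PF.
have Me' l (th : R) : 0 < th -> exists r, \forall s \near U, Ex (M s) (e l r) <= th.
  move=> th0; have [r [N hN]] := Me l th th0; exists r.
  by apply: filterS hN _; apply: hU; exact: invset_filter_size.
have [mu mu_open] := ulim_measure H M.
have imu : finvariant f mu.
  apply: (ulim_invariant H mu_open (cs_f S)) => g cg.
  have mf := dcont_measurable H (cs_f S).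
  under eq_fun => s do rewrite (Ex_invariant mf (iM s) (dcont_bmeas H cg)) subrr.
  exact: cvg_cst.
exists mu; split; last 1 first.
- apply: le_trans (free_ge S imu mc cphi); rewrite lee_fin.
  apply: (tight_FE S mu_open mc iM cphi) => // t th th0.
  have [r hr_] := Me' 0%N th th0; exists (KV (t, r)).1, (KV (t, r)).2.
  have [? ? ? ? _] := hKV (t, r); split => //.
  apply: filterS hr_ => s; apply: le_trans => /=.
  rewrite -/(W t r) Ex_sum; last by move=> t'; exact: bmeas_indic.
  rewrite (bigD1 t) //= Ex_indic// lerDl; apply: sumr_ge0 => t' _.
  by rewrite Ex_indic// pr_ge0.
- split=> // B mB iB.
  (* The indicator of B is approximated in L1 by a bump, whose time averages are, under [M s], close
     to an invariant function that is nearly constant. In the limit the indicator of B, being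
     invariant, is within 4 th of a constant in mean, which bounds p (1 - p) for the mass p of B. *)
  suff key (th : R) : 0 < th -> pr mu B * (1 - pr mu B) <= 4 * th.
    have : pr mu B * (1 - pr mu B) <= 0.
      apply/ler_addgt0Pr => th th0; rewrite add0r.
      by have := key (th / 4); rewrite [4 * _]mulrC divfK//; apply; rewrite divr_gt0.
    have p0 := pr_ge0 mu B; have p1 := fap_le1 (pr_fap mu) mB.
    rewrite (prE mu mB) => h.
    have : pr mu B * (1 - pr mu B) == 0 by rewrite eq_le h mulr_ge0// subr_ge0.
    by rewrite mulf_eq0 subr_eq0 => /orP[/eqP->|/eqP<-]; [left|right].
  move=> th0.
  have [i [hi _]] := bump_approx H mu mu mB th0.
  pose j := pickle i; have gjE : gj j = bump H i by rewrite /gj pickleK.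
  have [r hr_] := Me' j.+2 th th0.
  have [N N0 hN] := inv_nat_small th0.
  have [_ gs01 gsf _] := hgs j.
  have mlev k : measurable [set x | k%:R / N%:R < gs j x] /\
      f @^-1` [set x | k%:R / N%:R < gs j x] = [set x | k%:R / N%:R < gs j x].
    by split; [exact: bmeas_level|apply/seteqP; split => x /=; rewrite gsf].
  pose lev (k : nat) : invset f := exist _ _ (mlev k).
  (* The level sets of the invariant function are invariant, so they belong to all families far
     along U and get mass 0 or 1. *)
  have Ulev : \forall s \near U, forall k, (k < N)%N -> List.In (lev k) s.
    elim: (N) => [|n IH]; first exact: filterE.
    have := hU _ (invset_filter_in (lev n)) => /= hn.
    by apply: filterS2 IH hn => s IH hn k; rewrite ltnS leq_eqVlt => /orP[/eqP->|/IH].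
  have /choice[cs hcs] : forall s, exists c : R, 0 <= c <= 1 /\
      ((forall k, (k < N)%N -> List.In (lev k) s) -> Ex (M s) (fun x => `|gs j x - c|) <= N%:R^-1).
    move=> s; have [h|h] := pselect (forall k, (k < N)%N -> List.In (lev k) s); last first.
      by exists 0; rewrite lexx ler01.
    have [|c0 [c01 hc0]] := @zero_one_concentrated (M s) (gs j) N N0 (bgs j) gs01.
      by move=> k /h /(M01 s).
    by exists c0.
  have cs1 s : `|cs s| <= 1 by have [/andP[? ?] _] := hcs s; rewrite ger0_norm.
  have [c0 hc0] := ultra_cvg_ex cs1.
  have c01 : 0 <= c0 <= 1.
    apply/andP; split.
      by apply: (ucvg_le (cvg_cst 0) hc0); apply: filterE => s; case: (hcs s) => /andP[].
    by apply: (@ucvg_le _ _ U _ cs (fun=> 1) _ _ hc0 (@cvg_cst _ _ _ _ _)); apply: filterE => s; case: (hcs s) => /andP[].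
  have cA : dcont_real d (fun x => `|avg f r.+1 (gj j) x - c0|).
    apply: (dcont_real_comp1 (g := fun x => avg f r.+1 (gj j) x - c0) _ (@norm_continuous _ R)).
    apply: dcont_realB; last exact: dcont_cst.
    by apply: (avg_dcont S); rewrite gjE; exact: bump_dcont.
  have bA := dcont_bmeas H cA.
  have bc (g : X -> R) (b : R) : bmeas g -> bmeas (fun x => `|g x - b|).
    by move=> bg; apply: bmeas_norm; apply: bmeasB => //; exact: bmeas_cst.
  have near : \forall s \near U, Ex (M s) (fun x => `|avg f r.+1 (gj j) x - c0|) <= 3 * th.
    have hc : \forall s \near U, `|c0 - cs s| < th by move/cvgrPdist_lt: hc0 => /(_ _ th0).
    apply: filterS3 hr_ Ulev hc => s h1 h2 h3.
    have [_ /(_ h2) h4] := hcs s.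
    apply: (@le_trans _ _ (Ex (M s) (fun x => e j.+2 r x + (`|gs j x - cs s| + th)))).
      apply: Ex_le => //; first by apply: bmeasD => //; apply: bmeasD; [exact: bc|exact: bmeas_cst].
      move=> x /=; rewrite (_ : _ - c0 = (avg f r.+1 (gj j) x - gs j x) + ((gs j x - cs s) + (cs s - c0))); last by ring.
      apply: le_trans (ler_normD _ _) _; rewrite lerD2l.
      by apply: le_trans (ler_normD _ _) _; rewrite lerD2l distrC ltW.
    rewrite ExD//; last by apply: bmeasD; [exact: bc|exact: bmeas_cst].
    by rewrite ExD ?Ex_cst; [lra|exact: bc|exact: bmeas_cst].
  have h1 : Ex mu (fun x => `|avg f r.+1 (gj j) x - c0|) <= 3 * th.
    exact: (ucvg_le (ulim_Ex H mu_open cA) (cvg_cst _) near).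
  have bB : bmeas (\1_B : X -> R) by exact: bmeas_indic.
  have bgB : bmeas (fun x => `|gj j x - \1_B x|) by apply: bmeas_norm; exact: bmeasB.
  have avB x : avg f r.+1 (\1_B : X -> R) x = \1_B x.
    have iBk k : \1_B (iter k f x) = \1_B x :> R.
      elim: k => //= k <-; rewrite !indicE; congr (_%:R).
      by rewrite -[in RHS]iB.
    rewrite /avg (eq_bigr (fun=> \1_B x)); last by move=> k _; exact: iBk.
    by rewrite sumr_const card_ord -[X in _ * X]mulr_natl mulKf.
  have h2 : Ex mu (fun x => `|avg f r.+1 (gj j) x - \1_B x|) <= th.
    apply: (@le_trans _ _ (Ex mu (avg f r.+1 (fun x => `|gj j x - \1_B x|)))); last first.
      by rewrite (Ex_avg S) // gjE.
    apply: Ex_le; first by apply: bmeas_norm; exact: bmeasB.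
      exact: (avg_bmeas S).
    move=> x; rewrite -[X in `|_ - X|]avB /avg -mulrBr normrM gtr0_norm ?r0// ler_wpM2l ?(ltW (r0 _))//.
    by rewrite -sumrB; apply: le_trans (ler_norm_sum _ _ _) _.
  have h3 : Ex mu (fun x => `|\1_B x - c0|) <= 4 * th.
    apply: (@le_trans _ _ (Ex mu (fun x => `|avg f r.+1 (gj j) x - \1_B x| + `|avg f r.+1 (gj j) x - c0|))).
      apply: Ex_le; first exact: bc.
        by apply: bmeasD => //; apply: bmeas_norm; exact: bmeasB.
      move=> x; rewrite (_ : \1_B x - c0 = - (avg f r.+1 (gj j) x - \1_B x) + (avg f r.+1 (gj j) x - c0)); last by ring.
      by apply: le_trans (ler_normD _ _) _; rewrite normrN.
    by rewrite ExD//; [lra|apply: bmeas_norm; exact: bmeasB].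
  apply: le_trans h3.
  (* As c0 lies in [0, 1], this function equals the distance of the indicator of B to c0. Its mean
     exceeds b (1 - b) by c0 (1 - b)^2 + (1 - c0) b^2, where b is the mass of B. *)
  apply: (@le_trans _ _ (Ex mu (fun x => c0 + (1 - 2 * c0) * \1_B x))).
    rewrite ExD; [|exact: bmeas_cst|exact: bmeasZ].
    rewrite Ex_cst ExZ// Ex_indic//; set b := pr mu B; case/andP: c01 => c00 c01.
    have : 0 <= (1 - c0) * b ^+ 2 by rewrite mulr_ge0 ?sqr_ge0 ?subr_ge0.
    have : 0 <= c0 * (1 - b) ^+ 2 by rewrite mulr_ge0 ?sqr_ge0.
    by rewrite !expr2; nra.
  apply: Ex_le; [|exact: bc|].
    by apply: bmeasD; [exact: bmeas_cst|exact: bmeasZ].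
  move=> x; case/andP: c01 => ? ?; rewrite indicE; case: (x \in B) => /=.
    by rewrite ger0_norm; lra.
  by rewrite sub0r normrN ger0_norm; lra.
(* Half of the mass stays on one closed set [F r], and a lower bound on a closed set survives in the
   limit. *)
have [r hr_] := Me' 1%N 2^-1 ltac:(lra).
have b1 s : `|pr (M s) (F r)| <= 1 by rewrite ger0_norm ?pr_ge0 ?(fap_le1 (pr_fap _)).
have [l hl] := ultra_cvg_ex b1.
have l2 : 2^-1 <= l.
  apply: (ucvg_le (cvg_cst _) hl); apply: filterS hr_ => s /=.
  by rewrite Ex_indic; [rewrite (fapC (pr_fap _)) //; lra|exact: measurableC].
have mNE := NE_measurable S eps.
rewrite (prE mu mNE) lte_fin; apply: (@lt_le_trans _ _ (pr mu (F r))).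
  have cF : dclosed d (F r) by exact: (close_pairs_closed S).
  by apply: lt_le_trans (ulim_closed H mu_open cF hl); lra.
by apply: (fap_le (pr_fap _)) => //; rewrite (NE_bigcup S) => x Fx; exists r.
Qed.

End ErgodicReduction.

(** * Pressure and free energy *)

Section Pressure.
Context {R : realType} {dsp : measure_display} {X : measurableType dsp}.
Context (d : X -> X -> R) (f finv : X -> X) (S : csys d f finv) (phi : X -> R).
Context (cphi : dcont_real d phi).
Implicit Types (mu nu : probability X R) (E : seq X) (C : set (X * nat)) (T : finType).

Let H := cs_space S.
Let bphi : bmeas phi := dcont_bmeas H cphi.
Notation Phi := (birkhoff f phi).

Lemma elog_le (x y : \bar R) : (x <= y)%E -> (elog x <= elog y)%E.
Proof.
case: x y => [x||] [y||] //=; rewrite ?leey ?leNye// ?lee_fin.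
  move=> xy; case: ltP => x0; last by rewrite leNye.
  have y0 := lt_le_trans x0 xy; by rewrite y0 lee_fin ler_ln.
Qed.

Lemma Lambda_mono C (r r' : R) n : r <= r' -> (Lambda d f phi C r' n <= Lambda d f phi C r n)%E.
Proof.
move=> rr; apply: le_ereal_sup => _ [E [uE [sE CE]] <-]; exists E => //; split => //; split => //.
by move=> x y xE yE xy; apply: le_lt_trans rr _; exact: sE.
Qed.

Lemma limn_esup_mono (u v : (\bar R)^nat) : (forall n, u n <= v n)%E -> (limn_esup u <= limn_esup v)%E.
Proof.
move=> uv; apply: le_ereal_inf_tmp => _ [A FA <-].
apply: (@le_trans _ _ (ereal_sup (u @` A))); first by apply: ereal_inf_lbound; exists A.
apply: ge_ereal_sup => _ [n An <-]; apply: le_trans (uv n) _.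
by apply: ereal_sup_ubound; exists n.
Qed.

Lemma pressure_delta_mono C (r r' : R) : r <= r' ->
  (pressure_delta d f phi C r' <= pressure_delta d f phi C r)%E.
Proof.
move=> rr; apply: limn_esup_mono => n.
by apply: lee_wpmul2l; [rewrite lee_fin invr_ge0|apply: elog_le; exact: Lambda_mono].
Qed.

Lemma pressure_collE C : pressure_coll d f phi C =
  ereal_sup [set pressure_delta d f phi C r | r in [set r | 0 < r]].
Proof.
rewrite /pressure_coll; apply: cvg_lim => //.
have -> : [set r : R | 0 < r] = [set` Interval (BRight 0) +oo%O].
  by apply/seteqP; split => r /=; rewrite in_itv /= andbT.
by apply: nonincreasing_at_right_cvge => // r r' _ _; exact: pressure_delta_mono.
Qed.

Lemma pressure_delta_le C (r : R) : 0 < r -> (pressure_delta d f phi C r <= pressure_coll d f phi C)%E.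
Proof. by move=> r0; rewrite pressure_collE; apply: ereal_sup_ubound; exists r. Qed.

Lemma pressure_coll_gt C (x : \bar R) : (x < pressure_coll d f phi C)%E ->
  exists2 r : R, 0 < r & (x < pressure_delta d f phi C r)%E.
Proof. by rewrite pressure_collE => /ereal_sup_gt[_ [r r0 <-] h]; exists r. Qed.

Lemma NE_mono (r r' : R) : r <= r' -> NE d f finv r `<=` NE d f finv r'.
Proof. by move=> rr x [y yx h]; exists y => // n; apply: le_trans rr. Qed.

Lemma Pexp_lt (x : \bar R) : (Pexp_perp d f finv phi < x)%E ->
  exists2 r : R, 0 < r & (Pexp_perp_eps d f finv phi r < x)%E.
Proof.
have -> : Pexp_perp d f finv phi =
    ereal_inf [set Pexp_perp_eps d f finv phi r | r in [set r | 0 < r]].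
  rewrite /Pexp_perp; apply: cvg_lim => //.
  have -> : [set r : R | 0 < r] = [set` Interval (BRight 0) +oo%O].
    by apply/seteqP; split => r /=; rewrite in_itv /= andbT.
  apply: nondecreasing_at_right_cvge => // r r' _ _ rr.
  apply: le_ereal_sup => _ [mu [emu mur] <-]; exists mu => //; split => //.
  apply: lt_le_trans mur _; apply: le_measure; rewrite ?inE.
  - exact: (NE_measurable S).
  - exact: (NE_measurable S).
  - exact: NE_mono.
by move=> /ereal_inf_lt[_ [r r0 <-] h]; exists r.
Qed.

Lemma psum_Lambda C (r : R) n E : uniq E -> sep d f n r E -> (forall x, x \in E -> C (x, n)) ->
  ((psum f phi E n)%:E <= Lambda d f phi C r n)%E.
Proof.
move=> uE sE CE; apply: ereal_sup_ubound; exists E => //; split; first exact/NoDupP.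
by split; [exact/sepP|move=> x /InP; exact: CE].
Qed.

Lemma psum_le_pressure C (r a : R) : (pressure_delta d f phi C r < a%:E)%E ->
  exists n0, forall n E, (n0 <= n)%N -> uniq E -> sep d f n r E ->
    (forall x, x \in E -> C (x, n)) -> psum f phi E n <= expR (n%:R * a).
Proof.
move=> /limn_esup_lt[n0 hn0]; exists n0.+1 => n E n0n uE sE CE.
have [->|E0] := eqVneq E [::]; first by rewrite /psum big_nil expR_ge0.
have n0' : 0 < n%:R :> R by rewrite ltr0n; case: (n) n0n.
have := hn0 n (ltnW n0n).
have := elog_le (psum_Lambda uE sE CE); rewrite /= psum_gt0// => h1 h2.
have : (n%:R^-1%:E * (ln (psum f phi E n))%:E < a%:E)%E.
  by apply: le_lt_trans h2; apply: lee_wpmul2l => //; rewrite lee_fin invr_ge0 ltW.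
rewrite -EFinM lte_fin mulrC ltr_pdivrMr// mulrC => h3.
by rewrite -(lnK (psum_gt0 f phi n E0)) ler_expR ltW.
Qed.

Lemma psum_ge_pressure C (r a : R) : (a%:E < pressure_delta d f phi C r)%E ->
  forall n0, exists n E, [/\ (n0 < n)%N, uniq E, sep d f n r E,
    forall x, x \in E -> C (x, n) & expR (n%:R * a) <= psum f phi E n].
Proof.
move=> /limn_esup_gt h n0; have [n n0n hn] := h n0.+1.
have n0' : 0 < n%:R :> R by rewrite ltr0n; case: (n) n0n.
have : ((expR (n%:R * a))%:E < Lambda d f phi C r n)%E.
  case: (Lambda d f phi C r n) hn => [L| |] /=; rewrite ?ltry//.
    case: ifPn => L0; last by rewrite mulrNy gtr0_sg ?invr_gt0// mul1e.
    rewrite -EFinM lte_fin mulrC ltr_pdivlMr// => hL.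
    by rewrite lte_fin -(lnK L0) ltr_expR mulrC.
  by rewrite mulrNy gtr0_sg ?invr_gt0// mul1e.
move=> /ereal_sup_gt[_ [E [/NoDupP uE [/sepP sE CE]] <-]]; rewrite lte_fin => hE.
by exists n, E; split => //; [move=> x /InP; exact: CE|exact: ltW].
Qed.

(** Growth rates have to be bounded to have limits along an ultrafilter. The upper bound is
    [gibbs_average_ex] for words of length q = 1. *)
Lemma psum_bounds (r : R) : 0 < r -> exists2 A : R, 0 < A & forall n E, (0 < n)%N -> E != [::] ->
  uniq E -> sep d f n r E -> `|ln (psum f phi E n) / n%:R| <= A.
Proof.
move=> r0; have [T [c [mc _ hc]]] := nullbd_cod H (dirac point : probability X R) r0.
have [C C0 hC] := bmeas_pos bphi.
pose L : R := ln #|{ffun 'I_1 -> T}|%:R.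
have T1 : (0 < #|{ffun 'I_1 -> T}|)%N by apply/card_gt0P; exists [ffun=> c point].
have L0 : 0 <= L by rewrite ln_ge0// ler1n.
exists (2 * L + C + 1); first by lra.
move=> n E n0 E0 uE sE; have n0' : 0 < n%:R :> R by rewrite ltr0n.
have [M [_ /(_ T c 1%N isT mc hc)]] := gibbs_average_ex S cphi n0 E0 uE sE.
rewrite !mul1r -/L => up.
have MH : Hent (pr M) (wd f c 1) <= L.
  by apply: Hent_le_card; [exact: pr_fap|exact: (mcod_wd S)].
have /ler_normlW MC := Ex_bound M bphi hC.
have low : - (n%:R * C) <= ln (psum f phi E n).
  case: E E0 {uE sE up} => // x E _.
  rewrite -(expRK (- (n%:R * C))) ler_ln ?posrE ?expR_gt0 ?psum_gt0//.
  rewrite /psum big_cons; apply: (@le_trans _ _ (expR (Phi x n))); last first.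
    by rewrite lerDl; apply: sumr_ge0 => y _; exact: expR_ge0.
  rewrite ler_expR lerNl -sumrN; apply: (@le_trans _ _ (\sum_(k < n) C)).
    by apply: ler_sum => k _; have := hC (iter k f x); rewrite ler_norml lerNl => /andP[].
  by rewrite sumr_const card_ord mulr_natl.
rewrite normrM [`|_^-1|]gtr0_norm ?invr_gt0// ler_pdivrMr// ler_norml.
have n1 : 1 <= n%:R :> R by rewrite ler1n.
have h1 : L <= n%:R * L by rewrite ler_peMl.
have h2 : n%:R * (Hent (pr M) (wd f c 1) + Ex M phi) <= n%:R * (L + C) by rewrite ler_wpM2l// lerD.
have -> : (2 * L + C + 1) * n%:R = 2 * (n%:R * L) + n%:R * C + n%:R by ring.
have h3 : 0 <= n%:R * L by rewrite mulr_ge0.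
have h4 : 0 <= n%:R * C by rewrite mulr_ge0// ltW.
move: h2; rewrite [n%:R * (L + C)]mulrDr => h2.
by apply/andP; split; lra.
Qed.

Lemma ultra_nat (G : nat -> Prop) : (forall n0, exists2 n, (n0 <= n)%N & G n) ->
  exists U : set_system nat, [/\ UltraFilter U, forall N, U [set n | (N <= n)%N] & U [set n | G n]].
Proof.
move=> hG; pose F : set_system nat := [set P | exists N, forall n, (N <= n)%N -> G n -> P n].
have FF : ProperFilter F.
  split; first by move=> [N hN]; have [n Nn Gn] := hG N; exact: hN n Nn Gn.
  split; first by exists 0%N.
    move=> P Q [N hN] [N' hN']; exists (maxn N N') => n; rewrite geq_max => /andP[Nn N'n] Gn.
    by split; [exact: hN|exact: hN'].
  by move=> P Q PQ [N hN]; exists N => n Nn Gn; apply: PQ; exact: hN.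
have [U [UU hU]] := ultraFilterLemma FF.
by exists U; split; [exact: UU|move=> N; apply: hU; exists N|apply: hU; exists 0%N].
Qed.

Lemma pressure_attained (a : R) : (a%:E < top_pressure d f phi)%E ->
  exists mu, finvariant f mu /\ (a%:E <= free_energy mu f phi)%E.
Proof.
move=> /pressure_coll_gt[r r0 /psum_ge_pressure h].
pose G n := (0 < n)%N /\ exists E, [/\ uniq E, sep d f n r E & expR (n%:R * a) <= psum f phi E n].
have hG n0 : exists2 n, (n0 <= n)%N & G n.
  have [n [E [n0n uE sE _ hE]]] := h n0; exists n; first exact: ltnW.
  by split; [case: (n) n0n|exists E].
have [U [UU Uinf UG]] := ultra_nat hG.
have /choice[E hE] : forall n, exists E, [/\ E != [::] /\ uniq E, sep d f n r E &
    G n -> expR (n%:R * a) <= psum f phi E n].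
  move=> n; have [[n0 [E [uE sE aE]]]|nG] := pselect (G n).
    exists E; split => //; split => //; apply/eqP => E0.
    by move: aE; rewrite E0 /psum big_nil leNgt expR_gt0.
  by exists [:: point]; split => // x y; rewrite !inE => /eqP-> /eqP->.
have [A A0 hA] := psum_bounds r0.
pose u n := ln (psum f phi (E n) n) / n%:R.
have uA n : `|u n| <= A.
  case: n => [|n]; first by rewrite /u invr0 mulr0 normr0 ltW.
  by have [[E0 uE] sE _] := hE n.+1; exact: hA.
have [l hl] := ultra_cvg_ex (U := U) uA.
have al : a <= l.
  apply: (@ucvg_le _ _ U _ (fun=> a) u _ _ _ hl); first exact: cvg_cst.
  apply: filterS UG => n Gn; have [n0 _] := Gn; have [[E0 uE] sE /(_ Gn) ha] := hE n.
  rewrite ler_pdivlMr ?ltr0n// mulrC -[leLHS]expRK ler_ln ?posrE ?expR_gt0//.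
  exact: psum_gt0.
have [||mu [M [imu lmu _ _ _]]] := misiurewicz S cphi Uinf r0 _ _ hl.
- by move=> n; case: (hE n).
- by move=> n; case: (hE n).
by exists mu; split => //; apply: le_trans lmu; rewrite lee_fin.
Qed.

(* The Gibbs inequality against the weights expR (W t), after the entropy rate is bounded by the
   static entropy of c. *)
Lemma entropy_bound (eps : R) nu T (c : X -> T) T' (c' : X -> T') n (g : X -> R) (W : T -> R) :
  finvariant f nu -> pr nu (NE d f finv eps) = 0 -> (0 < n)%N -> mcod c -> mcod c' ->
  (forall x y, c x = c y -> forall k, (k < n)%N -> d (iter k f x) (iter k f y) <= eps) ->
  bmeas g -> (forall x, g x <= W (c x)) ->
  n%:R * hr f (pr nu) c' + Ex nu g <= ln (\sum_t expR (W t)).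
Proof.
move=> inu nNE n0 mc mc' dc bg gW.
have h1 := expansive_rate S inu nNE n0 mc mc' dc.
pose Z := \sum_t expR (W t).
have Z0 : 0 < Z.
  by rewrite /Z (bigD1 (c point)) //= ltr_pwDl ?expR_gt0//; apply: sumr_ge0 => t _; exact: expR_ge0.
have h2 : Hent (pr nu) c <= \sum_t pr nu (c @^-1` [set t]) * (- ln (expR (W t) / Z)).
  apply: Hent_gibbs => //; first exact: pr_fap.
  - by move=> t; rewrite divr_ge0 ?expR_ge0// ltW.
  - by rewrite -mulr_suml divff ?gt_eqF.
  - by move=> t _; rewrite divr_gt0 ?expR_gt0.
have s1 : \sum_t pr nu (c @^-1` [set t]) = 1 := fap_sum1 (pr_fap nu) mc.
have h3 : \sum_t pr nu (c @^-1` [set t]) * (- ln (expR (W t) / Z)) =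
    ln Z - \sum_t pr nu (c @^-1` [set t]) * W t.
  rewrite -[X in X - _]mul1r -s1 mulr_suml -sumrB; apply: eq_bigr => t _.
  by rewrite ln_div ?posrE ?expR_gt0// expRK; ring.
have h4 : Ex nu g <= \sum_t pr nu (c @^-1` [set t]) * W t.
  have bI t : bmeas (\1_(c @^-1` [set t]) : X -> R) by exact: bmeas_indic (mc t).
  pose G (t : T) (x : X) := W t * \1_(c @^-1` [set t]) x.
  have bG t : bmeas (G t) by exact: bmeasZ (bI t).
  apply: (@le_trans _ _ (Ex nu (fun x => \sum_t G t x))); last first.
    rewrite (Ex_sum nu _ bG).
    by apply: ler_sum => t _; rewrite ExZ; [rewrite Ex_indic 1?mulrC//; exact: mc|exact: bI].
  apply: Ex_le => //; first exact: (bmeas_sum _ bG).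
  move=> x; rewrite (bigD1 (c x)) //= big1 ?addr0 /G.
    by rewrite indicE mem_set ?mulr1.
  by move=> t tx; rewrite indicE memNset ?mulr0// => /= xt; rewrite xt eqxx in tx.
rewrite -/Z; lra.
Qed.

Context (eps : R) (eps0 : 0 < eps).

Lemma NE_free_le nu (a : R) : finvariant f nu -> pr nu (NE d f finv eps) = 1 ->
  (Pexp_perp_eps d f finv phi eps < a%:E)%E -> (free_energy nu f phi <= a%:E)%E.
Proof.
move=> inu nNE Pa; rewrite leNgt; apply/negP => /(ergodic_reduction S cphi inu nNE)[mu [emu muN aF]].
have : (free_energy mu f phi <= Pexp_perp_eps d f finv phi eps)%E by apply: ereal_sup_ubound; exists mu.
by move=> h; have := lt_le_trans Pa (le_trans aF h); rewrite ltxx.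
Qed.

(** By [FE_mix], when the part on [NE] has free energy at most a, the other part has to exceed a. *)
Lemma off_NE nu (a : R) : finvariant f nu -> (Pexp_perp_eps d f finv phi eps < a%:E)%E ->
  (a%:E < free_energy nu f phi)%E ->
  exists nu', [/\ finvariant f nu', pr nu' (NE d f finv eps) = 0 & (a%:E < free_energy nu' f phi)%E].
Proof.
move=> inu Pa aF; have mNE := NE_measurable S eps; have iNE := NE_invariant S eps.
have [n0|n0] := eqVneq (pr nu (NE d f finv eps)) 0; first by exists nu.
have [n1|n1] := eqVneq (pr nu (NE d f finv eps)) 1.
  by have := lt_le_trans aF (NE_free_le inu n1 Pa); rewrite ltxx.
have t01 : 0 < pr nu (NE d f finv eps) < 1.
  by rewrite lt_neqAle eq_sym n0 pr_ge0 lt_neqAle n1 (fap_le1 (pr_fap nu)).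
have [mu1 [mu2 [i1 i2 m1 m2 hm]]] := cond_split S inu mNE iNE t01.
exists mu2; split => //.
have [T [c [mc ac]]] := free_gt S inu cphi aF.
apply: lt_le_trans (free_ge S i2 mc cphi); rewrite lte_fin.
have := FE_mix S inu i1 i2 mc bphi t01 hm.
have := le_trans (free_ge S i1 mc cphi) (NE_free_le i1 m1 Pa); rewrite lee_fin.
case/andP: t01; set t := pr nu _ => t0 t1 h1 h2; rewrite ltNge; apply/negP => h3.
by move: ac; rewrite ltNge => /negP; apply; apply: le_trans h2 _; nra.
Qed.

(** Some a < P still bounds free energies on [NE], so any mass there would push the mean strictly
    below P. *)
Lemma NE_null nu (P : R) : finvariant f nu -> (Pexp_perp_eps d f finv phi eps < P%:E)%E ->
  (P%:E <= free_energy nu f phi)%E ->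
  (forall mu, finvariant f mu -> pr mu (NE d f finv eps) = 0 -> (free_energy mu f phi <= P%:E)%E) ->
  pr nu (NE d f finv eps) = 0.
Proof.
move=> inu PP PF hP; have mNE := NE_measurable S eps; have iNE := NE_invariant S eps.
have [a Pa aP] : exists2 a : R, (Pexp_perp_eps d f finv phi eps < a%:E)%E & a < P.
  case: (Pexp_perp_eps d f finv phi eps) PP => [b| |] //=; rewrite ?lte_fin ?ltNge ?leey// => bP.
    by exists ((b + P) / 2); rewrite ?lte_fin; lra.
  by exists (P - 1); rewrite ?ltNyr//; lra.
apply/eqP/negPn/negP => n0.
have [n1|n1] := eqVneq (pr nu (NE d f finv eps)) 1.
  by have := le_lt_trans (le_trans PF (NE_free_le inu n1 Pa)) (_ : (a%:E < P%:E)%E); rewrite ltxx lte_fin aP => /(_ isT).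
have t01 : 0 < pr nu (NE d f finv eps) < 1.
  by rewrite lt_neqAle eq_sym n0 pr_ge0 lt_neqAle n1 (fap_le1 (pr_fap nu)).
have [mu1 [mu2 [i1 i2 m1 m2 hm]]] := cond_split S inu mNE iNE t01.
set t := pr nu _ in t01 hm; case/andP: (t01) => t0 t1.
have : (free_energy nu f phi <= (t * a + (1 - t) * P)%:E)%E.
  apply: (free_le S inu cphi) => T c mc; apply: le_trans (FE_mix S inu i1 i2 mc bphi t01 hm) _.
  have := le_trans (free_ge S i1 mc cphi) (NE_free_le i1 m1 Pa); rewrite lee_fin => h1.
  have := le_trans (free_ge S i2 mc cphi) (hP _ i2 m2); rewrite lee_fin => h2.
  by apply: lerD; rewrite ler_wpM2l//; lra.
by move=> /(le_trans PF); rewrite lee_fin; nra.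
Qed.

(** A coding with atoms of diameter at most eps bounds all free energies off [NE] by one constant.
    Infinite pressure would produce a measure of larger free energy, and then such a measure off
    [NE]. *)
Lemma pressure_finite : (Pexp_perp_eps d f finv phi eps < top_pressure d f phi)%E ->
  exists P : R, top_pressure d f phi = P%:E.
Proof.
move=> PP; have [T [c [mc _ hc]]] := nullbd_cod H (dirac point : probability X R) eps0.
have [C C0 hC] := bmeas_pos bphi.
have bound nu : finvariant f nu -> pr nu (NE d f finv eps) = 0 ->
    (free_energy nu f phi <= (ln #|T|%:R + C)%:E)%E.
  move=> inu nN; apply: (free_le S inu cphi) => T' c' mc'.
  apply: lerD; last by have := Ex_bound nu bphi hC; rewrite ler_norml => /andP[].
  have := @expansive_rate _ _ _ _ _ _ S eps nu T T' c c' 1 inu nN isT mc mc'.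
  rewrite mul1r => h; apply: le_trans (Hent_le_card (pr_fap nu) mc); apply: h.
  by move=> x y xy [|//] _; exact: hc.
case E : (top_pressure d f phi) PP => [P| |] PP; [by exists P| |by rewrite ltNge leNye in PP].
have [a a1 a2] : exists2 a : R, (Pexp_perp_eps d f finv phi eps < a%:E)%E & ln #|T|%:R + C <= a.
  case: (Pexp_perp_eps d f finv phi eps) PP => [b| |] //= _.
    by exists (Num.max (b + 1) (ln #|T|%:R + C)); rewrite ?le_max ?lexx ?orbT// lte_fin lt_max; apply/orP; left; lra.
  by exists (ln #|T|%:R + C); rewrite ?ltNyr.
have [|nu [inu aF]] := @pressure_attained (a + 1); first by rewrite E ltry.
have aF' : (a%:E < free_energy nu f phi)%E by apply: lt_le_trans aF; rewrite lte_fin; lra.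
have [nu' [inu' nN' F']] := off_NE inu a1 aF'.
by have := lt_le_trans F' (bound _ inu' nN'); rewrite lte_fin; lra.
Qed.

End Pressure.

(** * Gluing orbit segments *)

Section Gluing.
Context {R : realType} {dsp : measure_display} {X : measurableType dsp}.
Context (d : X -> X -> R) (f finv : X -> X) (S : csys d f finv) (phi : X -> R).
Implicit Types (E : seq X) (T : finType) (u : seq (X * nat)) (t : seq nat).

Let H := cs_space S.
Notation Phi := (birkhoff f phi).

(** Points with equal keys form a separated set, so each key is charged one partition sum. *)
Lemma keyed_sum (I T : finType) (key : I -> T) (y : I -> X) L (r B : R) : 0 <= r ->
  (forall E, uniq E -> sep d f L r E -> psum f phi E L <= B) ->
  (forall i j, i <> j -> key i = key j -> r < dn d f L (y i) (y j)) ->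
  \sum_i expR (Phi (y i) L) <= #|T|%:R * B.
Proof.
move=> r0 hB hsep; rewrite (partition_big key xpredT) //=.
apply: (@le_trans _ _ (\sum_(t : T) B)); last by rewrite sumr_const -[X in X <= _]mulr_natl.
apply: ler_sum => t _.
pose E := [seq y i | i <- enum [pred i | key i == t]].
have inj : {in enum [pred i | key i == t] &, injective y}.
  move=> i j; rewrite !mem_enum !inE => /eqP it /eqP jt yij.
  have [//|/eqP ij] := eqVneq i j.
  by have := hsep i j ij; rewrite it jt yij (dnxx f H) => /(_ erefl); rewrite ltNge r0.
have -> : \sum_(i | key i == t) expR (Phi (y i) L) = psum f phi E L.
  by rewrite /psum /E big_map big_enum.
apply: hB; first by rewrite map_inj_in_uniq ?enum_uniq.
move=> x x' /mapP[i]; rewrite mem_enum inE => /eqP it -> /mapP[j].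
rewrite mem_enum inE => /eqP jt -> yy; apply: hsep; last by rewrite it jt.
by move=> ij; apply: yy; rewrite ij.
Qed.

Lemma birkhoffD z m n : Phi z (m + n) = Phi z m + Phi (iter m f z) n.
Proof.
rewrite /birkhoff big_split_ord /=; congr (_ + _).
by apply: eq_bigr => k _; rewrite addnC iterD.
Qed.

Lemma birkhoff_abs (C : R) z n : (forall x, `|phi x| <= C) -> `|Phi z n| <= n%:R * C.
Proof.
move=> hC; apply: le_trans (ler_norm_sum _ _ _) _.
apply: (@le_trans _ _ (\sum_(k < n) C)); first by apply: ler_sum.
by rewrite sumr_const card_ord mulr_natl.
Qed.

Definition seg u i := nth (point, 0%N) u i.

(* The conclusion of (W)-specification for the list u of orbit segments, with gaps t. *)
Definition shadows (rho : R) z u t := forall j, (j < size u)%N ->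
  dn d f (seg u j).2 (iter (\sum_(i < j) ((seg u i).2 + nth 0%N t i)) f z) (seg u j).1 < rho.

(** The bound is [tau.+1] to be positive, and the gap after the last segment, absent from the list,
    reads as 0. *)
Lemma W_spec_shadows (G : set (X * nat)) (rho : R) : W_spec d f G rho ->
  exists2 tau, (0 < tau)%N & forall u, (forall a, a \in u -> G a) ->
    exists y t, (forall i, (nth 0 t i <= tau)%N) /\ shadows rho y u t.
Proof.
move=> [tau ht]; exists tau.+1 => // u uG.
have [i /InP/uG //|y [t [_ tt h]]] := ht u.
exists y, t; split.
  move=> i; have [it|it] := ltnP i (size t); last by rewrite nth_default.
  by have /andP[_ /leqW] := tt _ (proj2 (InP _ _) (mem_nth 0%N it)).
move=> j ju; rewrite /seg (set_nth_default (y, 0%N) (point, 0%N) ju).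
have -> : (\sum_(i < j) ((nth (point, 0) u i).2 + nth 0 t i) = \sum_(i < j) ((nth (y, 0) u i).2 + nth 0 t i))%N.
  apply: eq_bigr => i _; congr (_.2 + _)%N; apply: set_nth_default.
  exact: ltn_trans (ltn_ord i) ju.
exact: h.
Qed.

(** Each segment costs K by the Bowen property, and every time outside the segments, in a gap or
    after the last segment, costs C. *)
Lemma shadow_birkhoff (G : set (X * nat)) (rho epsB K C : R) z u t L :
  (forall x n y, G (x, n) -> dn d f n x y < epsB -> `|Phi x n - Phi y n| <= K) ->
  (forall x, `|phi x| <= C) -> rho <= epsB -> (forall a, a \in u -> G a) -> shadows rho z u t ->
  (\sum_(i < size u) ((seg u i).2 + nth 0 t i) <= L)%N ->
  \sum_(i < size u) Phi (seg u i).1 (seg u i).2 <=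
    Phi z L + (size u)%:R * K + (L - \sum_(i < size u) (seg u i).2)%:R * C.
Proof.
move=> hK hC re uG sh; set pos := fun j => (\sum_(i < j) ((seg u i).2 + nth 0 t i))%N.
move=> posL.
have step j : (j <= size u)%N -> \sum_(i < j) Phi (seg u i).1 (seg u i).2 <=
    Phi z (pos j) + j%:R * K + (\sum_(i < j) nth 0 t i)%:R * C.
  elim: j => [|j IH] ju; first by rewrite /pos !big_ord0 /birkhoff big_ord0 !mul0r !addr0.
  rewrite /pos !big_ord_recr /= -/(pos j) !birkhoffD -addn1 !natrD !mulrDl mul1r.
  have h1 := IH (ltnW ju).
  have h2 : Phi (seg u j).1 (seg u j).2 <= Phi (iter (pos j) f z) (seg u j).2 + K.
    have uj : G ((seg u j).1, (seg u j).2).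
      by have := uG _ (mem_nth (point, 0%N) ju); rewrite -/(seg u j); case: (seg u j).
    have := hK _ _ (iter (pos j) f z) uj; rewrite (dn_sym f H).
    move=> /(_ (lt_le_trans (sh j ju) re)); rewrite ler_norml; lra.
  have := birkhoff_abs (iter (seg u j).2 f (iter (pos j) f z)) (nth 0%N t j) hC.
  rewrite -iterD addnC ler_norml => /andP[h3 _].
  by move: h1 h2 h3; lra.
have h1 := step _ (leqnn _).
have h2 := birkhoff_abs (iter (pos (size u)) f z) (L - pos (size u)) hC.
have h3 : Phi z L = Phi z (pos (size u)) + Phi (iter (pos (size u)) f z) (L - pos (size u)).
  by rewrite -birkhoffD subnKC.
have h4 : (L - \sum_(i < size u) (seg u i).2 = \sum_(i < size u) nth 0 t i + (L - pos (size u)))%N.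
  have e : pos (size u) = (\sum_(i < size u) (seg u i).2 + \sum_(i < size u) nth 0 t i)%N by rewrite /pos big_split.
  rewrite -/(pos (size u)) in posL; move: posL; rewrite e; lia.
rewrite h4 natrD mulrDl h3; move: h2; rewrite ler_norml => /andP[h2 _]; lra.
Qed.

Lemma sum_blocks (F : nat -> nat) J m :
  (\sum_(i < J * m) F i = \sum_(j < J) \sum_(i < m) F (j * m + i))%N.
Proof.
elim: J => [|J IH]; first by rewrite mul0n !big_ord0.
by rewrite big_ord_recr /= mulSnr big_split_ord /= IH.
Qed.

Lemma sumr_blocks (F : nat -> R) J m :
  \sum_(i < J * m) F i = \sum_(j < J) \sum_(i < m) F (j * m + i)%N.
Proof.
elim: J => [|J IH]; first by rewrite mul0n !big_ord0.
by rewrite big_ord_recr /= mulSnr big_split_ord /= IH.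
Qed.

(* Gluing arbitrarily many letters compares the J-th power of the sum over the alphabet with a
   partition sum of length about J * l; the keys and the gap lengths are the only loss. *)
Lemma letter_sum (G : set (X * nat)) (P rho epsB K C r : R) (A T : finType) (u : A -> seq (X * nat))
    (key : A -> T) m tau l D :
  (forall e : R, 0 < e -> exists n0, forall n E, (n0 <= n)%N -> uniq E -> sep d f n r E ->
     psum f phi E n <= expR (n%:R * (P + e))) ->
  (forall x n y, G (x, n) -> dn d f n x y < epsB -> `|Phi x n - Phi y n| <= K) ->
  (forall x, `|phi x| <= C) -> rho <= epsB -> 0 <= r -> (0 < m)%N -> (0 < tau)%N -> 0 <= C ->
  (forall v, (forall a, a \in v -> G a) ->
    exists y t, (forall i, (nth 0 t i <= tau)%N) /\ shadows rho y v t) ->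
  (forall a, size (u a) = m) -> (forall a b, b \in u a -> G b) ->
  (forall a b, key a = key b -> (\sum_(i < m) (seg (u a) i).2 = \sum_(i < m) (seg (u b) i).2)%N) ->
  (forall a, (\sum_(i < m) (seg (u a) i).2 <= l <= \sum_(i < m) (seg (u a) i).2 + D)%N) ->
  (forall a b z z' t, a <> b -> key a = key b -> (forall i, (nth 0 t i <= tau)%N) ->
     shadows rho z (u a) t -> shadows rho z' (u b) t ->
     exists2 k, (k < l + m * tau)%N & r < d (iter k f z) (iter k f z')) ->
  \sum_a expR (\sum_(i < m) Phi (seg (u a) i).1 (seg (u a) i).2) <=
    #|T|%:R * (tau.+1 ^ m)%:R * expR (m%:R * K + (m * tau + D)%:R * C) * expR ((l + m * tau)%:R * P).
Proof.
move=> hP hK hC re r0 m0 tau0 C0 hspec um uG ulen ul usep.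
set W := \sum_a _; set Q := #|T|%:R * _ * _.
have W0 : 0 <= W by apply: sumr_ge0 => a _; exact: expR_ge0.
have Lm0 : (0 < l + m * tau)%N by rewrite addn_gt0 muln_gt0 m0 tau0 orbT.
pose ph (a : A) := \sum_(i < m) Phi (seg (u a) i).1 (seg (u a) i).2.
have key1 (e : R) : 0 < e -> W <= Q * expR ((l + m * tau)%:R * (P + e)).
  move=> e0; have [n0 hn0] := hP e e0.
  (* J makes the length L reach the threshold n0 of the upper bound. This bound has no prefactor, so
     the J-th root returns an estimate for one letter. *)
  pose J := n0.+1; pose L := (J * (l + m * tau))%N.
  have n0L : (n0 <= L)%N by apply: (@leq_trans J) => //; rewrite leq_pmulr.
  pose v (th : {ffun 'I_J -> A}) := mkseq (fun i => (seg (u (th (inord (i %/ m)))) (i %% m))) (J * m).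
  have vsz th : size (v th) = (J * m)%N by rewrite size_mkseq.
  have vnth th (j : 'I_J) i : (i < m)%N -> (seg (v th) (j * m + i)) = (seg (u (th j)) i).
    move=> im; rewrite /seg nth_mkseq; last first.
      by apply: (@leq_trans (j.+1 * m)); [rewrite mulSnr ltn_add2l|rewrite leq_mul2r ltn_ord orbT].
    by rewrite divnMDl// divn_small// addn0 inord_val modnMDl modn_small.
  have vlen th (j : nat) : (j <= J)%N -> (\sum_(i < j * m) (seg (v th) i).2 =
      \sum_(j' < j) \sum_(i < m) (seg (u (th (inord j'))) i).2)%N.
    move=> jJ; rewrite (sum_blocks (fun i => (seg (v th) i).2)); apply: eq_bigr => j' _; apply: eq_bigr => i _.
    have j'J : (j' < J)%N by exact: leq_trans jJ.
    by rewrite -(vnth th (inord j') i)// inordK.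
  have /choice[yt hyt] : forall th, exists yt : X * seq nat,
      (forall i, (nth 0 yt.2 i <= tau)%N) /\ shadows rho yt.1 (v th) yt.2.
    move=> th; have [|y [t h]] := hspec (v th); last by exists (y, t).
    move=> a /mapP[i]; rewrite mem_iota add0n => /andP[_ iJ] ->.
    by apply: (uG (th (inord (i %/ m)))); rewrite mem_nth// um ltn_pmod.
  pose y th := (yt th).1; pose t th i := nth 0%N (yt th).2 i.
  have tt th i : (t th i <= tau)%N by have [h _] := hyt th; exact: h.
  pose start th j := (\sum_(i < j * m) ((seg (v th) i).2 + t th i))%N.
  have startE th j : (j <= J)%N -> (start th j = \sum_(j' < j) \sum_(i < m) (seg (u (th (inord j'))) i).2 +
      \sum_(i < j * m) t th i)%N.
    by move=> jJ; rewrite /start big_split /= vlen.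
  have start_le th j : (j <= J)%N -> (start th j <= j * (l + m * tau))%N.
    move=> jJ; rewrite startE// mulnDr leq_add//.
      apply: (@leq_trans (\sum_(j' < j) l)); last by rewrite sum_nat_const card_ord.
      by apply: leq_sum => j' _; case/andP: (ul (th (inord j'))).
    apply: (@leq_trans (\sum_(i < j * m) tau)); first by apply: leq_sum => i _; exact: tt.
    by rewrite sum_nat_const card_ord mulnA.
  have sh th (j : 'I_J) : shadows rho (iter (start th j) f (y th)) (u (th j)) (mkseq (fun i => t th (j * m + i)%N) m).
    move=> i; rewrite um => im.
    have [_ /(_ (j * m + i)%N)] := hyt th; rewrite vsz vnth//.
    have -> : (j * m + i < J * m)%N.
      by apply: (@leq_trans (j.+1 * m)); [rewrite mulSnr ltn_add2l|rewrite leq_mul2r ltn_ord orbT].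
    move=> /(_ isT); rewrite big_split_ord /= addnC iterD.
    rewrite -/(start th j) (eq_bigr (fun i' : 'I_i => ((seg (u (th j)) (i')).2 + nth 0 (mkseq (fun i => t th (j * m + i)) m) i')%N)); first by [].
    move=> i' _; have i'm := ltn_trans (ltn_ord i') im.
    by rewrite vnth// nth_mkseq.
  (* Words with equal keys and equal gap lengths have their letters at the same times, so a letter
     in which they differ separates the gluings. *)
  pose ky (th : {ffun 'I_J -> A}) := ([ffun j => key (th j)] : {ffun 'I_J -> T},
                 [ffun i : 'I_(J * m) => inord (t th i)] : {ffun 'I_(J * m) -> 'I_tau.+1}).
  have dsep th th' : th <> th' -> ky th = ky th' -> r < dn d f L (y th) (y th').
    move=> thth' [/ffunP k1 /ffunP k2].
    have kk j : key (th j) = key (th' j) by have := k1 j; rewrite !ffunE.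
    have tE i : (i < J * m)%N -> t th i = t th' i.
      move=> iJ; have := k2 (Ordinal iJ); rewrite !ffunE /= => /(congr1 val) /=.
      by rewrite !inordK ?ltnS ?tt.
    have [j thj] : exists j, th j <> th' j.
      apply: contrapT => h; apply: thth'; apply/ffunP => j.
      by apply: contrapT => hj; apply: h; exists j.
    have jJ : (j <= J)%N by exact: ltnW.
    have sE : start th j = start th' j.
      rewrite !startE//; congr (_ + _)%N; first by apply: eq_bigr => j' _; exact: ulen.
      apply: eq_bigr => i _; apply: tE; apply: leq_trans (ltn_ord i) _.
      by rewrite leq_mul2r jJ orbT.
    have tmE : mkseq (fun i => t th (j * m + i)%N) m = mkseq (fun i => t th' (j * m + i)%N) m.
      apply/eq_in_map => i; rewrite mem_iota add0n => /andP[_ im]; apply: tE.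
      by apply: (@leq_trans (j.+1 * m)); [rewrite mulSnr ltn_add2l|rewrite leq_mul2r ltn_ord orbT].
    have tl i : (nth 0 (mkseq (fun i => t th (j * m + i)%N) m) i <= tau)%N.
      have [im|im] := ltnP i m; last by rewrite nth_default// size_mkseq.
      by rewrite nth_mkseq.
    have sh' := sh th' j; rewrite -tmE in sh'.
    have [k kl hk] := usep _ _ _ _ _ thj (kk j) tl (sh th j) sh'.
    rewrite ltNge; apply/negP => /(dn_leP _ _ _ _ _ r0) /(_ (k + start th j)%N).
    have kL : (k + start th j < L)%N.
      apply: (@leq_trans (j.+1 * (l + m * tau))); last by rewrite leq_mul2r ltn_ord orbT.
      by rewrite mulSn; exact: leq_trans (leq_add kl (start_le th j jJ)) _.
    by move=> /(_ kL); rewrite !iterD {2}sE leNgt hk.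
  have hsum := keyed_sum r0 (fun E => hn0 L E n0L) dsep.
  have c1 : #|{: {ffun 'I_J -> T} * {ffun 'I_(J * m) -> 'I_tau.+1}}|%:R = (#|T|%:R * (tau.+1 ^ m)%:R) ^+ J :> R.
    by rewrite card_prod !card_ffun !card_ord natrM exprMn natrX -!natrX -expnM mulnC.
  have WJ : W ^+ J = \sum_(th : {ffun 'I_J -> A}) expR (\sum_j ph (th j)).
    rewrite -[in LHS](card_ord J) -prodr_const bigA_distr_bigA /=.
    by apply: eq_bigr => th _; rewrite expR_sum.
  have phle (th : {ffun 'I_J -> A}) : \sum_j ph (th j) <= Phi (y th) L + J%:R * (m%:R * K + (m * tau + D)%:R * C).
    have vG a : a \in v th -> G a.
      move=> /mapP[i]; rewrite mem_iota add0n => /andP[_ iJ] ->.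
      by apply: (uG (th (inord (i %/ m)))); rewrite mem_nth// um ltn_pmod.
    have := @shadow_birkhoff G rho epsB K C (y th) (v th) (yt th).2 L hK hC re vG (proj2 (hyt th)).
    rewrite vsz -/(start th J) => /(_ (start_le th J (leqnn J))).
    rewrite (sumr_blocks (fun i => Phi (seg (v th) i).1 (seg (v th) i).2)).
    rewrite (eq_bigr (fun j => ph (th j))); last first.
      by move=> j _; apply: eq_bigr => i _; rewrite vnth.
    move/le_trans; apply; rewrite -addrA lerD2l mulrDr natrM mulrA lerD2l mulrA -natrM ler_wpM2r// ler_nat.
    rewrite vlen// mulnDr /L leq_subLR.
    apply: (@leq_trans (\sum_(j' < J) (\sum_(i < m) (seg (u (th (inord j'))) i).2 + D) + J * (m * tau))%N).
      rewrite [X in (X <= _)%N]mulnDr leq_add2r; apply: (@leq_trans (\sum_(j' < J) l)); first by rewrite sum_nat_const card_ord.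
      by apply: leq_sum => j' _; case/andP: (ul (th (inord j'))).
    by rewrite big_split /= sum_nat_const card_ord -addnA leq_add2l addnC.
  have Q0 : 0 <= Q * expR ((l + m * tau)%:R * (P + e)).
    by rewrite !mulr_ge0 ?expR_ge0.
  rewrite -(@ler_pXn2r _ J)// ?nnegrE// WJ.
  apply: (@le_trans _ _ (\sum_th expR (Phi (y th) L) * expR (J%:R * (m%:R * K + (m * tau + D)%:R * C)))).
    by apply: ler_sum => th _; rewrite -expRD ler_expR.
  rewrite -mulr_suml; apply: le_trans (ler_wpM2r (expR_ge0 _) hsum) _.
  have -> : expR (L%:R * (P + e)) = expR ((l + m * tau)%:R * (P + e)) ^+ J.
    by rewrite -expRM_natl /L natrM mulrA.
  by rewrite c1 [expR (J%:R * _)]expRM_natl -!exprMn /Q mulrAC.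
rewrite leNgt; apply/negP; set a : R := (l + m * tau)%:R; set q := Q * _ => qW.
have a0 : 0 < a by rewrite ltr0n.
have key2 (e : R) : 0 < e -> W <= q * expR (a * e).
  by move=> /key1; rewrite /q -mulrA -expRD mulrDr.
have q0 : 0 < q.
  rewrite lt_neqAle eq_sym; apply/andP; split; last by rewrite !mulr_ge0 ?expR_ge0.
  by apply/eqP => q0; have := key2 1 ltr01; rewrite q0 mul0r leNgt -{1}q0 qW.
have WP : 0 < W := lt_trans q0 qW.
have Wq : 1 < W / q by rewrite ltr_pdivlMr ?mul1r.
have l0 : 0 < ln (W / q) by rewrite ln_gt0.
(* If W > q, this e makes the factor the square root of W / q, too small to bring q up to W. *)
have := key2 (ln (W / q) / (2 * a)) ltac:(by rewrite divr_gt0// mulr_gt0).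
have fld (b c : R) : 0 < b -> b * (c / (2 * b)) = c / 2 by move=> b0; field; rewrite gt_eqF.
rewrite fld//.
rewrite leNgt; have -> // : q * expR (ln (W / q) / 2) < W.
have Wqq : W = q * expR (ln (W / q)) by rewrite lnK ?posrE ?divr_gt0// mulrC divfK ?gt_eqF.
by rewrite {2}Wqq ltr_pM2l// ltr_expR; lra.
Qed.

(** Letters made of one segment, with a trivial key. Shadowing within rho <= r / 4 leaves a
    separation of at least r / 2, hence above r / 3. *)
Lemma separated_sum (G : set (X * nat)) (P epsB K C r : R) :
  (forall r : R, 0 < r -> forall e : R, 0 < e -> exists n0, forall n E, (n0 <= n)%N -> uniq E -> sep d f n r E ->
     psum f phi E n <= expR (n%:R * (P + e))) ->
  (forall x n y, G (x, n) -> dn d f n x y < epsB -> `|Phi x n - Phi y n| <= K) -> 0 < epsB ->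
  (forall x, `|phi x| <= C) -> 0 <= C -> (forall rho : R, 0 < rho -> W_spec d f G rho) -> 0 < r ->
  exists2 A : R, 0 < A & forall n E, uniq E -> sep d f n r E -> (forall x, x \in E -> G (x, n)) ->
    psum f phi E n <= A * expR (n%:R * P).
Proof.
move=> hP hK eB hC C0 hW r0; pose rho := Num.min (r / 4) epsB.
have rho0 : 0 < rho by rewrite lt_min eB andbT divr_gt0.
have rho1 : rho <= r / 4 by rewrite ge_min lexx.
have [tau tau0 hspec] := W_spec_shadows (hW _ rho0).
have r30 : 0 < r / 3 by rewrite divr_gt0.
exists (#|{: unit}|%:R * (tau.+1 ^ 1)%:R * expR (1 * K + (1 * tau + 0)%:R * C) * expR ((1 * tau)%:R * P)).
  by rewrite !mulr_gt0 ?expR_gt0// ?ltr0n ?expn_gt0// card_unit.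
move=> n E uE sE EG.
pose u (a : 'I_(size E)) := [:: (nth point E a, n)].
have -> : psum f phi E n = \sum_a expR (\sum_(i < 1) Phi (seg (u a) i).1 (seg (u a) i).2).
  rewrite /psum (big_nth point) big_mkord; apply: eq_bigr => a _.
  by rewrite big_ord1.
have rhoE : rho <= epsB by rewrite ge_min lexx orbT.
apply: le_trans (@letter_sum G P rho epsB K C (r / 3) _ _ u (fun=> tt) 1 tau n 0 (hP _ r30) hK hC rhoE
  (ltW r30) isT tau0 C0 hspec _ _ _ _ _) _ => //.
- by move=> a b; rewrite inE => /eqP->; apply: EG; exact: mem_nth.
- by move=> a b _; rewrite !big_ord1.
- by move=> a; rewrite !big_ord1 /= addn0 leqnn.
2: by rewrite [(n + _)%:R]natrD [(n%:R + _) * P]mulrDl [expR (n%:R * P + _)]expRD [expR (n%:R * P) * _]mulrC mulrA.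
move=> a b z z' t ab _ _ /(_ 0%N isT) sh /(_ 0%N isT) sh'.
rewrite big_ord0 /= in sh; rewrite big_ord0 /= in sh'.
have dab : r < dn d f n (nth point E a) (nth point E b).
  apply: sE; [exact: mem_nth|exact: mem_nth|].
  by move=> /eqP; rewrite nth_uniq// => /eqP/val_inj.
have [k kn hk] : exists2 k, (k < n)%N & r < d (iter k f (nth point E a)) (iter k f (nth point E b)).
  apply: contrapT => h; move: dab; rewrite ltNge => /negP; apply; apply/(dn_leP _ _ _ _ _ (ltW r0)) => k kn.
  by rewrite leNgt; apply/negP => hk; apply: h; exists k.
exists k; first exact: ltn_addr.
have h1 := elimT (dn_ltP d f n z (nth point E a) rho0) sh k kn.
have h2 := elimT (dn_ltP d f n z' (nth point E b) rho0) sh' k kn.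
have := dtri (iter k f (nth point E a)) (iter k f z) (iter k f (nth point E b)) H.
have := dtri (iter k f z) (iter k f z') (iter k f (nth point E b)) H.
rewrite (dsym (iter k f (nth point E a)) (iter k f z) H).
by lra.
Qed.

End Gluing.

Lemma middle_length (a b c k : nat) : k = (a + b + c)%N -> b = (k - a - c)%N.
Proof. by lia. Qed.

(** * Counting separated orbits *)

Section Counting.
Context {R : realType} {dsp : measure_display} {X : measurableType dsp}.
Context (d : X -> X -> R) (f finv : X -> X) (S : csys d f finv) (phi : X -> R).
Context (PP GG SS : set (X * nat)) (p g s : X -> nat -> nat).
Implicit Types (E : seq X) (mu nu : probability X R) (n : nat).

Let H := cs_space S.
Notation Phi := (birkhoff f phi).

(* eps is a scale of expansivity, epsB and K come from the Bowen property, r is the working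
   scale, and 4w separates P from the pressure of PP `|` SS. *)
Record scales (P eps epsB K C w r : R) : Prop := Scales {
  sc_dec : decomposition f PP GG SS p g s;
  sc_up : forall r : R, 0 < r -> forall e : R, 0 < e -> exists n0, forall n E, (n0 <= n)%N ->
    uniq E -> sep d f n r E -> psum f phi E n <= expR (n%:R * (P + e));
  sc_bowen : forall x n y, GG (x, n) -> dn d f n x y < epsB -> `|Phi x n - Phi y n| <= K;
  sc_C : forall x, `|phi x| <= C;
  sc_spec : forall rho : R, 0 < rho -> W_spec d f GG rho;
  sc_PS : forall r : R, 0 < r -> exists2 A : R, 0 < A & forall n E, uniq E -> sep d f n r E ->
    (forall x, x \in E -> (PP `|` SS) (x, n)) -> psum f phi E n <= A * expR (n%:R * (P - 4 * w));
  sc_r0 : 0 < r;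
  sc_rB : r < epsB;
  sc_w0 : 0 < w;
  sc_osc : forall x y, d x y <= r -> `|phi x - phi y| <= w;
  sc_eps : 2 * r <= eps;
  sc_exp : (Pexp_perp_eps d f finv phi eps < P%:E)%E }.

Context (P eps epsB K C w r : R) (sc : scales P eps epsB K C w r).

Let r0 := sc_r0 sc.
Let w0 := sc_w0 sc.

Lemma sc_C0 : 0 <= C.
Proof. exact: le_trans (normr_ge0 _) (sc_C sc point). Qed.

Lemma birkhoff_osc (a b : R) n x y : 0 <= b -> (forall x y, d x y <= b -> `|phi x - phi y| <= a) ->
  dn d f n x y <= b -> `|Phi x n - Phi y n| <= n%:R * a.
Proof.
move=> b0 osc /(dn_leP _ _ _ _ _ b0) h; rewrite /birkhoff -sumrB.
apply: le_trans (ler_norm_sum _ _ _) _; apply: (@le_trans _ _ (\sum_(k < n) a)).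
  by apply: ler_sum => k _; apply: osc; exact: h.
by rewrite sumr_const card_ord mulr_natl.
Qed.

Lemma birkhoff_split x n : (0 < n)%N -> let a := p x n in let b := g x n in let c := s x n in
  (a + b + c = n)%N /\ forall y, Phi y n = Phi y a + Phi (iter a f y) b + Phi (iter (a + b) f y) c.
Proof.
move=> n0 /=; have [e _ _ _] := (sc_dec sc).2 x n n0; split; first by rewrite -e.
by move=> y; rewrite {1}e birkhoffD -addrA birkhoffD addrA.
Qed.

(** By [sc_osc], the variation of Phi over prefix and suffix between the center and a point of its
    Bowen ball of radius r; the core varies by K only. *)
Definition defect x n : R := (p x n + s x n)%:R * w.

Lemma ball_birkhoff n x y : (0 < n)%N -> dn d f n x y <= r ->
  Phi y n <= Phi x n + K + defect x n.
Proof.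
move=> n0 xy; have [en spl] := birkhoff_split x n0; rewrite /defect !spl.
have [_ _ Gx _] := (sc_dec sc).2 x n n0.
have r0' := ltW r0.
have h1 : `|Phi x (p x n) - Phi y (p x n)| <= (p x n)%:R * w.
  apply: (birkhoff_osc r0' (sc_osc sc)); apply: le_trans xy; apply: (dn_mono d f); lia.
have h2 : `|Phi (iter (p x n) f x) (g x n) - Phi (iter (p x n) f y) (g x n)| <= K.
  apply: (sc_bowen sc Gx); apply: le_lt_trans (sc_rB sc); apply: le_trans xy.
  by apply: (dn_iter_le d f); lia.
have h3 : `|Phi (iter (p x n + g x n) f x) (s x n) - Phi (iter (p x n + g x n) f y) (s x n)| <= (s x n)%:R * w.
  apply: (birkhoff_osc r0' (sc_osc sc)); apply: le_trans xy; apply: (dn_iter_le d f); lia.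
by move: h1 h2 h3; rewrite natrD mulrDl !ler_norml => /andP[h1 _] /andP[h2 _] /andP[h3 _]; lra.
Qed.

Lemma sum_subseq (T : eqType) (L L' : seq T) (F : T -> R) : uniq L -> uniq L' ->
  {subset L <= L'} -> (forall t, 0 <= F t) -> \sum_(t <- L) F t <= \sum_(t <- L') F t.
Proof.
move=> uL uL' sub F0; rewrite [leRHS](bigID (fun t => t \in L)) /=.
have pq : perm_eq [seq t <- L' | t \in L] L.
  apply: uniq_perm => //; first exact: filter_uniq.
  by move=> t; rewrite mem_filter; case: (boolP (t \in L)) => // /sub ->.
rewrite -[X in _ <= X + _]big_filter (perm_big _ pq).
by rewrite lerDl; apply: sumr_ge0.
Qed.

Lemma sum_inj (T : eqType) E (L : seq T) (h : X -> T) (F : T -> R) : uniq E -> uniq L ->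
  {in E &, injective h} -> (forall x, x \in E -> h x \in L) -> (forall t, 0 <= F t) ->
  \sum_(x <- E) F (h x) <= \sum_(t <- L) F t.
Proof.
move=> uE uL hinj hL F0; rewrite -(big_map h xpredT F); apply: sum_subseq => //.
  by rewrite map_inj_in_uniq.
by move=> t /mapP[x xE ->]; exact: hL.
Qed.

Lemma geo_sum (N : nat) : \sum_(a < N) expR (- (a%:R * w)) <= (1 - expR (- w))^-1.
Proof.
have q1 : expR (- w) < 1 by rewrite expR_lt1 oppr_lt0.
rewrite -[leRHS]mul1r ler_pdivlMr ?subr_gt0//.
suff -> : (\sum_(a < N) expR (- (a%:R * w))) * (1 - expR (- w)) = 1 - expR (- (N%:R * w)).
  by rewrite gerBl expR_ge0.
elim: N => [|N IH]; first by rewrite big_ord0 !mul0r oppr0 expR0 subrr.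
rewrite big_ord_recr /= mulrDl IH -natr1 mulrDl mul1r opprD expRD; ring.
Qed.

Lemma nearest n (a : R) (B : set X) (L : seq X) : (forall z, B z -> exists2 x, x \in L & dn d f n x z <= a) ->
  exists h : X -> X, forall z, B z -> h z \in L /\ dn d f n (h z) z <= a.
Proof.
move=> hL; have /choice[h hh] : forall z, exists x, B z -> x \in L /\ dn d f n x z <= a.
  move=> z; have [/hL[x xL xz]|nB] := pselect (B z); first by exists x.
  by exists z.
by exists h.
Qed.

(* Points with prefix and suffix of given lengths are coded by separated sets of prefixes,
   cores and suffixes, so they are exponentially few when the prefix or the suffix is long. *)
Lemma cover_sum (a : R) : 0 < a <= r -> exists2 A : R, 0 < A & forall n E, (0 < n)%N ->
  uniq E -> sep d f n a E ->
  \sum_(x <- E) expR (Phi x n + 2 * defect x n) <= A * expR (n%:R * P).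
Proof.
move=> /andP[a0 ar]; have a20 : 0 < a / 2 by rewrite divr_gt0.
have a2r : a / 2 <= r by lra.
have a2 := ltW a20.
have [A1 A10 hA1] := sc_PS sc a20.
have [A3 A30 hA3] := separated_sum S (sc_up sc) (sc_bowen sc) (lt_trans r0 (sc_rB sc)) (sc_C sc) sc_C0 (sc_spec sc) a20.
pose q := (1 - expR (- w))^-1.
have q0 : 0 < q by rewrite invr_gt0 subr_gt0 expR_lt1 oppr_lt0.
exists (A1 * A3 * A1 * expR K * (q * q)); first by rewrite !mulr_gt0 ?expR_gt0.
move=> n E n0 uE sE.
have part (i j : nat) : (i <= n)%N -> (j <= n)%N ->
    \sum_(x <- E | (p x n == i) && (s x n == j)) expR (Phi x n + 2 * defect x n) <=
    A1 * A3 * A1 * expR K * expR (n%:R * P) * (expR (- (i%:R * w)) * expR (- (j%:R * w))).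
  move=> iN jN; rewrite -big_filter; set F := [seq x <- E | _].
  have FE x : x \in F -> [/\ x \in E, p x n = i & s x n = j].
    by rewrite mem_filter => /andP[/andP[/eqP ? /eqP ?] ?].
  have [->|[x0 x0F]] : F = [::] \/ exists x, x \in F.
    by case: F {FE} => [|x F]; [left|right; exists x; rewrite mem_head].
    by rewrite big_nil !mulr_ge0 ?expR_ge0// ltW.
  pose m := (n - i - j)%N.
  have gm x : x \in F -> [/\ g x n = m, (i + m + j = n)%N, PP (x, i), GG (iter i f x, m) & SS (iter (i + m) f x, j)].
    move=> /FE[_ pi sj]; have [e Px Gx Sx] := (sc_dec sc).2 x n n0.
    have gE : g x n = m by rewrite /m -pi -sj; exact: middle_length.
    by rewrite pi in Px Gx Sx; rewrite gE in Gx Sx; rewrite sj in Sx; split => //; rewrite -gE -pi -sj -e.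
  have [_ imj _ _ _] := gm x0 x0F.
  have [B1 [u1 s1 P1 n1]] := max_sep H (cs_f S) i [set x | PP (x, i)] a20.
  have [B2 [u2 s2 P2 n2]] := max_sep H (cs_f S) m [set x | GG (x, m)] a20.
  have [B3 [u3 s3 P3 n3]] := max_sep H (cs_f S) j [set x | SS (x, j)] a20.
  have [h1 hh1] := nearest n1; have [h2 hh2] := nearest n2; have [h3 hh3] := nearest n3.
  pose h x := (h1 x, (h2 (iter i f x), h3 (iter (i + m) f x))).
  pose W (t : X * (X * X)) := expR (Phi t.1 i) * (expR (Phi t.2.1 m) * expR (Phi t.2.2 j)).
  (* Two defects come from the weight and one from replacing prefix and suffix by points of nets.
     The pressure gap 4 w per bad time then leaves a factor exp(- w), which is summable over i and
     j. *)
  have c0 : 0 <= expR (K + 3 * ((i + j)%:R * w)) by exact: expR_ge0.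
  apply: (@le_trans _ _ (expR (K + 3 * ((i + j)%:R * w)) * \sum_(x <- F) W (h x))).
    rewrite mulr_sumr !big_seq; apply: ler_sum => x xF.
    have [gx _ Px Gx Sx] := gm x xF; have [_ px sx] := FE x xF.
    have [_ d1] := hh1 _ Px; have [B2x d2] := hh2 _ Gx; have [_ d3] := hh3 _ Sx.
    rewrite /W /= -!expRD ler_expR /defect px sx.
    have [_ /(_ x)] := birkhoff_split x n0; rewrite px gx sx => ->.
    have osc' y z k : dn d f k y z <= a / 2 -> `|Phi y k - Phi z k| <= k%:R * w.
      by move=> yz; apply: (birkhoff_osc (ltW r0) (sc_osc sc)); exact: le_trans a2r.
    have e1 := osc' _ _ _ d1; have e3 := osc' _ _ _ d3.
    have e2 : `|Phi (h2 (iter i f x)) m - Phi (iter i f x) m| <= K.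
      apply: (sc_bowen sc (P2 _ B2x)); apply: le_lt_trans (sc_rB sc); exact: le_trans d2 a2r.
    move: e1 e2 e3; rewrite natrD mulrDl !ler_norml => /andP[e1 _] /andP[e2 _] /andP[e3 _]; lra.
  apply: (@le_trans _ _ (expR (K + 3 * ((i + j)%:R * w)) * (psum f phi B1 i * (psum f phi B2 m * psum f phi B3 j)))).
    rewrite ler_wpM2l//.
    pose L := [seq (t1, t2) | t1 <- B1, t2 <- [seq (t3, t4) | t3 <- B2, t4 <- B3]].
    apply: (@le_trans _ _ (\sum_(t <- L) W t)).
      apply: sum_inj => //.
      - exact: filter_uniq.
      - apply: allpairs_uniq => //; last by move=> [? ?] [? ?] _ _ [-> ->].
        by apply: allpairs_uniq => //; move=> [? ?] [? ?] _ _ [-> ->].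
      (* Points with the same three codes are a-close on prefix, core and suffix, which contradicts
         separation. *)
      - move=> x y xF yF [e1 e2 e3]; have [_ _ Px Gx Sx] := gm x xF; have [_ _ Py Gy Sy] := gm y yF.
        have [xE _ _] := FE x xF; have [yE _ _] := FE y yF.
        have [//|/eqP xy] := eqVneq x y; have := sE x y xE yE xy; rewrite ltNge => /negP[].
        have tri u v z k : dn d f k u v <= a / 2 -> dn d f k u z <= a / 2 -> dn d f k v z <= a.
          by move=> uv uz; apply: le_trans (dn_tri f H k v u z) _; rewrite (dn_sym f H) in uv; lra.
        have t1 := tri _ _ _ _ (hh1 _ Px).2; rewrite e1 in t1; have {}t1 := t1 _ (hh1 _ Py).2.
        have t2 := tri _ _ _ _ (hh2 _ Gx).2; rewrite e2 in t2; have {}t2 := t2 _ (hh2 _ Gy).2.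
        have t3 := tri _ _ _ _ (hh3 _ Sx).2; rewrite e3 in t3; have {}t3 := t3 _ (hh3 _ Sy).2.
        have nij : (n <= i + (m + j))%N by rewrite addnA imj.
        apply: (dn_split (ltW a0) nij t1).
        by apply: (dn_split (ltW a0) (leqnn _) t2); rewrite -!iterD addnC.
      - move=> x xF; have [_ _ Px Gx Sx] := gm x xF.
        apply/allpairsP; exists (h1 x, (h2 (iter i f x), h3 (iter (i + m) f x))) => /=.
        split => //; first exact: (hh1 _ Px).1.
        apply/allpairsP; exists (h2 (iter i f x), h3 (iter (i + m) f x)); split => //=; first exact: (hh2 _ Gx).1.
        exact: (hh3 _ Sx).1.
      by move=> t; rewrite !mulr_ge0 ?expR_ge0.
    rewrite le_eqVlt; apply/orP; left; apply/eqP.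
    rewrite /L big_allpairs_dep /psum big_distrl /=; apply: eq_bigr => t1 _.
    rewrite /W /= -mulr_sumr; congr (_ * _); rewrite big_allpairs_dep big_distrl /=.
    by apply: eq_bigr => t2 _; rewrite /= mulr_sumr.
  have b1 := hA1 i B1 u1 s1 (fun x xB => or_introl (P1 x xB)).
  have b2 := hA3 m B2 u2 s2 P2.
  have b3 := hA1 j B3 u3 s3 (fun x xB => or_intror (P3 x xB)).
  have pge B k : 0 <= psum f phi B k by apply: sumr_ge0 => x _; exact: expR_ge0.
  apply: (@le_trans _ _ (expR (K + 3 * ((i + j)%:R * w)) * (A1 * expR (i%:R * (P - 4 * w)) *
      (A3 * expR (m%:R * P) * (A1 * expR (j%:R * (P - 4 * w))))))).
    rewrite ler_wpM2l//; apply: ler_pM => //; first by rewrite mulr_ge0.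
    exact: ler_pM.
  have -> : n%:R * P = i%:R * P + m%:R * P + j%:R * P by rewrite -imj !natrD !mulrDl.
  set Q := A1 * A3 * A1.
  have -> : expR (K + 3 * ((i + j)%:R * w)) * (A1 * expR (i%:R * (P - 4 * w)) *
      (A3 * expR (m%:R * P) * (A1 * expR (j%:R * (P - 4 * w))))) =
     Q * (expR (K + 3 * ((i + j)%:R * w)) * expR (i%:R * (P - 4 * w)) * expR (m%:R * P) * expR (j%:R * (P - 4 * w))).
    by rewrite /Q; ring.
  have -> : Q * expR K * expR (i%:R * P + m%:R * P + j%:R * P) * (expR (- (i%:R * w)) * expR (- (j%:R * w))) =
    Q * (expR K * expR (i%:R * P + m%:R * P + j%:R * P) * (expR (- (i%:R * w)) * expR (- (j%:R * w)))) by ring.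
  rewrite -!expRD le_eqVlt; apply/orP; left; apply/eqP; congr (_ * expR _).
  by rewrite natrD; ring.
pose k x : 'I_n.+1 * 'I_n.+1 := (inord (p x n), inord (s x n)).
have kE x (i j : 'I_n.+1) : (k x == (i, j)) = (p x n == i) && (s x n == j).
  have [e _ _ _] := (sc_dec sc).2 x n n0.
  have pn : (p x n < n.+1)%N by rewrite ltnS [leqRHS]e -addnA leq_addr.
  have sn : (s x n < n.+1)%N by rewrite ltnS [leqRHS]e leq_addl.
  by rewrite /k xpair_eqE -!val_eqE [X in (X == _) && _]inordK// [X in _ && (X == _)]inordK.
pose M (i j : 'I_n.+1) := expR (- (i%:R * w)) * expR (- (j%:R * w)).
have pij (ij : 'I_n.+1 * 'I_n.+1) :
    \sum_(x <- E | k x == ij) expR (Phi x n + 2 * defect x n) <=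
    A1 * A3 * A1 * expR K * expR (n%:R * P) * M ij.1 ij.2.
  case: ij => i j; rewrite (eq_bigl _ _ (fun x => kE x i j)).
  exact: part (ltn_ord i) (ltn_ord j).
rewrite (partition_big k xpredT) //=; apply: le_trans (ler_sum _ (fun ij _ => pij ij)) _.
rewrite -mulr_sumr -(pair_big xpredT xpredT M) /=.
rewrite -big_distrlr /=.
rewrite [leRHS]mulrAC ler_wpM2l//; first by rewrite !mulr_ge0 ?expR_ge0// ltW.
have geo := geo_sum n.+1; have geo0 : 0 <= \sum_(i < n.+1) expR (- (i%:R * w)) by apply: sumr_ge0 => i _; exact: expR_ge0.
exact: ler_pM.
Qed.

End Counting.

(** * Free energy against partition sums *)

Section Equilibrium.
Context {R : realType} {dsp : measure_display} {X : measurableType dsp}.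
Context (d : X -> X -> R) (f finv : X -> X) (S : csys d f finv) (phi : X -> R).
Context (cphi : dcont_real d phi).
Context (PP GG SS : set (X * nat)) (p g s : X -> nat -> nat).
Context (P eps epsB K C w r : R) (sc : scales d f finv phi PP GG SS p g s P eps epsB K C w r).
Implicit Types (E : seq X) (mu nu : probability X R) (n : nat).

Let H := cs_space S.
Let r0 := sc_r0 sc.
Let w0 := sc_w0 sc.
Notation Phi := (birkhoff f phi).
Notation dft := (defect p s w).

(** An upper bound for Phi on the Bowen ball of radius r around x, by [ball_birkhoff]. *)
Definition hat x n := Phi x n + K + dft x n.

Lemma sep_cod (Z : set X) n (a : R) : measurable Z -> 0 < a -> exists (E E' : seq X) (N : nat) (c : X -> 'I_N),
  [/\ uniq E /\ sep d f n a E /\ (forall x, x \in E -> Z x), uniq E' /\ sep d f n a E',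
      N = size (E ++ E') /\ mcod c, forall x, dn d f n (nth point (E ++ E') (c x)) x <= a &
      forall x, Z x <-> (c x < size E)%N].
Proof.
move=> mZ a0.
have [E [uE sE EZ nE]] := max_sep H (cs_f S) n Z a0.
have [E' [uE' sE' EZ' nE']] := max_sep H (cs_f S) n (~` Z) a0.
pose B i := [set y | dn d f n (nth point (E ++ E') i) y <= a].
have mB i : measurable (B i) by apply: (closed_measurable H); exact: bowen_closed (cs_f S) _ _ _.
pose F i := (if (i < size E)%N then Z else ~` Z) `&` B i.
have mF i : measurable (F i) by apply: measurableI => //; case: ifP => _ //; exact: measurableC.
pose L := mkseq F (size (E ++ E')).
have Lsz : size L = size (E ++ E') by rewrite size_mkseq.
have LF i : (i < size L)%N -> nth set0 L i = F i by rewrite Lsz => iL; rewrite nth_mkseq.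
have [||c [mc cF]] := first_cod (A := L).
- by move=> i iL; rewrite LF.
- move=> x; have [Zx|Zx] := pselect (Z x).
    have [y yE yx] := nE x Zx; have iE : (index y E < size E)%N by rewrite index_mem.
    have iL : (index y E < size L)%N by rewrite Lsz size_cat ltn_addr.
    exists (index y E) => //; rewrite LF// /F iE; split => //.
    by rewrite /B /= nth_cat iE nth_index.
  have [y yE yx] := nE' x Zx; have iE : (index y E' < size E')%N by rewrite index_mem.
  have iL : (size E + index y E' < size L)%N by rewrite Lsz size_cat ltn_add2l.
  exists (size E + index y E')%N => //; rewrite LF// /F ltnNge leq_addr /=; split => //.
  by rewrite /B /= nth_cat ltnNge leq_addr /= addKn nth_index.
have cFx x : F (c x) x.
  have : (c @^-1` [set c x]) x by [].
  by rewrite cF LF// => -[].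
exists E, E', (size L), c; split => //.
  by move=> x; case: (cFx x).
move=> x; have := cFx x; rewrite /F; case: ifPn => _ [].
  by [].
by move=> nZ _; split.
Qed.

(** [entropy_bound] with weights tilted by lam on Z. A lower bound a stands for the free energy,
    whose finiteness is not assumed. *)
Lemma entropy_split nu (Z : set X) n (lam : R) : finvariant f nu -> pr nu (NE d f finv eps) = 0 ->
  measurable Z -> (0 < n)%N -> exists E E', [/\ uniq E /\ sep d f n r E /\ (forall x, x \in E -> Z x),
   uniq E' /\ sep d f n r E' & forall a : R, (a%:E <= free_energy nu f phi)%E ->
   expR (n%:R * a + lam * pr nu Z) <=
     expR lam * (\sum_(x <- E) expR (hat x n)) + \sum_(x <- E') expR (hat x n)].
Proof.
move=> inu nN mZ n0; have n0' : 0 < n%:R :> R by rewrite ltr0n.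
have [E [E' [N [c [hE hE' [eN mc] cn cZ]]]]] := sep_cod n mZ r0.
exists E, E'; split => // a aF.
set Q := (X in _ <= X); pose B := ln Q.
have bI : bmeas (\1_Z : X -> R) by exact: bmeas_indic.
have bPhi : bmeas (Phi ^~ n) by exact: (dcont_bmeas H (birkhoff_dcont S cphi n)).
pose W (t : nat) := hat (nth point (E ++ E') t) n + (if (t < size E)%N then lam else 0).
have gW x : Phi x n + lam * \1_Z x <= W (c x).
  apply: lerD; first exact: (ball_birkhoff sc n0 (cn x)).
  rewrite indicE; have [Zx|Zx] := pselect (Z x).
    by rewrite mem_set// mulr1 (proj1 (cZ x) Zx).
  rewrite memNset// mulr0; case: ifPn => // h.
  by case: Zx; apply/cZ.
have sumW : \sum_(t : 'I_N) expR (W t) = Q.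
  rewrite -(big_mkord xpredT (fun t => expR (W t))) eN size_cat.
  rewrite (@big_cat_nat _ _ _ (size E))//=; last exact: leq_addr.
  congr (_ + _).
    rewrite mulr_sumr [RHS](big_nth point) !big_nat; apply: eq_bigr => i /andP[_ iE].
    by rewrite /W iE nth_cat iE expRD mulrC.
  rewrite [RHS](big_nth point) -{1}(add0n (size E)) big_addn addKn !big_nat; apply: eq_bigr => i _.
  by rewrite /W nth_cat !ltnNge leq_addl /= addnK addr0.
have Q0 : 0 < Q.
  rewrite -sumW (bigD1 (c point)) //= ltr_pwDl ?expR_gt0//.
  by apply: sumr_ge0 => t _; exact: expR_ge0.
have dc x y : c x = c y -> forall k, (k < n)%N -> d (iter k f x) (iter k f y) <= eps.
  move=> cxy k kn; apply: le_trans (sc_eps sc).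
  have h1 := elimT (dn_leP d f n _ _ (ltW r0)) (cn x) k kn.
  have h2 := elimT (dn_leP d f n _ _ (ltW r0)) (cn y) k kn.
  rewrite -cxy in h2.
  have := dtri (iter k f x) (iter k f (nth point (E ++ E') (c x))) (iter k f y) H.
  by rewrite (dsym (iter k f x) (iter k f (nth _ _ _)) H); lra.
have : (free_energy nu f phi <= ((B - lam * pr nu Z) / n%:R)%:E)%E.
  apply: (free_le S inu cphi) => T c' mc'.
  have bg : bmeas (fun x => Phi x n + lam * \1_Z x) by apply: bmeasD => //; exact: bmeasZ.
  have := entropy_bound (W := fun t : 'I_N => W t) S inu nN n0 mc mc' dc bg gW; rewrite sumW -/B.
  rewrite ExD//; last exact: bmeasZ.
  rewrite ExZ// Ex_indic// (Ex_birkhoff S cphi)// => h.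
  by rewrite ler_pdivlMr// /FE mulrDl; lra.
move=> /(le_trans aF); rewrite lee_fin ler_pdivlMr// => h.
by rewrite -(lnK Q0) ler_expR -/B; lra.
Qed.

Lemma hat_sum : exists2 A : R, 0 < A & forall n E, (0 < n)%N -> uniq E -> sep d f n r E ->
  \sum_(x <- E) expR (hat x n + dft x n) <= A * expR (n%:R * P).
Proof.
have [|A A0 hA] := cover_sum S sc (a := r); first by rewrite r0 lexx.
exists (expR K * A); first by rewrite mulr_gt0 ?expR_gt0.
move=> n E n0 uE sE.
apply: (@le_trans _ _ (expR K * \sum_(x <- E) expR (Phi x n + 2 * dft x n))).
  rewrite mulr_sumr; apply: ler_sum => x _; rewrite -expRD ler_expR /hat; lra.
by rewrite -mulrA ler_wpM2l ?expR_ge0// hA.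
Qed.

Lemma defect_ge0 x n : 0 <= dft x n.
Proof. by rewrite /defect mulr_ge0// ltW. Qed.

Lemma hat_sum_le : exists2 A : R, 0 < A & forall n E, (0 < n)%N -> uniq E -> sep d f n r E ->
  \sum_(x <- E) expR (hat x n) <= A * expR (n%:R * P).
Proof.
have [A A0 hA] := hat_sum; exists A => // n E n0 uE sE; apply: le_trans (hA n E n0 uE sE).
by apply: ler_sum => x _; rewrite ler_expR lerDl defect_ge0.
Qed.

Lemma free_le_off_NE nu : finvariant f nu -> pr nu (NE d f finv eps) = 0 ->
  (free_energy nu f phi <= P%:E)%E.
Proof.
move=> inu nN; rewrite leNgt; apply/negP => PF.
have [a Pa aF] : exists2 a : R, P < a & (a%:E <= free_energy nu f phi)%E.
  case: (free_energy nu f phi) PF => [b| |]//; rewrite ?lte_fin => Pb.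
    by exists ((P + b) / 2); rewrite ?lee_fin; lra.
  by exists (P + 1); rewrite ?leey//; lra.
have [A A0 hA] := hat_sum_le.
have : a - P <= 0.
  apply: (@arch_le0 _ _ (Num.max 0 (ln (2 * A)))) => -[|n]; first by rewrite mul0r le_max lexx.
  rewrite le_max; apply/orP; right.
  have [E [E' [[uE [sE _]] [uE' sE'] /(_ a aF)]]] := entropy_split 0 inu nN (@measurableT _ X) (ltn0Sn n).
  rewrite mul0r addr0 expR0 mul1r => h.
  have A20 : 0 < 2 * A by lra.
  have : expR (n.+1%:R * a) <= 2 * A * expR (n.+1%:R * P).
    by have := hA _ _ (ltn0Sn n) uE sE; have := hA _ _ (ltn0Sn n) uE' sE'; lra.
  by rewrite -{1}(lnK A20) -expRD ler_expR mulrBr; lra.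
by lra.
Qed.

Lemma free_le_pressure nu : finvariant f nu -> (free_energy nu f phi <= P%:E)%E.
Proof.
move=> inu; rewrite leNgt; apply/negP => /(off_NE S cphi inu (sc_exp sc))[mu [imu muN]].
by rewrite ltNge free_le_off_NE.
Qed.

Lemma equilibrium_NE nu : finvariant f nu -> (P%:E <= free_energy nu f phi)%E ->
  pr nu (NE d f finv eps) = 0.
Proof.
by move=> inu nuP; apply: (NE_null S cphi inu (sc_exp sc) nuP) => mu imu _; exact: free_le_pressure.
Qed.

(** The sum in [hat_sum] carries one more factor, the exponential of the defect. Points with p + s >
    M therefore contribute at most exp(- M w) times its bound, which for large M is at most half of
    the given lower bound. *)
Lemma trim_defect (be : R) : 0 < be -> exists (M : nat) (c : R), 0 < c /\ forall n E, (0 < n)%N ->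
  uniq E -> sep d f n r E -> be * expR (n%:R * P) <= \sum_(x <- E) expR (hat x n) ->
  c * expR (n%:R * P) <= psum f phi [seq x <- E | (p x n + s x n <= M)%N] n.
Proof.
move=> be0; have [A A0 hA] := hat_sum.
have [M hM] : exists M : nat, A * expR (- (M%:R * w)) <= be / 2.
  pose b := 2 * be^-1 * A; have b0 : 0 < b by rewrite !mulr_gt0 ?invr_gt0.
  exists (Num.truncn (b / w)).+1; set k := _.+1%:R.
  have kb : b <= k * w by rewrite -ler_pdivrMr// ltW// truncnS_gt.
  have e1 : b <= expR (k * w).
    by apply: le_trans kb _; apply: le_trans (expR_ge1Dx _); rewrite lerDr.
  rewrite expRN ler_pdivrMr ?expR_gt0// -ler_pdivrMl ?divr_gt0//.
  by rewrite invf_div.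
exists M, (expR (- (K + M%:R * w)) * (be / 2)); split.
  by rewrite mulr_gt0 ?expR_gt0// divr_gt0.
move=> n E n0 uE sE low; set G := [seq x <- E | _].
have eP := expR_gt0 (n%:R * P).
have tail : \sum_(x <- E | ~~ (p x n + s x n <= M)%N) expR (hat x n) <= be / 2 * expR (n%:R * P).
  apply: (@le_trans _ _ (expR (- (M%:R * w)) * \sum_(x <- E) expR (hat x n + dft x n))).
    rewrite mulr_sumr [leRHS](bigID (fun x => ~~ (p x n + s x n <= M)%N)) /=.
    rewrite -[leLHS]addr0; apply: lerD; last first.
      by apply: sumr_ge0 => x _; rewrite mulr_ge0 ?expR_ge0.
    apply: ler_sum => x; rewrite -ltnNge => xM; rewrite -expRD ler_expR addrC -addrA lerDl subr_ge0.
    by rewrite /defect ler_wpM2r ?(ltW w0)// ler_nat ltnW.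
  apply: (@le_trans _ _ (expR (- (M%:R * w)) * (A * expR (n%:R * P)))).
    by rewrite ler_wpM2l ?expR_ge0// hA.
  by rewrite mulrA ler_wpM2r ?(ltW eP)// mulrC.
have main : be / 2 * expR (n%:R * P) <= \sum_(x <- G) expR (hat x n).
  move: low; rewrite (bigID (fun x => (p x n + s x n <= M)%N)) /= -big_filter -/G.
  have key (a b c' : R) : b <= a -> 2 * a <= c' + b -> a <= c' by move=> *; lra.
  by move=> h; apply: key tail _; rewrite mulrA [2 * _]mulrC divfK.
rewrite -mulrA expRN ler_pdivrMl ?expR_gt0//; apply: le_trans main _.
rewrite /psum mulr_sumr !big_seq; apply: ler_sum => x; rewrite mem_filter => /andP[xM _].
rewrite -expRD ler_expR /hat /defect.
have : (p x n + s x n)%:R * w <= M%:R * w by rewrite ler_wpM2r ?(ltW w0)// ler_nat.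
lra.
Qed.

(* Inside a set of measure at least al, giving the weight lam to that set in the entropy
   bound forces the partition sum over the set itself to grow like exp (n P). *)
Lemma equilibrium_lower (al : R) : 0 < al -> exists (M : nat) (c : R), 0 < c /\
  forall nu (Z : set X) n, finvariant f nu -> (P%:E <= free_energy nu f phi)%E ->
    measurable Z -> al <= pr nu Z -> (0 < n)%N ->
    exists E, [/\ uniq E, sep d f n r E, forall x, x \in E -> Z x,
      forall x, x \in E -> (p x n + s x n <= M)%N & c * expR (n%:R * P) <= psum f phi E n].
Proof.
move=> al0; have [A' A'0 hA'] := hat_sum_le.
(* With this choice the left side is at least (A' + 1) exp(n P), while the complement of Z accounts
   for at most A' exp(n P); Z is left with exp(n P), up to the factor exp(lam). *)
pose lam := ln (A' + 1) / al.
have lam_al (b : R) : al <= b -> A' + 1 <= expR (lam * b).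
  move=> alb; rewrite -[leLHS](@lnK R) ?posrE; last by lra.
  rewrite ler_expR /lam mulrAC ler_pdivlMr// ler_wpM2l// ln_ge0//; lra.
have lam0 : 0 < (expR lam)^-1 by rewrite invr_gt0 expR_gt0.
have [M [c [c0 hc]]] := trim_defect lam0.
exists M, c; split => // nu Z n inu nuP mZ alZ n0.
have [E [E' [[uE [sE EZ]] [uE' sE'] /(_ P nuP)]]] := entropy_split lam inu (equilibrium_NE inu nuP) mZ n0.
rewrite expRD => h; have h' := hA' n E' n0 uE' sE'.
have eP := expR_gt0 (n%:R * P).
have low : (expR lam)^-1 * expR (n%:R * P) <= \sum_(x <- E) expR (hat x n).
  rewrite ler_pdivrMl ?expR_gt0//.
  have : expR (n%:R * P) * (A' + 1) <= expR (n%:R * P) * expR (lam * pr nu Z) by rewrite ler_pM2l// lam_al.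
  rewrite mulrDr mulr1 [expR (n%:R * P) * A']mulrC.
  lra.
have GE x : x \in [seq x <- E | (p x n + s x n <= M)%N] -> x \in E by rewrite mem_filter => /andP[].
exists [seq x <- E | (p x n + s x n <= M)%N]; split.
- exact: filter_uniq.
- by move=> x y /GE xE /GE yE; exact: sE.
- by move=> x /GE/EZ.
- by move=> x; rewrite mem_filter => /andP[].
exact: hc.
Qed.

End Equilibrium.

Lemma visit_length (k m n : nat) : (k + m <= n)%N -> (n - m = k + (n - (k + m)))%N.
Proof. by lia. Qed.

Lemma late_visits (N m n : nat) : (\sum_(k < n) (N < k + m)%N <= n + m - N)%N.
Proof.
elim: n => [|n IH]; first by rewrite big_ord0.
rewrite big_ord_recr /=; apply: leq_trans (leq_add IH (leqnn _)) _.
by case: ltnP => h; lia.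
Qed.

(** * The Gibbs property *)

Section GibbsMeasure.
Context {R : realType} {dsp : measure_display} {X : measurableType dsp}.
Context (d : X -> X -> R) (f finv : X -> X) (S : csys d f finv) (phi : X -> R).
Context (cphi : dcont_real d phi).
Context (PP GG SS : set (X * nat)) (p g s : X -> nat -> nat).
Context (P eps epsB K C w r : R) (sc : scales d f finv phi PP GG SS p g s P eps epsB K C w r).
Implicit Types (E : seq X) (mu nu : probability X R) (n : nat).

Let H := cs_space S.
Let r0 := sc_r0 sc.
Notation Phi := (birkhoff f phi).

Lemma prefix_code : exists2 A : R, 0 < A & forall k, exists (L : seq X) (V : X -> R) (h : X -> X),
  [/\ uniq L, forall x, h x \in L /\ dn d f k (h x) x <= r / 2, forall x, Phi x k <= V (h x) &
      \sum_(y <- L) expR (V y) <= A * expR (k%:R * P)].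
Proof.
have r20 : 0 < r / 2 by rewrite divr_gt0.
have [|A A0 hA] := cover_sum S sc (a := r / 2); first by rewrite r20; lra.
exists (Num.max 1 (expR K * A)); first by rewrite lt_max ltr01.
(* The decomposition concerns positive lengths; the empty prefix has a trivial code of weight 1,
   whence the maximum with 1. *)
case=> [|k].
  exists [:: point], (fun=> 0), (fun=> point); split => //.
  - by move=> x; rewrite mem_head /dn big_ord0 ltW.
  - by move=> x; rewrite /birkhoff big_ord0.
  - by rewrite big_seq1 mul0r expR0 mulr1 le_max lexx.
have [L [uL sL _ nL]] := max_sep H (cs_f S) k.+1 setT r20.
have [h hh] := nearest nL.
exists L, (fun x => hat f phi p s K w x k.+1), h; split => //.
- by move=> x; exact: hh.
- move=> x; apply: (ball_birkhoff sc) => //; have [_] := hh x I; lra.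
apply: (@le_trans _ _ (expR K * \sum_(y <- L) expR (Phi y k.+1 + 2 * defect p s w y k.+1))).
  rewrite mulr_sumr; apply: ler_sum => y _; rewrite -expRD ler_expR /hat.
  by have := defect_ge0 sc y k.+1; lra.
apply: (@le_trans _ _ (expR K * (A * expR (k.+1%:R * P)))).
  by rewrite ler_wpM2l ?expR_ge0// hA.
by rewrite mulrA ler_wpM2r ?expR_ge0// le_max lexx orbT.
Qed.

(* A separated orbit visiting the Bowen ball at time k is determined by its past and its future,
   and each of the two is counted by the uniform upper bound on partition sums. *)
Lemma ball_visits : exists2 A : R, 0 < A & forall n E k m z (a b : R), uniq E -> sep d f n r E ->
  (k + m <= n)%N -> 0 < a <= r / 2 -> (forall y, dn d f m z y < a -> Phi y m <= b) ->
  \sum_(x <- E | `[< dn d f m z (iter k f x) < a >]) expR (Phi x n) <= A * expR (b + (n - m)%:R * P).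
Proof.
have [A A0 hA] := prefix_code; exists (A * A); first by rewrite mulr_gt0.
move=> n E k m z a b uE sE kmn /andP[a0 ar] hb.
rewrite -big_filter; set F := [seq x <- E | _].
have FE x : x \in F -> x \in E /\ dn d f m z (iter k f x) < a.
  by rewrite mem_filter => /andP[/asboolP].
have [L1 [V1 [h1 [u1 n1 v1 s1]]]] := hA k.
have [L2 [V2 [h2 [u2 n2 v2 s2]]]] := hA (n - (k + m))%N.
pose h x := (h1 x, h2 (iter (k + m) f x)).
pose W (t : X * X) := expR (V1 t.1) * expR (V2 t.2).
have nE : (n = k + m + (n - (k + m)))%N by rewrite subnKC.
apply: (@le_trans _ _ (expR b * \sum_(x <- F) W (h x))).
  rewrite mulr_sumr !big_seq; apply: ler_sum => x /FE[xE xz].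
  rewrite /W /= -!expRD ler_expR {1}nE !birkhoffD.
  by have := v1 x; have := v2 (iter (k + m) f x); have := hb _ xz; lra.
pose L := [seq (t1, t2) | t1 <- L1, t2 <- L2].
have r20 : 0 <= r / 2 by rewrite divr_ge0// ltW.
have tri j u u' v : dn d f j u v <= r / 2 -> dn d f j u u' <= r / 2 -> dn d f j v u' <= r.
  by move=> uv uz; apply: le_trans (dn_tri f H j v u u') _; rewrite (dn_sym f H) in uv; lra.
apply: (@le_trans _ _ (expR b * \sum_(t <- L) W t)).
  rewrite ler_wpM2l ?expR_ge0//; apply: sum_inj.
  - exact: filter_uniq.
  - by apply: allpairs_uniq => //; move=> [? ?] [? ?] _ _ [-> ->].
  - move=> x y /FE[xE xz] /FE[yE yz] [e1 e2].
    have [//|/eqP xy] := eqVneq x y; have := sE x y xE yE xy; rewrite ltNge => /negP[].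
    have t1 : dn d f k x y <= r by apply: (tri _ (h1 x)); [exact: (n1 x).2|rewrite e1; exact: (n1 y).2].
    have t2 : dn d f m (iter k f x) (iter k f y) <= r.
      by apply: (tri _ z); apply: ltW; exact: lt_le_trans ar.
    have t3 : dn d f (n - (k + m)) (iter (k + m) f x) (iter (k + m) f y) <= r.
      by apply: (tri _ (h2 (iter (k + m) f x))); [exact: (n2 _).2|rewrite e2; exact: (n2 _).2].
    have l1 : (n <= k + (m + (n - (k + m))))%N by rewrite addnA -nE.
    apply: (dn_split (ltW r0) l1 t1).
    apply: (dn_split (ltW r0) (leqnn _) t2).
    by move: t3; rewrite [(k + m)%N]addnC !iterD.
  - move=> x xF; apply/allpairsP; exists (h x); split => //; [exact: (n1 _).1|exact: (n2 _).1].
  - by move=> t; rewrite mulr_ge0 ?expR_ge0.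
have -> : \sum_(t <- L) W t = (\sum_(t <- L1) expR (V1 t)) * (\sum_(t <- L2) expR (V2 t)).
  rewrite /L big_allpairs_dep big_distrl /=; apply: eq_bigr => t1 _.
  by rewrite mulr_sumr.
apply: (@le_trans _ _ (expR b * (A * expR (k%:R * P) * (A * expR ((n - (k + m))%:R * P))))).
  by rewrite ler_wpM2l ?expR_ge0// ler_pM//; apply: sumr_ge0 => t _; exact: expR_ge0.
rewrite (visit_length kmn).
rewrite natrD mulrDl !expRD le_eqVlt; apply/orP; left; apply/eqP; ring.
Qed.

Context (hatt : forall a : R, a < P -> exists mu, finvariant f mu /\ (a%:E <= free_energy mu f phi)%E).

(** For each n a measure off [NE] with free energy above P - 1 / n is used; the deficit costs only a
    factor exp(-1), so the exponent is exactly P. One of the two nets of [entropy_split] carries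
    half of the sum. *)
Lemma sep_lower : exists2 c : R, 0 < c & forall n, (0 < n)%N -> exists E, [/\ uniq E, sep d f n r E &
  c * expR (n%:R * P) <= psum f phi E n].
Proof.
have be0 : 0 < expR (-1) / 2 :> R by rewrite divr_gt0 ?expR_gt0.
have [M [c [c0 hc]]] := trim_defect S sc be0.
exists c => // n n0; have n0' : 0 < n%:R :> R by rewrite ltr0n.
have [a [a1 a2 a3]] : exists a : R, [/\ (Pexp_perp_eps d f finv phi eps < a%:E)%E, P - n%:R^-1 <= a & a < P].
  have ni : 0 < n%:R^-1 :> R by rewrite invr_gt0.
  case: (Pexp_perp_eps d f finv phi eps) (sc_exp sc) => [b| |] //=; rewrite ?lte_fin => bP.
    exists (Num.max ((b + P) / 2) (P - n%:R^-1)); split; rewrite ?lte_fin ?lt_max ?le_max ?gt_max ?lexx ?orbT//.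
      by apply/orP; left; lra.
    by apply/andP; split; lra.
  by exists (P - n%:R^-1); split; rewrite ?ltNyr//; lra.
have [|mu [imu muF]] := hatt (a := (a + P) / 2); first lra.
have aF : (a%:E < free_energy mu f phi)%E by apply: lt_le_trans muF; rewrite lte_fin; lra.
have [nu [inu nN nuF]] := off_NE S cphi imu a1 aF.
have [E [E' [[uE [sE _]] [uE' sE'] /(_ a (ltW nuF))]]] := entropy_split S cphi sc 0 inu nN (@measurableT _ X) n0.
rewrite mul0r addr0 expR0 mul1r => h.
have low : expR (-1) * expR (n%:R * P) <= expR (n%:R * a).
  rewrite -expRD ler_expR.
  have : n%:R * (P - n%:R^-1) <= n%:R * a by rewrite ler_wpM2l// ltW.
  by rewrite mulrBr divff ?gt_eqF//; lra.
have [h1|h1] := leP (expR (-1) / 2 * expR (n%:R * P)) (\sum_(x <- E) expR (hat f phi p s K w x n)).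
  exists [seq x <- E | (p x n + s x n <= M)%N]; split; [exact: filter_uniq| |exact: hc].
  by move=> x y; rewrite !mem_filter => /andP[_ xE] /andP[_ yE]; exact: sE.
exists [seq x <- E' | (p x n + s x n <= M)%N]; split; [exact: filter_uniq| |].
  by move=> x y; rewrite !mem_filter => /andP[_ xE] /andP[_ yE]; exact: sE'.
apply: hc => //; move: h1 h low; rewrite mulrAC.
set e := expR (-1) * _; lra.
Qed.

(** Q does not depend on the radius a, which will shrink with the tolerance in the large deviations;
    b is any upper bound for Phi on the ball. *)
Lemma gibbs_exists : exists (mu : probability X R) (Q : R), [/\ finvariant f mu,
  (P%:E <= free_energy mu f phi)%E, 0 < Q & forall m z (a b : R), 0 < a <= r / 2 ->
    (forall y, dn d f m z y < a -> Phi y m <= b) ->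
    pr mu (bowen_ball d f m z a) <= Q * expR (b - m%:R * P)].
Proof.
have [c c0 hc] := sep_lower; have [A A0 hA] := ball_visits.
have [U [UU Uinf _]] := @ultra_nat (fun=> True) (fun n0 => ex_intro2 _ _ n0 (leqnn n0) I).
have /choice[E hE] : forall n, exists E, [/\ E != [::] /\ uniq E, sep d f n r E &
    (0 < n)%N -> c * expR (n%:R * P) <= psum f phi E n].
  case=> [|n]; first by exists [:: point]; split => // x y; rewrite !inE => /eqP-> /eqP->.
  have [E [uE sE h]] := hc n.+1 isT; exists E; split => //; split => //.
  apply/eqP => E0; move: h; rewrite E0 /psum big_nil leNgt mulr_gt0 ?expR_gt0//.
have [B B0 hB] := psum_bounds S cphi r0.
pose u n := ln (psum f phi (E n) n) / n%:R.
have uB n : `|u n| <= B.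
  case: n => [|n]; first by rewrite /u invr0 mulr0 normr0 ltW.
  by have [[E0 uE] sE _] := hE n.+1; exact: hB.
have [l hl] := ultra_cvg_ex (U := U) uB.
have Pl : P <= l.
  have h0 : (ln c / n%:R) @[n --> U] --> (0 : R).
    apply: (@ultra_cvg0 _ U UU Uinf _ `|ln c|) => n n0.
    by rewrite normrM [`|_^-1|]ger0_norm ?invr_ge0.
  have h1 : (P + ln c / n%:R) @[n --> U] --> (P + 0 : R) by apply: cvgD => //; apply: cvg_cst.
  rewrite -[P]addr0; apply: (ucvg_le h1 hl).
  apply: filterS (Uinf 1%N) => n n0; have [[E0 uE] sE /(_ n0) h] := hE n.
  have n0' : 0 < n%:R :> R by rewrite ltr0n.
  rewrite /u ler_pdivlMr// mulrDl divfK ?gt_eqF// -[P * _]expRK addrC -lnM ?posrE ?expR_gt0//.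
  by rewrite ler_ln ?posrE ?mulr_gt0 ?expR_gt0 ?psum_gt0// [P * _]mulrC.
have [||mu [M [imu lmu gM _ hopen]]] := misiurewicz S cphi Uinf r0 _ _ hl.
- by move=> n; case: (hE n).
- by move=> n; case: (hE n).
exists mu, (A / c); split => //.
- by apply: le_trans lmu; rewrite lee_fin.
- by rewrite divr_gt0.
move=> m z a b a0 hb; pose O := bowen_ball d f m z a.
have oO : dopen d O by exact: (bowen_open H (cs_f S)).
have mO := open_measurable H oO.
have b1 n : `|pr (M n) O| <= 1 by rewrite ger0_norm ?pr_ge0 ?(fap_le1 (pr_fap _)).
have [l' hl'] := ultra_cvg_ex (U := U) b1.
apply: le_trans (hopen O l' oO hl') _.
have h0 : (m%:R / n%:R) @[n --> U] --> (0 : R).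
  apply: (@ultra_cvg0 _ U UU Uinf _ m%:R) => n n0.
  by rewrite ger0_norm ?divr_ge0.
set D := A / c * _.
have h1 : (D + m%:R / n%:R) @[n --> U] --> (D + 0 : R) by apply: cvgD => //; apply: cvg_cst.
rewrite -[D]addr0; apply: (ucvg_le hl' h1).
apply: filterS (Uinf m.+1) => n mn; have n0 : (0 < n)%N by exact: leq_ltn_trans mn.
have n0' : 0 < n%:R :> R by rewrite ltr0n.
have [[E0 uE] sE /(_ n0) hn] := hE n.
have Z0 : 0 < psum f phi (E n) n by exact: psum_gt0.
rewrite -(Ex_indic (M n) mO) (gM n n0 _ (bmeas_indic mO)).
rewrite ler_pdivrMl//.
pose V k := \sum_(x <- E n | `[< dn d f m z (iter k f x) < a >]) expR (Phi x n).
have swap : \sum_(x <- E n) expR (Phi x n) * (n%:R^-1 * \sum_(k < n) \1_O (iter k f x)) =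
    n%:R^-1 * \sum_(k < n) V k.
  transitivity (n%:R^-1 * \sum_(x <- E n) \sum_(k < n) expR (Phi x n) * \1_O (iter k f x)).
    by rewrite mulr_sumr; apply: eq_bigr => x _; rewrite mulrCA -mulr_sumr.
  congr (_ * _); rewrite exchange_big /=; apply: eq_bigr => k _.
  rewrite /V [RHS]big_mkcond /=; apply: eq_bigr => x _.
  rewrite indicE /O /bowen_ball; case: asboolP => h.
    by rewrite mem_set ?mulr1.
  by rewrite memNset ?mulr0.
have D0 : 0 <= D by rewrite mulr_ge0 ?expR_ge0// ltW// divr_gt0.
(* Visits whose window passes time n are bounded by the whole partition sum. They occur for at most
   m starting times, a proportion m / n that vanishes in the limit. *)
have hV (k : 'I_n) : V k <= psum f phi (E n) n * (D + (n < k + m)%N%:R).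
  have [nk|kn] := ltnP n (k + m).
    apply: (@le_trans _ _ (psum f phi (E n) n * 1)); last by rewrite ler_pM2l// lerDr.
    rewrite mulr1 /V big_mkcond /=; apply: ler_sum => x _.
    by case: ifP => // _; exact: expR_ge0.
  rewrite addr0; apply: le_trans (hA n (E n) k m z a b uE sE kn a0 hb) _.
  rewrite natrB; last by exact: ltnW.
  have -> : b + (n%:R - m%:R) * P = (b - m%:R * P) + n%:R * P by ring.
  rewrite expRD mulrA /D mulrC [A / c]mulrC -!mulrA [_ * (c^-1 * _)]mulrCA ler_pdivlMl//.
  by rewrite mulrA ler_wpM2r// mulr_ge0 ?expR_ge0// ltW.
rewrite swap ler_pdivrMl//; apply: le_trans (ler_sum _ (fun k _ => hV k)) _.
rewrite -mulr_sumr mulrCA ler_pM2l// [n%:R * (D + _)]mulrDr [n%:R * (m%:R / _)]mulrC divfK ?gt_eqF//.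
rewrite big_split /= sumr_const card_ord mulr_natl lerD2l -natr_sum ler_nat.
by have := late_visits n m n; rewrite addKn.
Qed.

End GibbsMeasure.

(** * Uniqueness *)

Section Blocks.
Context {R : realType} {dsp : measure_display} {X : measurableType dsp}.
Context (d : X -> X -> R) (f finv : X -> X) (S : csys d f finv).
Implicit Types (mu nu : probability X R) (h : X -> R).


(** One good length suffices for all large ones: taking averages of length r + 1 first changes an
    average over Q times by at most (r + 1) / Q, and averaging preserves the mean of the deviation
    from [hs]. *)
Lemma mean_ergodic_large nu h (hs : X -> R) (e : R) : finvariant f nu -> bmeas h ->
  (forall x, 0 <= h x <= 1) -> bmeas hs -> (forall x, hs (f x) = hs x) -> 0 < e ->
  (exists r, Ex nu (fun x => `|avg f r.+1 h x - hs x|) <= e / 2) ->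
  exists N, forall Q, (N <= Q)%N -> (0 < Q)%N -> Ex nu (fun x => `|avg f Q h x - hs x|) <= e.
Proof.
move=> inu bh h01 bhs hsf e0 [r hr_].
have ba n (u : X -> R) : bmeas u -> bmeas (avg f n u) by exact: (avg_bmeas S).
exists (Num.truncn (r.+1%:R / (e / 2))).+1 => Q NQ Q0; have Q0' : 0 < Q%:R :> R by rewrite ltr0n.
have e20 : 0 < e / 2 by rewrite divr_gt0.
have rQ : r.+1%:R / Q%:R <= e / 2.
  rewrite ler_pdivrMr// mulrC -ler_pdivrMr//; apply: ltW; apply: lt_le_trans (truncnS_gt _) _.
  by rewrite ler_nat.
pose D x := `|avg f r.+1 h x - hs x|.
have bD : bmeas D by apply: bmeas_norm; apply: bmeasB => //; exact: ba.
have bR : bmeas (fun x => `|avg f Q h x - hs x|) by apply: bmeas_norm; apply: bmeasB => //; exact: ba.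
apply: (@le_trans _ _ (Ex nu (fun x => r.+1%:R / Q%:R + avg f Q D x))).
  apply: Ex_le => //; first by apply: bmeasD; [exact: bmeas_cst|exact: ba].
  move=> x; rewrite (_ : _ - hs x = - (avg f Q (avg f r.+1 h) x - avg f Q h x) + (avg f Q (avg f r.+1 h) x - hs x)); last by ring.
  apply: le_trans (ler_normD _ _) _; rewrite normrN; apply: lerD; first exact: avg_avg_near.
  have hsk k : hs (iter k f x) = hs x by elim: k => //= k IH; rewrite hsf.
  have -> : hs x = avg f Q hs x.
    rewrite /avg (eq_bigr (fun=> hs x)); last by move=> k _; exact: hsk.
    by rewrite sumr_const card_ord -[X in _ * X]mulr_natl mulKf ?gt_eqF.
  rewrite /avg -mulrBr normrM gtr0_norm ?invr_gt0// ler_wpM2l ?invr_ge0// -sumrB.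
  exact: ler_norm_sum.
rewrite ExD; [|exact: bmeas_cst|exact: ba].
by rewrite Ex_cst (Ex_avg S Q0 inu bD); lra.
Qed.

Definition low_blocks h (N L : nat) (a : R) : set X :=
  [set x | forall j, (j < N)%N -> avg f L h (iter (j * L) f x) <= a].

Lemma low_blocks_measurable h N L a : bmeas h -> measurable (low_blocks h N L a).
Proof.
move=> bh; elim: N => [|N IH].
  by have -> : low_blocks h 0 L a = setT by apply/seteqP; split.
have -> : low_blocks h N.+1 L a = low_blocks h N L a `&` iter (N * L) f @^-1` [set x | avg f L h x <= a].
  apply/seteqP; split => x /=.
    by move=> hx; split => [j jN|]; apply: hx => //; exact: ltnW.
  by move=> [hx hN] j; rewrite ltnS leq_eqVlt => /orP[/eqP->//|]; exact: hx.
apply: measurableI => //; apply: (iter_measurable S).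
have -> : [set x | avg f L h x <= a] = ~` [set x | a < avg f L h x].
  by apply/seteqP; split => x /=; rewrite leNgt => /negP.
by apply: measurableC; apply: bmeas_level; exact: (avg_bmeas S).
Qed.

(** Block averages are close to one invariant function, which is at most some a' < a on a set of
    mass at least 2 al and takes the same value at all blocks of an orbit. Hence al does not depend
    on N, although the blocks have to be long. *)
Lemma low_blocks_mass nu h (a : R) : finvariant f nu -> bmeas h -> (forall x, 0 <= h x <= 1) ->
  Ex nu h < a -> exists2 al : R, 0 < al & forall N, exists L0, forall L, (L0 <= L)%N -> (0 < L)%N ->
    al <= pr nu (low_blocks h N L a).
Proof.
move=> inu bh h01 ha.
have [hs [bhs hs01 hsf hsm]] := mean_ergodic S inu bh h01.
pose a' := (Ex nu h + a) / 2; pose k := a - a'.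
have k0 : 0 < k by rewrite /k /a'; lra.
have Eh0 : 0 <= Ex nu h by apply: Ex_ge0 => x; case/andP: (h01 x).
have a'0 : 0 < a' by rewrite /a'; lra.
have Ehs : Ex nu hs <= Ex nu h.
  apply/ler_addgt0Pr => e e0; have [r hr_] := hsm e e0.
  have ba : bmeas (avg f r.+1 h) by exact: (avg_bmeas S).
  have := Ex_abs nu (bmeasB bhs ba); rewrite ExB// (Ex_avg S)//.
  have -> : (fun x => `|hs x - avg f r.+1 h x|) = (fun x => `|avg f r.+1 h x - hs x|).
    by apply/funext => x; rewrite distrC.
  by move=> /le_trans /(_ hr_); rewrite ler_norml; lra.
pose al := 1 - Ex nu h / a'.
have al0 : 0 < al by rewrite subr_gt0 ltr_pdivrMr// mul1r /a'; lra.
exists (al / 2); first by rewrite divr_gt0.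
(* Each of the N blocks deviates with probability at most th / k, so together they cost at most al /
   2. *)
move=> N; pose th := al * k / (2 * N.+1%:R).
have th0 : 0 < th by rewrite divr_gt0 ?mulr_gt0.
have [|L0 hL0] := mean_ergodic_large inu bh h01 bhs hsf th0; first by apply: hsm; rewrite divr_gt0.
exists L0 => L L0L Lp; have hL := hL0 L L0L Lp.
have bD : bmeas (fun x => `|avg f L h x - hs x|) by apply: bmeas_norm; apply: bmeasB => //; exact: (avg_bmeas S).
pose B0 := [set x | a' < hs x]; pose BD := [set x | k < `|avg f L h x - hs x|].
have mB0 : measurable B0 by exact: bmeas_level.
have mBD : measurable BD by exact: bmeas_level.
pose Bj j := iter (j * L) f @^-1` BD.
have mBj j : measurable (Bj j) by exact: (iter_measurable S).
have pBD : pr nu BD <= th / k.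
  apply: le_trans (Ex_markov nu bD (fun x => normr_ge0 _) k0) _.
  by rewrite ler_wpM2r// invr_ge0 ltW.
have pBj j : pr nu (Bj j) <= th / k.
  by rewrite (minv_iter S (j * L) (pr_minv inu) mBD).
have pB0 : pr nu B0 <= 1 - al.
  have hs0 x : 0 <= hs x by case/andP: (hs01 x).
  apply: le_trans (Ex_markov nu bhs hs0 a'0) _.
  by rewrite /al opprB addrCA subrr addr0 ler_wpM2r// invr_ge0 ltW.
pose V := \big[setU/set0]_(j < N) Bj j.
have mV : measurable V by exact: bigsetU_measurable.
have pV : pr nu V <= al / 2.
  apply: le_trans (fap_bigU_le nu N mBj) _.
  apply: (@le_trans _ _ (\sum_(j < N) th / k)); first by apply: ler_sum => j _.
  rewrite sumr_const card_ord -[X in X <= _]mulr_natl.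
  have fld (q b c : R) : q != 0 -> b != 0 -> c * b / (2 * q) / b = c / 2 / q.
    by move=> q0 b0; field; rewrite ?q0 ?b0.
  have -> : th / k = al / 2 / N.+1%:R by rewrite /th fld ?gt_eqF.
  rewrite mulrCA -[leRHS]mulr1 ler_wpM2l ?divr_ge0 ?(ltW al0)// ler_pdivrMr// mul1r ler_nat.
  exact: leqnSn.
have sub : ~` low_blocks h N L a `<=` B0 `|` V.
  move=> x nx; have [x0|x0] := pselect (B0 x); [by left|right].
  have {}x0 : hs x <= a' by rewrite leNgt; apply/negP.
  have hsk j : hs (iter j f x) = hs x by elim: j => //= j IH; rewrite hsf.
  apply: contrapT => nV; apply: nx => j jN; rewrite leNgt; apply/negP => aj.
  apply: nV; rewrite /V -(bigcup_mkord N Bj); exists j => //=.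
  rewrite /Bj /BD /= hsk; apply: lt_le_trans (ler_norm _).
  by rewrite /k; lra.
have mZ := low_blocks_measurable N L a bh.
have := fap_le (pr_fap nu) (measurableC mZ) (measurableU _ _ mB0 mV) sub.
rewrite (fapC (pr_fap nu) mZ) => h1.
by have := fapUle (pr_fap nu) mB0 mV; lra.
Qed.

Lemma window_sum (F : nat -> R) e v L : (forall i, 0 <= F i) -> (e + v <= L)%N ->
  \sum_(m < v) F (e + m)%N <= \sum_(i < L) F i.
Proof.
move=> F0 evL; rewrite -(subnKC evL) !big_split_ord /= -addrA addrCA lerDl addr_ge0//; exact: sumr_ge0.
Qed.

Lemma avg_window h L x a e v : (forall y, 0 <= h y) -> (0 < L)%N -> (e + v <= L)%N ->
  avg f L h x <= a -> \sum_(m < v) h (iter (e + m) f x) <= L%:R * a.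
Proof.
move=> h0 L0 evL; rewrite /avg ler_pdivrMl ?ltr0n//; apply: le_trans.
exact: (window_sum (F := fun i => h (iter i f x))).
Qed.

(* Two words following different patterns disagree on a whole block: there z follows an orbit
   with large averages and z' follows an orbit with small averages. *)
Lemma block_clash h (rho k a1 a2 : R) (z z' x1 x2 : X) (L ra rb p1 s1 p2 s2 n2 t0 M tau : nat) :
  (forall x, 0 <= h x <= 1) -> 0 < rho -> (forall x y, d x y <= rho -> `|h x - h y| <= k) ->
  (ra < rb)%N -> (t0 <= tau)%N -> (p1 + s1 <= M)%N -> (p2 + s2 <= M)%N -> (L <= n2)%N ->
  0 <= k -> (0 < L)%N -> (2 * (2 * M + tau) <= L)%N ->
  dn d f (n2 - p2 - s2) (iter ((ra * L - p1 - s1) + t0) f z) (iter p2 f x2) < rho ->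
  dn d f (rb * L - p1 - s1) z' (iter p1 f x1) < rho ->
  avg f L h (iter (ra * L) f x1) <= a1 -> avg f L (fun x => 1 - h x) x2 <= a2 ->
  (0 < ra)%N -> L%:R * (a1 + a2 + 3 * k) + (2 * (2 * M + tau))%:R < L%:R ->
  exists2 j, (j < rb * L)%N & rho < d (iter j f z) (iter j f z').
Proof.
move=> h01 rho0 osc rab t0t ps1 ps2 Ln2 k0 L0 BL c2 c1 A1 A2 ra0 clash.
apply: contrapT => near_.
have {}near_ j : (j < rb * L)%N -> d (iter j f z) (iter j f z') <= rho.
  by move=> jr; rewrite leNgt; apply/negP => lt_j; apply: near_; exists j.
(* B is a margin for the trimmed ends and the gap. On the remaining window of v times, e is the
   position in the block of x1 that corresponds to position B of x2. *)
pose B := (2 * M + tau)%N; pose v := (L - 2 * B)%N; pose e := (B + t0 - s1 - p2)%N.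
have raL : (ra.+1 * L <= rb * L)%N by rewrite leq_mul2r rab orbT.
have raL' : (L <= ra * L)%N by rewrite leq_pmull.
(* The comparison runs along x2, z, z', x1, and each of the three steps costs k. *)
have step m : (m < v)%N -> h (iter (B + m) f x2) <= h (iter (e + m) f (iter (ra * L) f x1)) + 3 * k.
  move=> mv; pose o := (ra * L - p1 - s1 + t0)%N; pose i := (B + m - p2)%N.
  have q1 : (i < n2 - p2 - s2)%N by move: mv ps2 Ln2; rewrite /i /v /B; clear -BL; lia.
  have q2 : (i + o < rb * L - p1 - s1)%N.
    by move: mv ps1 ps2 t0t BL raL raL'; rewrite mulSn /i /o /v /B; clear; lia.
  have q3 : (i + o + p1 = e + m + ra * L)%N.
    by move: mv ps1 ps2 t0t BL raL raL'; rewrite mulSn /i /o /v /B /e /B; clear; lia.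
  have q4 : (i + p2 = B + m)%N by move: ps2; rewrite /i /B; clear; lia.
  have d1 := elimT (dn_ltP d f _ _ _ rho0) c2 i q1.
  have d2 := elimT (dn_ltP d f _ _ _ rho0) c1 (i + o)%N q2.
  have d3 := near_ (i + o)%N ltac:(by apply: leq_trans q2 _; rewrite -subnDA leq_subr).
  rewrite -!iterD -/o q4 in d1; rewrite -!iterD q3 in d2.
  have := osc _ _ (ltW d1); have := osc _ _ (ltW d2); have := osc _ _ d3.
  by rewrite -iterD !ler_norml; lra.
have Bv : (B + v <= L)%N by rewrite /v; move: BL; rewrite -/B; clear; lia.
have ev : (e + v <= L)%N by rewrite /e /v; move: BL t0t; rewrite /B; clear; lia.
have h0 y : 0 <= h y by case/andP: (h01 y).
have h1 y : 0 <= 1 - h y by case/andP: (h01 y); rewrite subr_ge0.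
have w1 := avg_window h0 L0 ev A1.
have w2 := avg_window h1 L0 Bv A2.
have w3 : \sum_(m < v) h (iter (B + m) f x2) <=
    \sum_(m < v) h (iter (e + m) f (iter (ra * L) f x1)) + v%:R * (3 * k).
  have -> : v%:R * (3 * k) = \sum_(m < v) (3 * k) by rewrite sumr_const card_ord mulr_natl.
  by rewrite -big_split /=; apply: ler_sum => m _; exact: step.
have w4 : \sum_(m < v) (1 - h (iter (B + m) f x2)) = v%:R - \sum_(m < v) h (iter (B + m) f x2).
  by rewrite sumrB sumr_const card_ord.
have vE : v%:R = L%:R - (2 * B)%:R :> R by rewrite /v natrB.
have w5 : v%:R * (3 * k) <= L%:R * (3 * k).
  by rewrite ler_wpM2r ?mulr_ge0// ler_nat leq_subr.
move: clash; rewrite -/B; rewrite w4 in w2; move: w1 w2 w3 w5; rewrite mulrDr mulrDr vE.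
lra.
Qed.

End Blocks.

Lemma common_bound (a b c e k : nat) : exists L, [/\ a <= L, b <= L, c <= L, e <= L & k <= L]%N.
Proof. by exists (a + b + c + e + k)%N; split; lia. Qed.

Lemma two_lengths (a b c a' b' c' n n' : nat) : (a + b + c = n -> a' + b' + c' = n' ->
  b + b' + (a + c + (a' + c')) = n + n')%N.
Proof. by lia. Qed.

Lemma second_bound (k a b c e t tau : nat) : (k < b - c - e -> t <= tau -> k + (a + t) < a + b + 2 * tau)%N.
Proof. by lia. Qed.

Section Uniqueness.
Context {R : realType} {dsp : measure_display} {X : measurableType dsp}.
Context (d : X -> X -> R) (f finv : X -> X) (S : csys d f finv) (phi : X -> R).
Context (cphi : dcont_real d phi).
Context (PP GG SS : set (X * nat)) (p g s : X -> nat -> nat).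
Context (P eps epsB K C w r : R) (sc : scales d f finv phi PP GG SS p g s P eps epsB K C w r).
Implicit Types (E : seq X) (mu nu : probability X R) (n : nat).

Let H := cs_space S.
Let r0 := sc_r0 sc.
Notation Phi := (birkhoff f phi).

Lemma sum_two (F : nat -> R) : \sum_(i < 2) F i = F 0%N + F 1%N.
Proof. by rewrite !big_ord_recr big_ord0 /= add0r. Qed.

Lemma unif_iter (M : nat) (a : R) : 0 < a -> exists2 rho : R, 0 < rho & forall x y, d x y <= rho ->
  forall k, (k <= M)%N -> d (iter k f x) (iter k f y) <= a /\ d (iter k finv x) (iter k finv y) <= a.
Proof.
move=> a0; elim: M => [|M [rho rho0 IH]].
  by exists a => // x y xy k; rewrite leqn0 => /eqP->.
have [r1 r10 h1] := dcont_fun_unif H (dcont_fun_iter M.+1 (cs_f S)) a0.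
have [r2 r20 h2] := dcont_fun_unif H (dcont_fun_iter M.+1 (cs_finv S)) a0.
exists (Num.min rho (Num.min (r1 / 2) (r2 / 2))); first by rewrite !lt_min rho0 !divr_gt0.
move=> x y; rewrite !le_min => /andP[xy /andP[xy1 xy2]] k; rewrite leq_eqVlt => /orP[/eqP->|kM].
  by split; apply: ltW; [apply: h1|apply: h2]; lra.
exact: IH.
Qed.

(** The trimmed ends lie within M iterates, forwards or backwards, of the core, so a rho-close core
    would force r-closeness on the whole segment. *)
Lemma core_far (rho : R) (M : nat) n x y a b : (forall x y, d x y <= rho ->
    forall k, (k <= M)%N -> d (iter k f x) (iter k f y) <= r /\ d (iter k finv x) (iter k finv y) <= r) ->
  0 <= rho -> (a + b <= M)%N -> (M < n)%N -> r < dn d f n x y ->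
  rho < dn d f (n - a - b) (iter a f x) (iter a f y).
Proof.
move=> hrho rho0 abM Mn xy; rewrite ltNge; apply/negP => /(dn_leP _ _ _ _ _ rho0) core.
move: xy; rewrite ltNge => /negP; apply; apply/(dn_leP _ _ _ _ _ (ltW r0)) => k kn.
have [ka|ak] := ltnP k a.
  have back u : iter k f u = iter (a - k) finv (iter a f u).
    by rewrite -{2}(subnK (ltnW ka)) iterD (iter_cancel' S).
  have core0 : d (iter a f x) (iter a f y) <= rho by apply: (core 0%N); lia.
  by rewrite !back; apply: (hrho _ _ core0 _ _).2; lia.
have [kb|bk] := ltnP k (n - b).
  have kE : (k = k - a + a)%N by rewrite subnK.
  have kc : (k - a < n - a - b)%N by lia.
  have := core _ kc; rewrite -!iterD -kE => /hrho h.
  by have [] := h 0%N (leq0n M).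
pose j := (n - b - a).-1.
have jc : (j < n - a - b)%N by rewrite /j; lia.
have kE : (k = k - (j + a) + (j + a))%N by rewrite subnK//; rewrite /j; lia.
have := core _ jc; rewrite -!iterD => /hrho h.
have [] := h (k - (j + a))%N; first by rewrite /j; lia.
by rewrite -!iterD -kE.
Qed.

Lemma far_shadow (rho rho' : R) n x y z z' : 0 < rho -> 4 * rho <= rho' -> rho' < dn d f n x y ->
  dn d f n z x < rho -> dn d f n z' y < rho ->
  exists2 k, (k < n)%N & rho < d (iter k f z) (iter k f z').
Proof.
move=> rho0 rr xy zx zy; have rho'0 : 0 <= rho' by apply: le_trans rr; rewrite mulr_ge0// ltW.
have [k kn hk] : exists2 k, (k < n)%N & rho' < d (iter k f x) (iter k f y).
  apply: contrapT => h; move: xy; rewrite ltNge => /negP; apply; apply/(dn_leP _ _ _ _ _ rho'0) => k kn.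
  by rewrite leNgt; apply/negP => hk; apply: h; exists k.
exists k => //.
have h1 := elimT (dn_ltP d f n z x rho0) zx k kn.
have h2 := elimT (dn_ltP d f n z' y rho0) zy k kn.
have := dtri (iter k f x) (iter k f z) (iter k f y) H.
have := dtri (iter k f z) (iter k f z') (iter k f y) H.
rewrite (dsym (iter k f x) (iter k f z) H); lra.
Qed.

Definition core x n := (iter (p x n) f x, g x n).

Lemma core_length x n : (0 < n)%N -> g x n = (n - p x n - s x n)%N.
Proof. by move=> n0; have [e _ _ _] := (sc_dec sc).2 x n n0; exact: middle_length. Qed.

Lemma core_total x n : (0 < n)%N -> (p x n + g x n + s x n = n)%N.
Proof. by move=> n0; have [e _ _ _] := (sc_dec sc).2 x n n0. Qed.

Lemma core_birkhoff x n (M : nat) : (0 < n)%N -> (p x n + s x n <= M)%N ->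
  Phi x n - M%:R * C <= Phi (core x n).1 (core x n).2.
Proof.
move=> n0 psM; have [_ /(_ x) ->] := birkhoff_split sc x n0; rewrite /core /=.
have h1 := birkhoff_abs f x (p x n) (sc_C sc).
have h2 := birkhoff_abs f (iter (p x n + g x n) f x) (s x n) (sc_C sc).
have : (p x n + s x n)%:R * C <= M%:R * C by rewrite ler_wpM2r ?(sc_C0 sc)// ler_nat.
rewrite natrD mulrDl; move: h1 h2; rewrite !ler_norml => /andP[_ h1] /andP[_ h2]; lra.
Qed.

Lemma equilibrium_averages nu1 nu2 h : finvariant f nu1 -> finvariant f nu2 ->
  (P%:E <= free_energy nu1 f phi)%E -> (P%:E <= free_energy nu2 f phi)%E ->
  dcont_real d h -> (forall x, 0 <= h x <= 1) -> Ex nu2 h <= Ex nu1 h.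
Proof.
move=> i1 i2 F1 F2 ch h01; rewrite leNgt; apply/negP => lt12.
have bh := dcont_bmeas H ch.
pose gap := Ex nu2 h - Ex nu1 h; have gap0 : 0 < gap by rewrite subr_gt0.
(* The two thresholds and the three comparisons of [block_clash] give a1 + a2 + 3 k = 1 - gap / 4,
   and L will be so large that L gap / 4 exceeds the boundary effects. *)
pose a1 := Ex nu1 h + gap / 4; pose a2 := 1 - Ex nu2 h + gap / 4; pose k := gap / 12.
have k0 : 0 < k by rewrite divr_gt0.
pose h' x := 1 - h x.
have bh' : bmeas h' by apply: bmeasB => //; exact: bmeas_cst.
have h'01 x : 0 <= h' x <= 1 by rewrite /h'; have := h01 x; lra.
have [|al1 al10 m1] := low_blocks_mass S i1 bh h01 (a := a1); first by rewrite /a1; lra.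
have [|al2 al20 m2] := low_blocks_mass S i2 bh' h'01 (a := a2).
  by rewrite /h' ExB ?Ex_cst//; [rewrite /a2; lra|exact: bmeas_cst].
have al0 : 0 < Num.min al1 al2 by rewrite lt_min al10.
have [M [c [c0 low]]] := equilibrium_lower S cphi sc al0.
have [rho' rho'0 hrho'] := unif_iter M r0.
have [rg rg0 hrg] := dcont_unif H ch k0.
pose rho := Num.min (rho' / 4) (Num.min (rg / 2) epsB).
have rho0 : 0 < rho by rewrite !lt_min !divr_gt0//= (lt_trans r0 (sc_rB sc)).
have rho1 : 4 * rho <= rho'.
  by have : rho <= rho' / 4 by [rewrite ge_min lexx]; lra.
have rho2 : rho < rg.
  by have : rho <= rg / 2 by [rewrite !ge_min lexx orbT]; lra.
have rho3 : rho <= epsB by rewrite !ge_min lexx !orbT.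
have osc x y : d x y <= rho -> `|h x - h y| <= k by move=> xy; apply: ltW; apply: hrg; exact: le_lt_trans rho2.
have [tau tau0 hspec] := W_spec_shadows (sc_spec sc rho0).
pose T := (('I_M.+1 * 'I_M.+1) * ('I_M.+1 * 'I_M.+1))%type.
(* Q is the loss of [letter_sum] for one pair and q the constant in the lower sum for one switching
   time. Both are independent of N and L, so N can be chosen with N q > Q, and L after it. *)
pose Q := #|{: T}|%:R * (tau.+1 ^ 2)%:R * expR (2 * K + (2 * tau + 2 * M)%:R * C) * expR ((2 * tau)%:R * P).
pose q := expR (- ((2 * M)%:R * C)) * (c * c).
have q0 : 0 < q by rewrite !mulr_gt0 ?expR_gt0.
pose N := (Num.truncn (Q / q)).+1.
have NQ : Q < N%:R * q by rewrite -ltr_pdivrMr// truncnS_gt.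
have [L1 hL1] := m1 N.+1; have [L2 hL2] := m2 N.+1.
pose B := (2 * (2 * M + tau))%N.
have [L [LL1 LL2 LM LB Lgap]] := common_bound L1 L2 M.+1 B (Num.truncn (B%:R / (gap / 4))).+1.
have L0 : (0 < L)%N by exact: leq_ltn_trans LM.
have gap4 : 0 < gap / 4 by rewrite divr_gt0.
have clash : L%:R * (a1 + a2 + 3 * k) + B%:R < L%:R.
  have : B%:R < L%:R * (gap / 4).
    rewrite -ltr_pdivrMr//; apply: lt_le_trans (truncnS_gt _) _.
    by rewrite ler_nat.
  have -> : a1 + a2 + 3 * k = 1 - gap / 4 by rewrite /a1 /a2 /k /gap; field.
  by rewrite mulrBr mulr1; lra.
pose Z1 := low_blocks f h N.+1 L a1; pose Z2 := low_blocks f h' N.+1 L a2.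
have mZ1 : measurable Z1 by exact: (low_blocks_measurable S).
have mZ2 : measurable Z2 by exact: (low_blocks_measurable S).
have zl1 : Num.min al1 al2 <= pr nu1 Z1 by apply: le_trans (hL1 L LL1 L0); rewrite ge_min lexx.
have zl2 : Num.min al1 al2 <= pr nu2 Z2 by apply: le_trans (hL2 L LL2 L0); rewrite ge_min lexx orbT.
(* Both segments contain at least one block, and the total length (N + 1) L is the same for all
   switching times. *)
pose n1 (i : 'I_N) := (i.+1 * L)%N; pose n2 (i : 'I_N) := ((N - i) * L)%N.
have n1L i : (L <= n1 i)%N by rewrite leq_pmull.
have n2L i : (L <= n2 i)%N by rewrite leq_pmull// subn_gt0.
have n10 i : (0 < n1 i)%N by exact: leq_trans L0 (n1L i).
have n20 i : (0 < n2 i)%N by exact: leq_trans L0 (n2L i).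
have n12 i : (n1 i + n2 i = N.+1 * L)%N.
  by rewrite /n1 /n2 -mulnDl addSn subnKC// ltnW.
have /choice[E1 hE1] := fun i => low nu1 Z1 (n1 i) i1 F1 mZ1 zl1 (n10 i).
have /choice[E2 hE2] := fun i => low nu2 Z2 (n2 i) i2 F2 mZ2 zl2 (n20 i).
pose A := {i : 'I_N & ('I_(size (E1 i)) * 'I_(size (E2 i)))%type}.
pose x1 (a : A) := nth point (E1 (tag a)) (tagged a).1.
pose x2 (a : A) := nth point (E2 (tag a)) (tagged a).2.
have x1E a : x1 a \in E1 (tag a) by exact: mem_nth.
have x2E a : x2 a \in E2 (tag a) by exact: mem_nth.
pose N1 (a : A) := n1 (tag a); pose N2 (a : A) := n2 (tag a).
have ps1 a : (p (x1 a) (N1 a) + s (x1 a) (N1 a) <= M)%N by have [_ _ _ h1 _] := hE1 (tag a); exact: h1.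
have ps2 a : (p (x2 a) (N2 a) + s (x2 a) (N2 a) <= M)%N by have [_ _ _ h1 _] := hE2 (tag a); exact: h1.
pose u (a : A) := [:: core (x1 a) (N1 a); core (x2 a) (N2 a)].
(* The trimmed lengths determine the total length of the two cores, as [letter_sum] requires. The
   switching time is left out of the key: it is the gain, and [block_clash] separates it. *)
pose key (a : A) : T := ((inord (p (x1 a) (N1 a)), inord (s (x1 a) (N1 a))),
                         (inord (p (x2 a) (N2 a)), inord (s (x2 a) (N2 a)))).
have keyE a b : key a = key b -> [/\ p (x1 a) (N1 a) = p (x1 b) (N1 b), s (x1 a) (N1 a) = s (x1 b) (N1 b),
    p (x2 a) (N2 a) = p (x2 b) (N2 b) & s (x2 a) (N2 a) = s (x2 b) (N2 b)].
  have inj m m' : (m <= M)%N -> (m' <= M)%N -> inord m = inord m' :> 'I_M.+1 -> m = m'.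
    by move=> mM m'M /(congr1 val) /=; rewrite !inordK.
  have l1 m m' : (m + m' <= M)%N -> (m <= M)%N by apply: leq_trans; exact: leq_addr.
  have l2 m m' : (m + m' <= M)%N -> (m' <= M)%N by apply: leq_trans; exact: leq_addl.
  move=> [e1 e2 e3 e4]; split; apply: inj => //.
  - exact: l1 (ps1 a).
  - exact: l1 (ps1 b).
  - exact: l2 (ps1 a).
  - exact: l2 (ps1 b).
  - exact: l1 (ps2 a).
  - exact: l1 (ps2 b).
  - exact: l2 (ps2 a).
  - exact: l2 (ps2 b).
have len a : (\sum_(i < 2) (seg (u a) i).2 = g (x1 a) (N1 a) + g (x2 a) (N2 a))%N.
  by rewrite !big_ord_recr big_ord0 /= add0n.
have lenE a : (g (x1 a) (N1 a) + g (x2 a) (N2 a) + (p (x1 a) (N1 a) + s (x1 a) (N1 a) + (p (x2 a) (N2 a) + s (x2 a) (N2 a))) = N.+1 * L)%N.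
  by rewrite -(n12 (tag a)); exact: two_lengths (core_total (x1 a) (n10 (tag a))) (core_total (x2 a) (n20 (tag a))).
have sum_low : N%:R * q * expR ((N.+1 * L)%:R * P) <=
    \sum_a expR (\sum_(i < 2) Phi (seg (u a) i).1 (seg (u a) i).2).
  pose V i (j : 'I_(size (E1 i)) * 'I_(size (E2 i))) : R :=
    expR (- ((2 * M)%:R * C)) * (expR (Phi (nth point (E1 i) j.1) (n1 i)) * expR (Phi (nth point (E2 i) j.2) (n2 i))).
  apply: (@le_trans _ _ (\sum_(a : A) V (tag a) (tagged a))); last first.
    apply: ler_sum => a _; rewrite /V -!expRD ler_expR (sum_two (fun i => Phi (seg (u a) i).1 (seg (u a) i).2)).
    have := core_birkhoff (n10 (tag a)) (ps1 a); have := core_birkhoff (n20 (tag a)) (ps2 a).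
    by rewrite natrM /= -/(x1 a) -/(x2 a) -/(N1 a) -/(N2 a) /seg /=; lra.
  rewrite -(sig_big_dep xpredT (fun _ => xpredT) V) /=.
  have -> : N%:R * q * expR ((N.+1 * L)%:R * P) = \sum_(i < N) q * expR ((N.+1 * L)%:R * P).
    by rewrite sumr_const card_ord -[RHS]mulr_natl mulrA.
  apply: ler_sum => i _; rewrite /V.
  rewrite -mulr_sumr -mulrA ler_wpM2l ?expR_ge0//.
  have [_ _ _ _ b1] := hE1 i; have [_ _ _ _ b2] := hE2 i.
  rewrite -(pair_bigA _ (fun j1 j2 => expR (Phi (nth point (E1 i) (nat_of_ord j1)) (n1 i)) * expR (Phi (nth point (E2 i) (nat_of_ord j2)) (n2 i)))) /=.
  rewrite -big_distrlr /=.
  have -> : c * c * expR ((N.+1 * L)%:R * P) = (c * expR ((n1 i)%:R * P)) * (c * expR ((n2 i)%:R * P)).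
    by rewrite -(n12 i) natrD mulrDl expRD; ring.
  have psE E n : \sum_(j < size E) expR (Phi (nth point E j) n) = psum f phi E n.
    by rewrite /psum (big_nth point) big_mkord.
  by rewrite !psE ler_pM// mulr_ge0 ?expR_ge0// ltW.
have Ainj a b : tag a = tag b -> x1 a = x1 b -> x2 a = x2 b -> a = b.
  case: a b => [i [j1 j2]] [i' [j1' j2']] /= e; subst i'; rewrite /x1 /x2 /=.
  have [u1 _ _ _ _] := hE1 i; have [u2 _ _ _ _] := hE2 i.
  move=> /eqP; rewrite nth_uniq// => /eqP/val_inj-> /eqP; rewrite nth_uniq// => /eqP/val_inj->.
  by [].
have seg_sep a b z z' t : a <> b -> key a = key b -> (forall i, (nth 0 t i <= tau)%N) ->
     shadows d f rho z (u a) t -> shadows d f rho z' (u b) t ->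
     exists2 k, (k < N.+1 * L + 2 * tau)%N & rho < d (iter k f z) (iter k f z').
  move=> ab kab tt sha shb; have [e1 e2 e3 e4] := keyE _ _ kab.
  have sa1 := sha 0%N isT; have sa2 := sha 1%N isT.
  have sb1 := shb 0%N isT; have sb2 := shb 1%N isT.
  rewrite big_ord0 /= in sa1; rewrite big_ord0 /= in sb1.
  rewrite big_ord_recr big_ord0 /= add0n in sa2; rewrite big_ord_recr big_ord0 /= add0n in sb2.
  rewrite (core_length _ (n10 _)) in sa1; rewrite (core_length _ (n10 _)) in sb1.
  rewrite !(core_length _ (n20 _)) !(core_length _ (n10 _)) in sa2; rewrite !(core_length _ (n20 _)) !(core_length _ (n10 _)) in sb2.
  have rbL (i : 'I_N) : (i.+1 * L <= N.+1 * L + 2 * tau)%N.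
    by apply: leq_trans (leq_addr _ _); rewrite leq_mul2r ltnS (ltnW (ltn_ord i)) orbT.
  have zz1 a' : forall j, (j < N.+1)%N -> avg f L h (iter (j * L) f (x1 a')) <= a1.
    by have [_ _ h1 _ _] := hE1 (tag a'); exact: h1 _ (x1E a').
  have zz2 a' : avg f L h' (x2 a') <= a2.
    by have [_ _ h1 _ _] := hE2 (tag a'); exact: h1 _ (x2E a') 0%N isT.
  (* If a switches first, then during the next block its gluing follows the second measure while
     that of b still follows the first. *)
  case: (ltngtP (tag a) (tag b)) => tab.
  - rewrite -e1 -e2 in sb1.
    have [k' k'L hk'] := block_clash h01 rho0 osc (tab : ((tag a).+1 < (tag b).+1)%N) (tt 0%N) (ps1 a) (ps2 a) (n2L (tag a)) (ltW k0) L0 LB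
       sa2 sb1 (zz1 b (tag a).+1 (ltn_ord (tag a))) (zz2 a) isT clash.
    by exists k' => //; exact: leq_trans k'L (rbL (tag b)).
  - rewrite e1 e2 in sa1.
    have [k' k'L hk'] := block_clash h01 rho0 osc (tab : ((tag b).+1 < (tag a).+1)%N) (tt 0%N) (ps1 b) (ps2 b) (n2L (tag b)) (ltW k0) L0 LB
       sb2 sa1 (zz1 a (tag b).+1 (ltn_ord (tag b))) (zz2 b) isT clash.
    by exists k'; [exact: leq_trans k'L (rbL (tag a))|rewrite dsym].
  have tE : tag a = tag b by exact: val_inj.
  have eN1 : N1 a = N1 b by rewrite /N1 tE.
  have eN2 : N2 a = N2 b by rewrite /N2 tE.
  have NL : (N1 a + N2 a = N.+1 * L)%N by exact: n12.
  have sb1' : dn d f (N1 a - p (x1 a) (N1 a) - s (x1 a) (N1 a)) z' (iter (p (x1 a) (N1 a)) f (x1 b)) < rho.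
    by rewrite e1 e2 eN1.
  have sb2' : dn d f (N2 a - p (x2 a) (N2 a) - s (x2 a) (N2 a))
      (iter (N1 a - p (x1 a) (N1 a) - s (x1 a) (N1 a) + nth 0%N t 0) f z') (iter (p (x2 a) (N2 a)) f (x2 b)) < rho.
    by rewrite e1 e2 e3 e4 eN1 eN2.
  have [x12|x12] := pselect (x1 a = x1 b); last first.
    have x1b : x1 b \in E1 (tag a) by rewrite tE; exact: x1E.
    have [_ sE _ _ _] := hE1 (tag a).
    have far := core_far hrho' (ltW rho'0) (ps1 a) (leq_trans LM (n1L (tag a))) (sE _ _ (x1E a) x1b x12).
    have [k' k'L hk'] := far_shadow rho0 rho1 far sa1 sb1'.
    exists k' => //; apply: leq_trans k'L _; rewrite -subnDA; apply: leq_trans (leq_subr _ _) _.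
    by rewrite -NL -addnA leq_addr.
  have [x22|x22] := pselect (x2 a = x2 b); first by case: ab; exact: Ainj.
  have x2b : x2 b \in E2 (tag a) by rewrite tE; exact: x2E.
  have [_ sE _ _ _] := hE2 (tag a).
  have far := core_far hrho' (ltW rho'0) (ps2 a) (leq_trans LM (n2L (tag a))) (sE _ _ (x2E a) x2b x22).
  have [k' k'L hk'] := far_shadow rho0 rho1 far sa2 sb2'.
  exists (k' + (N1 a - p (x1 a) (N1 a) - s (x1 a) (N1 a) + nth 0 t 0))%N; last by rewrite [iter (k' + _) f z]iterD [iter (k' + _) f z']iterD.
  apply: leq_trans (second_bound _ k'L (tt 0%N)) _.
  by rewrite -NL leq_add2r leq_add2r -subnDA leq_subr.
have GG_core x n : (0 < n)%N -> GG (core x n) by move=> n0; have [_ _ h1 _] := (sc_dec sc).2 x n n0.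
have uG a b : b \in u a -> GG b.
  rewrite !inE => /orP[]/eqP->; [exact: (GG_core _ _ (n10 (tag a)))|exact: (GG_core _ _ (n20 (tag a)))].
have ulen a b : key a = key b -> (\sum_(i < 2) (seg (u a) i).2 = \sum_(i < 2) (seg (u b) i).2)%N.
  move=> /keyE[e1 e2 e3 e4]; rewrite !len; have := lenE a; rewrite -(lenE b) e1 e2 e3 e4.
  by move/addIn.
have ul a : (\sum_(i < 2) (seg (u a) i).2 <= N.+1 * L <= \sum_(i < 2) (seg (u a) i).2 + 2 * M)%N.
  rewrite len -(lenE a) leq_addr leq_add2l mul2n -addnn; exact: leq_add (ps1 a) (ps2 a).
have := @letter_sum _ _ _ d f finv S phi GG P rho epsB K C rho A T u key 2 tau (N.+1 * L) (2 * M)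
  (sc_up sc rho0) (sc_bowen sc) (sc_C sc) rho3 (ltW rho0) isT tau0 (sc_C0 sc) hspec (fun=> erefl) uG ulen ul seg_sep.
have eE : expR ((N.+1 * L + 2 * tau)%:R * P) = expR ((2 * tau)%:R * P) * expR ((N.+1 * L)%:R * P).
  by rewrite natrD mulrDl expRD mulrC.
move/(le_trans sum_low); rewrite eE mulrA ler_pM2r ?expR_gt0//.
by apply/negP; rewrite -ltNge; exact: NQ.
Qed.

Lemma equilibrium_unique nu1 nu2 : finvariant f nu1 -> finvariant f nu2 ->
  (P%:E <= free_energy nu1 f phi)%E -> (P%:E <= free_energy nu2 f phi)%E ->
  forall B, measurable B -> pr nu1 B = pr nu2 B.
Proof.
move=> i1 i2 F1 F2; apply: (pr_ext (H := H)) => i.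
apply/le_anti/andP; split; apply: equilibrium_averages => //; try exact: bump_dcont; exact: bump01.
Qed.

End Uniqueness.

(** * Large deviations *)

Section LargeDeviations.
Context {R : realType} {dsp : measure_display} {X : measurableType dsp}.
Context (d : X -> X -> R) (f finv : X -> X) (S : csys d f finv) (phi : X -> R).
Context (cphi : dcont_real d phi).
Implicit Types (E : seq X) (mu nu : probability X R) (n : nat) (A : set (probability X R)).

Let H := cs_space S.
Notation Phi := (birkhoff f phi).

Lemma ereal_between (x y : \bar R) : (x < y)%E -> exists2 a : R, (x < a%:E)%E & (a%:E < y)%E.
Proof.
case: x y => [x| |] [y| |] //=; rewrite ?lte_fin => xy.
- by exists ((x + y) / 2); rewrite lte_fin; lra.
- by exists (x + 1); rewrite ?ltry// lte_fin; lra.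
- by exists (y - 1); rewrite ?ltNyr// lte_fin; lra.
- by exists 0; rewrite ?ltNyr ?ltry.
Qed.

Definition empirical n x nu := forall B, measurable B ->
  nu B = ((n%:R)^-1 * \sum_(k < n) (\1_B (iter k f x) : R))%:E.

Lemma empirical_Ex n x nu h : empirical n x nu -> bmeas h -> Ex nu h = avg f n h x.
Proof.
move=> hnu bh.
have hl B : measurable B -> pr nu B = \sum_(k < n) n%:R^-1 * pr (dirac (iter k f x) : probability X R) B.
  move=> mB; rewrite {1}/pr hnu//= mulr_sumr; apply: eq_bigr => k _.
  by rewrite -(Ex_indic (dirac _ : probability X R) mB) Ex_dirac//; exact: bmeas_indic.
rewrite (Ex_lin hl) ?invr_ge0//.
by rewrite /avg mulr_sumr; apply: eq_bigr => k _; rewrite Ex_dirac.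
Qed.

Lemma empirical_ex n x : (0 < n)%N -> exists nu, empirical n x nu.
Proof.
move=> n0; have n0' : n%:R != 0 :> R by rewrite pnatr_eq0 -lt0n.
have [||nu [hnu _]] := @prob_discrete R _ X 'I_n (fun k => iter k f x) (fun=> n%:R^-1).
- by move=> k; rewrite invr_ge0.
- by rewrite sumr_const card_ord -[LHS]mulr_natl divff.
exists nu => B mB; rewrite (prE nu mB) hnu// mulr_sumr.
by congr EFin; apply: eq_bigr => k _.
Qed.

(** A weak neighbourhood of an empirical measure tests finitely many continuous functions, whose
    orbit averages depend continuously on the point. Closedness makes the event measurable. *)
Lemma empirical_closed n A : (0 < n)%N -> weak_closed d A -> dclosed d (empirical_preimage f n A).
Proof.
move=> n0 cA x nx; have [nux hx] := empirical_ex x n0.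
have nA : ~ A nux by move=> Ax; apply: nx; exists nux.
have [gs [e [cgs e0] hA]] := cA nux nA.
have nbd : forall gs' : seq (X -> R), (forall g, List.In g gs' -> dcont_real d g) -> exists2 rho : R, 0 < rho &
    forall y, d x y < rho -> forall g, List.In g gs' -> `|avg f n g y - avg f n g x| < e.
  elim=> [|g gs' IH] hgs'; first by exists 1.
  have [rho rho0 h] := IH (fun g' hg' => hgs' g' (or_intror hg')).
  have [rho' rho'0 h'] := avg_dcont S n (hgs' g (or_introl erefl)) x e0.
  exists (Num.min rho rho'); first by rewrite lt_min rho0.
  move=> y; rewrite lt_min => /andP[y1 y2] g' [<-|]; last exact: h.
  by rewrite distrC; exact: h'.
have [rho rho0 h] := nbd gs cgs; exists rho => // y xy [nuy Ay hy].
suff : (weak_nbhd d nux gs e `&` A) nuy by rewrite hA.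
split => // g gin; have bg := dcont_bmeas H (cgs g gin).
rewrite -/(Ex nuy g) -/(Ex nux g) (empirical_Ex hy bg) (empirical_Ex hx bg).
exact: h.
Qed.

(** Induction on the list; positive weights allow the tail to be renormalised. *)
Lemma mconvex_comb A E (nu : X -> probability X R) (w : X -> R) : mconvex A -> E != [::] ->
  (forall x, x \in E -> A (nu x)) -> (forall x, x \in E -> 0 < w x) -> \sum_(x <- E) w x = 1 ->
  forall m : probability X R,
    (forall B, measurable B -> pr m B = \sum_(x <- E) w x * pr (nu x) B) -> A m.
Proof.
move=> cA; elim: E w => // x E IH w _ hA w0 w1 m hm.
have [E0|E0] := eqVneq E [::].
  rewrite E0 !big_seq1 in w1 hm; apply: (cA (nu x) (nu x) 1).
  - by apply: hA; rewrite mem_head.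
  - by apply: hA; rewrite mem_head.
  - by rewrite ler01 lexx.
  move=> B mB; rewrite (prE m mB) (prE (nu x) mB) hm// big_seq1 w1 subrr mul0e adde0 mul1e mul1r.
  by [].
rewrite big_cons in w1.
have wE : 0 < \sum_(y <- E) w y.
  case: E E0 {IH hm w1} hA w0 => // y E _ hA w0; rewrite big_cons ltr_pwDl ?w0 ?inE ?eqxx ?orbT//.
  by rewrite big_seq; apply: sumr_ge0 => z zE; rewrite ltW// w0// !inE zE !orbT.
set t := \sum_(y <- E) w y in w1 wE.
have tx : w x = 1 - t by rewrite -w1 addrK.
pose w' y := w y / t.
have w'1 : \sum_(y <- E) w' y = 1 by rewrite -mulr_suml divff ?gt_eqF.
have w'0 y : y \in E -> 0 < w' y by move=> yE; rewrite divr_gt0// w0// inE yE orbT.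
have [||m' hm'] := @prob_mix _ _ _ 'I_(size E) (fun i => nu (nth point E i)) (fun i => w' (nth point E i)).
- by move=> i; apply: ltW; apply: w'0; exact: mem_nth.
- by rewrite -[RHS]w'1 [RHS](big_nth point) big_mkord.
have Am' : A m'.
  apply: (IH w' E0) => // [y yE|B mB]; first by apply: hA; rewrite inE yE orbT.
  by rewrite hm'// [RHS](big_nth point) big_mkord.
apply: (cA m' (nu x) t) => //.
- by apply: hA; rewrite mem_head.
- by rewrite ltW//=; have := w0 x (mem_head _ _); rewrite tx; lra.
move=> B mB; rewrite (prE m mB) (prE m' mB) (prE (nu x) mB) -!EFinM -EFinD hm// big_cons tx addrC.
congr EFin; congr (_ + _); rewrite hm'// mulr_sumr [LHS](big_nth point) big_mkord.
by apply: eq_bigr => j _; rewrite mulrA /w' [t * _]mulrC divfK ?gt_eqF.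
Qed.

(** The Gibbs average is a convex combination of the empirical measures of the points of E. *)
Lemma gibbs_average_in A E n m : mconvex A -> (0 < n)%N -> E != [::] ->
  (forall x, x \in E -> empirical_preimage f n A x) -> gibbs_average f phi E n m -> A m.
Proof.
move=> cA n0 E0 EA gm.
have /choice[nu hnu] : forall x, exists nu, empirical_preimage f n A x -> A nu /\ empirical n x nu.
  move=> x; have [[nu Anu hnu]|nx] := pselect (empirical_preimage f n A x); first by exists nu.
  by exists (dirac point).
have Z0 := psum_gt0 f phi n E0.
apply: (mconvex_comb (nu := nu) (w := fun x => expR (Phi x n) / psum f phi E n) cA E0).
- by move=> x /EA/hnu[].
- by move=> x _; rewrite divr_gt0 ?expR_gt0.
- by rewrite -mulr_suml divff ?gt_eqF.
move=> B mB; rewrite -(Ex_indic m mB) (gm _ (bmeas_indic mB)) mulr_sumr !big_seq.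
apply: eq_bigr => x /EA/hnu[_ hx].
by rewrite {1}/pr hx//= mulrA [_^-1 * _]mulrC.
Qed.

Context (P Q r : R) (mu : probability X R).
Context (r0 : 0 < r).
Context (Q0 : 0 < Q).
Context (gibbs_bound : forall m z (a b : R), 0 < a <= r -> (forall y, dn d f m z y < a -> Phi y m <= b) ->
    pr mu (bowen_ball d f m z a) <= Q * expR (b - m%:R * P)).

(** Z is covered by Bowen balls around a net of its own points, so small that Phi varies by at most
    n eta on each; their scale depends on eta and not on n or Z. *)
Lemma closed_mass (eta : R) : 0 < eta -> exists2 ga : R, 0 < ga & forall n (Z : set X), (0 < n)%N ->
  measurable Z -> exists E, [/\ uniq E, sep d f n ga E, forall x, x \in E -> Z x &
    pr mu Z <= Q * expR (n%:R * (eta - P)) * psum f phi E n].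
Proof.
move=> eta0; have [rp rp0 osc] := dcont_unif H cphi eta0.
pose a := Num.min (rp / 2) r; have a0 : 0 < a by rewrite lt_min r0 divr_gt0.
exists (a / 2); first by rewrite divr_gt0.
move=> n Z n0 mZ; have a20 : 0 < a / 2 by rewrite divr_gt0.
have [E [uE sE EZ nE]] := max_sep H (cs_f S) n Z a20.
exists E; split => //.
pose Bx x := bowen_ball d f n x a.
have mB x : measurable (Bx x) by apply: (open_measurable H); exact: (bowen_open H (cs_f S)).
pose V := \big[setU/set0]_(i < size E) Bx (nth point E i).
have mV : measurable V by exact: bigsetU_measurable.
have ZV : Z `<=` V.
  move=> z /nE[x xE xz]; rewrite /V -(bigcup_mkord (size E) (fun i => Bx (nth point E i))).
  exists (index x E); first by rewrite /= index_mem.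
  by rewrite nth_index// /Bx /bowen_ball /=; lra.
apply: le_trans (fap_le (pr_fap mu) mZ mV ZV) _.
apply: le_trans (fap_bigU_le mu (size E) (fun i => mB (nth point E i))) _.
rewrite /psum (big_nth point) big_mkord mulr_sumr; apply: ler_sum => i _.
set x := nth point E i.
have ar : 0 < a <= r by rewrite a0 ge_min lexx orbT.
have hb y : dn d f n x y < a -> Phi y n <= Phi x n + n%:R * eta.
  move=> xy; have oc u v : d u v <= rp / 2 -> `|phi u - phi v| <= eta.
    by move=> uv; apply: ltW; apply: osc; lra.
  have arp : a <= rp / 2 by rewrite ge_min lexx.
  have rp20 : 0 <= rp / 2 by lra.
  have := birkhoff_osc rp20 oc (le_trans (ltW xy) arp).
  by rewrite distrC ler_norml; lra.
apply: le_trans (gibbs_bound ar hb) _.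
by rewrite -mulrA -expRD ler_pM2l// ler_expR mulrBr; lra.
Qed.

Lemma large_deviations A : weak_closed d A -> mconvex A -> top_pressure d f phi = P%:E ->
  (limn_esup (fun n => ((n%:R)^-1)%:E * elog (mu (empirical_preimage f n A)))
   <= ereal_sup [set (free_energy nu f phi - top_pressure d f phi)%E
                | nu in [set nu : probability X R | A nu /\ finvariant f nu]])%E.
Proof.
move=> clA cvA PE; rewrite leNgt; apply/negP => /ereal_between[b supb blim].
have [a supa] := ereal_between supb; rewrite lte_fin => ab.
pose Z n := empirical_preimage f n A.
have mZ n : (0 < n)%N -> measurable (Z n) by move=> n0; apply: (closed_measurable H); exact: empirical_closed.
(* If the inequality failed, with a < b in between, the loss eta would still leave a limit measure
   in A with free energy at least P + b - eta > P + a. *)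
pose eta := (b - a) / 2; have eta0 : 0 < eta by rewrite divr_gt0// subr_gt0.
have [ga ga0 hga] := closed_mass eta0.
pose good n := (0 < n)%N /\ exists E, [/\ E != [::], uniq E, sep d f n ga E, forall x, x \in E -> Z n x &
  b + P - eta - ln Q / n%:R <= ln (psum f phi E n) / n%:R].
have hgood n0 : exists2 n, (n0 <= n)%N & good n.
  have [n n0n hn] := limn_esup_gt blim n0.+1.
  have n1 : (0 < n)%N by exact: leq_ltn_trans n0n.
  have n1' : 0 < n%:R :> R by rewrite ltr0n.
  exists n; first exact: ltnW.
  split => //; have [E [uE sE EZ hE]] := hga n (Z n) n1 (mZ n n1).
  move: hn; rewrite -/(Z n) (prE mu (mZ n n1)) /=; case: ifPn => [Z0|_]; last first.
    by rewrite mulrNy gtr0_sg ?invr_gt0// mul1e.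
  rewrite -EFinM lte_fin => hb.
  have psE : 0 < psum f phi E n.
    have : 0 < Q * expR (n%:R * (eta - P)) * psum f phi E n by exact: lt_le_trans hE.
    by rewrite pmulr_rgt0// mulr_gt0 ?expR_gt0.
  exists E; split => //; first by apply/eqP => E0; move: psE; rewrite E0 /psum big_nil ltxx.
  have : ln (pr mu (Z n)) <= ln Q + n%:R * (eta - P) + ln (psum f phi E n).
    rewrite -[X in _ + X + _]expRK -!lnM ?posrE ?mulr_gt0 ?expR_gt0//.
    by rewrite ler_ln ?posrE ?mulr_gt0 ?expR_gt0.
  move: hb; rewrite mulrC ltr_pdivlMr// => hb hln.
  rewrite ler_pdivlMr// mulrBl divfK ?gt_eqF//.
  by move: hb hln; rewrite mulrBr !mulrBl mulrDl [n%:R * eta]mulrC [n%:R * P]mulrC; lra.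
have [U [UU Uinf UG]] := ultra_nat hgood.
have /choice[E hE] : forall n, exists E, [/\ E != [::] /\ uniq E, sep d f n ga E &
    good n -> (forall x, x \in E -> Z n x) /\ b + P - eta - ln Q / n%:R <= ln (psum f phi E n) / n%:R].
  move=> n; have [[n0 [E [E0 uE sE EZ hE]]]|ng] := pselect (good n); first by exists E.
  by exists [:: point]; split => // x y; rewrite !inE => /eqP-> /eqP->.
have [B B0 hB] := psum_bounds S cphi ga0.
pose u n := ln (psum f phi (E n) n) / n%:R.
have uB n : `|u n| <= B.
  case: n => [|n]; first by rewrite /u invr0 mulr0 normr0 ltW.
  by have [[E0 uE] sE _] := hE n.+1; exact: hB.
have [l hl] := ultra_cvg_ex (U := U) uB.
have bl : b + P - eta <= l.
  have h0 : (ln Q / n%:R) @[n --> U] --> (0 : R).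
    apply: (@ultra_cvg0 _ U UU Uinf _ `|ln Q|) => n n0.
    by rewrite normrM [`|_^-1|]ger0_norm ?invr_ge0.
  have h1 : (b + P - eta - ln Q / n%:R) @[n --> U] --> (b + P - eta - 0 : R).
    by apply: cvgB => //; apply: cvg_cst.
  rewrite -[b + P - eta]subr0; apply: (ucvg_le h1 hl).
  by apply: filterS UG => n gn; have [_ _ /(_ gn)[]] := hE n.
have [||nu [M [inu lnu gM Mcvg _]]] := misiurewicz S cphi Uinf ga0 _ _ hl.
- by move=> n; case: (hE n).
- by move=> n; case: (hE n).
have MA : \forall n \near U, A (M n).
  apply: filterS UG => n gn; have [[E0 uE] sE /(_ gn)[EZ _]] := hE n; have [n0 _] := gn.
  exact: gibbs_average_in cvA n0 E0 EZ (gM n n0).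
have Anu : A nu.
  apply: contrapT => nA; have [gs [e [cgs e0] hA]] := clA nu nA.
  have nbd : forall gs' : seq (X -> R), (forall g, List.In g gs' -> dcont_real d g) ->
      \forall n \near U, forall g, List.In g gs' -> `|Ex (M n) g - Ex nu g| < e.
    elim=> [|g gs' IH] hgs'; first by apply: filterE => n g [].
    have h1 := IH (fun g' hg' => hgs' g' (or_intror hg')).
    have h2 : \forall n \near U, `|Ex nu g - Ex (M n) g| < e.
      by move/cvgrPdist_lt: (Mcvg g (hgs' g (or_introl erefl))) => /(_ _ e0).
    by apply: filterS2 h1 h2 => n h1 h2 g' [<-|]; [rewrite distrC|exact: h1].
  have FF : U set0.
    apply: filterS2 MA (nbd gs cgs) => n An hn.
    suff : (weak_nbhd d nu gs e `&` A) (M n) by rewrite hA.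
    by split.
  exact: (@filter_not_empty _ U _ FF).
have : (free_energy nu f phi - top_pressure d f phi <= a%:E)%E.
  by apply: ltW; apply: le_lt_trans supa; apply: ereal_sup_ubound; exists nu.
rewrite PE leNgt => /negP; apply.
apply: (@lt_le_trans _ _ (l%:E - P%:E)%E); last by apply: leeB.
by rewrite -EFinB lte_fin; move: bl; rewrite /eta; lra.
Qed.

End LargeDeviations.

(** Extends to all n the bounds known for large n: separated sets for bounded lengths have bounded
    size. *)
Lemma psum_small {R : realType} {dsp : measure_display} {X : measurableType dsp} (d : X -> X -> R)
    (f finv : X -> X) (S : csys d f finv) (phi : X -> R) (C b : R) N (a : R) :
  (forall x, `|phi x| <= C) -> 0 < a -> exists2 A : R, 0 < A & forall n E, (n < N)%N -> uniq E ->
    sep d f n a E -> psum f phi E n <= A * expR (n%:R * b).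
Proof.
move=> hC a0; elim: N => [|N [A A0 IH]]; first by exists 1.
have [k hk] := sep_bounded (cs_space S) (cs_f S) N a0.
pose A' := k.+1%:R * expR (N%:R * C) * expR (- (N%:R * b)).
exists (Num.max A A'); first by rewrite lt_max A0.
move=> n E; rewrite ltnS leq_eqVlt => /orP[/eqP->|nN] uE sE; last first.
  by apply: le_trans (IH n E nN uE sE) _; rewrite ler_wpM2r ?expR_ge0// le_max lexx.
apply: (@le_trans _ _ (A' * expR (N%:R * b))); last by rewrite ler_wpM2r ?expR_ge0// le_max lexx orbT.
rewrite /A' -mulrA -expRD addrC subrr expR0 mulr1.
apply: (@le_trans _ _ (\sum_(x <- E) expR (N%:R * C))).
  by apply: ler_sum => x _; rewrite ler_expR; have := birkhoff_abs f x N hC; rewrite ler_norml => /andP[].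
rewrite big_const_seq count_predT iter_addr_0 -[X in X <= _]mulr_natl ler_wpM2r ?expR_ge0// ler_nat.
exact: leqW (hk E uE sE).
Qed.

(** * Choice of the scales and conclusion *)

Unset Implicit Arguments.

Theorem theoremD (R : realType) (dsp : measure_display) (X : measurableType dsp)
  (d : X -> X -> R) (f finv : X -> X) (phi : X -> R)
  (P G S : set (X * nat)) (p g s : X -> nat -> nat) :
  is_metric d ->
  dcompact d ->
  @measurable dsp X = <<s dopen d >> ->
  (forall x, f (finv x) = x) -> (forall x, finv (f x) = x) ->
  dcont_fun d f -> dcont_fun d finv ->
  dcont_real d phi ->
  (Pexp_perp d f finv phi < top_pressure d f phi)%E ->
  decomposition f P G S p g s ->
  (forall delta : R, 0 < delta -> W_spec d f G delta) ->
  bowen_prop d f phi G ->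
  (pressure_coll d f phi (P `|` S) < top_pressure d f phi)%E ->
  exists mu : probability X R,
    [/\ equilibrium_state f phi mu,
        (forall nu : probability X R, equilibrium_state f phi nu ->
           forall B, measurable B -> nu B = mu B) &
        forall A : set (probability X R), weak_closed d A -> mconvex A ->
          (limn_esup (fun n => ((n%:R)^-1)%:E * elog (mu (empirical_preimage f n A)))
           <= ereal_sup [set (free_energy nu f phi - top_pressure d f phi)%E
                        | nu in [set nu : probability X R | A nu /\ finvariant f nu]])%E].
Proof.
move=> dm dc db fK Kf cf cfinv cphi exp_lt dec spec bow PS_lt.
have Sy : csys d f finv by split.
have H := cs_space Sy.
have [eps eps0 eps_lt] := Pexp_lt Sy exp_lt.
have [pr0 PE] := pressure_finite Sy cphi eps0 eps_lt.
set P0 := pr0 in PE; rewrite PE in eps_lt PS_lt.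
have [epsB [K [eB hK]]] := bow.
have bphi := dcont_bmeas H cphi.
have [C C0 hC] := bmeas_pos bphi.
have [P1 PS1] := ereal_between PS_lt; rewrite lte_fin => P1P.
(* P1 lies strictly between the pressure of the bad collections and P, so the bound with exponent P1
   = P - 4 w holds at every scale. *)
pose w := (P0 - P1) / 4; have w0 : 0 < w by rewrite divr_gt0// subr_gt0.
have wE : P0 - 4 * w = P1 by rewrite /w; field.
have [rp rp0 osc] := dcont_unif H cphi w0.
(* The halves make the bounds strict: r-close points have oscillation below w, r is below epsB, and
   two points of one Bowen ball of radius r stay within 2 r <= eps. *)
pose r := Num.min (rp / 2) (Num.min (epsB / 2) (eps / 2)).
have r0 : 0 < r by rewrite !lt_min !divr_gt0.
have r1 : r <= rp / 2 by rewrite ge_min lexx.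
have r2 : r <= epsB / 2 by rewrite !ge_min lexx orbT.
have r3 : r <= eps / 2 by rewrite !ge_min lexx !orbT.
have sc : scales d f finv phi P G S p g s P0 eps epsB K C w r.
  split => //.
  - move=> a a0 e e0; have aP : (pressure_delta d f phi setT a < (P0 + e)%:E)%E.
      apply: le_lt_trans (pressure_delta_le d f phi setT a0) _.
      by rewrite -/(top_pressure d f phi) PE lte_fin; lra.
    have [n0 hn0] := psum_le_pressure aP; exists n0 => n E n0n uE sE.
    exact: hn0.
  - move=> a a0; have aP : (pressure_delta d f phi (P `|` S) a < P1%:E)%E.
      exact: le_lt_trans (pressure_delta_le d f phi _ a0) PS1.
    have [n0 hn0] := psum_le_pressure aP; rewrite wE.
    have [A A0 hA] := psum_small Sy P1 n0 hC a0.
    exists (Num.max 1 A); first by rewrite lt_max ltr01.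
    move=> n E uE sE PE'; have [nn|nn] := ltnP n n0.
      apply: le_trans (hA n E nn uE sE) _.
      by rewrite ler_wpM2r ?expR_ge0// le_max lexx orbT.
    apply: le_trans (hn0 n E nn uE sE PE') _.
    by rewrite ler_peMl ?expR_ge0// le_max lexx.
  - by apply: le_lt_trans r2 _; lra.
  - by move=> x y xy; apply: ltW; apply: osc; lra.
  - by lra.
have hatt (a : R) : a < P0 -> exists mu : probability X R, finvariant f mu /\ (a%:E <= free_energy mu f phi)%E.
  by move=> aP; apply: (pressure_attained Sy cphi); rewrite PE lte_fin.
have [mu [Q [imu muP Q0 gibbs]]] := gibbs_exists Sy cphi sc hatt.
have r20 : 0 < r / 2 by rewrite divr_gt0.
have le_P nu : finvariant f nu -> (free_energy nu f phi <= P0%:E)%E by exact: (free_le_pressure Sy cphi sc).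
exists mu; split.
- by split => // nu inu; exact: le_trans (le_P nu inu) muP.
- move=> nu [inu nu_max] B mB; rewrite (prE nu mB) (prE mu mB); congr EFin.
  by apply: (equilibrium_unique Sy cphi sc) => //; exact: le_trans muP (nu_max mu imu).
- by move=> A clA cvA; exact: (large_deviations Sy cphi r20 Q0 gibbs clA cvA PE).
Qed.
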